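(* The minimal positive Green's function $G(x,y,\xi,\eta)$ of $\mathcal{L}=\Delta-1$ on $\Sigma$ (equivalently of $L=\partial_x^2+\partial_y^2-P(y)$ on $\mathbb{R}\times(0,\infty)$ with respect to Lebesgue measure) is given, for $x,\xi\in\mathbb{R}$, $y,\eta\in(0,\infty)$ with $(x,y)\neq(\xi,\eta)$, by $$G(x,y,\xi,\eta)=\frac1{2\pi}\int_0^\infty\operatorname{Re}\Big\{a(s)\,w(s,y)\,w(s,\eta)+\overline{w(s,y)}\,w(s,\eta)\Big\}\frac{e^{-|x-\xi|\sqrt{s^2+\frac14}}}{\sqrt{s^2+\frac14}}\,ds .$$
   Context: $\Sigma=\mathbb{R}\times(0,\infty)$ with metric $P(y)(dx^2+dy^2)$, $P(y)=\frac{e^{4y}+10e^{2y}+1}{4(e^{2y}-1)^2}$; $\Delta=P^{-1}(\partial_x^2+\partial_y^2)$, $\mathcal{L}=\Delta-1$. The minimal positive Green's function is the increasing limit of Dirichlet Green's functions of an exhaustion by relatively compact smooth domains, normalized by $-L_{(x,y)}\int G(x,y,\xi,\eta)\phi(\xi,\eta)\,d\xi\,d\eta=\phi(x,y)$. For $s\ge0$ and $y>0$: $a(s)=-\dfrac{\Gamma(1-is)\Gamma(\frac32+is)}{\Gamma(1+is)\Gamma(\frac32-is)}$, and $w(s,y)=\dfrac{e^{(1-is)y}}{\sqrt{e^{2y}-1}}\,{}_2F_1(-\tfrac12,-\tfrac12+is;1+is;e^{-2y})$, with ${}_2F_1$ the Gauss hypergeometric function. *)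

(* Defs.v *)
From HB Require Import structures.
From mathcomp Require Import all_boot all_order all_algebra.
From mathcomp Require Import all_classical all_reals all_analysis.
From mathcomp Require Import complex.
Set Implicit Arguments. Unset Strict Implicit. Unset Printing Implicit Defensive.
Import Order.TTheory GRing.Theory Num.Theory.
Import numFieldNormedType.Exports.
Local Open Scope classical_set_scope.
Local Open Scope ring_scope.

Section GreenDefs.
Variable R : realType.

Definition Sigma : set (R * R) := [set p | 0 < p.2].

Definition Pconf (y : R) : R :=
  (expR (4 * y) + 10 * expR (2 * y) + 1) / (4 * (expR (2 * y) - 1) ^+ 2).

Definition dx (f : R -> R -> R) : R -> R -> R :=
  fun x y => derive1 (fun t => f t y) x.
Definition dy (f : R -> R -> R) : R -> R -> R :=
  fun x y => derive1 (fun t => f x t) y.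

Fixpoint Ck_on (k : nat) (A : set (R * R)) (f : R -> R -> R) : Prop :=
  {within A, continuous (fun p : R * R => f p.1 p.2)} /\
  match k with
  | 0 => True
  | k'.+1 =>
      (forall p, A p -> derivable (fun t => f t p.2) p.1 1 /\
                        derivable (fun t => f p.1 t) p.2 1) /\
      Ck_on k' A (dx f) /\ Ck_on k' A (dy f)
  end.

Definition smooth (f : R -> R -> R) : Prop := forall k, Ck_on k setT f.

Definition Lop (u : R -> R -> R) : R -> R -> R :=
  fun x y => dx (dx u) x y + dy (dy u) x y - Pconf y * u x y.

(* Omega is a domain (nonempty connected open set), relatively compact in Sigma,
   with C^infinity boundary: near each boundary point Omega is a sublevel set
   {rho < 0} of a smooth function rho with non-vanishing gradient there *)
Definition rc_smooth_domain (O : set (R * R)) : Prop :=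
  [/\ open O, connected O, O !=set0,
      compact (closure O) /\ closure O `<=` Sigma &
      forall b, (closure O `\` O) b ->
        exists U : set (R * R), [/\ open U, U b &
          exists rho : R -> R -> R,
            [/\ smooth rho,
                dx rho b.1 b.2 != 0 \/ dy rho b.1 b.2 != 0 &
                O `&` U = [set q | U q /\ rho q.1 q.2 < 0]]]].

Definition exhaustion (Om : nat -> set (R * R)) : Prop :=
  [/\ forall n, rc_smooth_domain (Om n),
      forall n, closure (Om n) `<=` Om n.+1 &
      \bigcup_n Om n = Sigma].

Definition leb2 := ((@lebesgue_measure R) \x (@lebesgue_measure R))%E.

Definition testfun (O : set (R * R)) (phi : R -> R -> R) : Prop :=
  smooth phi /\
  exists K : set (R * R), [/\ compact K, K `<=` O &
                             forall p, ~ K p -> phi p.1 p.2 = 0].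

(* G is the Dirichlet Green's function of L on O, normalised by
   - L_{(x,y)} \int G(x,y,xi,eta) phi(xi,eta) dxi deta = phi(x,y):
   for (x,y) in O, G(x,y,.,.) is continuous on O \ {(x,y)}, and for every
   phi in C_c^infinity(O) the function u = \int_O G(.,.,q) phi(q) dq is
   well defined (integrable integrand), C^2 in O, tends to 0 at every boundary
   point of O, and solves - L u = phi in O. *)
Definition dirichlet_green (O : set (R * R)) (G : R -> R -> R -> R -> R) : Prop :=
  (forall x y, O (x, y) ->
     {within O `\ (x, y), continuous (fun q : R * R => G x y q.1 q.2)}) /\
  forall phi, testfun O phi ->
    (forall x y, O (x, y) ->
       leb2.-integrable O (fun q : R * R => (G x y q.1 q.2 * phi q.1 q.2)%:E)) /\
    let u := fun x y => Rintegral leb2 O (fun q : R * R => G x y q.1 q.2 * phi q.1 q.2) in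
    [/\ Ck_on 2 O u,
        forall b, (closure O `\` O) b ->
          (fun p : R * R => u p.1 p.2) @ within O (nbhs b) --> 0 &
        forall p, O p -> - Lop u p.1 p.2 = phi p.1 p.2].

Local Open Scope complex_scope.

Definition cexp (z : R[i]) : R[i] :=
  (expR (complex.Re z))%:C * (cos (complex.Im z) +i* sin (complex.Im z)).

(* Euler's Gamma function, Gamma(z) = \int_0^oo t^{z-1} e^{-t} dt,
   for Re z > 0 (the only case used below), split in real and imaginary parts
   using t^{z-1} = t^{Re z - 1} (cos (Im z ln t) + i sin (Im z ln t)) *)
Definition cGamma (z : R[i]) : R[i] :=
  (Rintegral (@lebesgue_measure R) `]0%R, +oo[
     (fun t => t `^ (complex.Re z - 1) * expR (- t) * cos (complex.Im z * ln t)))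
  +i*
  (Rintegral (@lebesgue_measure R) `]0%R, +oo[
     (fun t => t `^ (complex.Re z - 1) * expR (- t) * sin (complex.Im z * ln t))).

Definition poch (a : R[i]) (k : nat) : R[i] := \prod_(j < k) (a + (j%:R)%:C).

(* Gauss hypergeometric function 2F1(a,b;c;z), as the sum of its series
   \sum_k (a)_k (b)_k / ((c)_k k!) z^k (limit of partial sums, taken
   componentwise); used only for 0 < z < 1 where the series converges *)
Definition hyp2F1_partial (a b c z : R[i]) (N : nat) : R[i] :=
  \sum_(k < N) poch a k * poch b k / (poch c k * ((k`!)%:R)%:C) * z ^+ k.
Definition hyp2F1 (a b c z : R[i]) : R[i] :=
  limn (fun N => complex.Re (hyp2F1_partial a b c z N))
  +i* limn (fun N => complex.Im (hyp2F1_partial a b c z N)).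

Definition acoef (s : R) : R[i] :=
  - (cGamma (1 -i* s) * cGamma ((3 / 2) +i* s))
    / (cGamma (1 +i* s) * cGamma ((3 / 2) -i* s)).

Definition wfun (s y : R) : R[i] :=
  cexp ((1 -i* s) * y%:C) / (Num.sqrt (expR (2 * y) - 1))%:C
  * hyp2F1 (- (1 / 2))%:C ((- (1 / 2)) +i* s) (1 +i* s) (expR (- (2 * y)))%:C.

Definition green_integrand (x y xi eta : R) (s : R) : R :=
  let r := Num.sqrt (s ^+ 2 + 1 / 4) in
  complex.Re (acoef s * wfun s y * wfun s eta + (wfun s y)^* * wfun s eta)
  * (expR (- (`|x - xi| * r)) / r).

End GreenDefs.

(* Main.v *)
(** Separating variables with [e^{ikx}], [L] becomes [u'' = (k^2 + P) u] in [y], and [P = 1/4 + 3 / (4 sinh^2 y)].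
    With [lam = k^2 + 1/4] (or [lam = - s^2] on the spectral side), the solutions of
    [u'' = (lam + 3 / (4 sinh^2 y)) u] have integral representations of Mehler-Dirichlet type, which transport
    solutions of [h'' = lam h]: the even [h = cosh] gives the solution regular at [y = 0], a bounded [h] gives one
    that is oscillating or decaying at infinity.  Comparing behaviours at infinity, the regular solution [J_s] is a
    combination of [w(s, .)] and its conjugate with coefficients [b(s)] and conjugate; a Beta integral
    evaluates [b(s)] by Gamma functions, and the density of the statement becomes
    [J_s(y) J_s(eta) / |b(s)|^2].  The partial fraction integrals [int cos (s t) / (k^2 + s^2) ds] turn the
    integral of this density against [1 / (kap^2 + s^2)] into the resolvent kernel of the equation in [y].

    On the other side, the maximum principle makes the Dirichlet Green's functions increase with the domain.
    Testing against a bump adapted to the logarithmic singularity gives a Harnack type bound, so that they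
    converge locally uniformly, off the pole, to a continuous [g].  Testing [g] against
    [cos (k (x - x0)) beta(y)], with the resolvent solution of the equation in [y] corrected by a multiple of
    [x^2 + 16] as a barrier, identifies the cosine transform of [g] in [x].  The Abel (Poisson kernel) inversion
    of this transform gives the formula for [x <> xi].  For [x = xi] the integral converges only conditionally,
    and the formula follows by letting [x - xi] tend to [0], through a Tauberian theorem for integrands of
    size [O(1/s)]. *)

(* The hypotheses give continuity of [G n] off the pole and the Dirichlet problem solved by
   potentials of test functions. So every property of the limit is obtained with the pole [p] fixed,
   by testing in the second argument and reading the solved equation at [p]. Two divergences shape
   the argument. The exchange of the integral in [k] (dual to x) with the spectral integral in [s]
   meets [cos (k X) / (k^2 + 1/4 + s^2)], which is not absolutely integrable in [(k, s)]; hence the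
   factor [exp (- d k)] and an integration by parts that gains [s^-2] uniformly in [d]. And the
   pointwise bounds on the derivatives [p1], [q1] of the transported solutions grow like [s], so the
   resolvent identity is proved for [p0], [q0] and then differentiated once in each variable. The
   constant [1 / (2 pi)] has three sources: [1 / pi] from the resolvent kernel ([uk_E]), [1 / pi]
   from the mass of the Poisson kernel, and [pi / 2] from the cosine transform of
   [1 / (k^2 + 1/4 + s^2)]. *)
Require Import Defs.
From HB Require Import structures.
From mathcomp Require Import all_boot all_order all_algebra.
From mathcomp Require Import all_classical all_reals all_analysis.
From mathcomp Require Import measurable_realfun ring lra.
From mathcomp Require Import complex.
Set Implicit Arguments. Unset Strict Implicit. Unset Printing Implicit Defensive.
Import Order.TTheory GRing.Theory Num.Theory.
Import numFieldNormedType.Exports.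
Local Open Scope classical_set_scope.
Local Open Scope ring_scope.

(** * Calculus on the half line *)

Section calculus.
Variable R : realType.
Implicit Types (f g : R -> R) (x a b c : R).

(** Separates the computed form of a derivative from the wanted one: [der] applies it with [a]
    unknown, fills [a] from the syntax of the function, and leaves the algebraic identity
    [a = b]. *)
Lemma der_eq f x a b : is_derive x 1 f a -> a = b -> is_derive x 1 f b.
Proof. by move=> ? <-. Qed.

Lemma derC c x : is_derive x (1 : R) (fun=> c : R) 0.
Proof. exact: is_derive_cst. Qed.

Lemma derI x : is_derive x (1 : R) (fun t : R => t) 1.
Proof. exact: is_derive_id. Qed.

Lemma derD f g x a b : is_derive x 1 f a -> is_derive x 1 g b ->
  is_derive x 1 (fun t => f t + g t) (a + b).
Proof. by move=> ? ?; exact: is_deriveD. Qed.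

Lemma derN f x a : is_derive x 1 f a -> is_derive x 1 (fun t => - f t) (- a).
Proof. by move=> ?; exact: is_deriveN. Qed.

Lemma derB f g x a b : is_derive x 1 f a -> is_derive x 1 g b ->
  is_derive x 1 (fun t => f t - g t) (a - b).
Proof. by move=> ? ?; exact: is_deriveB. Qed.

Lemma derM f g x a b : is_derive x 1 f a -> is_derive x 1 g b ->
  is_derive x 1 (fun t => f t * g t) (a * g x + f x * b).
Proof.
move=> df dg; refine (der_eq (is_deriveM df dg) _).
by rewrite /GRing.scale/=; ring.
Qed.

Lemma derX n f x a : is_derive x 1 f a ->
  is_derive x 1 (fun t => f t ^+ n) (n%:R * f x ^+ n.-1 * a).
Proof.
move=> df; rewrite (_ : (fun t => f t ^+ n) = f ^+ n); last by apply/funext => t; rewrite !fctE.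
refine (der_eq (is_deriveX n df) _).
by rewrite /GRing.scale/= mulr_natl.
Qed.

Lemma derV f x a : f x != 0 -> is_derive x 1 f a ->
  is_derive x 1 (fun t => (f t)^-1) (- a / f x ^+ 2).
Proof.
move=> f0 df; refine (der_eq (is_deriveV f0 df) _).
by rewrite /GRing.scale/=; field.
Qed.

Lemma der_comp f g x a b : is_derive (g x) 1 f a -> is_derive x 1 g b ->
  is_derive x 1 (fun t => f (g t)) (a * b).
Proof.
move=> df dg; refine (der_eq (is_derive1_comp df dg) _).
by rewrite /GRing.scale/=.
Qed.

Lemma derexp f x a : is_derive x 1 f a ->
  is_derive x 1 (fun t => expR (f t)) (expR (f x) * a).
Proof. exact: der_comp. Qed.

Lemma dersin f x a : is_derive x 1 f a ->
  is_derive x 1 (fun t => sin (f t)) (cos (f x) * a).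
Proof. exact: der_comp. Qed.

Lemma dercos f x a : is_derive x 1 f a ->
  is_derive x 1 (fun t => cos (f t)) (- sin (f x) * a).
Proof. exact: der_comp. Qed.

Lemma derln f x a : 0 < f x -> is_derive x 1 f a ->
  is_derive x 1 (fun t => ln (f t)) ((f x)^-1 * a).
Proof. by move=> fx; apply: der_comp; exact: is_derive1_ln. Qed.

Lemma dersqrt f x a : 0 < f x -> is_derive x 1 f a ->
  is_derive x 1 (fun t => Num.sqrt (f t)) ((2 * Num.sqrt (f x))^-1 * a).
Proof. by move=> fx; apply: der_comp; exact: is_derive1_sqrt. Qed.

Lemma der_cts f x a : is_derive x 1 f a -> {for x, continuous f}.
Proof.
move=> [df _]; apply: differentiable_continuous.
exact/derivable1_diffP.
Qed.

Lemma ctsC c x : {for x, continuous (fun=> c : R)}.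
Proof. exact: cvg_cst. Qed.

Lemma ctsI x : {for x, continuous (fun t : R => t)}.
Proof. exact: cvg_id. Qed.

Lemma ctsD f g x : {for x, continuous f} -> {for x, continuous g} ->
  {for x, continuous (fun t => f t + g t)}.
Proof. exact: cvgD. Qed.

Lemma ctsN f x : {for x, continuous f} -> {for x, continuous (fun t => - f t)}.
Proof. exact: cvgN. Qed.

Lemma ctsM f g x : {for x, continuous f} -> {for x, continuous g} ->
  {for x, continuous (fun t => f t * g t)}.
Proof. exact: cvgM. Qed.

Lemma ctsX n f x : {for x, continuous f} -> {for x, continuous (fun t => f t ^+ n)}.
Proof. by move=> cf; apply: (cvg_comp f (fun u => u ^+ n) cf); exact: exprn_continuous. Qed.

Lemma ctsV f x : f x != 0 -> {for x, continuous f} ->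
  {for x, continuous (fun t => (f t)^-1)}.
Proof. by move=> ? ?; exact: cvgV. Qed.

Lemma cts_comp f g x : {for g x, continuous f} -> {for x, continuous g} ->
  {for x, continuous (fun t => f (g t))}.
Proof. by move=> cf cg; apply: (cvg_comp g f cg). Qed.

Lemma ctsexp f x : {for x, continuous f} -> {for x, continuous (fun t => expR (f t))}.
Proof. by apply: cts_comp; exact: continuous_expR. Qed.

Lemma ctssin f x : {for x, continuous f} -> {for x, continuous (fun t => sin (f t))}.
Proof. by apply: cts_comp; exact: continuous_sin. Qed.

Lemma ctscos f x : {for x, continuous f} -> {for x, continuous (fun t => cos (f t))}.
Proof. by apply: cts_comp; exact: continuous_cos. Qed.

Lemma ctssqrt f x : {for x, continuous f} ->
  {for x, continuous (fun t => Num.sqrt (f t))}.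
Proof. by apply: cts_comp; exact: sqrt_continuous. Qed.

Lemma ctsln f x : 0 < f x -> {for x, continuous f} ->
  {for x, continuous (fun t => ln (f t))}.
Proof. by move=> ?; apply: cts_comp; exact: continuous_ln. Qed.

Lemma ctsabs f x : {for x, continuous f} ->
  {for x, continuous (fun t => `|f t|)}.
Proof. exact: cvg_norm. Qed.

End calculus.
Ltac derh h := first [eassumption | match goal with H : forall t, is_derive t _ h _ |- _ => eapply H end | idtac].

(** Follows the syntax of the function and leaves as goals the nonvanishing and positivity
    conditions of inverses, logarithms and roots. Unknown functions are looked up among the
    hypotheses. *)
Ltac der1 := try eassumption; lazymatch goal with
 | |- is_derive _ _ (fun t => t) _ => exact: derI
 | |- is_derive _ _ (fun _ => ?c) _ => exact: derC
 | |- is_derive _ _ (fun t => @?f t + - (@?g t)) _ => eapply (@derB _ f g); [der1|der1]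
 | |- is_derive _ _ (fun t => @?f t + @?g t) _ => eapply (@derD _ f g); [der1|der1]
 | |- is_derive _ _ (fun t => - (@?f t)) _ => eapply (@derN _ f); der1
 | |- is_derive _ _ (fun t => @?f t * @?g t) _ => eapply (@derM _ f g); [der1|der1]
 | |- is_derive _ _ (fun t => (@?f t)^-1) _ => eapply (@derV _ f); [|der1]
 | |- is_derive _ _ (fun t => (@?f t) ^+ ?n) _ => eapply (@derX _ n f); der1
 | |- is_derive _ _ (fun t => expR (@?f t)) _ => eapply (@derexp _ f); der1
 | |- is_derive _ _ (fun t => sin (@?f t)) _ => eapply (@dersin _ f); der1
 | |- is_derive _ _ (fun t => cos (@?f t)) _ => eapply (@dercos _ f); der1
 | |- is_derive _ _ (fun t => ln (@?f t)) _ => eapply (@derln _ f); [|der1]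
 | |- is_derive _ _ (fun t => Num.sqrt (@?f t)) _ => eapply (@dersqrt _ f); [|der1]
 | |- is_derive _ _ (fun t => ?h t) _ => derh h
 | |- is_derive _ _ (fun t => ?h (@?f t)) _ => eapply (@der_comp _ h f); [derh h |der1]
 | |- is_derive _ _ ?h _ => derh h
 end.

Ltac der := eapply der_eq; [der1|].
Ltac ctsh h := first [assumption | match goal with H : forall t, {for t, continuous h} |- _ => exact (H _) | H : continuous h |- _ => exact (H _) end | idtac].

Ltac cts1 := try assumption; lazymatch goal with
 | |- {for _, continuous (fun t => t)} => exact: ctsI
 | |- {for _, continuous (fun _ => ?c)} => exact: ctsC
 | |- {for _, continuous (fun t => @?f t + @?g t)} => apply (@ctsD _ f g); [cts1|cts1]
 | |- {for _, continuous (fun t => - (@?f t))} => apply (@ctsN _ f); cts1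
 | |- {for _, continuous (fun t => @?f t * @?g t)} => apply (@ctsM _ f g); [cts1|cts1]
 | |- {for _, continuous (fun t => (@?f t)^-1)} => apply (@ctsV _ f); [|cts1]
 | |- {for _, continuous (fun t => (@?f t) ^+ ?n)} => apply (@ctsX _ n f); cts1
 | |- {for _, continuous (fun t => expR (@?f t))} => apply (@ctsexp _ f); cts1
 | |- {for _, continuous (fun t => sin (@?f t))} => apply (@ctssin _ f); cts1
 | |- {for _, continuous (fun t => cos (@?f t))} => apply (@ctscos _ f); cts1
 | |- {for _, continuous (fun t => Num.sqrt (@?f t))} => apply (@ctssqrt _ f); cts1
 | |- {for _, continuous (fun t => ln (@?f t))} => apply (@ctsln _ f); [|cts1]
 | |- {for _, continuous (fun t => `|@?f t|)} => apply (@ctsabs _ f); cts1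
 | |- {for _, continuous (fun t => ?h t)} => ctsh h
 | |- {for _, continuous (fun t => ?h (@?f t))} => apply (@cts_comp _ h f); [ctsh h|cts1]
 | |- {for _, continuous ?h} => ctsh h
 | _ => idtac
 end.

Ltac cts := cts1; try assumption.

(** * Dominated convergence and differentiation under the integral sign *)

Section integration.
Context d (T : measurableType d) (R : realType) (mu : {measure set T -> \bar R}).
Implicit Types (D : set T) (f g : T -> R).

Lemma integrable_dom D f g : measurable D -> measurable_fun D f ->
  (forall t, D t -> `|f t| <= g t) -> mu.-integrable D (EFin \o g) ->
  mu.-integrable D (EFin \o f).
Proof.
move=> mD mf fg ig; apply: (le_integrable mD) ig; first exact/measurable_EFinP.
move=> t Dt /=; rewrite lee_fin (le_trans (fg _ Dt))//.
exact: ler_norm.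
Qed.

Lemma integrable_sum D f g : measurable D -> mu.-integrable D (EFin \o f) ->
  mu.-integrable D (EFin \o g) -> mu.-integrable D (EFin \o (fun t => f t + g t)).
Proof. by move=> mD i1 i2; apply: (@integrableD _ _ _ _ D mD (EFin \o f) (EFin \o g)). Qed.

Lemma integrable_diff D f g : measurable D -> mu.-integrable D (EFin \o f) ->
  mu.-integrable D (EFin \o g) -> mu.-integrable D (EFin \o (fun t => f t - g t)).
Proof. by move=> mD i1 i2; apply: (@integrableB _ _ _ _ D mD (EFin \o f) (EFin \o g)). Qed.

Lemma integrable_scale D f (c : R) : measurable D -> mu.-integrable D (EFin \o f) ->
  mu.-integrable D (EFin \o (fun t => c * f t)).
Proof. by move=> mD i1; exact: (integrableZl mD c i1). Qed.

Lemma normr_Rintegral_le D f g : measurable D -> mu.-integrable D (EFin \o f) ->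
  mu.-integrable D (EFin \o g) -> (forall t, D t -> `|f t| <= g t) ->
  `|Rintegral mu D f| <= Rintegral mu D g.
Proof.
move=> mD i1 i2 fg; apply: le_trans (le_normr_Rintegral mD i1) _.
apply: le_Rintegral => //.
by have := integrable_norm i1.
Qed.

Lemma dominated_cvg_seq D (f : nat -> T -> R) (g G : T -> R) : measurable D ->
  (forall n, measurable_fun D (f n)) ->
  (forall t, D t -> f ^~ t @ \oo --> g t) ->
  (forall n t, D t -> `|f n t| <= G t) -> mu.-integrable D (EFin \o G) ->
  mu.-integrable D (EFin \o g) /\
  (fun n => Rintegral mu D (f n)) @ \oo --> Rintegral mu D g.
Proof.
move=> mD mf fg fG iG.
have mg : measurable_fun D g by exact: (measurable_fun_cvg mf fg).
have [||||| ig _ cv] := @dominated_convergence _ _ _ mu _ mD (fun n => EFin \o f n) (EFin \o g) (EFin \o G).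
- by move=> n; exact/measurable_EFinP.
- exact/measurable_EFinP.
- by apply: aeW => t Dt /=; apply: cvg_EFin; [exact: nearW|exact: fg].
- exact: iG.
- by apply: aeW => t n Dt /=; rewrite lee_fin fG.
split => //; rewrite /Rintegral; apply/fine_cvg; rewrite fineK//.
by apply: integrable_fin_num.
Qed.

Lemma dominated_cvg_at_right D (f : R -> T -> R) (g G : T -> R) (a b : R) : a < b ->
  measurable D ->
  (forall x, a < x < b -> measurable_fun D (f x)) ->
  (forall t, D t -> f x t @[x --> a^'+] --> g t) ->
  (forall x t, a < x < b -> D t -> `|f x t| <= G t) -> mu.-integrable D (EFin \o G) ->
  mu.-integrable D (EFin \o g) /\
  Rintegral mu D (f x) @[x --> a^'+] --> Rintegral mu D g.
Proof.
move=> ab mD mf fg fG iG.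
(* Clamping the parameter into []a, b[] gives measurability and domination for every term of a
   sequence, not just eventually; for large [n] the clamp does nothing. *)
pose m x := Num.min x ((a + b) / 2).
have mab x : a < x -> a < m x < b by move=> ax; rewrite /m lt_min ax gt_min /=; apply/andP; split; [lra|apply/orP; right; lra].
have key (u : R^nat) : (forall n, a < u n) -> u n @[n --> \oo] --> a ->
   mu.-integrable D (EFin \o g) /\ Rintegral mu D (f (u n)) @[n --> \oo] --> Rintegral mu D g.
  move=> au ua.
  have nu : \forall n \near \oo, m (u n) = u n.
    near=> n; rewrite /m min_l//.
    by near: n; apply: (cvgr_le a ua); lra.
  have [|||ig h] := @dominated_cvg_seq D (fun n => f (m (u n))) g G mD _ _ _ iG.
  - by move=> n; apply: mf; exact: mab.
  - move=> t Dt.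
    have := fg t Dt => /cvg_at_rightP/(_ u) h.
    have {}h := h (conj au ua).
    by apply: cvg_trans h; apply: near_eq_cvg; near=> n; rewrite (near nu n).
  - by move=> n t Dt; apply: fG => //; exact: mab.
  - split => //.
    by apply: cvg_trans h; apply: near_eq_cvg; near=> n; rewrite (near nu n).
split.
  have [//||//] := key (fun n => a + n.+1%:R^-1).
  - by move=> n; rewrite ltrDl invr_gt0.
  - rewrite -[X in _ --> X]addr0; apply: cvgD; [exact: cvg_cst|exact: cvg_harmonic].
by apply/cvg_at_rightP => u [au ua]; have [] := key u au ua.
Unshelve. all: by end_near. Qed.

Lemma dominated_cvg_pinfty D (f : R -> T -> R) (g G : T -> R) (a : R) :
  measurable D ->
  (forall x, a < x -> measurable_fun D (f x)) ->
  (forall t, D t -> f x t @[x --> +oo] --> g t) ->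
  (forall x t, a < x -> D t -> `|f x t| <= G t) -> mu.-integrable D (EFin \o G) ->
  mu.-integrable D (EFin \o g) /\
  Rintegral mu D (f x) @[x --> +oo] --> Rintegral mu D g.
Proof.
move=> mD mf fg fG iG.
pose m x := Num.max x (a + 1).
have mab x : a < m x by rewrite /m lt_max; apply/orP; right; lra.
have key (u : R^nat) : u n @[n --> \oo] --> +oo ->
   mu.-integrable D (EFin \o g) /\ Rintegral mu D (f (u n)) @[n --> \oo] --> Rintegral mu D g.
  move=> ua.
  have nu : \forall n \near \oo, m (u n) = u n.
    near=> n; rewrite /m max_l//.
    by near: n; move/cvgryPge : ua; exact.
  have [|||ig h] := @dominated_cvg_seq D (fun n => f (m (u n))) g G mD _ _ _ iG.
  - by move=> n; exact: mf.
  - move=> t Dt.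
    have := fg t Dt => /cvg_pinftyP/(_ u ua) h.
    by apply: cvg_trans h; apply: near_eq_cvg; near=> n; rewrite (near nu n).
  - by move=> n t Dt; apply: fG => //; exact: mab.
  - split => //.
    by apply: cvg_trans h; apply: near_eq_cvg; near=> n; rewrite (near nu n).
split.
  by have [] := key (fun n => n%:R) (@cvgr_idn R).
by apply/cvg_pinftyP => u ua; have [] := key u ua.
Unshelve. all: by end_near. Qed.

Lemma der_under_integral D (f f' : R -> T -> R) (G : T -> R) (a u v : R) :
  measurable D -> u < a < v ->
  (forall x, u < x < v -> mu.-integrable D (EFin \o f x)) ->
  (forall x t, u < x < v -> D t -> is_derive x 1 (f ^~ t) (f' x t)) ->
  mu.-integrable D (EFin \o G) ->
  (forall x t, u < x < v -> D t -> `|f' x t| <= G t) ->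
  is_derive a 1 (fun x => Rintegral mu D (f x)) (Rintegral mu D (f' a)).
Proof.
move=> mD uav iF dF iG fG.
pose G' t := `|G t|.
have E x t : u < x < v -> D t -> partial1of2 f x t = f' x t.
  by move=> xuv Dt; rewrite partial1of2E; have [_ ->] := dF x t xuv Dt.
have Ia : `]u, v[%classic a by rewrite /= in_itv.
have H1 : forall x, `]u, v[%classic x -> mu.-integrable D (EFin \o f x).
  by move=> x; rewrite /= in_itv/=; exact: iF.
have H2 : forall x y, `]u, v[%classic x -> D y -> derivable (f ^~ y) x 1.
  by move=> x y; rewrite /= in_itv/= => xuv Dy; have [] := dF x y xuv Dy.
have H3 : forall y, 0 <= G' y by move=> y; exact: normr_ge0.
have H4 : mu.-integrable D (EFin \o G') by have := integrable_norm iG.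
have H5 : forall x y, `]u, v[%classic x -> D y -> `|partial1of2 f x y| <= G' y.
  move=> x y; rewrite /= in_itv/= => xuv Dy.
  rewrite E// (le_trans (fG _ _ xuv Dy))//; exact: ler_norm.
have D1 := @derivable_under_integral _ _ _ mu f D mD a u v Ia H1 H2 G' H3 H4 H5.
have D2 := @differentiation_under_integral _ _ _ mu f D mD a u v Ia H1 H2 G' H3 H4 H5.
apply: DeriveDef; first exact: D1.
rewrite -derive1E D2; apply: eq_Rintegral => t; rewrite inE => Dt.
by rewrite E.
Qed.

End integration.

Ltac intg := try assumption; lazymatch goal with
 | |- is_true (integrable ?m ?D (comp _ ?F)) => lazymatch F with
   | (fun t => @?f t + - (@?g t))%R =>
     apply (@integrable_diff _ _ _ m D f g); [by []|intg|intg]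
   | (fun t => @?f t + @?g t)%R =>
     apply (@integrable_sum _ _ _ m D f g); [by []|intg|intg]
   | (fun t => @?e t * @?f t)%R => lazymatch e with
     | (fun _ => ?c) => apply (@integrable_scale _ _ _ m D f c); [by []|intg]
     | _ => idtac
     end
   | _ => idtac
   end
 | _ => idtac
 end.

(** * Fundamental theorem of calculus and integrability on half lines *)

Section lebesgue_calculus.
Variable R : realType.
Local Notation mu := (@lebesgue_measure R).
Implicit Types (f F : R -> R).

Lemma continuous_measurableT D f : measurable D -> (forall t, {for t, continuous f}) ->
  measurable_fun D f.
Proof.
move=> mD cf; apply: (@measurable_funTS _ _ _ _ D f).
by apply: continuous_measurable_fun => x; exact: cf.
Qed.

Lemma continuous_measurable_oy (a : R) f : (forall t, a < t -> {for t, continuous f}) ->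
  measurable_fun `]a, +oo[ f.
Proof.
move=> cf; apply: open_continuous_measurable_fun => //.
by move=> x; rewrite inE/= in_itv/= andbT; exact: cf.
Qed.

Lemma continuous_within_itv (a b : itv_bound R) f :
  (forall t, t \in Interval a b -> {for t, continuous f}) ->
  {within [set` Interval a b], continuous f}.
Proof.
move=> cf; apply: continuous_in_subspaceT => x; rewrite inE/=; exact: cf.
Qed.

Lemma continuous_integrable_itv (a b : R) f :
  (forall t, a <= t <= b -> {for t, continuous f}) ->
  mu.-integrable `[a, b] (EFin \o f).
Proof.
move=> cf; apply: continuous_compact_integrable; first exact: segment_compact.
by apply: continuous_within_itv => t; rewrite in_itv/=; exact: cf.
Qed.

Lemma Rintegral_FTC (a b : R) F f : a <= b ->
  (forall t, a <= t <= b -> is_derive t 1 F (f t)) ->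
  (forall t, a <= t <= b -> {for t, continuous f}) ->
  Rintegral mu `[a, b] f = F b - F a.
Proof.
rewrite le_eqVlt => /predU1P[<-|ab] dF cf.
  by rewrite set_itv1 Rintegral_set1 subrr.
rewrite /Rintegral (@continuous_FTC2 _ f F a b ab) //.
- by apply: continuous_within_itv => t; rewrite in_itv/=; exact: cf.
- have cF t : a <= t <= b -> {for t, continuous F}.
    by move=> tab; exact: der_cts (dF t tab).
  split.
  + move=> t; rewrite in_itv/= => /andP[t1 t2].
    by have [] := dF t _; rewrite ?(ltW t1) ?(ltW t2).
  + by apply: cvg_at_right_filter; apply: cF; rewrite lexx ltW.
  + by apply: cvg_at_left_filter; apply: cF; rewrite lexx ltW.
- move=> t; rewrite in_itv/= => /andP[t1 t2].
  have tab : a <= t <= b by rewrite (ltW t1) (ltW t2).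
  by rewrite derive1E; have [_ ->] := dF t tab.
Qed.

Lemma Rintegral_itvcy_cvg (a : R) f : mu.-integrable `[a, +oo[ (EFin \o f) ->
  Rintegral mu `[a, x] f @[x --> +oo] --> Rintegral mu `[a, +oo[ f.
Proof.
move=> iF.
have mf : measurable_fun `[a, +oo[ f by apply/measurable_EFinP; exact: (measurable_int mu iF).
have [//|||||_ h] := @dominated_cvg_pinfty _ _ R mu `[a, +oo[
  (fun (x t : R) => f t * (t <= x)%R%:R) f (fun t => `|f t|) a.
- move=> x ax; apply: measurable_funM => //.
  have -> : (fun t : R => (t <= x)%R%:R : R) = \1_(`]-oo, x]).
    by apply/funext => t; rewrite indicE; congr (_%:R); rewrite mem_setE in_itv.
  exact: measurable_indic.
- move=> t at_; apply: cvg_near_cst; near=> x.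
  have -> : t <= x by near: x; apply: nbhs_pinfty_ge; exact: num_real.
  by rewrite mulr1.
- by move=> x t ax at_; rewrite normrM ler_piMr//; case: (t <= x); rewrite ?normr1 ?normr0.
- by have := integrable_norm iF.
apply: cvg_trans h; apply: near_eq_cvg; near=> x.
rewrite [RHS]Rintegral_mkcond [LHS]Rintegral_mkcond; apply: eq_Rintegral => t _.
rewrite /patch !mem_setE !in_itv/= andbT; case: (leP a t) => //= _.
by case: (leP t x); rewrite ?mulr1 ?mulr0.
Unshelve. all: by end_near. Qed.

Lemma Rintegral_FTCy (a l : R) F f :
  (forall t, a <= t -> is_derive t 1 F (f t)) ->
  (forall t, a <= t -> {for t, continuous f}) ->
  mu.-integrable `[a, +oo[ (EFin \o f) ->
  F x @[x --> +oo] --> l ->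
  Rintegral mu `[a, +oo[ f = l - F a.
Proof.
move=> dF cf iF Fl.
have h := Rintegral_itvcy_cvg iF.
have h2 : Rintegral mu `[a, x] f @[x --> +oo] --> l - F a.
  have h3 : F x - F a @[x --> +oo] --> l - F a by apply: cvgB => //; exact: cvg_cst.
  apply: cvg_trans h3; apply: near_eq_cvg; near=> x.
  apply/esym/Rintegral_FTC.
  - by near: x; apply: nbhs_pinfty_ge; exact: num_real.
  - by move=> t /andP[ta _]; exact: dF.
  - by move=> t /andP[ta _]; exact: cf.
exact: (cvg_unique _ h h2).
Unshelve. all: by end_near. Qed.

Lemma integrable_invDsqr : mu.-integrable `[0, +oo[ (EFin \o (fun r : R => (1 + r ^+ 2)^-1)).
Proof.
apply/integrableP; split.
  apply/measurable_EFinP; apply: continuous_measurableT => // t; cts.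
  by rewrite gt_eqF//; nra.
under eq_integral => x _.
  rewrite gee0_abs//; last by rewrite lee_fin invr_ge0; nra.
  over.
by rewrite integral0y_oneDsqr ltry.
Qed.

Lemma Rintegral_invDsqr : Rintegral mu `[0, +oo[ (fun r : R => (1 + r ^+ 2)^-1) = pi / 2.
Proof. by rewrite /Rintegral integral0y_oneDsqr. Qed.

Lemma cvg_expRN_pinfty (c : R) : 0 < c -> expR (- (c * x)) @[x --> +oo] --> (0 : R).
Proof.
move=> c0; apply: (cvg_comp (fun x : R => c * x) (fun x => expR (- x))).
  by apply/cvgryPge => A; near=> x; rewrite mulrC -ler_pdivrMr//; near: x; apply: nbhs_pinfty_ge; rewrite num_real.
exact: cvgr_expR.
Unshelve. all: by end_near. Qed.

Lemma integral_expRN (c : R) : 0 < c ->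
  (\int[mu]_(x in `[0%R, +oo[) (expR (- (c * x)))%:E = (c^-1)%:E)%E.
Proof.
move=> c0.
have c00 : c != 0 by rewrite gt_eqF.
have dF (t : R) : is_derive t 1 (fun x => - expR (- (c * x)) / c) (expR (- (c * t))).
  by der => //=; field.
rewrite (@ge0_continuous_FTC2y _ (fun x => expR (- (c * x))) (fun x => - expR (- (c * x)) / c) 0 0).
- by rewrite mulr0 oppr0 expR0 -EFinB; congr EFin; field.
- by move=> x _; exact: expR_ge0.
- by apply: continuous_within_itv => t _; cts.
- rewrite -[X in _ --> X](mul0r c^-1) -[X in X * _]oppr0; apply: cvgM; last exact: cvg_cst.
  by apply: cvgN; exact: cvg_expRN_pinfty.
- by move=> x _; have [] := dF x.
- by apply: cvg_at_right_filter; exact: der_cts (dF 0).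
- by move=> x _; rewrite derive1E; have [_ ->] := dF x.
Qed.

Lemma integrable_expRN (c : R) : 0 < c ->
  mu.-integrable `[0, +oo[ (EFin \o (fun x => expR (- (c * x)))).
Proof.
move=> c0; apply/integrableP; split.
  by apply/measurable_EFinP; apply: continuous_measurableT => // t; cts.
under eq_integral => x _.
  rewrite gee0_abs//; last by rewrite lee_fin expR_ge0.
  over.
by rewrite integral_expRN// ltry.
Qed.

End lebesgue_calculus.

(** * Integral representations *)

Section transmutation_kernel.
Variable R : realType.
Local Notation mu := (@lebesgue_measure R).
Implicit Types (v r t X y : R).

(* [hyp (sinh t) = cosh t] and [ash] is the inverse of [sinh]; [shh y = sinh (y / 2)], [chh y = cosh (y / 2)]. *)
Definition hyp (v : R) : R := Num.sqrt (1 + v ^+ 2).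

Lemma hyp2 v : hyp v ^+ 2 = 1 + v ^+ 2.
Proof. by rewrite sqr_sqrtr//; nra. Qed.

Lemma hyp_ge1 v : 1 <= hyp v.
Proof. by rewrite -[X in X <= _]sqrtr1 ler_sqrt; nra. Qed.

Lemma hyp_gt0 v : 0 < hyp v. Proof. exact: lt_le_trans (hyp_ge1 v). Qed.
Lemma hyp_neq0 v : hyp v != 0. Proof. by rewrite gt_eqF// hyp_gt0. Qed.

Lemma le_hyp v : `|v| <= hyp v.
Proof. by rewrite -sqrtr_sqr ler_sqrt; nra. Qed.

Lemma der_hyp v : is_derive v 1 hyp (v / hyp v).
Proof.
have := hyp_neq0 v; rewrite /hyp => h; der; first by nra.
by rewrite /=; field.
Qed.

Lemma cts_hyp v : {for v, continuous hyp}.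
Proof. exact: der_cts (der_hyp v). Qed.

Definition ash (v : R) : R := ln (v + hyp v).

Lemma ash_arg_gt0 v : 0 < v + hyp v.
Proof.
have := le_hyp v; have := hyp2 v; have := hyp_gt0 v.
case: (lerP 0 v) => v0; last first.
  by move=> h1 h2 _; nra.
by move=> ? _ _; lra.
Qed.

Lemma der_ash v : is_derive v 1 ash ((hyp v)^-1).
Proof.
have h := hyp_neq0 v; have h2 := ash_arg_gt0 v; rewrite /ash.
have d := der_hyp v.
der => //.
by rewrite /=; field; rewrite h gt_eqF.
Qed.

Lemma cts_ash v : {for v, continuous ash}.
Proof. exact: der_cts (der_ash v). Qed.

Lemma ash0 : ash 0 = 0.
Proof. by rewrite /ash /hyp expr0n addr0 sqrtr1 add0r ln1. Qed.

Lemma ash_ge0 v : 0 <= v -> 0 <= ash v.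
Proof. by move=> v0; rewrite ln_ge0// ; have := hyp_ge1 v; lra. Qed.

Definition shh (y : R) : R := (expR (y / 2) - expR (- (y / 2))) / 2.
Definition chh (y : R) : R := (expR (y / 2) + expR (- (y / 2))) / 2.

Lemma chh_gt0 y : 0 < chh y.
Proof. by rewrite /chh; have := expR_gt0 (y / 2); have := expR_gt0 (- (y / 2)); lra. Qed.

Lemma hyp_shh y : hyp (shh y) = chh y.
Proof.
apply/eqP; rewrite -(@eqrXn2 _ 2)// ?ltW ?hyp_gt0 ?chh_gt0// hyp2; apply/eqP.
rewrite /shh /chh expRN; field; rewrite gt_eqF//; exact: expR_gt0.
Qed.

Lemma ash_shh y : ash (shh y) = y / 2.
Proof.
rewrite /ash hyp_shh (_ : _ + _ = expR (y / 2)) ?expRK// /shh /chh.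
by field.
Qed.

Lemma shh_gt0 y : 0 < y -> 0 < shh y.
Proof. by move=> y0; rewrite /shh divr_gt0// subr_gt0 ltr_expR; lra. Qed.

Lemma der_shh y : is_derive y 1 shh (chh y / 2).
Proof. by rewrite /shh /chh; der => //; rewrite /=; field. Qed.

Lemma der_chh y : is_derive y 1 chh (shh y / 2).
Proof. by rewrite /shh /chh; der => //; rewrite /=; field. Qed.

Section kernel.
Variables (h h' : R -> R) (lam : R).
Hypothesis dh : forall t : R, is_derive t 1 h (h' t).
Hypothesis dh' : forall t : R, is_derive t 1 h' (lam * h t).

(* [K0], [K1], [K2] are the transported function [h (2 arsinh v) / cosh (arsinh v)] and its first two derivatives. *)
Definition K0 (v : R) : R := h (2 * ash v) / hyp v.

Definition K1 (v : R) : R :=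
  2 * h' (2 * ash v) / hyp v ^+ 2 - v * h (2 * ash v) / hyp v ^+ 3.

Definition K2 (v : R) : R :=
  (4 * lam - 1) * h (2 * ash v) / hyp v ^+ 3 - 6 * v * h' (2 * ash v) / hyp v ^+ 4
  + 3 * v ^+ 2 * h (2 * ash v) / hyp v ^+ 5.

Lemma der_K0 v : is_derive v 1 K0 (K1 v).
Proof.
have hv := hyp_neq0 v; have d1 := der_hyp v; have d2 := der_ash v; rewrite /K0 /K1.
have d3 := dh (2 * ash v).
by der => //; rewrite /=; field.
Qed.

Lemma der_K1 v : is_derive v 1 K1 (K2 v).
Proof.
have hv := hyp_neq0 v; have d1 := der_hyp v; have d2 := der_ash v; rewrite /K1 /K2.
have d3 := dh (2 * ash v). have d4 := dh' (2 * ash v).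
der => //; rewrite ?expf_neq0//.
rewrite /=; field. by rewrite ?expf_neq0.
Qed.

(** The function [h (2 arsinh v)] satisfies [(1 + v^2) y'' + v y' = 4 lam y]; dividing it by [hyp v]
    changes this into the equation below, whose first order coefficient is the one needed for the
    exact derivatives in [q_ode] and [p_ode]. *)
Lemma K_ode v : (1 + v ^+ 2) * K2 v + 3 * v * K1 v + K0 v = 4 * lam * K0 v.
Proof.
have hv := hyp_neq0 v; rewrite /K0 /K1 /K2 -hyp2.
by field.
Qed.

Lemma cts_h t : {for t, continuous h}. Proof. exact: der_cts (dh t). Qed.
Lemma cts_h' t : {for t, continuous h'}. Proof. exact: der_cts (dh' t). Qed.
Lemma cts_K0 v : {for v, continuous K0}. Proof. exact: der_cts (der_K0 v). Qed.
Lemma cts_K1 v : {for v, continuous K1}. Proof. exact: der_cts (der_K1 v). Qed.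

Lemma cts_K2 v : {for v, continuous K2}.
Proof.
have c1 := cts_h; have c2 := cts_h'; have c3 := cts_ash; have c4 := cts_hyp.
by rewrite /K2; cts; rewrite expf_neq0// hyp_neq0.
Qed.

Section second_kind.
Variables A B : R.
Hypothesis hA : forall t, 0 <= t -> `|h t| <= A.
Hypothesis hB : forall t, 0 <= t -> `|h' t| <= B.
Lemma A_ge0 : 0 <= A. Proof. exact: le_trans (hA (lexx 0)). Qed.
Lemma B_ge0 : 0 <= B. Proof. exact: le_trans (hB (lexx 0)). Qed.

(** Each derivative gains a factor [1 / hyp v]. This makes the integrands of [q0], [q1], [q2]
    bounded by multiples of one weight [(1 + r^2)^-1], with powers of [1 / X] as the only dependence
    on [X]. *)
Lemma K0_le v : 0 <= v -> `|K0 v| <= A / hyp v.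
Proof.
move=> v0; rewrite normrM normfV (gtr0_norm (hyp_gt0 v)) ler_pM2r ?invr_gt0 ?hyp_gt0//.
by apply: hA; rewrite mulr_ge0// ash_ge0.
Qed.

Lemma K1_le v : 0 <= v -> `|K1 v| <= (2 * B + A) / hyp v ^+ 2.
Proof.
move=> v0; have t0 : 0 <= 2 * ash v by rewrite mulr_ge0// ash_ge0.
have hv := hyp_gt0 v; have hv0 := hyp_neq0 v.
have -> : K1 v = (2 * h' (2 * ash v) - v / hyp v * h (2 * ash v)) / hyp v ^+ 2.
  by rewrite /K1; field.
rewrite normrM (@gtr0_norm _ (_ ^-1)) ?invr_gt0 ?exprn_gt0// ler_pM2r ?invr_gt0 ?exprn_gt0//.
apply: le_trans (ler_normB _ _) _; apply: lerD.
  by rewrite normrM ger0_norm// ler_pM2l// hB.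
rewrite normrM -[X in _ <= X]mul1r; apply: ler_pM => //; last exact: hA.
by rewrite normrM normfV (gtr0_norm hv) ler_pdivrMr// mul1r le_hyp.
Qed.

Lemma K2_le v : 0 <= v -> `|K2 v| <= ((4 * `|lam| + 4) * A + 6 * B) / hyp v ^+ 3.
Proof.
move=> v0; have t0 : 0 <= 2 * ash v by rewrite mulr_ge0// ash_ge0.
have hv := hyp_gt0 v; have hv0 := hyp_neq0 v.
have -> : K2 v = ((4 * lam - 1) * h (2 * ash v) - 6 * (v / hyp v) * h' (2 * ash v)
    + 3 * (v / hyp v) ^+ 2 * h (2 * ash v)) / hyp v ^+ 3.
  by rewrite /K2; field.
rewrite normrM (@gtr0_norm _ (_ ^-1)) ?invr_gt0 ?exprn_gt0// ler_pM2r ?invr_gt0 ?exprn_gt0//.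
have k0 : 0 <= v / hyp v <= 1.
  apply/andP; split; first by rewrite divr_ge0// ltW.
  by rewrite ler_pdivrMr// mul1r (le_trans (ler_norm _) (le_hyp v)).
set k := v / hyp v in k0 *.
have -> : (4 * `|lam| + 4) * A + 6 * B = (4 * `|lam| + 1) * A + 6 * B + 3 * A by ring.
have k2 : `|k| <= 1 by rewrite ger0_norm; lra.
apply: le_trans (ler_normD _ _) _; apply: lerD; last first.
  rewrite normrM; apply: ler_pM => //; last exact: hA.
  by move/andP: k0 => [k01 k02]; rewrite ger0_norm; nra.
apply: le_trans (ler_normB _ _) _; apply: lerD.
  rewrite normrM; apply: ler_pM => //; last exact: hA.
  by apply: le_trans (ler_normB _ _) _; rewrite normrM normr1 ger0_norm.
rewrite normrM; apply: ler_pM => //; last exact: hB.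
by move/andP: k0 => [k01 k02]; rewrite ger0_norm; nra.
Qed.

(* [q0] and its derivatives: a solution in [X = sinh (y / 2)] determined by its behaviour at infinity. *)
Definition q0 (X : R) := Rintegral mu `[0, +oo[ (fun r => K0 (X * hyp r) / hyp r).

Definition q1 (X : R) := Rintegral mu `[0, +oo[ (fun r => K1 (X * hyp r)).
Definition q2 (X : R) := Rintegral mu `[0, +oo[ (fun r => hyp r * K2 (X * hyp r)).

Lemma hypM_ge X r : 0 < X -> X * hyp r <= hyp (X * hyp r).
Proof. by move=> X0; apply: le_trans (le_hyp _); exact: ler_norm. Qed.

Lemma q0_dom X r : 0 < X -> `|K0 (X * hyp r) / hyp r| <= A / X * (1 + r ^+ 2)^-1.
Proof.
move=> X0; have r0 := hyp_gt0 r; have Xr : 0 < X * hyp r by exact: mulr_gt0.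
rewrite normrM normfV (gtr0_norm r0) ler_pdivrMr//.
apply: le_trans (K0_le (ltW Xr)) _; rewrite -hyp2.
have -> : A / X * (hyp r ^+ 2)^-1 * hyp r = A / (X * hyp r).
  by field; rewrite hyp_neq0 gt_eqF.
by apply: ler_wpM2l; rewrite ?A_ge0// lef_pV2 ?posrE ?hyp_gt0// hypM_ge.
Qed.

Lemma q1_dom X r : 0 < X -> `|K1 (X * hyp r)| <= (2 * B + A) / X ^+ 2 * (1 + r ^+ 2)^-1.
Proof.
move=> X0; have r0 := hyp_gt0 r; have Xr : 0 < X * hyp r by exact: mulr_gt0.
apply: le_trans (K1_le (ltW Xr)) _; rewrite -hyp2.
have -> : (2 * B + A) / X ^+ 2 * (hyp r ^+ 2)^-1 = (2 * B + A) / (X * hyp r) ^+ 2.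
  by field; rewrite hyp_neq0 gt_eqF.
apply: ler_wpM2l; first by have := A_ge0; have := B_ge0; lra.
rewrite lef_pV2 ?posrE ?exprn_gt0 ?hyp_gt0//; by apply: lerXn2r; rewrite ?nnegrE ?hypM_ge//; apply: ltW; rewrite ?hyp_gt0.
Qed.

Lemma q2_dom X r : 0 < X -> `|hyp r * K2 (X * hyp r)| <=
   ((4 * `|lam| + 4) * A + 6 * B) / X ^+ 3 * (1 + r ^+ 2)^-1.
Proof.
move=> X0; have r0 := hyp_gt0 r; have Xr : 0 < X * hyp r by exact: mulr_gt0.
rewrite normrM (gtr0_norm r0) mulrC -ler_pdivlMr//.
apply: le_trans (K2_le (ltW Xr)) _; rewrite -hyp2.
set C := (X in X / _ <= _).
have -> : C / X ^+ 3 * (hyp r ^+ 2)^-1 / hyp r = C / (X * hyp r) ^+ 3.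
  by field; rewrite hyp_neq0 gt_eqF.
apply: ler_wpM2l; first by rewrite /C; have := A_ge0; have := B_ge0; have := normr_ge0 lam; nra.
rewrite lef_pV2 ?posrE ?exprn_gt0 ?hyp_gt0//; by apply: lerXn2r; rewrite ?nnegrE ?hypM_ge//; apply: ltW; rewrite ?hyp_gt0.
Qed.

Lemma cts_q0i X t : {for t, continuous (fun r => K0 (X * hyp r) / hyp r)}.
Proof. by have c1 := cts_K0; have c2 := cts_hyp; cts; exact: hyp_neq0. Qed.

Lemma cts_q1i X t : {for t, continuous (fun r => K1 (X * hyp r))}.
Proof. by have c1 := cts_K1; have c2 := cts_hyp; cts. Qed.

Lemma cts_q2i X t : {for t, continuous (fun r => hyp r * K2 (X * hyp r))}.
Proof. by have c1 := cts_K2; have c2 := cts_hyp; cts. Qed.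

Lemma int_cauchy c : mu.-integrable `[0, +oo[ (EFin \o (fun r : R => c * (1 + r ^+ 2)^-1)).
Proof. by apply: integrable_scale => //; exact: integrable_invDsqr. Qed.

Lemma int_q0 X : 0 < X -> mu.-integrable `[0, +oo[ (EFin \o (fun r => K0 (X * hyp r) / hyp r)).
Proof.
move=> X0; apply: (integrable_dom _ _ _ (int_cauchy (A / X))) => //.
  by apply: continuous_measurableT => // t; exact: cts_q0i.
by move=> r _; exact: q0_dom.
Qed.

Lemma int_q1 X : 0 < X -> mu.-integrable `[0, +oo[ (EFin \o (fun r => K1 (X * hyp r))).
Proof.
move=> X0; apply: (integrable_dom _ _ _ (int_cauchy _)) => //.
  by apply: continuous_measurableT => // t; exact: cts_q1i.
by move=> r _; exact: q1_dom.
Qed.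

Lemma int_q2 X : 0 < X -> mu.-integrable `[0, +oo[ (EFin \o (fun r => hyp r * K2 (X * hyp r))).
Proof.
move=> X0; apply: (integrable_dom _ _ _ (int_cauchy _)) => //.
  by apply: continuous_measurableT => // t; exact: cts_q2i.
by move=> r _; exact: q2_dom.
Qed.

Lemma der_q0 X : 0 < X -> is_derive X 1 q0 (q1 X).
Proof.
move=> X0.
apply: (@der_under_integral _ _ R mu `[0, +oo[ (fun X r => K0 (X * hyp r) / hyp r)
  (fun X r => K1 (X * hyp r)) (fun r => (2 * B + A) / (X / 2) ^+ 2 * (1 + r ^+ 2)^-1) X (X / 2) (2 * X)).
- by [].
- by apply/andP; split; lra.
- by move=> x /andP[x1 _]; apply: int_q0; lra.
- move=> x r _ _; have d := der_K0 (x * hyp r).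
  by der => //; rewrite /=; field; exact: hyp_neq0.
- exact: int_cauchy.
- move=> x r /andP[x1 _] _; apply: le_trans (q1_dom _ _) _; first lra.
  apply: ler_wpM2r; first by rewrite invr_ge0; nra.
  apply: ler_wpM2l; first by have := A_ge0; have := B_ge0; lra.
  by rewrite lef_pV2 ?posrE ?exprn_gt0//; [apply: lerXn2r; rewrite ?nnegrE; lra|lra|lra].
Qed.

Lemma der_q1 X : 0 < X -> is_derive X 1 q1 (q2 X).
Proof.
move=> X0.
apply: (@der_under_integral _ _ R mu `[0, +oo[ (fun X r => K1 (X * hyp r))
  (fun X r => hyp r * K2 (X * hyp r)) (fun r => ((4 * `|lam| + 4) * A + 6 * B) / (X / 2) ^+ 3 * (1 + r ^+ 2)^-1) X (X / 2) (2 * X)).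
- by [].
- by apply/andP; split; lra.
- by move=> x /andP[x1 _]; apply: int_q1; lra.
- move=> x r _ _; have d := der_K1 (x * hyp r).
  by der => //; rewrite /=; ring.
- exact: int_cauchy.
- move=> x r /andP[x1 _] _; apply: le_trans (q2_dom _ _) _; first lra.
  apply: ler_wpM2r; first by rewrite invr_ge0; nra.
  apply: ler_wpM2l; first by have := A_ge0; have := B_ge0; have := normr_ge0 lam; nra.
  by rewrite lef_pV2 ?posrE ?exprn_gt0//; [apply: lerXn2r; rewrite ?nnegrE; lra|lra|lra].
Qed.

Lemma cvg_inv_pinfty : (x : R)^-1 @[x --> +oo] --> (0 : R).
Proof.
apply/cvgrPdist_lt => e e0; near=> x.
have x0 : e^-1 < x by near: x; apply: nbhs_pinfty_gt; exact: num_real.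
have xp : 0 < x by rewrite (lt_trans _ x0)// invr_gt0.
rewrite sub0r normrN gtr0_norm ?invr_gt0// -[e]invrK ltf_pV2 ?posrE ?invr_gt0//.
Unshelve. all: by end_near. Qed.

(* Applying the Legendre operator to the integrand gives the exact derivative
   of [r |-> r * K1 (X * hyp r) / X]. *)
Lemma q_ode X : 0 < X ->
  (1 + X ^+ 2) * q2 X + (X^-1 + 3 * X) * q1 X + q0 X = 4 * lam * q0 X.
Proof.
move=> X0.
have i0 := int_q0 X0. have i1 := int_q1 X0. have i2 := int_q2 X0.
have X00 : X != 0 by rewrite gt_eqF.
pose g r := (1 + X ^+ 2) * (hyp r * K2 (X * hyp r)) + (X^-1 + 3 * X) * K1 (X * hyp r)
  + (1 - 4 * lam) * (K0 (X * hyp r) / hyp r).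
have gE r : g r = r ^+ 2 / hyp r * K2 (X * hyp r) + X^-1 * K1 (X * hyp r).
  have hr := hyp_neq0 r.
  have E : (1 - 4 * lam) * K0 (X * hyp r) = - (1 + (X * hyp r) ^+ 2) * K2 (X * hyp r) - 3 * (X * hyp r) * K1 (X * hyp r).
    by have := K_ode (X * hyp r); lra.
  rewrite /g [X in _ + X]mulrA E.
  have -> : r ^+ 2 = hyp r ^+ 2 - 1 by rewrite hyp2; ring.
  by field; rewrite X00 hr.
have ig : mu.-integrable `[0, +oo[ (EFin \o g).
  by rewrite /g; intg.
have Ig : Rintegral mu `[0, +oo[ g =
   (1 + X ^+ 2) * q2 X + (X^-1 + 3 * X) * q1 X + (1 - 4 * lam) * q0 X.
  rewrite /g RintegralD//; last 2 first.
  - by intg.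
  - by intg.
  rewrite RintegralD//; last 2 first.
  - by intg.
  - by intg.
  by rewrite !RintegralZl.
have : Rintegral mu `[0, +oo[ g = 0 - (fun r => r * K1 (X * hyp r) / X) 0.
  apply: (@Rintegral_FTCy R 0 0 (fun r => r * K1 (X * hyp r) / X) g).
  - move=> r _; rewrite gE; have d := der_K1 (X * hyp r); have d2 := der_hyp r.
    have hr := hyp_neq0 r.
    by der => //; rewrite /=; field; rewrite hr X00.
  - by move=> r _; rewrite /g; have c0 := @cts_q0i X; have c1 := @cts_q1i X; have c2 := @cts_q2i X;
      apply: ctsD; [apply: ctsD|]; (apply: ctsM; [exact: ctsC|]).
  - exact: ig.
  - pose C := (2 * B + A) / X ^+ 2 / X.
    have BA0 : 0 <= 2 * B + A by have := A_ge0; have := B_ge0; lra.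
    have C0 : 0 <= C by rewrite /C !divr_ge0 ?exprn_ge0 ?(ltW X0).
    apply: (@squeeze_cvgr _ _ _ _ (fun r => - (C * r^-1)) (fun r => C * r^-1)).
    + near=> r.
      have r0 : 0 < r by near: r; apply: nbhs_pinfty_gt; exact: num_real.
      rewrite -ler_norml.
      rewrite normrM normrM normfV (gtr0_norm r0) (gtr0_norm X0).
      have h1 : `|K1 (X * hyp r)| <= (2 * B + A) / X ^+ 2 * (1 + r ^+ 2)^-1 by exact: q1_dom.
      have h2 : r * (1 + r ^+ 2)^-1 <= r^-1.
        rewrite -[X in _ <= X]mul1r ler_pdivrMr; last nra.
        by rewrite mulrAC ler_pdivlMr//; nra.
      have h3 : r * `|K1 (X * hyp r)| <= (2 * B + A) / X ^+ 2 * (r * (1 + r ^+ 2)^-1).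
        by rewrite mulrCA ler_pM2l.
      rewrite /C ler_pdivrMr//.
      have -> : (2 * B + A) / X ^+ 2 / X / r * X = (2 * B + A) / X ^+ 2 * r^-1.
        by field; rewrite X00 gt_eqF.
      apply: le_trans h3 _; apply: ler_wpM2l => //.
      by rewrite divr_ge0 ?exprn_ge0 ?(ltW X0).
    + rewrite -[X in _ --> X]oppr0 -[X in _ --> - X](mulr0 C); apply: cvgN.
      by apply: cvgM; [exact: cvg_cst|exact: cvg_inv_pinfty].
    + rewrite -[X in _ --> X](mulr0 C).
      by apply: cvgM; [exact: cvg_cst|exact: cvg_inv_pinfty].
rewrite Ig mul0r mul0r subr0 => E.
by rewrite -[RHS]addr0 -E; ring.
Unshelve. all: by end_near. Qed.

End second_kind.
End kernel.
End transmutation_kernel.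

(** * The solution regular at the origin, Wronskians, and limits at the origin *)

Section first_kind.
Variable R : realType.
Local Notation mu := (@lebesgue_measure R).
Implicit Types (v r t X Y x y a b : R) (F : R -> R).

Lemma continuous_bounded_itv F a b : (forall t, {for t, continuous F}) ->
  exists2 M, 0 <= M & forall t, a <= t <= b -> `|F t| <= M.
Proof.
move=> cF; case: (lerP a b) => ab; last first.
  by exists 0 => // t /andP[t1 t2]; have := le_trans t1 t2; rewrite leNgt ab.
have [|c _ cM] := @EVT_max R (fun t => `|F t|) a b ab.
  by apply: continuous_within_itv => t _; cts.
by exists `|F c| => // t tab; apply: cM; rewrite in_itv.
Qed.

Lemma Rintegrable_cst a b (c : R) : mu.-integrable `[a, b] (EFin \o (fun=> c)).
Proof. by apply: continuous_integrable_itv => t _; exact: ctsC. Qed.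

Lemma Rintegral_cst_itv a b (c : R) : a <= b -> Rintegral mu `[a, b] (fun=> c) = c * (b - a).
Proof.
move=> ab; rewrite mulrBr; apply: (@Rintegral_FTC R a b (fun t => c * t) (fun=> c)) => //.
- by move=> t _; der; rewrite /=; ring.
- by move=> t _; exact: ctsC.
Qed.

Lemma der_compact_parameter (F F1 m n : R -> R) a b Y :
  (forall v, is_derive v 1 F (F1 v)) -> (forall v, {for v, continuous F1}) ->
  (forall v, {for v, continuous m}) -> (forall v, {for v, continuous n}) ->
  is_derive Y 1 (fun Y => Rintegral mu `[a, b] (fun f => F (Y * m f) * n f))
    (Rintegral mu `[a, b] (fun f => F1 (Y * m f) * m f * n f)).
Proof.
move=> dF cF1 cm cn.
have cF v : {for v, continuous F} by exact: der_cts (dF v).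
have [M M0 mM] := continuous_bounded_itv a b cm.
have [N N0 nN] := continuous_bounded_itv a b cn.
have [C C0 hC] := continuous_bounded_itv (- ((`|Y| + 1) * M)) ((`|Y| + 1) * M) cF1.
apply: (@der_under_integral _ _ R mu `[a, b] (fun Y f => F (Y * m f) * n f)
  (fun Y f => F1 (Y * m f) * m f * n f) (fun=> C * M * N) Y (Y - 1) (Y + 1)).
- by [].
- by apply/andP; split; lra.
- by move=> x _; apply: continuous_integrable_itv => t _; cts.
- move=> x t _ _; have d := dF (x * m t).
  by der; rewrite /=; ring.
- exact: Rintegrable_cst.
- move=> x t /andP[x1 x2]; rewrite /= in_itv/= => tab.
  rewrite !normrM; apply: ler_pM; rewrite ?mulr_ge0 ?nN//.
  apply: ler_pM; rewrite ?mM//.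
  apply: hC; rewrite -ler_norml normrM; apply: ler_pM; rewrite ?mM//.
  rewrite ler_norml; have := ler_norm Y; have := ler_norm (- Y); rewrite normrN => h1 h2.
  by apply/andP; split; lra.
Qed.

Section kernel.
Variables (h h' : R -> R) (lam : R).
Hypothesis dh : forall t : R, is_derive t 1 h (h' t).
Hypothesis dh' : forall t : R, is_derive t 1 h' (lam * h t).

(* [p0] and its derivatives: the solution in [X = sinh (y / 2)] that is regular at [0]. *)
Definition p0 Y := Rintegral mu `[0, pi / 2] (fun f => K0 h (Y * sin f)).

Definition p1 Y := Rintegral mu `[0, pi / 2] (fun f => K1 h h' (Y * sin f) * sin f).
Definition p2 Y := Rintegral mu `[0, pi / 2] (fun f => K2 h h' lam (Y * sin f) * sin f ^+ 2).
Lemma cts_sin t : {for t, continuous (@sin R)}. Proof. exact: continuous_sin. Qed.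

Lemma der_p0 Y : is_derive Y 1 p0 (p1 Y).
Proof.
have := @der_compact_parameter (K0 h) (K1 h h') sin (fun=> 1) 0 (pi / 2) Y
  (der_K0 dh) (cts_K1 dh dh') cts_sin (fun t => @ctsC R 1 t).
rewrite /p0 /p1.
under [X in is_derive _ _ X _ -> _]eq_fun do under eq_Rintegral do rewrite mulr1.
by under eq_Rintegral do rewrite mulr1.
Qed.

Lemma der_p1 Y : is_derive Y 1 p1 (p2 Y).
Proof.
have := @der_compact_parameter (K1 h h') (K2 h h' lam) sin sin 0 (pi / 2) Y
  (der_K1 dh dh') (cts_K2 dh dh') cts_sin cts_sin.
rewrite /p1 /p2.
by under eq_Rintegral do rewrite -mulrA -expr2.
Qed.

Hypothesis h'0 : h' 0 = 0.

(** As in [q_ode], the operator applied to the integrand gives an exact derivative, here of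
    [- cos f * K1 (Y sin f) / Y]. The boundary terms vanish because [cos (pi / 2) = 0] and, by
    [h' 0 = 0], [K1] vanishes at 0. *)
Lemma p_ode Y : 0 < Y ->
  (1 + Y ^+ 2) * p2 Y + (Y^-1 + 3 * Y) * p1 Y + p0 Y = 4 * lam * p0 Y.
Proof.
move=> Y0; have Y00 : Y != 0 by rewrite gt_eqF.
have c0 := cts_K0 dh; have c1 := cts_K1 dh dh'; have c2 := cts_K2 dh dh'.
have pi0 : 0 <= pi / 2 :> R by rewrite divr_ge0// pi_ge0.
have i0 : mu.-integrable `[0, pi / 2] (EFin \o (fun f => K0 h (Y * sin f))).
  by apply: continuous_integrable_itv => t _; cts.
have i1 : mu.-integrable `[0, pi / 2] (EFin \o (fun f => K1 h h' (Y * sin f) * sin f)).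
  by apply: continuous_integrable_itv => t _; cts.
have i2 : mu.-integrable `[0, pi / 2] (EFin \o (fun f => K2 h h' lam (Y * sin f) * sin f ^+ 2)).
  by apply: continuous_integrable_itv => t _; cts.
pose g f := (1 + Y ^+ 2) * (K2 h h' lam (Y * sin f) * sin f ^+ 2)
  + (Y^-1 + 3 * Y) * (K1 h h' (Y * sin f) * sin f) + (1 - 4 * lam) * K0 h (Y * sin f).
have Ig : Rintegral mu `[0, pi / 2] g =
   (1 + Y ^+ 2) * p2 Y + (Y^-1 + 3 * Y) * p1 Y + (1 - 4 * lam) * p0 Y.
  rewrite /g RintegralD//; [|by intg|by intg].
  rewrite RintegralD//; [|by intg|by intg].
  by rewrite !RintegralZl.
have : Rintegral mu `[0, pi / 2] g = (fun f => - (cos f * K1 h h' (Y * sin f) / Y)) (pi / 2)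
    - (fun f => - (cos f * K1 h h' (Y * sin f) / Y)) 0.
  apply: (@Rintegral_FTC R 0 (pi / 2) (fun f => - (cos f * K1 h h' (Y * sin f) / Y)) g).
  - exact: pi0.
  - move=> f _; have d := der_K1 dh dh' (Y * sin f).
    der => //=.
    have E : (1 - 4 * lam) * K0 h (Y * sin f) = - (1 + (Y * sin f) ^+ 2) * K2 h h' lam (Y * sin f)
       - 3 * (Y * sin f) * K1 h h' (Y * sin f).
      by have := K_ode h h' lam (Y * sin f); lra.
    rewrite /g E.
    transitivity (sin f * K1 h h' (Y * sin f) / Y - cos f ^+ 2 * K2 h h' lam (Y * sin f)).
      by field.
    have -> : cos f ^+ 2 = 1 - sin f ^+ 2 by have := cos2Dsin2 f; lra.
    by field.
  - by move=> f _; rewrite /g; cts.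
rewrite Ig /= cos_pihalf sin0 cos0 mulr0.
have -> : K1 h h' 0 = 0.
  by rewrite /K1 ash0 mulr0 h'0; ring.
rewrite !mul0r mulr0 mul0r oppr0 subr0 => E.
by rewrite -[RHS]addr0 -E; ring.
Qed.

Lemma p0_0 : p0 0 = pi / 2 * h 0.
Proof.
rewrite /p0; under eq_Rintegral do rewrite mul0r.
have pi0 : 0 <= pi / 2 :> R by rewrite divr_ge0// pi_ge0.
rewrite Rintegral_cst_itv// subr0.
by rewrite mulrC /K0 ash0 mulr0 /hyp expr0n addr0 sqrtr1 divr1.
Qed.

End kernel.

(** The substitution [x = exp t] moves the half line to the whole line. *)
Lemma der0_const_pos (F : R -> R) : (forall x, 0 < x -> is_derive x 1 F 0) ->
  forall x y, 0 < x -> 0 < y -> F x = F y.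
Proof.
move=> dF x y x0 y0.
have d (t : R) : is_derive t 1 (fun t => F (expR t)) 0.
  have e := dF _ (expR_gt0 t); have e2 := is_derive_expR t.
  by der; rewrite mul0r.
have := @is_derive_0_is_cst R (fun t => F (expR t)) (ln x) (ln y) d.
by rewrite !lnK ?posrE.
Qed.

(* For a solution [u0] of this Legendre type equation, [om y * u0' (sinh (y / 2))] solves
   [u'' = (lam + 3 / (4 sinh^2 y)) u]: see [solY_JJ]. *)
Definition solX (lam : R) (u0 u1 u2 : R -> R) := forall X, 0 < X ->
  [/\ is_derive X 1 u0 (u1 X), is_derive X 1 u1 (u2 X) &
   (1 + X ^+ 2) * u2 X + (X^-1 + 3 * X) * u1 X + u0 X = 4 * lam * u0 X].

(** The Wronskian times Abel's integrating factor: the logarithmic derivative of [X (1 + X^2)] is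
    [(X^-1 + 3 X) / (1 + X^2)]. *)
Definition wrX (u0 u1 v0 v1 : R -> R) X := X * (1 + X ^+ 2) * (u1 X * v0 X - u0 X * v1 X).

Lemma wrX_const lam (u0 u1 u2 v0 v1 v2 : R -> R) : solX lam u0 u1 u2 -> solX lam v0 v1 v2 ->
  forall X Y, 0 < X -> 0 < Y -> wrX u0 u1 v0 v1 X = wrX u0 u1 v0 v1 Y.
Proof.
move=> su sv; apply: der0_const_pos => X X0.
have X00 : X != 0 by rewrite gt_eqF.
have [du0 du1 eu] := su X X0; have [dv0 dv1 ev] := sv X X0.
rewrite /wrX; der; rewrite /=.
have E (a b c : R) : (1 + X ^+ 2) * c + (X^-1 + 3 * X) * b + a = 4 * lam * a ->
   X * (1 + X ^+ 2) * c = (4 * lam - 1) * X * a - (1 + 3 * X ^+ 2) * b.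
  move=> e; have -> : X * (1 + X ^+ 2) * c = X * (4 * lam * a - a - (X^-1 + 3 * X) * b) by rewrite -e; ring.
  by field.
have e1 := E _ _ _ eu; have e2 := E _ _ _ ev.
transitivity ((1 + 3 * X ^+ 2) * (u1 X * v0 X - u0 X * v1 X)
   + (X * (1 + X ^+ 2) * u2 X * v0 X - u0 X * (X * (1 + X ^+ 2) * v2 X))); first by ring.
by rewrite e1 e2; ring.
Qed.

Section zero_limits.
Variables (h h' : R -> R) (lam A B : R).
Hypothesis dh : forall t : R, is_derive t 1 h (h' t).
Hypothesis dh' : forall t : R, is_derive t 1 h' (lam * h t).
Hypothesis hA : forall t, 0 <= t -> `|h t| <= A.
Hypothesis hB : forall t, 0 <= t -> `|h' t| <= B.

Lemma solX_q : solX lam (q0 h) (q1 h h') (q2 h h' lam).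
Proof.
move=> X X0; split.
- exact: (der_q0 dh hA hB).
- exact: (der_q1 dh dh' hA hB).
- exact: (q_ode dh dh' hA hB).
Qed.

(** [X * (r / hyp r) * K1 (X hyp r)] is the derivative in [r] of [K0 (X hyp r)] and integrates to
    [- K0 X]. The rest carries the weight [1 - r / hyp r <= (1 + r^2)^-1], which is integrable and
    leaves one factor [X]. *)
Lemma q1_near0 X : 0 < X -> `|X * q1 h h' X + K0 h X| <= X * ((2 * B + A) * (pi / 2)).
Proof.
move=> X0.
have A0 := A_ge0 hA; have B0 := B_ge0 hB.
have i1 := int_q1 dh dh' hA hB X0.
have c1 := cts_K1 dh dh'. have ch := @cts_hyp R.
pose g r := X * r / hyp r * K1 h h' (X * hyp r).
have ck r : 0 <= r -> `|r / hyp r| <= 1.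
  move=> r0; rewrite normrM normfV (gtr0_norm (hyp_gt0 r)) ler_pdivrMr ?hyp_gt0// mul1r.
  exact: le_hyp.
have cg t : {for t, continuous g} by rewrite /g; cts; exact: hyp_neq0.
have ig : mu.-integrable `[0, +oo[ (EFin \o g).
  apply: (@integrable_dom _ _ _ mu _ g (fun r => X * `|K1 h h' (X * hyp r)|)) => //.
  - exact: continuous_measurableT.
  - move=> r /=; rewrite in_itv/= andbT => r0.
    rewrite /g -mulrA -mulrA normrM (gtr0_norm X0) ler_pM2l// mulrA normrM.
    by rewrite ler_piMl// ck.
  - by apply: integrable_scale => //; have := integrable_norm i1.
have Eg : Rintegral mu `[0, +oo[ g = 0 - K0 h (X * hyp 0).
  apply: (@Rintegral_FTCy R 0 0 (fun r => K0 h (X * hyp r)) g).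
  - move=> r _; have d := der_K0 dh (X * hyp r); have d2 := der_hyp r.
    by der; rewrite /g/=; ring.
  - by [].
  - exact: ig.
  - apply: (@squeeze_cvgr _ _ _ _ (fun r => - (A / X * r^-1)) (fun r => A / X * r^-1)).
    + near=> r.
      have r0 : 0 < r by near: r; apply: nbhs_pinfty_gt; exact: num_real.
      rewrite -ler_norml.
      apply: le_trans (K0_le hA _) _; first by rewrite mulr_ge0 ?ltW ?hyp_gt0.
      rewrite -mulrA; apply: ler_wpM2l => //.
      rewrite -invfM lef_pV2 ?posrE ?hyp_gt0 ?mulr_gt0//.
      apply: le_trans (hypM_ge _ X0); rewrite ler_pM2l//.
      exact: le_trans (ler_norm _) (le_hyp r).
    + rewrite -[X in _ --> X]oppr0 -[X in _ --> - X](mulr0 (A / X)); apply: cvgN.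
      by apply: cvgM; [exact: cvg_cst|exact: cvg_inv_pinfty].
    + rewrite -[X in _ --> X](mulr0 (A / X)).
      by apply: cvgM; [exact: cvg_cst|exact: cvg_inv_pinfty].
have hyp0 : hyp 0 = 1 :> R by rewrite /hyp expr0n addr0 sqrtr1.
rewrite hyp0 mulr1 sub0r in Eg.
have -> : X * q1 h h' X + K0 h X =
    Rintegral mu `[0, +oo[ (fun r => X * K1 h h' (X * hyp r) - g r).
  rewrite RintegralB//; last by intg.
  by rewrite RintegralZl// Eg opprK.
have -> : X * ((2 * B + A) * (pi / 2)) =
   Rintegral mu `[0, +oo[ (fun r => X * (2 * B + A) * (1 + r ^+ 2)^-1).
  rewrite RintegralZl//; last exact: integrable_invDsqr.
  by rewrite Rintegral_invDsqr mulrA.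
apply: normr_Rintegral_le => //.
- by intg.
- exact: int_cauchy.
- move=> r /=; rewrite in_itv/= andbT => r0.
  have hr := hyp_gt0 r; have hr0 := hyp_neq0 r.
  have -> : X * K1 h h' (X * hyp r) - g r = X * ((1 - r / hyp r) * K1 h h' (X * hyp r)).
    by rewrite /g; ring.
  rewrite normrM (gtr0_norm X0) -mulrA ler_pM2l// normrM mulrC.
  apply: ler_pM => //.
    apply: le_trans (K1_le hA hB _) _; first by rewrite mulr_ge0 ?ltW.
    rewrite ler_pdivrMr ?exprn_gt0 ?hyp_gt0// ler_peMr//; first lra.
    by rewrite exprn_ege1// hyp_ge1.
  have -> : 1 - r / hyp r = (hyp r * (hyp r + r))^-1.
    have h1 : hyp r + r != 0 by rewrite gt_eqF//; lra.
    have h2 : hyp r ^+ 2 - r ^+ 2 = 1 by rewrite hyp2; ring.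
    apply: (mulIf (mulf_neq0 hr0 h1)); rewrite mulVf ?mulf_neq0//.
    by rewrite -[RHS]h2; field.
  rewrite gtr0_norm; last by rewrite invr_gt0 mulr_gt0//; lra.
  rewrite -hyp2 lef_pV2 ?posrE ?exprn_gt0 ?mulr_gt0//; last lra.
  by rewrite expr2 ler_pM2l//; lra.
Unshelve. all: by end_near. Qed.

(** The logarithmic singularity of [q0] at the origin has coefficient [- h 0]; this fixes the
    Wronskians with the regular solutions. *)
Lemma q1_lim0 : X * q1 h h' X @[X --> 0^'+] --> - h 0.
Proof.
pose C := (2 * B + A) * (pi / 2).
have -> : (fun X => X * q1 h h' X) = (fun X => (X * q1 h h' X + K0 h X) - K0 h X).
  by apply/funext => X; ring.
rewrite -[X in _ --> X]sub0r; apply: cvgB; last first.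
  have -> : h 0 = K0 h 0 by rewrite /K0 ash0 mulr0 /hyp expr0n addr0 sqrtr1 divr1.
  by apply: cvg_at_right_filter; exact: (cts_K0 dh).
have cC (c : R) : X * c @[X --> 0^'+] --> (0 : R).
  rewrite -[X in _ --> X](mul0r c); apply: cvgM; last exact: cvg_cst.
  by apply: cvg_at_right_filter; exact: cvg_id.
apply: (@squeeze_cvgr _ _ _ _ (fun X => - (X * C)) (fun X => X * C)).
- near=> X; rewrite -ler_norml; apply: q1_near0.
  by near: X; exact: nbhs_right_gt.
- by rewrite -[X in _ --> X]oppr0; apply: cvgN; exact: cC.
- exact: cC.
Unshelve. all: by end_near. Qed.

Lemma q0_lim0 : X * q0 h X @[X --> 0^'+] --> (0 : R).
Proof.
have A0 := A_ge0 hA.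
have c0 := cts_K0 dh. have ch := @cts_hyp R.
have := @dominated_cvg_at_right _ _ R mu `[0, +oo[ (fun X r => X * (K0 h (X * hyp r) / hyp r))
  (fun=> 0) (fun r => A * (1 + r ^+ 2)^-1) 0 1.
case => //.
- by move=> X _; apply: continuous_measurableT => // t; cts; exact: hyp_neq0.
- move=> r _.
  have cC (c : R) : X * c @[X --> 0^'+] --> (0 : R).
    rewrite -[X in _ --> X](mul0r c); apply: cvgM; last exact: cvg_cst.
    by apply: cvg_at_right_filter; exact: cvg_id.
  have X0 : \forall X \near 0^'+, 0 < X :> R by exact: nbhs_right_gt.
  have bd : \forall X \near 0^'+, `|X * (K0 h (X * hyp r) / hyp r)| <= X * A.
    near=> X; have Xp : 0 < X by near: X.
    rewrite normrM (gtr0_norm Xp) ler_pM2l// normrM normfV (gtr0_norm (hyp_gt0 r)).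
    rewrite ler_pdivrMr ?hyp_gt0//; apply: le_trans (K0_le hA _) _.
      by rewrite mulr_ge0 ?ltW ?hyp_gt0.
    apply: ler_wpM2l => //; apply: (@le_trans _ _ 1); last exact: hyp_ge1.
    by rewrite invf_le1 ?hyp_gt0// hyp_ge1.
  apply: (@squeeze_cvgr _ _ _ _ (fun X => - (X * A)) (fun X => X * A)).
  + by near=> X; rewrite -ler_norml; near: X.
  + by rewrite -[X in _ --> X]oppr0; apply: cvgN; exact: cC.
  + exact: cC.
- move=> X r /andP[X0 _] _; rewrite normrM (gtr0_norm X0).
  rewrite mulrC -ler_pdivlMr//; apply: le_trans (q0_dom hA _ X0) _.
  by rewrite [X in _ <= X]mulrAC.
- exact: int_cauchy.
move=> _; rewrite Rintegral_cst// mul0r => h1.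
apply: cvg_trans h1; apply: near_eq_cvg; near=> X.
rewrite RintegralZl//.
apply: (int_q0 dh hA); near: X; exact: nbhs_right_gt.
Unshelve. all: by end_near. Qed.

End zero_limits.
End first_kind.

(** * Behaviour at infinity *)

Section asymptotics.
Variable R : realType.
Local Notation mu := (@lebesgue_measure R).
Implicit Types (r t X x y s z c : R) (f g : R -> R).

Definition asy s f c1 c2 :=
  (fun y => f y - (c1 * cos (s * y) + c2 * sin (s * y))) @ +oo --> (0 : R).

Lemma cvgy_eq f g (l l' : R) : f @ +oo --> l -> (forall y, 0 < y -> f y = g y) ->
  l = l' -> g @ +oo --> l'.
Proof.
move=> fl fg <-; apply: cvg_trans fl; apply: near_eq_cvg; near=> y.
by apply: fg; near: y; apply: nbhs_pinfty_gt; exact: num_real.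
Unshelve. all: by end_near. Qed.

Lemma cvgy_cst (W : R) : (fun _ : R => W) @ +oo --> W.
Proof. exact: cvg_cst. Qed.

Lemma cvgyD f g (a b : R) : f @ +oo --> a -> g @ +oo --> b ->
  (fun y => f y + g y) @ +oo --> a + b.
Proof. by move=> fa gb; exact: cvgD. Qed.

Lemma cvgyB f g (a b : R) : f @ +oo --> a -> g @ +oo --> b ->
  (fun y => f y - g y) @ +oo --> a - b.
Proof. by move=> fa gb; exact: cvgB. Qed.

Lemma cvgyM f g (a b : R) : f @ +oo --> a -> g @ +oo --> b ->
  (fun y => f y * g y) @ +oo --> a * b.
Proof. by move=> fa gb; exact: cvgM. Qed.

Lemma cvg0_bounded f g C : f @ +oo --> (0 : R) -> (forall y, `|g y| <= C) ->
  (fun y => f y * g y) @ +oo --> (0 : R).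
Proof.
move=> f0 gC; have C0 : 0 <= C by exact: le_trans (gC 0).
apply/norm_cvg0P; apply: (@squeeze_cvgr _ _ _ _ (fun=> 0) (fun y => `|f y| * C)).
- by apply: nearW => y; rewrite normr_ge0 normrM ler_wpM2l.
- exact: cvg_cst.
- by rewrite -[X in _ --> X](mul0r C); apply: cvgM; [exact/norm_cvg0P|exact: cvg_cst].
Qed.

Lemma trig_bounded s c1 c2 y : `|c1 * cos (s * y) + c2 * sin (s * y)| <= `|c1| + `|c2|.
Proof.
apply: le_trans (ler_normD _ _) _; rewrite !normrM; apply: lerD; rewrite ler_piMr//.
- by rewrite ler_norml cos_geN1 cos_le1.
- by rewrite ler_norml sin_geN1 sin_le1.
Qed.

Lemma asyD s f g c1 c2 d1 d2 : asy s f c1 c2 -> asy s g d1 d2 ->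
  asy s (fun y => f y + g y) (c1 + d1) (c2 + d2).
Proof.
by move=> af ag; apply: (cvgy_eq (cvgyD af ag)) => [y _ /=|]; ring.
Qed.

Lemma asyM s f (k : R -> R) c1 c2 (k0 : R) : asy s f c1 c2 -> k @ +oo --> k0 ->
  asy s (fun y => k y * f y) (k0 * c1) (k0 * c2).
Proof.
move=> af kk.
have h1 : (fun y => k y * (f y - (c1 * cos (s * y) + c2 * sin (s * y)))) @ +oo --> (0 : R).
  by rewrite -[X in _ --> X](mulr0 k0); apply: cvgM.
have h2 : (fun y => (k y - k0) * (c1 * cos (s * y) + c2 * sin (s * y))) @ +oo --> (0 : R).
  apply: cvg0_bounded; last by move=> y; exact: trig_bounded.
  by rewrite -[X in _ --> X](subrr k0); apply: cvgB => //; exact: cvg_cst.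
by apply: (cvgy_eq (cvgyD h1 h2)) => [y _ /=|]; ring.
Qed.

Lemma asyZ s f (k : R) c1 c2 : asy s f c1 c2 -> asy s (fun y => k * f y) (k * c1) (k * c2).
Proof. by move=> af; apply: asyM => //; exact: cvg_cst. Qed.

Lemma asy_eq s f g c1 c2 d1 d2 : asy s f c1 c2 -> (forall y, 0 < y -> f y = g y) ->
  c1 = d1 -> c2 = d2 -> asy s g d1 d2.
Proof.
by move=> af fg <- <-; apply: (cvgy_eq af) => // y y0; rewrite fg.
Qed.

Lemma asy_trig s f P Q c1 c2 : P @ +oo --> c1 -> Q @ +oo --> c2 ->
  (forall y, 0 < y -> f y = P y * cos (s * y) + Q y * sin (s * y)) -> asy s f c1 c2.
Proof.
move=> Pc Qc fE.
have ac : asy s (fun y => cos (s * y)) 1 0.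
  by rewrite /asy; under eq_fun do rewrite mul1r mul0r addr0 subrr; exact: cvg_cst.
have as_ : asy s (fun y => sin (s * y)) 0 1.
  by rewrite /asy; under eq_fun do rewrite mul1r mul0r add0r subrr; exact: cvg_cst.
apply: asy_eq (asyD (asyM ac Pc) (asyM as_ Qc)) _ _ _.
- by move=> y y0 /=; rewrite fE.
- by ring.
- by ring.
Qed.

Lemma asy_prod s f g c1 c2 d1 d2 : asy s f c1 c2 -> asy s g d1 d2 ->
  (fun y => f y * g y - (c1 * cos (s * y) + c2 * sin (s * y)) * (d1 * cos (s * y) + d2 * sin (s * y)))
    @ +oo --> (0 : R).
Proof.
move=> af ag.
have h1 := cvg0_bounded af (trig_bounded s d1 d2).
have h2 := cvg0_bounded ag (trig_bounded s c1 c2).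
have h3 : (fun y => (f y - (c1 * cos (s * y) + c2 * sin (s * y))) * (g y - (d1 * cos (s * y) + d2 * sin (s * y)))) @ +oo --> (0 : R).
  by rewrite -[X in _ --> X](mulr0 0); apply: cvgM.
by apply: (cvgy_eq (cvgyD (cvgyD h1 h2) h3)) => [y _ /=|]; ring.
Qed.

(** The three conditions say that the limiting quadratic form in [cos] and [sin] is
    [W (cos^2 + sin^2)], so the oscillations cancel. *)
Lemma asy_wronskian s (f f1 g g1 : R -> R) c1 c2 c1' c2' d1 d2 d1' d2' (W : R) :
  asy s f c1 c2 -> asy s f1 c1' c2' -> asy s g d1 d2 -> asy s g1 d1' d2' ->
  c1 * d1' - c1' * d1 = W -> c2 * d2' - c2' * d2 = W ->
  c1 * d2' + c2 * d1' - c1' * d2 - c2' * d1 = 0 ->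
  (fun y => f y * g1 y - f1 y * g y) @ +oo --> W.
Proof.
move=> af af1 ag ag1 e1 e2 e3.
have hW := @cvgy_cst W.
apply: (cvgy_eq (cvgyD (cvgyB (asy_prod af ag1) (asy_prod af1 ag)) hW)) => [y _ /=|]; last by ring.
have -> : W = (c1 * d1' - c1' * d1) * cos (s * y) ^+ 2 + (c2 * d2' - c2' * d2) * sin (s * y) ^+ 2
     + (c1 * d2' + c2 * d1' - c1' * d2 - c2' * d1) * (cos (s * y) * sin (s * y)).
  by rewrite e1 e2 e3 -[LHS]mulr1 -(cos2Dsin2 (s * y)); ring.
by ring.
Qed.

Variable s : R.
Definition lnD r := ln (1 + r ^+ 2).
(** [Ic + i Is] is the Beta type integral of [(1 + r^2)^(-1 + is)] over the half line. *)
Definition Ic := Rintegral mu `[0, +oo[ (fun r => (1 + r ^+ 2)^-1 * cos (s * lnD r)).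
Definition Is := Rintegral mu `[0, +oo[ (fun r => (1 + r ^+ 2)^-1 * sin (s * lnD r)).
(** Scaling out the growth at infinity: with [z = exp (- y)], the point [shh y * hyp r] equals
    [exp (y / 2) * kap z r], its [hyp] equals [exp (y / 2) * etz z r], and the phase [2 s arsinh]
    equals [s y + thz z r]. The limit in [y] becomes the limit [z -> 0+] of integrals with a
    dominated integrand. *)
Definition kap z r := hyp r * ((1 - z) / 2).
Definition etz z r := Num.sqrt (z + kap z r ^+ 2).
Definition thz z r := s * (2 * ln (kap z r + etz z r)).

Lemma cts_kapr z r : {for r, continuous (kap z)}.
Proof. by have c := @cts_hyp R; rewrite /kap; cts. Qed.

Lemma cts_etzr z r : {for r, continuous (etz z)}.
Proof. by have c := @cts_kapr z; rewrite /etz; cts. Qed.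

Lemma cts_kapz z r : {for z, continuous (kap ^~ r)}.
Proof. by rewrite /kap; cts. Qed.

Lemma cts_etzz z r : {for z, continuous (etz ^~ r)}.
Proof. by have c := @cts_kapz z r; rewrite /etz; cts. Qed.

Lemma kap_gt0 z r : z < 1 -> 0 < kap z r.
Proof. by move=> z1; rewrite mulr_gt0 ?hyp_gt0//; lra. Qed.

Lemma kap_le_etz z r : 0 <= z < 1 -> kap z r <= etz z r.
Proof.
move=> /andP[z0 z1]; rewrite /etz -[X in X <= _]gtr0_norm ?kap_gt0// -sqrtr_sqr ler_sqrt//.
  lra.
by rewrite addr_ge0// sqr_ge0.
Qed.

Lemma etz_gt0 z r : 0 <= z < 1 -> 0 < etz z r.
Proof. by move=> z01; apply: lt_le_trans (kap_le_etz _ z01); apply: kap_gt0; lra. Qed.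

Lemma etz0 r : etz 0 r = hyp r / 2.
Proof.
rewrite /etz add0r sqrtr_sqr gtr0_norm ?kap_gt0//.
by rewrite /kap; lra.
Qed.

Lemma kap0 r : kap 0 r = hyp r / 2.
Proof. by rewrite /kap; lra. Qed.

Lemma cts_thzr z r : 0 <= z < 1 -> {for r, continuous (thz z)}.
Proof.
move=> z01; have c1 := @cts_kapr z; have c2 := @cts_etzr z; rewrite /thz; cts.
by rewrite addr_gt0 ?etz_gt0 ?kap_gt0//; lra.
Qed.

Lemma thz_lim r : thz z r @[z --> 0^'+] --> s * lnD r.
Proof.
have -> : s * lnD r = thz 0 r.
  rewrite /thz /lnD kap0 etz0 (_ : hyp r / 2 + hyp r / 2 = hyp r); last lra.
  by rewrite -hyp2 lnXn ?hyp_gt0// mulr2n; ring.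
apply: cvg_at_right_filter.
have c1 := @cts_kapz 0 r; have c2 := @cts_etzz 0 r.
have : {for 0, continuous (fun z => s * (2 * ln (kap z r + etz z r)))}.
  by cts; rewrite addr_gt0 ?etz_gt0 ?kap_gt0// lexx ltr01.
exact.
Qed.

Section three_weights.
Variable m : R -> R -> R.
Hypothesis m_cts : forall z r, 0 < z < 1 -> {for r, continuous (m z)}.
Hypothesis m_le : forall z r, 0 < z < 1 -> `|m z r| <= (1 + r ^+ 2)^-1.
Hypothesis m_lim : forall r, m z r @[z --> 0^'+] --> (1 + r ^+ 2)^-1.

Lemma weight_int (T : R -> R) z : 0 < z < 1 -> (forall r, {for r, continuous T}) -> (forall r, `|T r| <= 1) ->
  mu.-integrable `[0, +oo[ (EFin \o (fun r => m z r * T r)).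
Proof.
move=> z01 cT T1; have c := fun r => @m_cts z r z01.
apply: (@integrable_dom _ _ _ mu _ _ (fun r => (1 + r ^+ 2)^-1)) => //.
- by apply: continuous_measurableT => // t; cts.
- move=> r _; rewrite normrM; apply: le_trans (@m_le z r z01).
  by rewrite ler_piMr.
- exact: integrable_invDsqr.
Qed.

Lemma weight_lim (T : R -> R) : (forall t, {for t, continuous T}) -> (forall t, `|T t| <= 1) ->
  Rintegral mu `[0, +oo[ (fun r => m z r * T (thz z r)) @[z --> 0^'+] -->
  Rintegral mu `[0, +oo[ (fun r => (1 + r ^+ 2)^-1 * T (s * lnD r)).
Proof.
move=> cT T1.
have [//|//|||||_ h] := @dominated_cvg_at_right _ _ R mu `[0, +oo[ (fun z r => m z r * T (thz z r))
  (fun r => (1 + r ^+ 2)^-1 * T (s * lnD r)) (fun r => (1 + r ^+ 2)^-1) 0 1.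
- move=> z z01; apply: continuous_measurableT => // r.
  have c := @m_cts z r z01; have c2 : {for r, continuous (thz z)}.
    by apply: cts_thzr; lra.
  by cts.
- move=> r _; apply: cvgM; first exact: m_lim.
  by apply: (cvg_comp (thz ^~ r) T); [exact: thz_lim|exact: cT].
- move=> z r z01 _; rewrite normrM; apply: le_trans (@m_le z r z01).
  by rewrite ler_piMr.
- exact: integrable_invDsqr.
- exact: h.
Qed.

Lemma weight_limy (T : R -> R) : (forall t, {for t, continuous T}) -> (forall t, `|T t| <= 1) ->
  Rintegral mu `[0, +oo[ (fun r => m (expR (- y)) r * T (thz (expR (- y)) r)) @[y --> +oo] -->
  Rintegral mu `[0, +oo[ (fun r => (1 + r ^+ 2)^-1 * T (s * lnD r)).
Proof.
move=> cT T1; have := weight_lim cT T1.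
apply: (cvg_comp (fun y => expR (- y))).
have h : expR (- y) @[y --> +oo] --> (0 : R) by exact: cvgr_expR.
move=> A [e e0 eA].
have /cvgrPdist_lt/(_ e e0) := h; apply: filterS => y /=.
by rewrite sub0r normrN => he; apply: eA => //=; [rewrite sub0r normrN|exact: expR_gt0].
Qed.

End three_weights.
(** [m0] is the weight in [X q0]; [m1] and [m2] are the weights of the [h'] and [h] parts of
    [X^2 q1], where [X = shh y]. All three tend to [(1 + r^2)^-1], which is also their common
    bound. *)
Definition m0 z r := (1 - z) / 2 / (etz z r * hyp r).
Definition m1 z r := ((1 - z) / 2) ^+ 2 / etz z r ^+ 2.
Definition m2 z r := ((1 - z) / 2) ^+ 2 * kap z r / etz z r ^+ 3.

Lemma m0_cts z r : 0 < z < 1 -> {for r, continuous (m0 z)}.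
Proof.
move=> z01; have c1 := @cts_etzr z; have c2 := @cts_hyp R; rewrite /m0; cts.
by rewrite mulf_neq0// ?hyp_neq0// gt_eqF// etz_gt0//; lra.
Qed.

Lemma m1_cts z r : 0 < z < 1 -> {for r, continuous (m1 z)}.
Proof.
move=> z01; have c1 := @cts_etzr z; rewrite /m1; cts.
by rewrite expf_neq0// gt_eqF// etz_gt0//; lra.
Qed.

Lemma m2_cts z r : 0 < z < 1 -> {for r, continuous (m2 z)}.
Proof.
move=> z01; have c1 := @cts_etzr z; have c2 := @cts_kapr z; rewrite /m2; cts.
by rewrite expf_neq0// gt_eqF// etz_gt0//; lra.
Qed.

Lemma m0_le z r : 0 < z < 1 -> `|m0 z r| <= (1 + r ^+ 2)^-1.
Proof.
move=> z01; have h := @hyp_gt0 R r.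
have e : 0 < etz z r by apply: etz_gt0; lra.
have ke : kap z r <= etz z r by apply: kap_le_etz; lra.
rewrite ger0_norm; last by rewrite /m0 divr_ge0 ?mulr_ge0 ?(ltW e) ?(ltW h)//; lra.
rewrite /m0 ler_pdivrMr ?mulr_gt0// -hyp2.
have -> : (hyp r ^+ 2)^-1 * (etz z r * hyp r) = etz z r / hyp r by field; rewrite gt_eqF.
by rewrite ler_pdivlMr// mulrC.
Qed.

Lemma m1_le z r : 0 < z < 1 -> `|m1 z r| <= (1 + r ^+ 2)^-1.
Proof.
move=> z01; have h := @hyp_gt0 R r.
have e : 0 < etz z r by apply: etz_gt0; lra.
have k : 0 < kap z r by apply: kap_gt0; lra.
have ke : kap z r <= etz z r by apply: kap_le_etz; lra.
rewrite ger0_norm; last by rewrite /m1 divr_ge0 ?sqr_ge0.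
rewrite /m1 ler_pdivrMr ?exprn_gt0// -hyp2 [leRHS]mulrC ler_pdivlMr ?exprn_gt0//.
rewrite -exprMn mulrC; apply: lerXn2r; rewrite ?nnegrE ?(ltW e)//.
exact: ltW.
Qed.

Lemma m2_le z r : 0 < z < 1 -> `|m2 z r| <= (1 + r ^+ 2)^-1.
Proof.
move=> z01; have e : 0 < etz z r by apply: etz_gt0; lra.
have k : 0 < kap z r by apply: kap_gt0; lra.
have ke : kap z r <= etz z r by apply: kap_le_etz; lra.
apply: le_trans (m1_le r z01).
have -> : m2 z r = m1 z r * (kap z r / etz z r) by rewrite /m1 /m2; field; rewrite gt_eqF.
rewrite normrM ler_piMr// ger0_norm; last by rewrite divr_ge0// ltW.
by rewrite ler_pdivrMr// mul1r.
Qed.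

Lemma m0_lim r : m0 z r @[z --> 0^'+] --> (1 + r ^+ 2)^-1.
Proof.
have h := @hyp_gt0 R r.
have -> : (1 + r ^+ 2)^-1 = m0 0 r.
  by rewrite /m0 etz0 -hyp2; field; rewrite gt_eqF.
apply: cvg_at_right_filter; have c2 := @cts_etzz 0 r.
have : {for 0, continuous (fun z => (1 - z) / 2 / (etz z r * hyp r))}.
  by cts; rewrite mulf_neq0 ?hyp_neq0// etz0 mulf_neq0 ?hyp_neq0.
exact.
Qed.

Lemma m1_lim r : m1 z r @[z --> 0^'+] --> (1 + r ^+ 2)^-1.
Proof.
have h := @hyp_gt0 R r.
have -> : (1 + r ^+ 2)^-1 = m1 0 r.
  by rewrite /m1 etz0 -hyp2; field; rewrite gt_eqF.
apply: cvg_at_right_filter; have c2 := @cts_etzz 0 r.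
have : {for 0, continuous (fun z => ((1 - z) / 2) ^+ 2 / etz z r ^+ 2)}.
  by cts; rewrite expf_neq0// etz0 mulf_neq0 ?hyp_neq0.
exact.
Qed.

Lemma m2_lim r : m2 z r @[z --> 0^'+] --> (1 + r ^+ 2)^-1.
Proof.
have h := @hyp_gt0 R r.
have -> : (1 + r ^+ 2)^-1 = m2 0 r.
  by rewrite /m2 etz0 kap0 -hyp2; field; rewrite gt_eqF.
apply: cvg_at_right_filter; have c2 := @cts_etzz 0 r; have c1 := @cts_kapz 0 r.
have : {for 0, continuous (fun z => ((1 - z) / 2) ^+ 2 * kap z r / etz z r ^+ 3)}.
  by cts; rewrite expf_neq0// etz0 mulf_neq0 ?hyp_neq0.
exact.
Qed.

Lemma Rintegral_lin2 (D : set R) (a b : R) f g : measurable D ->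
  mu.-integrable D (EFin \o f) -> mu.-integrable D (EFin \o g) ->
  Rintegral mu D (fun r => a * f r + b * g r) = a * Rintegral mu D f + b * Rintegral mu D g.
Proof.
move=> mD i1 i2; rewrite RintegralD//; [|exact: integrable_scale|exact: integrable_scale].
by rewrite !RintegralZl.
Qed.

Lemma Rintegral_lin4 (D : set R) (a b c d : R) (f g f' g' : R -> R) : measurable D ->
  mu.-integrable D (EFin \o f) -> mu.-integrable D (EFin \o g) ->
  mu.-integrable D (EFin \o f') -> mu.-integrable D (EFin \o g') ->
  Rintegral mu D (fun r => (a * f r + b * g r) + (c * f' r + d * g' r)) =
  (a * Rintegral mu D f + b * Rintegral mu D g) + (c * Rintegral mu D f' + d * Rintegral mu D g').
Proof.
move=> mD i1 i2 i3 i4; rewrite RintegralD//; first by rewrite !Rintegral_lin2.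
- by apply: integrable_sum => //; exact: integrable_scale.
- by apply: integrable_sum => //; exact: integrable_scale.
Qed.

Definition wint (m : R -> R -> R) (T : R -> R) y :=
  Rintegral mu `[0, +oo[ (fun r => m (expR (- y)) r * T (thz (expR (- y)) r)).

Lemma cos_bd t : `|cos t| <= 1. Proof. by rewrite ler_norml cos_geN1 cos_le1. Qed.
Lemma sin_bd t : `|sin t| <= 1. Proof. by rewrite ler_norml sin_geN1 sin_le1. Qed.
Lemma cos_ct t : {for t, continuous (@cos R)}. Proof. exact: continuous_cos. Qed.
Lemma sin_ct t : {for t, continuous (@sin R)}. Proof. exact: continuous_sin. Qed.

Lemma expRN_in01 y : 0 < y -> 0 < expR (- y) < 1.
Proof. by move=> y0; rewrite expR_gt0 -[X in _ < X]expR0 ltr_expR; lra. Qed.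

Lemma shh_scale y : shh y = expR (y / 2) * ((1 - expR (- y)) / 2).
Proof.
have -> : expR (- y) = expR (- (y / 2)) ^+ 2 by rewrite -expRM_natl; congr expR; field.
by rewrite /shh expRN; field; rewrite gt_eqF// expR_gt0.
Qed.

Lemma vr_scale y r : shh y * hyp r = expR (y / 2) * kap (expR (- y)) r.
Proof. by rewrite shh_scale /kap; ring. Qed.

Lemma hypvr_scale y r : hyp (shh y * hyp r) = expR (y / 2) * etz (expR (- y)) r.
Proof.
rewrite vr_scale /hyp /etz; set E := expR (y / 2).
have E0 : 0 < E by exact: expR_gt0.
rewrite -[X in _ = X * _](gtr0_norm E0) -sqrtr_sqr -sqrtrM ?sqr_ge0//; congr Num.sqrt.
have -> : expR (- y) = (E ^+ 2)^-1 by rewrite /E -expRM_natl -expRN; congr expR; field.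
by field; rewrite gt_eqF.
Qed.

Lemma ash_scale y r : 0 < y ->
  s * (2 * ash (shh y * hyp r)) = s * y + thz (expR (- y)) r.
Proof.
move=> y0; have z01 := expRN_in01 y0.
rewrite /ash hypvr_scale vr_scale -mulrDr lnM ?posrE ?expR_gt0//; last first.
  by rewrite addr_gt0 ?kap_gt0 ?etz_gt0//; lra.
by rewrite expRK /thz; field.
Qed.

Section trig_integrals.
Variable y : R.
Hypothesis y0 : 0 < y.
Let z01 := expRN_in01 y0.
Let X0 := shh_gt0 y0.

Lemma ct_thz r : {for r, continuous (thz (expR (- y)))}.
Proof. by apply: cts_thzr; have := z01; lra. Qed.

Lemma int_wcos (m : R -> R -> R) : (forall z r, 0 < z < 1 -> {for r, continuous (m z)}) ->
  (forall z r, 0 < z < 1 -> `|m z r| <= (1 + r ^+ 2)^-1) ->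
  mu.-integrable `[0, +oo[ (EFin \o (fun r => m (expR (- y)) r * cos (thz (expR (- y)) r))).
Proof.
have ct := ct_thz.
by move=> mc ml; apply: (weight_int mc ml z01) => [r|r]; [cts|exact: cos_bd].
Qed.

Lemma int_wsin (m : R -> R -> R) : (forall z r, 0 < z < 1 -> {for r, continuous (m z)}) ->
  (forall z r, 0 < z < 1 -> `|m z r| <= (1 + r ^+ 2)^-1) ->
  mu.-integrable `[0, +oo[ (EFin \o (fun r => m (expR (- y)) r * sin (thz (expR (- y)) r))).
Proof.
have ct := ct_thz.
by move=> mc ml; apply: (weight_int mc ml z01) => [r|r]; [cts|exact: sin_bd].
Qed.

Let cs t := cos (s * t).
Let cs' t := - s * sin (s * t).
Let sn t := sin (s * t).
Let sn' t := s * cos (s * t).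

Lemma der_cs t : is_derive t 1 cs (cs' t).
Proof. by rewrite /cs /cs'; der; rewrite /=; ring. Qed.

Lemma der_cs' t : is_derive t 1 cs' (- s ^+ 2 * cs t).
Proof. by rewrite /cs /cs'; der; rewrite /=; ring. Qed.

Lemma der_sn t : is_derive t 1 sn (sn' t).
Proof. by rewrite /sn /sn'; der; rewrite /=; ring. Qed.

Lemma der_sn' t : is_derive t 1 sn' (- s ^+ 2 * sn t).
Proof. by rewrite /sn /sn'; der; rewrite /=; ring. Qed.

Lemma cs_le t : 0 <= t -> `|cs t| <= 1. Proof. by move=> _; exact: cos_bd. Qed.
Lemma sn_le t : 0 <= t -> `|sn t| <= 1. Proof. by move=> _; exact: sin_bd. Qed.

Lemma cs'_le t : 0 <= t -> `|cs' t| <= `|s|.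
Proof. by move=> _; rewrite normrM normrN ler_piMr// sin_bd. Qed.

Lemma sn'_le t : 0 <= t -> `|sn' t| <= `|s|.
Proof. by move=> _; rewrite normrM ler_piMr// cos_bd. Qed.

Let E0 := expR_gt0 (y / 2).
Let e0 r : 0 < etz (expR (- y)) r. Proof. by apply: etz_gt0; have := z01; lra. Qed.

Lemma Xq0_cos : shh y * q0 cs (shh y) =
  wint m0 cos y * cos (s * y) + (- wint m0 sin y) * sin (s * y).
Proof.
rewrite /q0 -RintegralZl//; last exact: (int_q0 der_cs cs_le).
transitivity (Rintegral mu `[0, +oo[ (fun r => cos (s * y) * (m0 (expR (- y)) r * cos (thz (expR (- y)) r)) +
   - sin (s * y) * (m0 (expR (- y)) r * sin (thz (expR (- y)) r)))); last first.
  rewrite Rintegral_lin2//; first by rewrite /wint; ring.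
  - exact: int_wcos m0_cts m0_le.
  - exact: int_wsin m0_cts m0_le.
apply: eq_Rintegral => r _.
rewrite /K0 /cs ash_scale// hypvr_scale cosD /m0 shh_scale.
by field; rewrite hyp_neq0 !gt_eqF ?E0 ?e0.
Qed.

Lemma Xq0_sin : shh y * q0 sn (shh y) =
  wint m0 sin y * cos (s * y) + wint m0 cos y * sin (s * y).
Proof.
rewrite /q0 -RintegralZl//; last exact: (int_q0 der_sn sn_le).
transitivity (Rintegral mu `[0, +oo[ (fun r => sin (s * y) * (m0 (expR (- y)) r * cos (thz (expR (- y)) r)) +
   cos (s * y) * (m0 (expR (- y)) r * sin (thz (expR (- y)) r)))); last first.
  rewrite Rintegral_lin2//; first by rewrite /wint; ring.
  - exact: int_wcos m0_cts m0_le.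
  - exact: int_wsin m0_cts m0_le.
apply: eq_Rintegral => r _.
rewrite /K0 /sn ash_scale// hypvr_scale sinD /m0 shh_scale.
by field; rewrite hyp_neq0 !gt_eqF ?E0 ?e0.
Qed.

Lemma Xq1_cos : shh y ^+ 2 * q1 cs cs' (shh y) =
  (- (2 * s * wint m1 sin y) - wint m2 cos y) * cos (s * y)
  + (- (2 * s * wint m1 cos y) + wint m2 sin y) * sin (s * y).
Proof.
rewrite /q1 -RintegralZl//; last exact: (int_q1 der_cs der_cs' cs_le cs'_le).
transitivity (Rintegral mu `[0, +oo[ (fun r =>
  (- (2 * s * sin (s * y)) * (m1 (expR (- y)) r * cos (thz (expR (- y)) r)) +
   - (2 * s * cos (s * y)) * (m1 (expR (- y)) r * sin (thz (expR (- y)) r)))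
  + (- cos (s * y) * (m2 (expR (- y)) r * cos (thz (expR (- y)) r)) +
   sin (s * y) * (m2 (expR (- y)) r * sin (thz (expR (- y)) r))))); last first.
  rewrite Rintegral_lin4//; first by rewrite /wint; ring.
  - exact: int_wcos m1_cts m1_le.
  - exact: int_wsin m1_cts m1_le.
  - exact: int_wcos m2_cts m2_le.
  - exact: int_wsin m2_cts m2_le.
apply: eq_Rintegral => r _.
rewrite /K1 /cs /cs' ash_scale// hypvr_scale sinD cosD vr_scale /m1 /m2 shh_scale.
by field; rewrite !gt_eqF ?E0 ?e0.
Qed.

Lemma Xq1_sin : shh y ^+ 2 * q1 sn sn' (shh y) =
  (2 * s * wint m1 cos y - wint m2 sin y) * cos (s * y)
  + (- (2 * s * wint m1 sin y) - wint m2 cos y) * sin (s * y).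
Proof.
rewrite /q1 -RintegralZl//; last exact: (int_q1 der_sn der_sn' sn_le sn'_le).
transitivity (Rintegral mu `[0, +oo[ (fun r =>
  ((2 * s * cos (s * y)) * (m1 (expR (- y)) r * cos (thz (expR (- y)) r)) +
   - (2 * s * sin (s * y)) * (m1 (expR (- y)) r * sin (thz (expR (- y)) r)))
  + (- sin (s * y) * (m2 (expR (- y)) r * cos (thz (expR (- y)) r)) +
   - cos (s * y) * (m2 (expR (- y)) r * sin (thz (expR (- y)) r))))); last first.
  rewrite Rintegral_lin4//; first by rewrite /wint; ring.
  - exact: int_wcos m1_cts m1_le.
  - exact: int_wsin m1_cts m1_le.
  - exact: int_wcos m2_cts m2_le.
  - exact: int_wsin m2_cts m2_le.
apply: eq_Rintegral => r _.
rewrite /K1 /sn /sn' ash_scale// hypvr_scale sinD cosD vr_scale /m1 /m2 shh_scale.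
by field; rewrite !gt_eqF ?E0 ?e0.
Qed.

End trig_integrals.
Definition csn t := cos (s * t).
Definition csn' t := - s * sin (s * t).
Definition snn t := sin (s * t).
Definition snn' t := s * cos (s * t).
(** [b1 + i b2 = (1 + 2is) (Ic - i Is)]. This is the coefficient [b(s)]: up to sign and [sqrt 2] it
    is the amplitude at infinity of the solutions built from [q1]. *)
Definition b1 := Ic + 2 * s * Is.
Definition b2 := 2 * s * Ic - Is.

Lemma wint_cos_lim (m : R -> R -> R) : (forall z r, 0 < z < 1 -> {for r, continuous (m z)}) ->
  (forall z r, 0 < z < 1 -> `|m z r| <= (1 + r ^+ 2)^-1) ->
  (forall r, m z r @[z --> 0^'+] --> (1 + r ^+ 2)^-1) -> wint m cos @ +oo --> Ic.
Proof. by move=> c l d; apply: (weight_limy c l d); [exact: cos_ct|exact: cos_bd]. Qed.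

Lemma wint_sin_lim (m : R -> R -> R) : (forall z r, 0 < z < 1 -> {for r, continuous (m z)}) ->
  (forall z r, 0 < z < 1 -> `|m z r| <= (1 + r ^+ 2)^-1) ->
  (forall r, m z r @[z --> 0^'+] --> (1 + r ^+ 2)^-1) -> wint m sin @ +oo --> Is.
Proof. by move=> c l d; apply: (weight_limy c l d); [exact: sin_ct|exact: sin_bd]. Qed.

Lemma asy_q0c : asy s (fun y => shh y * q0 csn (shh y)) Ic (- Is).
Proof.
apply: (asy_trig (P := wint m0 cos) (Q := fun y => - wint m0 sin y)).
- exact: wint_cos_lim m0_cts m0_le m0_lim.
- by apply: cvgN; exact: wint_sin_lim m0_cts m0_le m0_lim.
- by move=> y y0; rewrite Xq0_cos.
Qed.

Lemma asy_q0s : asy s (fun y => shh y * q0 snn (shh y)) Is Ic.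
Proof.
apply: (asy_trig (P := wint m0 sin) (Q := wint m0 cos)).
- exact: wint_sin_lim m0_cts m0_le m0_lim.
- exact: wint_cos_lim m0_cts m0_le m0_lim.
- by move=> y y0; rewrite Xq0_sin.
Qed.

Lemma asy_q1c : asy s (fun y => shh y ^+ 2 * q1 csn csn' (shh y)) (- b1) (- b2).
Proof.
have l1 := wint_cos_lim m1_cts m1_le m1_lim; have l2 := wint_sin_lim m1_cts m1_le m1_lim.
have l3 := wint_cos_lim m2_cts m2_le m2_lim; have l4 := wint_sin_lim m2_cts m2_le m2_lim.
apply: (asy_trig (P := fun y => - (2 * s * wint m1 sin y) - wint m2 cos y)
  (Q := fun y => - (2 * s * wint m1 cos y) + wint m2 sin y)).
- apply: (cvgy_eq (cvgyB (cvgyM (@cvgy_cst (- (2 * s))) l2) l3)) => [y _ /=|]; first by ring.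
  by rewrite /b1; ring.
- apply: (cvgy_eq (cvgyD (cvgyM (@cvgy_cst (- (2 * s))) l1) l4)) => [y _ /=|]; first by ring.
  by rewrite /b2; ring.
- by move=> y y0; rewrite Xq1_cos.
Qed.

Lemma asy_q1s : asy s (fun y => shh y ^+ 2 * q1 snn snn' (shh y)) b2 (- b1).
Proof.
have l1 := wint_cos_lim m1_cts m1_le m1_lim; have l2 := wint_sin_lim m1_cts m1_le m1_lim.
have l3 := wint_cos_lim m2_cts m2_le m2_lim; have l4 := wint_sin_lim m2_cts m2_le m2_lim.
apply: (asy_trig (P := fun y => 2 * s * wint m1 cos y - wint m2 sin y)
  (Q := fun y => - (2 * s * wint m1 sin y) - wint m2 cos y)).
- apply: (cvgy_eq (cvgyB (cvgyM (@cvgy_cst (2 * s)) l1) l4)) => [y _ /=|]; first by ring.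
  by rewrite /b2; ring.
- apply: (cvgy_eq (cvgyB (cvgyM (@cvgy_cst (- (2 * s))) l2) l3)) => [y _ /=|]; first by ring.
  by rewrite /b1; ring.
- by move=> y y0; rewrite Xq1_sin.
Qed.

End asymptotics.

(** * The separated equation *)

Section schroedinger.
Variable R : realType.
Local Notation mu := (@lebesgue_measure R).
Implicit Types (r t X x y s z c lam : R) (f g : R -> R).
(** [snh] is sinh and [cth] is coth, written in half angles; [om] is the Liouville factor that
    removes the first order term from the equation satisfied by [u1 (shh y)]. *)
Definition snh y : R := 2 * shh y * chh y.
Definition om y : R := Num.sqrt (snh y) * chh y.
Definition cth y : R := (1 + 2 * shh y ^+ 2) / snh y.

Lemma snh_gt0 y : 0 < y -> 0 < snh y.
Proof.
move=> y0; rewrite /snh; apply: mulr_gt0 (chh_gt0 y); apply: mulr_gt0 => //.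
exact: shh_gt0.
Qed.

Lemma chh2 y : chh y ^+ 2 = 1 + shh y ^+ 2.
Proof. by rewrite -hyp_shh hyp2. Qed.

Lemma sqrt_snh2 y : 0 < y -> Num.sqrt (snh y) ^+ 2 = snh y.
Proof. by move=> y0; rewrite sqr_sqrtr// ltW// snh_gt0. Qed.

Lemma om_gt0 y : 0 < y -> 0 < om y.
Proof. by move=> y0; rewrite mulr_gt0 ?chh_gt0// sqrtr_gt0 snh_gt0. Qed.

Lemma der_snh y : is_derive y 1 snh (1 + 2 * shh y ^+ 2).
Proof.
have d1 := der_shh y; have d2 := der_chh y; rewrite /snh; der.
by rewrite /=; have := chh2 y; nra.
Qed.

Lemma der_sqrt_snh y : 0 < y ->
  is_derive y 1 (fun y => Num.sqrt (snh y)) (cth y * Num.sqrt (snh y) / 2).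
Proof.
move=> y0; have S0 := snh_gt0 y0; have d := der_snh y; der => //.
have W0 : Num.sqrt (snh y) != 0 by rewrite gt_eqF// sqrtr_gt0.
move: (sqrt_snh2 y0) W0; rewrite /cth; move: (Num.sqrt (snh y)) => W <- W0.
by field.
Qed.

Lemma cth2 y : 0 < y -> cth y ^+ 2 = 1 + (snh y ^+ 2)^-1.
Proof.
move=> y0; have S0 := snh_gt0 y0.
have E : (1 + 2 * shh y ^+ 2) ^+ 2 = snh y ^+ 2 + 1.
  have -> : snh y ^+ 2 = 4 * shh y ^+ 2 * chh y ^+ 2 by rewrite /snh; ring.
  by rewrite chh2; ring.
by rewrite /cth exprMn E; field; rewrite gt_eqF.
Qed.

Lemma der_cth y : 0 < y -> is_derive y 1 cth (- (snh y ^+ 2)^-1).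
Proof.
move=> y0; have S0 := snh_gt0 y0; have S1 : snh y != 0 by rewrite gt_eqF.
have d := der_snh y; have d1 := der_shh y; rewrite /cth; der => //.
have E : (1 + 2 * shh y ^+ 2) ^+ 2 = snh y ^+ 2 + 1.
  have -> : snh y ^+ 2 = 4 * shh y ^+ 2 * chh y ^+ 2 by rewrite /snh; ring.
  by rewrite chh2; ring.
have E2 : 2 * shh y * chh y = snh y by [].
rewrite /=.
transitivity ((2 * shh y * chh y) / snh y - (1 + 2 * shh y ^+ 2) ^+ 2 / snh y ^+ 2); first by field.
by rewrite E E2; field.
Qed.

Definition JJ (u1 : R -> R) y := om y * u1 (shh y).

(** The derivative of [JJ u1], with [u2] eliminated through the equation of [u0]. So the asymptotics
    of [q0] and [q1] give those of a solution and of its derivative. *)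
Definition JJ' lam (u0 u1 : R -> R) y :=
  (4 * lam - 1) / 2 * (Num.sqrt (snh y) * u0 (shh y)) - cth y / 2 * JJ u1 y.

Definition solY lam f (f' : R -> R) := forall y, 0 < y ->
  is_derive y 1 f (f' y) /\ is_derive y 1 f' ((lam + 3 / (4 * snh y ^+ 2)) * f y).

Lemma solY_JJ lam (u0 u1 u2 : R -> R) : solX lam u0 u1 u2 -> solY lam (JJ u1) (JJ' lam u0 u1).
Proof.
move=> su y y0; have X0 := shh_gt0 y0; have [d0 d1 ode] := su _ X0.
have S0 := snh_gt0 y0; have S1 : snh y != 0 by rewrite gt_eqF.
have dX := der_shh y; have dC := der_chh y; have dW := der_sqrt_snh y0.
have dk := der_cth y0.
have W0 : Num.sqrt (snh y) != 0 by rewrite gt_eqF// sqrtr_gt0.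
have X1 : shh y != 0 by rewrite gt_eqF.
have hW := sqrt_snh2 y0.
have hu2 : chh y ^+ 2 * u2 (shh y) = (4 * lam - 1) * u0 (shh y) - ((shh y)^-1 + 3 * shh y) * u1 (shh y).
  by rewrite chh2; have := ode; lra.
have C1 : chh y != 0 by rewrite gt_eqF// chh_gt0.
have dJ : is_derive y 1 (JJ u1) (JJ' lam u0 u1 y).
  rewrite /JJ /om; der.
  rewrite /= /JJ' /JJ /om /cth.
  transitivity ((1 + 2 * shh y ^+ 2) / snh y * Num.sqrt (snh y) / 2 * chh y * u1 (shh y)
    + Num.sqrt (snh y) * (shh y / 2) * u1 (shh y)
    + Num.sqrt (snh y) / 2 * (chh y ^+ 2 * u2 (shh y))); first by field.
  by rewrite hu2 /snh; field; rewrite C1 X1.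
split => //.
rewrite {1}/JJ'.
der => /=.
rewrite /JJ'.
transitivity ((4 * lam - 1) / 4 * (om y * u1 (shh y)) + (snh y ^+ 2)^-1 / 2 * JJ u1 y
  + cth y ^+ 2 / 4 * JJ u1 y); first by rewrite /om; field.
by rewrite cth2// /JJ; field.
Qed.

Lemma wrY_const lam f (f' : R -> R) g (g' : R -> R) : solY lam f f' -> solY lam g g' ->
  forall y x, 0 < y -> 0 < x -> f y * g' y - f' y * g y = f x * g' x - f' x * g x.
Proof.
move=> sf sg; apply: (@der0_const_pos R (fun y => f y * g' y - f' y * g y)) => y y0.
have [d1 d2] := sf y y0; have [d3 d4] := sg y y0.
by der; rewrite /=; ring.
Qed.

Lemma solY_lin lam f (f' : R -> R) g (g' : R -> R) (a b : R) : solY lam f f' -> solY lam g g' ->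
  solY lam (fun y => a * f y + b * g y) (fun y => a * f' y + b * g' y).
Proof.
move=> sf sg y y0; have [d1 d2] := sf y y0; have [d3 d4] := sg y y0.
by split; der; rewrite /=; ring.
Qed.

(** The Wronskians of [f] with [u] and with [v] are constant and tend to 0, hence vanish; as [u] and
    [v] are independent ([W != 0]), [f] vanishes too. *)
Lemma solY_unique lam s (f f' u u' v v' : R -> R) (W : R) : W != 0 ->
  solY lam f f' -> solY lam u u' -> solY lam v v' ->
  asy s f 0 0 -> asy s f' 0 0 ->
  (exists c, exists d, asy s u c d) -> (exists c, exists d, asy s u' c d) ->
  (exists c, exists d, asy s v c d) -> (exists c, exists d, asy s v' c d) ->
  (fun y => u y * v' y - u' y * v y) @ +oo --> W ->
  forall y, 0 < y -> f y = 0.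
Proof.
move=> W0 sf su sv af af' [c1 [d1 au]] [c2 [d2 au']] [c3 [d3 av]] [c4 [d4 av']] hW y y0.
have key (g g' : R -> R) : solY lam g g' -> (exists c, exists d, asy s g c d) -> (exists c, exists d, asy s g' c d) ->
   f y * g' y - f' y * g y = 0.
  move=> sg [c [d ag]] [c' [d' ag']].
  have h : (fun y => f y * g' y - f' y * g y) @ +oo --> (0 : R).
    by apply: (asy_wronskian af af' ag ag'); ring.
  have h2 : (fun y => f y * g' y - f' y * g y) @ +oo --> f y * g' y - f' y * g y.
    apply: (cvgy_eq (@cvgy_cst R (f y * g' y - f' y * g y))) => // x x0.
    exact: (wrY_const sf sg).
  exact: (cvg_unique _ h2 h).
have hWy : u y * v' y - u' y * v y = W.
  have h2 : (fun y => u y * v' y - u' y * v y) @ +oo --> u y * v' y - u' y * v y.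
    apply: (cvgy_eq (@cvgy_cst R (u y * v' y - u' y * v y))) => // x x0.
    exact: (wrY_const su sv).
  exact: (cvg_unique _ h2 hW).
have e1 := key u u' su (ex_intro _ c1 (ex_intro _ d1 au)) (ex_intro _ c2 (ex_intro _ d2 au')).
have e2 := key v v' sv (ex_intro _ c3 (ex_intro _ d3 av)) (ex_intro _ c4 (ex_intro _ d4 av')).
apply: (mulfI W0); rewrite mulr0 -hWy.
transitivity (u y * (f y * v' y - f' y * v y) - v y * (f y * u' y - f' y * u y)); first by ring.
by rewrite e1 e2; ring.
Qed.

End schroedinger.

(** * Power series with radius of convergence at least 1 *)

Section power_series.
Variable R : realType.
Implicit Types (c d : nat -> R) (K z : R).
(** Radius of convergence at least 1, in a form that survives [pseries_diffs] and linear
    combinations. *)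
Definition subexp c := forall K, 0 < K < 1 -> exists M, forall k, `|c k| * K ^+ k <= M.

Lemma sum_geo1 K n : \sum_(0 <= k < n) k.+1%:R * K ^+ k * (1 - K) ^+ 2 =
  1 - n.+1%:R * K ^+ n + n%:R * K ^+ n.+1.
Proof.
elim: n => [|n IH]; first by rewrite big_geq// expr0 mul0r addr0 mulr1 subrr.
rewrite big_nat_recr//= IH !exprS -!natr1; ring.
Qed.

Lemma geo1_bound K k : 0 < K < 1 -> k.+1%:R * K ^+ k <= ((1 - K) ^+ 2)^-1.
Proof.
move=> /andP[K0 K1]; have K2 : 0 < (1 - K) ^+ 2 by rewrite exprn_gt0// subr_gt0.
rewrite -[leRHS]mul1r ler_pdivlMr//.
have := sum_geo1 K k.+1; rewrite big_nat_recr//= => e.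
have h1 : 0 <= \sum_(0 <= i < k) i.+1%:R * K ^+ i * (1 - K) ^+ 2.
  by apply: sumr_ge0 => i _; rewrite mulr_ge0 ?(ltW K2)// mulr_ge0// exprn_ge0// ltW.
have h2 : 1 - k.+2%:R * K ^+ k.+1 + k.+1%:R * K ^+ k.+2 <= 1.
  rewrite -subr_ge0.
  have -> : 1 - (1 - k.+2%:R * K ^+ k.+1 + k.+1%:R * K ^+ k.+2) = K ^+ k.+1 * (k.+1%:R * (1 - K) + 1).
    by rewrite [K ^+ k.+2]exprS -[k.+2%:R]natr1; ring.
  by rewrite mulr_ge0 ?exprn_ge0 ?(ltW K0)// addr_ge0// mulr_ge0// subr_ge0 ltW.
lra.
Qed.

(** The gap between [K] and [K' = (K + 1) / 2] absorbs the factor [k + 1], by [geo1_bound] at the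
    ratio [K / K']. *)
Lemma subexp_diffs c : subexp c -> subexp (pseries_diffs c).
Proof.
move=> sc K /andP[K0 K1].
pose K' := (K + 1) / 2; have K'01 : 0 < K' < 1 by rewrite /K'; lra.
have [M hM] := sc K' K'01.
have K'0 : 0 < K' by case/andP: K'01.
have Q01 : 0 < K / K' < 1.
  by rewrite divr_gt0//= ltr_pdivrMr// mul1r /K'; lra.
exists (((1 - K / K') ^+ 2)^-1 * (`|M| / K')) => k.
rewrite /pseries_diffs normrM ger0_norm//.
have -> : k.+1%:R * `|c k.+1| * K ^+ k = (k.+1%:R * (K / K') ^+ k) * (`|c k.+1| * K' ^+ k.+1 / K').
  by rewrite exprMn exprVn exprS; field; rewrite expf_neq0 gt_eqF.
apply: ler_pM.
- by rewrite mulr_ge0// exprn_ge0// divr_ge0// ltW.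
- by rewrite divr_ge0 ?(ltW K'0)// mulr_ge0// exprn_ge0// ltW.
- exact: geo1_bound.
- by rewrite ler_pM2r ?invr_gt0// (le_trans (hM _))// ler_norm.
Qed.

Lemma subexp_cvg c K : subexp c -> 0 < K < 1 -> cvgn (pseries c K).
Proof.
move=> sc /andP[K0 K1].
pose K' := (K + 1) / 2; have K'01 : 0 < K' < 1 by rewrite /K'; lra.
have [M hM] := sc K' K'01.
have K'0 : 0 < K' by case/andP: K'01.
apply: normed_cvg; apply: (@series_le_cvg _ _ (fun k => M * (K / K') ^+ k)).
- by move=> n; exact: normr_ge0.
- move=> n; apply: mulr_ge0; last by rewrite exprn_ge0// divr_ge0// ltW.
  by apply: le_trans (hM 0%N); rewrite mulr_ge0// exprn_ge0// ltW.
- move=> n; rewrite /= normrM (ger0_norm (exprn_ge0 n (ltW K0))).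
  have -> : `|c n| * K ^+ n = (`|c n| * K' ^+ n) * (K / K') ^+ n.
    by rewrite -mulrA -exprMn mulrCA divff ?gt_eqF// mulr1.
  by rewrite ler_wpM2r// exprn_ge0// divr_ge0// ltW.
- apply: is_cvg_geometric_series; rewrite ger0_norm; last by rewrite divr_ge0// ltW.
  by rewrite ltr_pdivrMr// mul1r /K'; lra.
Qed.

Definition psum c z := limn (pseries c z).

Lemma subexp_cvg0 c z : subexp c -> 0 <= z < 1 -> cvgn (pseries c z).
Proof.
move=> sc /andP[z0 z1].
pose K := (z + 1) / 2; have K01 : 0 < K < 1 by rewrite /K; lra.
apply: (is_cvg_pseries_inside (subexp_cvg sc K01)).
by rewrite !ger0_norm//; rewrite /K; lra.
Qed.

Lemma der_psum c z : subexp c -> 0 <= z < 1 -> is_derive z 1 (psum c) (psum (pseries_diffs c) z).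
Proof.
move=> sc /andP[z0 z1].
pose K := (z + 1) / 2; have K01 : 0 < K < 1 by rewrite /K; lra.
have s1 := subexp_diffs sc; have s2 := subexp_diffs s1.
apply: (@pseries_snd_diffs R c K z).
- exact: subexp_cvg.
- exact: subexp_cvg.
- exact: subexp_cvg.
- by rewrite !ger0_norm//; rewrite /K; lra.
Qed.

Lemma psum_lin c d (a b : R) z : subexp c -> subexp d -> 0 <= z < 1 ->
  psum (fun k => a * c k + b * d k) z = a * psum c z + b * psum d z.
Proof.
move=> sc sd z01; have h1 := subexp_cvg0 sc z01; have h2 := subexp_cvg0 sd z01.
apply/cvg_lim => //.
have : (fun n => a * pseries c z n + b * pseries d z n) @ \oo --> a * psum c z + b * psum d z.
  by apply: cvgD; apply: cvgM => //; exact: cvg_cst.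
apply: cvg_trans; apply: near_eq_cvg; apply: nearW => n.
rewrite /pseries/series/= !mulr_sumr -big_split/=; apply: eq_bigr => i _; ring.
Qed.

Lemma subexp_lin c d (a b : R) : subexp c -> subexp d -> subexp (fun k => a * c k + b * d k).
Proof.
move=> sc sd K K01; have [M hM] := sc K K01; have [N hN] := sd K K01.
have K0 : 0 <= K by lra.
exists (`|a| * M + `|b| * N) => k.
apply: (@le_trans _ _ ((`|a| * `|c k| + `|b| * `|d k|) * K ^+ k)).
  by rewrite ler_wpM2r ?exprn_ge0// (le_trans (ler_normD _ _))// !normrM.
by rewrite mulrDl -!mulrA lerD// ler_wpM2l.
Qed.

Lemma psum_shift c z : subexp c -> 0 <= z < 1 ->
  z * psum c z = psum (fun k => if k is k'.+1 then c k' else 0) z.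
Proof.
move=> sc z01; have h1 := subexp_cvg0 sc z01.
apply/esym/cvg_lim => //.
rewrite -(cvg_shiftn 1).
have : (fun n => z * pseries c z n) @ \oo --> z * psum c z.
  by apply: cvgM => //; exact: cvg_cst.
apply: cvg_trans; apply: near_eq_cvg; apply: nearW => n.
rewrite /= addn1 /pseries/series/= big_nat_recl//= mul0r add0r mulr_sumr.
by apply: eq_bigr => i _; rewrite exprS; ring.
Qed.

Lemma psum0 c : psum c 0 = c 0%N.
Proof.
apply/cvg_lim => //; rewrite -(cvg_shiftn 1).
apply: cvg_near_cst; apply: nearW => n; rewrite /= addn1 /pseries/series/= big_nat_recl//= expr0 mulr1.
by rewrite big1 ?addr0// => i _; rewrite exprS mul0r mulr0.
Qed.

Lemma psum_eq0 c z : (forall k, c k = 0) -> psum c z = 0.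
Proof.
move=> c0; apply/cvg_lim => //; apply: cvg_near_cst; apply: nearW => n.
by rewrite /pseries/series/= big1// => i _; rewrite c0 mul0r.
Qed.

End power_series.

(** * The hypergeometric solution *)

Section jost_series.
Variable R : realType.
Variable s : R.
Implicit Types (y z : R).
Local Open Scope complex_scope.

Definition jcoef k : R[i] := poch (- (1 / 2))%:C k * poch ((- (1 / 2)) +i* s) k /
  (poch (1 +i* s) k * ((k`!)%:R)%:C).

Definition ju k := complex.Re (jcoef k).
Definition jv k := complex.Im (jcoef k).

Lemma pochS (a : R[i]) k : poch a k.+1 = poch a k * (a + (k%:R)%:C).
Proof. by rewrite /poch big_ord_recr. Qed.

Lemma cshift_neq0 k : (1 +i* s) + (k%:R)%:C != 0 :> R[i].
Proof.
by apply/eqP => /(congr1 (@complex.Re R))/=; apply/eqP; rewrite gt_eqF.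
Qed.

Lemma poch_neq0 k : poch (1 +i* s : R[i]) k != 0.
Proof.
by rewrite /poch; apply/prodf_neq0 => i _; exact: cshift_neq0.
Qed.

Lemma jcoefS k : jcoef k.+1 * (((1 +i* s) + (k%:R)%:C) * (k.+1%:R)%:C) =
  jcoef k * (((- (1 / 2))%:C + (k%:R)%:C) * (((- (1 / 2)) +i* s) + (k%:R)%:C)).
Proof.
have f0 : ((k`!)%:R)%:C != 0 :> R[i].
  by apply/eqP => /(congr1 (@complex.Re R))/=; apply/eqP; rewrite pnatr_eq0 -lt0n fact_gt0.
have k0 : (k.+1%:R)%:C != 0 :> R[i].
  by apply/eqP => /(congr1 (@complex.Re R))/=; apply/eqP; rewrite pnatr_eq0.
have p0 := poch_neq0 k; have c0 := cshift_neq0 k.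
rewrite /jcoef !pochS factS natrM rmorphM/=.
move: f0 k0 p0 c0; move: ((k`!)%:R)%:C (k.+1%:R)%:C (poch (1 +i* s) k) ((1 +i* s) + (k%:R)%:C : R[i]) => a b c d f0 k0 p0 c0.
by field; rewrite f0 k0 p0 c0.
Qed.

Lemma jrec k : let n := k%:R : R in
  (n + 1) * ((n + 1) * ju k.+1 - s * jv k.+1) = (n - 1 / 2) * ((n - 1 / 2) * ju k - s * jv k) /\
  (n + 1) * ((n + 1) * jv k.+1 + s * ju k.+1) = (n - 1 / 2) * ((n - 1 / 2) * jv k + s * ju k).
Proof.
move=> n; have := jcoefS k; rewrite /ju /jv.
move: (jcoef k) (jcoef k.+1) => [u v] [u' v'] e.
have e1 := congr1 (@complex.Re R) e; have e2 := congr1 (@complex.Im R) e.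
move: e1 e2; rewrite /= -natr1 -/n => e1 e2; split; lra.
Qed.

Lemma j0 : ju 0 = 1 /\ jv 0 = 0.
Proof.
by rewrite /ju /jv /jcoef /poch !big_ord0 fact0 mul1r mul1r invr1.
Qed.

(** By [jrec] the ratio of consecutive coefficients has modulus [|(n - 1/2) (n - 1/2 + is)| / |(n +
    1) (n + 1 + is)| <= 1]. The bound is uniform in [s], which later makes the spectral density
    bounded. *)
Lemma jbound k : ju k ^+ 2 + jv k ^+ 2 <= 1.
Proof.
elim: k => [|k IH]; first by have [-> ->] := j0; lra.
have [] := jrec k; set n := k%:R : R; have n0 : 0 <= n by exact: ler0n.
move: (ju k) (jv k) (ju k.+1) (jv k.+1) IH => u v u' v' IH e1 e2.
have E : (n + 1) ^+ 2 * ((n + 1) ^+ 2 + s ^+ 2) * (u' ^+ 2 + v' ^+ 2) =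
  (n - 1 / 2) ^+ 2 * ((n - 1 / 2) ^+ 2 + s ^+ 2) * (u ^+ 2 + v ^+ 2).
  transitivity (((n + 1) * ((n + 1) * u' - s * v')) ^+ 2 + ((n + 1) * ((n + 1) * v' + s * u')) ^+ 2); first by ring.
  by rewrite e1 e2; ring.
have h1 : 0 < (n + 1) ^+ 2 * ((n + 1) ^+ 2 + s ^+ 2) by nra.
have h2 : (n - 1 / 2) ^+ 2 <= (n + 1) ^+ 2 by nra.
have h3 : (n - 1 / 2) ^+ 2 * ((n - 1 / 2) ^+ 2 + s ^+ 2) <= (n + 1) ^+ 2 * ((n + 1) ^+ 2 + s ^+ 2).
  by apply: ler_pM; rewrite ?sqr_ge0 ?addr_ge0 ?sqr_ge0// lerD2r.
have h4 : 0 <= u ^+ 2 + v ^+ 2 by rewrite addr_ge0 ?sqr_ge0.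
rewrite -(ler_pM2l h1) E mulr1.
by apply: le_trans h3; rewrite ler_piMr// mulr_ge0 ?addr_ge0 ?sqr_ge0.
Qed.

Lemma ju_le k : `|ju k| <= 1.
Proof.
rewrite -(@expr_le1 _ 2)// -normrX ger0_norm ?sqr_ge0//.
by have := jbound k; have := sqr_ge0 (jv k); lra.
Qed.

Lemma jv_le k : `|jv k| <= 1.
Proof.
rewrite -(@expr_le1 _ 2)// -normrX ger0_norm ?sqr_ge0//.
by have := jbound k; have := sqr_ge0 (ju k); lra.
Qed.

Lemma subexp_le1 (c : nat -> R) : (forall k, `|c k| <= 1) -> subexp c.
Proof.
move=> c1 K /andP[K0 K1]; exists 1 => k; apply: mulr_ile1 => //; first exact: exprn_ge0 (ltW K0).
by apply: exprn_ile1; exact: ltW.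
Qed.

Lemma sju : subexp ju. Proof. exact: subexp_le1 ju_le. Qed.
Lemma sjv : subexp jv. Proof. exact: subexp_le1 jv_le. Qed.

Lemma psum_le (c : nat -> R) z : (forall k, `|c k| <= 1) -> 0 <= z < 1 -> `|psum c z| <= (1 - z)^-1.
Proof.
move=> c1 z01; have cv := subexp_cvg0 (subexp_le1 c1) z01.
have h : `|pseries c z n| @[n --> \oo] --> `|psum c z| by exact: cvg_norm.
rewrite -(cvg_lim _ h)//; apply: limr_le; first by apply/cvg_ex; eexists; exact: h.
apply: nearW => n; rewrite /pseries/series/=.
apply: le_trans (ler_norm_sum _ _ _) _.
apply: (@le_trans _ _ (\sum_(0 <= k < n) z ^+ k)).
  have z0 : 0 <= z by lra.
  by apply: ler_sum => k _; rewrite normrM (ger0_norm (exprn_ge0 k z0)) ler_piMl// exprn_ge0.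
have z1 : 0 < 1 - z by lra.
rewrite -[leRHS]mul1r ler_pdivlMr// mulrC big_mkord -opprB mulNr -subrX1.
have z0 : 0 <= z by lra.
by have := exprn_ge0 n z0; lra.
Qed.

(* the hypergeometric equation, split in real and imaginary parts *)
Lemma hyp_ode z : 0 <= z < 1 ->
  let F1 := psum ju z in let F2 := psum jv z in
  let d1 := psum (pseries_diffs ju) z in let d2 := psum (pseries_diffs jv) z in
  let e1 := psum (pseries_diffs (pseries_diffs ju)) z in
  let e2 := psum (pseries_diffs (pseries_diffs jv)) z in
  z * (1 - z) * e1 + d1 - s * (1 - z) * d2 - F1 / 4 - s / 2 * F2 = 0 /\
  z * (1 - z) * e2 + d2 + s * (1 - z) * d1 - F2 / 4 + s / 2 * F1 = 0.
Proof.
move=> z01 F1 F2 d1 d2 e1 e2.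
(* Multiplication by [z] is a shift of the coefficients, so each equation is one linear combination
   of seven series; its coefficients vanish by [jrec]. *)
pose sh (c : nat -> R) := fun k : nat => if k is k'.+1 then c k' else 0.
have ssh c : subexp c -> subexp (sh c).
  move=> sc K K01; have [M hM] := sc K K01; exists `|M| => -[|k]/=.
    by rewrite normr0 mul0r.
  rewrite exprS mulrCA; apply: (@le_trans _ _ (`|c k| * K ^+ k)).
    rewrite ler_piMl ?mulr_ge0 ?exprn_ge0//; lra.
  by rewrite (le_trans (hM k))// ler_norm.
have [u v] := (sju, sjv).
have du := subexp_diffs u; have dv := subexp_diffs v.
have ddu := subexp_diffs du; have ddv := subexp_diffs dv.
have s1 := ssh _ ddu; have s2 := ssh _ (ssh _ ddu); have s3 := ssh _ ddv; have s4 := ssh _ (ssh _ ddv).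
have s5 := ssh _ du; have s6 := ssh _ dv.
have E1 : z * e1 = psum (sh (pseries_diffs (pseries_diffs ju))) z by exact: psum_shift.
have E2 : z * e2 = psum (sh (pseries_diffs (pseries_diffs jv))) z by exact: psum_shift.
have E3 : z * (z * e1) = psum (sh (sh (pseries_diffs (pseries_diffs ju)))) z by rewrite E1; exact: psum_shift.
have E4 : z * (z * e2) = psum (sh (sh (pseries_diffs (pseries_diffs jv)))) z by rewrite E2; exact: psum_shift.
have E5 : z * d1 = psum (sh (pseries_diffs ju)) z by exact: psum_shift.
have E6 : z * d2 = psum (sh (pseries_diffs jv)) z by exact: psum_shift.
have Lin (c1 c2 c3 c4 c5 c6 c7 : nat -> R) (a1 a2 a3 a4 a5 a6 a7 : R) :
  subexp c1 -> subexp c2 -> subexp c3 -> subexp c4 -> subexp c5 -> subexp c6 -> subexp c7 ->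
  (forall k, a1 * c1 k + a2 * c2 k + a3 * c3 k + a4 * c4 k + a5 * c5 k + a6 * c6 k + a7 * c7 k = 0) ->
  a1 * psum c1 z + a2 * psum c2 z + a3 * psum c3 z + a4 * psum c4 z + a5 * psum c5 z
    + a6 * psum c6 z + a7 * psum c7 z = 0.
  move=> h1 h2 h3 h4 h5 h6 h7 h.
  pose p2 k := a1 * c1 k + a2 * c2 k; pose p3 k := 1 * p2 k + a3 * c3 k.
  pose p4 k := 1 * p3 k + a4 * c4 k; pose p5 k := 1 * p4 k + a5 * c5 k.
  pose p6 k := 1 * p5 k + a6 * c6 k; pose p7 k := 1 * p6 k + a7 * c7 k.
  have k2 : subexp p2 by exact: subexp_lin. have k3 : subexp p3 by exact: subexp_lin.
  have k4 : subexp p4 by exact: subexp_lin. have k5 : subexp p5 by exact: subexp_lin.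
  have k6 : subexp p6 by exact: subexp_lin.
  have : psum p7 z = 0.
    by apply: psum_eq0 => k; rewrite /p7 /p6 /p5 /p4 /p3 /p2 !mul1r h.
  by rewrite /p7 psum_lin// /p6 psum_lin// /p5 psum_lin// /p4 psum_lin// /p3 psum_lin// /p2 psum_lin// !mul1r.
have D1 c k : pseries_diffs c k = (k%:R + 1) * c k.+1 by rewrite /pseries_diffs natr1.
have D2 c k : sh (pseries_diffs c) k = k%:R * c k.
  by case: k => [|k]; rewrite /= ?mul0r// D1 natr1.
have D3 c k : sh (pseries_diffs (pseries_diffs c)) k = k%:R * (k%:R + 1) * c k.+1.
  by case: k => [|k]; rewrite /= ?mul0r// !D1 -!natr1; ring.
have D4 c k : sh (sh (pseries_diffs (pseries_diffs c))) k = k%:R * (k%:R - 1) * c k.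
  by case: k => [|[|k]]; rewrite /= ?mul0r ?subrr ?mulr0 ?mul0r// !D1 -!natr1; ring.
split.
- have := Lin _ _ _ _ _ _ _ 1 (-1) 1 (- s) s (- (1 / 4)) (- (s / 2)) s1 s2 du dv s6 u v.
  rewrite -E1 -E3 -E6 -/F1 -/F2 -/d1 -/d2 => H.
  rewrite -[RHS]H; first by ring.
  move=> k; have [r1 r2] := jrec k; move: r1 r2.
  by rewrite !D1 !D3 !D4 !D2; lra.
- have := Lin _ _ _ _ _ _ _ 1 (-1) 1 s (- s) (- (1 / 4)) (s / 2) s3 s4 dv du s5 v u.
  rewrite -E2 -E4 -E5 -/F1 -/F2 -/d1 -/d2 => H.
  rewrite -[RHS]H; first by ring.
  move=> k; have [r1 r2] := jrec k; move: r1 r2.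
  by rewrite !D1 !D3 !D4 !D2; lra.
Qed.

End jost_series.

(** * The function [w], its asymptotics, and its relation with the integral representations *)

Section jost_solution.
Variable R : realType.
Variable s : R.
Implicit Types (y z : R).
Local Open Scope complex_scope.
Definition Zy y : R := expR (- (2 * y)).
Definition rho y : R := (Num.sqrt (1 - Zy y))^-1.
Definition G1 y := psum (ju s) (Zy y).
Definition G2 y := psum (jv s) (Zy y).

(* [w1 + i w2] is [w(s, .)] of the statement. *)
Definition w1 y := rho y * (cos (s * y) * G1 y + sin (s * y) * G2 y).

Definition w2 y := rho y * (cos (s * y) * G2 y - sin (s * y) * G1 y).

Lemma Zy01 y : 0 < y -> 0 < Zy y < 1.
Proof. by move=> y0; rewrite /Zy expR_gt0 -[X in _ < X]expR0 ltr_expR; lra. Qed.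

Lemma hyp_partialE z N : hyp2F1_partial (- (1 / 2))%:C ((- (1 / 2)) +i* s) (1 +i* s) z%:C N =
  (pseries (ju s) z N) +i* (pseries (jv s) z N).
Proof.
elim: N => [|N IH].
  by rewrite /hyp2F1_partial big_ord0 /pseries/series/= !big_geq.
have -> : hyp2F1_partial (- (1 / 2))%:C ((- (1 / 2)) +i* s) (1 +i* s) z%:C N.+1 =
  hyp2F1_partial (- (1 / 2))%:C ((- (1 / 2)) +i* s) (1 +i* s) z%:C N + jcoef s N * (z ^+ N)%:C.
  by rewrite /hyp2F1_partial big_ord_recr/= rmorphXn.
rewrite IH /pseries/series/= !big_nat_recr//= /ju /jv.
by case: (jcoef s N) => a b; apply/eqP; rewrite eq_complex/=; apply/andP; split; apply/eqP; ring.
Qed.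

Lemma rhoE y : 0 < y -> expR y / Num.sqrt (expR (2 * y) - 1) = rho y.
Proof.
move=> y0; have := Zy01 y0; rewrite /rho /Zy => /andP[z0 z1].
have E0 := expR_gt0 y.
have -> : expR (2 * y) - 1 = expR y ^+ 2 * (1 - expR (- (2 * y))).
  have -> : expR (2 * y) = expR y ^+ 2 by rewrite -expRM_natl; congr expR.
  have -> : expR (- (2 * y)) = (expR y ^+ 2)^-1 by rewrite expRN -expRM_natl; congr (expR _)^-1.
  by field; rewrite gt_eqF.
rewrite sqrtrM ?sqr_ge0// sqrtr_sqr gtr0_norm//.
have : 0 < Num.sqrt (1 - expR (- (2 * y))) by rewrite sqrtr_gt0 subr_gt0.
by move=> h; field; rewrite !gt_eqF.
Qed.

Lemma wfunE y : 0 < y -> wfun s y = w1 y +i* w2 y.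
Proof.
move=> y0; rewrite /wfun /hyp2F1.
have -> : (fun N => complex.Re (hyp2F1_partial (- (1 / 2))%:C ((- (1 / 2)) +i* s) (1 +i* s) (expR (- (2 * y)))%:C N)) = pseries (ju s) (Zy y).
  by apply/funext => N; rewrite hyp_partialE.
have -> : (fun N => complex.Im (hyp2F1_partial (- (1 / 2))%:C ((- (1 / 2)) +i* s) (1 +i* s) (expR (- (2 * y)))%:C N)) = pseries (jv s) (Zy y).
  by apply/funext => N; rewrite hyp_partialE.
rewrite -/(psum _ _) -/(psum _ _) -/(G1 y) -/(G2 y) /w1 /w2 -rhoE//.
have S0 : 0 < Num.sqrt (expR (2 * y) - 1).
  by rewrite sqrtr_gt0 subr_gt0 -[X in X < _]expR0 ltr_expR; lra.
rewrite /cexp.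
have -> : ((1 -i* s) * y%:C : R[i]) = y +i* (- (s * y)).
  by apply/eqP; rewrite eq_complex/=; apply/andP; split; apply/eqP; ring.
rewrite /= cosN sinN.
have -> : ((Num.sqrt (expR (2 * y) - 1))%:C : R[i])^-1 = ((Num.sqrt (expR (2 * y) - 1))^-1)%:C.
  by rewrite fmorphV.
apply/eqP; rewrite eq_complex/=; apply/andP; split; apply/eqP; ring.
Qed.

Definition g1 y := - (2 * Zy y * psum (pseries_diffs (ju s)) (Zy y)).
Definition g2 y := - (2 * Zy y * psum (pseries_diffs (jv s)) (Zy y)).

Definition k1 y := 4 * Zy y * psum (pseries_diffs (ju s)) (Zy y)
  + 4 * Zy y ^+ 2 * psum (pseries_diffs (pseries_diffs (ju s))) (Zy y).

Definition k2 y := 4 * Zy y * psum (pseries_diffs (jv s)) (Zy y)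
  + 4 * Zy y ^+ 2 * psum (pseries_diffs (pseries_diffs (jv s))) (Zy y).

Lemma der_Zy y : is_derive y 1 Zy (- (2 * Zy y)).
Proof. by rewrite /Zy; der; rewrite /=; ring. Qed.

Lemma der_psumZ (c : nat -> R) y : subexp c -> 0 < y ->
  is_derive y 1 (fun y => psum c (Zy y)) (- (2 * Zy y * psum (pseries_diffs c) (Zy y))).
Proof.
move=> sc y0; have [z0 z1] := andP (Zy01 y0).
have d := der_psum sc (_ : 0 <= Zy y < 1); have d2 := der_Zy y.
have {}d := d (_ : 0 <= Zy y < 1); rewrite (ltW z0) z1 in d.
have d3 := d isT.
by der; rewrite /=; ring.
Qed.

Lemma der_G1 y : 0 < y -> is_derive y 1 G1 (g1 y).
Proof. by move=> y0; exact: der_psumZ (sju s) y0. Qed.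

Lemma der_G2 y : 0 < y -> is_derive y 1 G2 (g2 y).
Proof. by move=> y0; exact: der_psumZ (sjv s) y0. Qed.

Lemma der_g1 y : 0 < y -> is_derive y 1 g1 (k1 y).
Proof.
move=> y0; have d1 := der_psumZ (subexp_diffs (sju s)) y0; have d2 := der_Zy y.
by rewrite /g1 /k1; der; rewrite /=; ring.
Qed.

Lemma der_g2 y : 0 < y -> is_derive y 1 g2 (k2 y).
Proof.
move=> y0; have d1 := der_psumZ (subexp_diffs (sjv s)) y0; have d2 := der_Zy y.
by rewrite /g2 /k2; der; rewrite /=; ring.
Qed.

Lemma G_ode y : 0 < y ->
  k1 y = (2 * Zy y * g1 y - 2 * s * (1 - Zy y) * g2 y + Zy y * G1 y + 2 * s * Zy y * G2 y) / (1 - Zy y) /\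
  k2 y = (2 * Zy y * g2 y + 2 * s * (1 - Zy y) * g1 y + Zy y * G2 y - 2 * s * Zy y * G1 y) / (1 - Zy y).
Proof.
move=> y0; have [z0 z1] := andP (Zy01 y0).
have := @hyp_ode R s (Zy y); rewrite (ltW z0) z1 => /(_ isT)/= [od1 od2].
have Z1 : 1 - Zy y != 0 by rewrite gt_eqF// subr_gt0.
split; apply: (mulIf Z1); rewrite mulfVK// /k1 /k2 /g1 /g2 /G1 /G2.
- by have := congr1 (fun t => 4 * Zy y * t) od1; rewrite /=; lra.
- by have := congr1 (fun t => 4 * Zy y * t) od2; rewrite /=; lra.
Qed.

Lemma der_rho y : 0 < y -> is_derive y 1 rho (- (Zy y / (1 - Zy y)) * rho y).
Proof.
move=> y0; have [z0 z1] := andP (Zy01 y0).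
have W0 : 0 < Num.sqrt (1 - Zy y) by rewrite sqrtr_gt0 subr_gt0.
have d := der_Zy y; rewrite /rho; der.
- by rewrite gt_eqF.
- by rewrite subr_gt0.
rewrite /=.
have hW : Num.sqrt (1 - Zy y) ^+ 2 = 1 - Zy y by rewrite sqr_sqrtr// subr_ge0 ltW.
move: W0 hW; move: (Num.sqrt (1 - Zy y)) => W W0 <-.
by field; rewrite gt_eqF.
Qed.

Definition w1' y := rho y * ((- (Zy y / (1 - Zy y)) * G1 y + g1 y + s * G2 y) * cos (s * y)
  + (- (Zy y / (1 - Zy y)) * G2 y - s * G1 y + g2 y) * sin (s * y)).

Definition w2' y := rho y * ((- (Zy y / (1 - Zy y)) * G2 y + g2 y - s * G1 y) * cos (s * y)
  + (Zy y / (1 - Zy y) * G1 y - s * G2 y - g1 y) * sin (s * y)).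

Lemma snh_Zy y : 0 < y -> 3 / (4 * snh y ^+ 2) = 3 * Zy y / (1 - Zy y) ^+ 2.
Proof.
move=> y0; have [z0 z1] := andP (Zy01 y0).
have e0 := expR_gt0 (y / 2).
have hZ : Zy y = (expR (y / 2) ^+ 4)^-1 by rewrite /Zy expRN -expRM_natl; congr (expR _)^-1; field.
have hs : snh y = (expR (y / 2) ^+ 4 - 1) / (2 * expR (y / 2) ^+ 2).
  by rewrite /snh /shh /chh expRN; field; rewrite gt_eqF.
rewrite hs hZ; rewrite hZ in z1.
move: e0 z1; move: (expR (y / 2)) => e e0 z1.
have e1 : 1 < e ^+ 4 by rewrite -invf_lt1// exprn_gt0.
field; rewrite (gt_eqF e0)/= !gt_eqF//; lra.
Qed.

Lemma solY_w1 : solY (- s ^+ 2) w1 w1'.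
Proof.
move=> y y0; have [z0 z1] := andP (Zy01 y0).
have Z1 : 1 - Zy y != 0 by rewrite gt_eqF// subr_gt0.
have d1 := der_G1 y0; have d2 := der_G2 y0; have d3 := der_g1 y0; have d4 := der_g2 y0.
have d5 := der_Zy y; have d6 := der_rho y0; have [od1 od2] := G_ode y0.
split.
- by rewrite /w1 /w1'; der; rewrite /=; field.
- rewrite /w1 /w1' (snh_Zy y0); der; last first.
    by rewrite od1 od2; field.
  all: exact: Z1.
Qed.

Lemma solY_w2 : solY (- s ^+ 2) w2 w2'.
Proof.
move=> y y0; have [z0 z1] := andP (Zy01 y0).
have Z1 : 1 - Zy y != 0 by rewrite gt_eqF// subr_gt0.
have d1 := der_G1 y0; have d2 := der_G2 y0; have d3 := der_g1 y0; have d4 := der_g2 y0.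
have d5 := der_Zy y; have d6 := der_rho y0; have [od1 od2] := G_ode y0.
split.
- by rewrite /w2 /w2'; der; rewrite /=; field.
- rewrite /w2 /w2' (snh_Zy y0); der; last first.
    by rewrite od1 od2; field.
  all: exact: Z1.
Qed.

Lemma Zy_lim : Zy @ +oo --> (0 : R).
Proof. exact: (@cvg_expRN_pinfty R 2). Qed.

Lemma cvgy_cts (F f : R -> R) (l : R) : f @ +oo --> l -> {for l, continuous F} ->
  (fun y => F (f y)) @ +oo --> F l.
Proof. by move=> fl cF; apply: (cvg_comp f F fl). Qed.

Lemma psumZ_lim (c : nat -> R) : subexp c -> (fun y => psum c (Zy y)) @ +oo --> c 0%N.
Proof.
move=> sc; rewrite -(psum0 c); apply: cvgy_cts; first exact: Zy_lim.
by apply: der_cts; apply: der_psum => //; rewrite lexx ltr01.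
Qed.

Lemma rho_lim : rho @ +oo --> (1 : R).
Proof.
have -> : 1 = (fun z => (Num.sqrt (1 - z))^-1) 0 :> R by rewrite subr0 sqrtr1 invr1.
apply: (@cvgy_cts (fun z => (Num.sqrt (1 - z))^-1) Zy 0); first exact: Zy_lim.
by cts; rewrite subr0 sqrtr1 oner_neq0.
Qed.

Lemma zr_lim : (fun y => Zy y / (1 - Zy y)) @ +oo --> (0 : R).
Proof.
have -> : 0 = (fun z => z / (1 - z)) 0 :> R by rewrite mul0r.
apply: (@cvgy_cts (fun z => z / (1 - z)) Zy 0); first exact: Zy_lim.
by cts; rewrite subr0 oner_neq0.
Qed.

Lemma G1_lim : G1 @ +oo --> (1 : R).
Proof. by have [<- _] := j0 s; exact: psumZ_lim (sju s). Qed.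

Lemma G2_lim : G2 @ +oo --> (0 : R).
Proof. by have [_ <-] := j0 s; exact: psumZ_lim (sjv s). Qed.

Lemma g1_lim : g1 @ +oo --> (0 : R).
Proof.
apply: (cvgy_eq (cvgyM (cvgyM (@cvgy_cst R (- 2)) Zy_lim) (psumZ_lim (subexp_diffs (sju s))))).
- by move=> y _ /=; rewrite /g1; ring.
- by rewrite mulr0 mul0r.
Qed.

Lemma g2_lim : g2 @ +oo --> (0 : R).
Proof.
apply: (cvgy_eq (cvgyM (cvgyM (@cvgy_cst R (- 2)) Zy_lim) (psumZ_lim (subexp_diffs (sjv s))))).
- by move=> y _ /=; rewrite /g2; ring.
- by rewrite mulr0 mul0r.
Qed.

Lemma asy_w1 : asy s w1 1 0.
Proof.
apply: (asy_trig (P := fun y => rho y * G1 y) (Q := fun y => rho y * G2 y)).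
- by apply: (cvgy_eq (cvgyM rho_lim G1_lim)) => //; ring.
- by apply: (cvgy_eq (cvgyM rho_lim G2_lim)) => //; ring.
- by move=> y _; rewrite /w1; ring.
Qed.

Lemma asy_w2 : asy s w2 0 (- 1).
Proof.
apply: (asy_trig (P := fun y => rho y * G2 y) (Q := fun y => -1 * (rho y * G1 y))).
- by apply: (cvgy_eq (cvgyM rho_lim G2_lim)) => //; ring.
- by apply: (cvgy_eq (cvgyM (@cvgy_cst R (-1)) (cvgyM rho_lim G1_lim))) => //; ring.
- by move=> y _; rewrite /w2; ring.
Qed.

Lemma asy_w1' : asy s w1' 0 (- s).
Proof.
have cs := @cvgy_cst R s.
apply: (asy_trig (P := fun y => rho y * (- (Zy y / (1 - Zy y)) * G1 y + g1 y + s * G2 y))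
  (Q := fun y => rho y * (- (Zy y / (1 - Zy y)) * G2 y - s * G1 y + g2 y))).
- apply: (cvgy_eq (cvgyM rho_lim (cvgyD (cvgyB g1_lim (cvgyM zr_lim G1_lim)) (cvgyM cs G2_lim)))).
    by move=> y _ /=; ring.
  by ring.
- apply: (cvgy_eq (cvgyM rho_lim (cvgyB (cvgyB g2_lim (cvgyM zr_lim G2_lim)) (cvgyM cs G1_lim)))).
    by move=> y _ /=; ring.
  by ring.
- by move=> y _; rewrite /w1'; ring.
Qed.

Lemma asy_w2' : asy s w2' (- s) 0.
Proof.
have cs := @cvgy_cst R s.
apply: (asy_trig (P := fun y => rho y * (- (Zy y / (1 - Zy y)) * G2 y + g2 y - s * G1 y))
  (Q := fun y => rho y * (Zy y / (1 - Zy y) * G1 y - s * G2 y - g1 y))).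
- apply: (cvgy_eq (cvgyM rho_lim (cvgyB (cvgyB g2_lim (cvgyM zr_lim G2_lim)) (cvgyM cs G1_lim)))).
    by move=> y _ /=; ring.
  by ring.
- apply: (cvgy_eq (cvgyM rho_lim (cvgyB (cvgyB (cvgyM zr_lim G1_lim) g1_lim) (cvgyM cs G2_lim)))).
    by move=> y _ /=; ring.
  by ring.
- by move=> y _; rewrite /w2'; ring.
Qed.

(** [coth (y / 2)], which tends to 1: the factors in [JJ] and [JJ'] are functions of [tt] times
    powers of [shh]. *)
Definition tt y : R := chh y / shh y.

Lemma tt_lim : tt @ +oo --> (1 : R).
Proof.
have e : (fun y : R => expR (- y)) @ +oo --> (0 : R) by exact: cvgr_expR.
have -> : 1 = (fun z => (1 + z) / (1 - z)) 0 :> R by rewrite addr0 subr0 divr1.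
have h : (fun y => (fun z => (1 + z) / (1 - z)) (expR (- y))) @ +oo --> (fun z => (1 + z) / (1 - z)) (0 : R).
  apply: (@cvgy_cts (fun z => (1 + z) / (1 - z)) (fun y => expR (- y)) 0 e).
  by cts; rewrite subr0 oner_neq0.
apply: (cvgy_eq h) => // y y0; rewrite /tt /chh /shh.
have E0 := expR_gt0 (y / 2).
have -> : expR (- y) = (expR (y / 2) ^+ 2)^-1 by rewrite expRN -expRM_natl; congr (expR _)^-1; field.
have E1 : 1 < expR (y / 2) by rewrite -[X in X < _]expR0 ltr_expR; lra.
have E2 : expR (y / 2) ^+ 2 - 1 != 0 by rewrite gt_eqF// subr_gt0 exprn_egt1.
by rewrite expRN; field; rewrite E2 gt_eqF.
Qed.

Lemma om_scale y : 0 < y -> om y = Num.sqrt (2 * tt y) * tt y * shh y ^+ 2.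
Proof.
move=> y0; have X0 := shh_gt0 y0.
have -> : Num.sqrt (2 * tt y) = Num.sqrt (snh y) / shh y.
  rewrite (_ : 2 * tt y = snh y / shh y ^+ 2); last by rewrite /tt /snh; field; rewrite gt_eqF.
  by rewrite sqrtrM ?(ltW (snh_gt0 y0))// sqrtrV ?sqr_ge0// sqrtr_sqr gtr0_norm.
by rewrite /om /tt; field; rewrite gt_eqF.
Qed.

Lemma sqrt_snh_scale y : 0 < y -> Num.sqrt (snh y) = Num.sqrt (2 * tt y) * shh y.
Proof.
move=> y0; have X0 := shh_gt0 y0; have C0 := chh_gt0 y.
have := om_scale y0; rewrite /om /tt => e.
by apply: (mulIf (_ : chh y != 0)); rewrite ?gt_eqF// e; field; rewrite gt_eqF.
Qed.

Lemma cth_scale y : 0 < y -> cth y = (tt y + (tt y)^-1) / 2.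
Proof.
move=> y0; have X0 := shh_gt0 y0; have C0 := chh_gt0 y.
rewrite /cth /snh /tt (_ : 1 + 2 * shh y ^+ 2 = chh y ^+ 2 + shh y ^+ 2); last by rewrite chh2; ring.
by field; rewrite !gt_eqF.
Qed.

Lemma sqrt2tt_lim : (fun y => Num.sqrt (2 * tt y)) @ +oo --> Num.sqrt 2.
Proof.
have := @cvgy_cts (fun t => Num.sqrt (2 * t)) tt 1 tt_lim; rewrite mulr1; apply.
by cts.
Qed.

Lemma cth_lim : (fun y : R => cth y) @ +oo --> (1 : R).
Proof.
have h := @cvgy_cts (fun t => (t + t^-1) / 2) tt 1 tt_lim.
apply: (cvgy_eq (h _)); first by cts; exact: oner_neq0.
- by move=> y y0; rewrite cth_scale.
- by field.
Qed.

Definition Jc := JJ (q1 (csn s) (csn' s)).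
Definition Js := JJ (q1 (snn s) (snn' s)).

Lemma solX_c : solX (- s ^+ 2) (q0 (csn s)) (q1 (csn s) (csn' s)) (q2 (csn s) (csn' s) (- s ^+ 2)).
Proof. exact: (solX_q (der_cs s) (der_cs' s) (@cs_le _ s) (@cs'_le _ s)). Qed.

Lemma solX_s : solX (- s ^+ 2) (q0 (snn s)) (q1 (snn s) (snn' s)) (q2 (snn s) (snn' s) (- s ^+ 2)).
Proof. exact: (solX_q (der_sn s) (der_sn' s) (@sn_le _ s) (@sn'_le _ s)). Qed.

Local Notation b1 := (b1 s).
Local Notation b2 := (b2 s).
Local Notation r2 := (Num.sqrt 2).

Lemma asy_J (u : R -> R) c d : asy s (fun y => shh y ^+ 2 * u (shh y)) c d ->
  asy s (JJ u) (r2 * c) (r2 * d).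
Proof.
move=> a; have k := cvgyM sqrt2tt_lim tt_lim.
apply: (asy_eq (asyM a k)).
- by move=> y y0; rewrite /JJ om_scale//; ring.
- by ring.
- by ring.
Qed.

Lemma asy_J' (u0 u1 : R -> R) c d c' d' : asy s (fun y => shh y * u0 (shh y)) c d ->
  asy s (fun y => shh y ^+ 2 * u1 (shh y)) c' d' ->
  asy s (JJ' (- s ^+ 2) u0 u1) (r2 * (- (2 * s ^+ 2 + 1 / 2) * c - c' / 2)) (r2 * (- (2 * s ^+ 2 + 1 / 2) * d - d' / 2)).
Proof.
move=> a a'; have k1 := cvgyM (@cvgy_cst R (- (2 * s ^+ 2 + 1 / 2))) sqrt2tt_lim.
have k2 := cvgyM (@cvgy_cst R (- (1 / 2))) cth_lim.
apply: (asy_eq (asyD (asyM a k1) (asyM (asy_J a') k2))).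
- by move=> y y0; rewrite /JJ' sqrt_snh_scale//; field.
- by field.
- by field.
Qed.

(** In complex form [Jc = - r2 Re (b w)], and below [Js = r2 Im (b w)]. The two sides solve the same
    equation and agree at infinity together with their derivatives; [solY_unique] applies with [w1],
    [w2], whose Wronskian is [- s], whence [s != 0]. *)
Lemma Jc_w y : s != 0 -> 0 < y -> Jc y = - r2 * (b1 * w1 y - b2 * w2 y).
Proof.
move=> s0 y0.
have sJ := solY_JJ solX_c.
have sw := solY_lin b1 (- b2) solY_w1 solY_w2.
have sD := solY_lin 1 r2 sJ sw.
apply/eqP; rewrite -subr_eq0; apply/eqP.
have := @solY_unique R (- s ^+ 2) s _ _ _ _ _ _ (- s) _ sD solY_w1 solY_w2.
rewrite oppr_eq0 => /(_ s0) H.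
have H1 : asy s (fun y => 1 * JJ (q1 (csn s) (csn' s)) y + r2 * (b1 * w1 y + - b2 * w2 y)) 0 0.
  apply: (asy_eq (asyD (asyZ 1 (asy_J (asy_q1c s))) (asyZ r2 (asyD (asyZ b1 asy_w1) (asyZ (- b2) asy_w2))))) => //; ring.
have H2 : asy s (fun y => 1 * JJ' (- s ^+ 2) (q0 (csn s)) (q1 (csn s) (csn' s)) y + r2 * (b1 * w1' y + - b2 * w2' y)) 0 0.
  apply: (asy_eq (asyD (asyZ 1 (asy_J' (asy_q0c s) (asy_q1c s))) (asyZ r2 (asyD (asyZ b1 asy_w1') (asyZ (- b2) asy_w2'))))) => //.
  - by rewrite /b1 /b2; field.
  - by rewrite /b1 /b2; field.
have := H H1 H2 (ex_intro _ _ (ex_intro _ _ asy_w1)) (ex_intro _ _ (ex_intro _ _ asy_w1'))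
  (ex_intro _ _ (ex_intro _ _ asy_w2)) (ex_intro _ _ (ex_intro _ _ asy_w2')).
have W : (fun y => w1 y * w2' y - w1' y * w2 y) @ +oo --> - s.
  by apply: (asy_wronskian asy_w1 asy_w1' asy_w2 asy_w2'); ring.
move=> /(_ W y y0) <-; rewrite /Jc; ring.
Qed.

Lemma Js_w y : s != 0 -> 0 < y -> Js y = r2 * (b1 * w2 y + b2 * w1 y).
Proof.
move=> s0 y0.
have sJ := solY_JJ solX_s.
have sw := solY_lin b1 b2 solY_w2 solY_w1.
have sD := solY_lin 1 (- r2) sJ sw.
apply/eqP; rewrite -subr_eq0; apply/eqP.
have := @solY_unique R (- s ^+ 2) s _ _ _ _ _ _ (- s) _ sD solY_w1 solY_w2.
rewrite oppr_eq0 => /(_ s0) H.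
have H1 : asy s (fun y => 1 * JJ (q1 (snn s) (snn' s)) y + - r2 * (b1 * w2 y + b2 * w1 y)) 0 0.
  apply: (asy_eq (asyD (asyZ 1 (asy_J (asy_q1s s))) (asyZ (- r2) (asyD (asyZ b1 asy_w2) (asyZ b2 asy_w1))))) => //; ring.
have H2 : asy s (fun y => 1 * JJ' (- s ^+ 2) (q0 (snn s)) (q1 (snn s) (snn' s)) y + - r2 * (b1 * w2' y + b2 * w1' y)) 0 0.
  apply: (asy_eq (asyD (asyZ 1 (asy_J' (asy_q0s s) (asy_q1s s))) (asyZ (- r2) (asyD (asyZ b1 asy_w2') (asyZ b2 asy_w1'))))) => //.
  - by rewrite /b1 /b2; field.
  - by rewrite /b1 /b2; field.
have := H H1 H2 (ex_intro _ _ (ex_intro _ _ asy_w1)) (ex_intro _ _ (ex_intro _ _ asy_w1'))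
  (ex_intro _ _ (ex_intro _ _ asy_w2)) (ex_intro _ _ (ex_intro _ _ asy_w2')).
have W : (fun y => w1 y * w2' y - w1' y * w2 y) @ +oo --> - s.
  by apply: (asy_wronskian asy_w1 asy_w1' asy_w2 asy_w2'); ring.
move=> /(_ W y y0) <-; rewrite /Js; ring.
Qed.

Definition bb := b1 ^+ 2 + b2 ^+ 2.

(** If [b] vanished, so would [Jc] and then [q1] on the whole half line, against [X q1 -> -1] at the
    origin. *)
Lemma bb_gt0 : s != 0 -> 0 < bb.
Proof.
move=> s0; rewrite lt_neqAle addr_ge0 ?sqr_ge0// andbT eq_sym; apply/negP => /eqP e.
have e1 : b1 = 0 by move: e; rewrite /bb => /eqP; rewrite paddr_eq0 ?sqr_ge0// sqrf_eq0 => /andP[/eqP].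
have e2 : b2 = 0 by move: e; rewrite /bb => /eqP; rewrite paddr_eq0 ?sqr_ge0// !sqrf_eq0 => /andP[_ /eqP].
have q10 X : 0 < X -> q1 (csn s) (csn' s) X = 0.
  move=> X0; pose y := 2 * ash X.
  have y0 : 0 < y by rewrite mulr_gt0// ln_gt0//; have := hyp_ge1 X; lra.
  have yX : shh y = X.
    rewrite /shh /y (_ : 2 * ash X / 2 = ash X); last by field.
    have h := ash_arg_gt0 X.
    rewrite expRN /ash lnK ?posrE//.
    have e3 : hyp X ^+ 2 = 1 + X ^+ 2 by exact: hyp2.
    apply: (mulIf (_ : X + hyp X != 0)); first by rewrite gt_eqF.
    transitivity (((X + hyp X) ^+ 2 - 1) / 2); first by field; rewrite gt_eqF.
    have -> : (X + hyp X) ^+ 2 = X ^+ 2 + 2 * X * hyp X + hyp X ^+ 2 by ring.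
    by have -> : X * (X + hyp X) = X ^+ 2 + X * hyp X; [ring|rewrite e3; field].
  have := Jc_w s0 y0; rewrite e1 e2 !mul0r subrr mulr0 /Jc /JJ yX => /eqP.
  by rewrite mulf_eq0 gt_eqF ?om_gt0//= => /eqP.
have := q1_lim0 (der_cs s) (der_cs' s) (@cs_le _ s) (@cs'_le _ s); rewrite mulr0 cos0 => h.
have h0 : X * q1 (csn s) (csn' s) X @[X --> 0^'+] --> (0 : R).
  apply: cvg_near_cst; near=> X; rewrite q10 ?mulr0//; near: X; exact: nbhs_right_gt.
have e4 : -1 = 0 :> R by exact: (cvg_unique _ h h0).
by move/eqP: e4; rewrite oppr_eq0 oner_eq0.
Unshelve. all: by end_near. Qed.

End jost_solution.

(** * Integration tools *)

Section half_line.
Variable R : realType.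
Local Notation mu := (@lebesgue_measure R).
Implicit Types (x y t r : R).

Lemma Rintegral_FTCoy (a l m : R) (F f : R -> R) :
  (forall t, a < t -> is_derive t 1 F (f t)) ->
  (forall t, a < t -> {for t, continuous f}) ->
  mu.-integrable `]a, +oo[ (EFin \o f) ->
  F x @[x --> +oo] --> l -> F x @[x --> a^'+] --> m ->
  Rintegral mu `]a, +oo[ f = l - m.
Proof.
move=> dF cf iF Fl Fm.
have mf : measurable_fun `]a, +oo[ f by apply/measurable_EFinP; exact: (measurable_int mu iF).
have [//|//|||||_ h] := @dominated_cvg_at_right _ _ R mu `]a, +oo[
  (fun (x t : R) => f t * (x <= t)%R%:R) f (fun t => `|f t|) a (a + 1).
- by rewrite ltrDl.
- move=> x ax; apply: measurable_funM => //.
  have -> : (fun t : R => (x <= t)%R%:R : R) = \1_(`[x, +oo[).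
    by apply/funext => t; rewrite indicE; congr (_%:R); rewrite mem_setE in_itv/= andbT.
  exact: measurable_indic.
- move=> t; rewrite /= in_itv/= andbT => ta; apply: cvg_near_cst; near=> x.
  have -> : x <= t by near: x; exact: nbhs_right_le.
  by rewrite mulr1.
- by move=> x t _ _; rewrite normrM ler_piMr//; case: (x <= t); rewrite ?normr1 ?normr0.
- by have := integrable_norm iF.
have h2 : l - F x @[x --> a^'+] --> l - m by apply: cvgB => //; exact: cvg_cst.
suff e : \forall x \near a^'+, Rintegral mu `]a, +oo[ (fun t => f t * (x <= t)%R%:R) = l - F x.
  have h3 : Rintegral mu `]a, +oo[ (fun t => f t * (x <= t)%R%:R) @[x --> a^'+] --> l - m.
    by apply: cvg_trans h2; apply: near_eq_cvg; near=> x; rewrite (near e x).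
  exact: (cvg_unique _ h h3).
near=> x.
have ax : a < x by near: x; exact: nbhs_right_gt.
have <- : Rintegral mu `[x, +oo[ f = l - F x.
  apply: (@Rintegral_FTCy R x l F f).
  - by move=> t xt; apply: dF; exact: lt_le_trans xt.
  - by move=> t xt; apply: cf; exact: lt_le_trans xt.
  - apply: integrableS iF => //.
    by move=> t; rewrite /= !in_itv/= !andbT; exact: lt_le_trans.
  - exact: Fl.
rewrite [RHS]Rintegral_mkcond [LHS]Rintegral_mkcond; apply: eq_Rintegral => t _.
rewrite /patch !mem_setE !in_itv/= !andbT; case: (leP x t) => xt.
  by rewrite (lt_le_trans ax xt) mulr1.
by case: ifP => _; rewrite ?mulr0.
Unshelve. all: by end_near. Qed.

Lemma measurable_indic_le (D : set R) x : measurable D -> measurable_fun D (fun t : R => (t <= x)%R%:R : R).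
Proof.
move=> mD; have -> : (fun t : R => (t <= x)%R%:R : R) = \1_(`]-oo, x]).
  by apply/funext => t; rewrite indicE; congr (_%:R); rewrite mem_setE in_itv.
exact: measurable_indic.
Qed.

(** With [F] the primitive of [f] starting at 0, [F (c x)] has derivative [c f (c x)] and the same
    limits as [F] at 0 and at infinity. *)
Lemma Rintegral_scale (f : R -> R) (c : R) : 0 < c ->
  (forall t, 0 < t -> {for t, continuous f}) ->
  mu.-integrable `]0, +oo[ (EFin \o f) ->
  mu.-integrable `]0, +oo[ (EFin \o (fun t => f (c * t))) ->
  c * Rintegral mu `]0, +oo[ (fun t => f (c * t)) = Rintegral mu `]0, +oo[ f.
Proof.
move=> c0 cf iF ifc.
have mf : measurable_fun (`]0, +oo[%classic : set R) f by apply/measurable_EFinP; exact: (measurable_int mu iF).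
pose F x := Rintegral mu `]0, x] f.
have FE x : F x = Rintegral mu `]0, +oo[ (fun t => f t * (t <= x)%R%:R).
  rewrite /F [RHS]Rintegral_mkcond [LHS]Rintegral_mkcond; apply: eq_Rintegral => t _.
  rewrite /patch !mem_setE !in_itv/= !andbT; case: (ltP 0 t) => //= _.
  by case: (leP t x); rewrite ?mulr1 ?mulr0.
have dF x : 0 < x -> is_derive x 1 F (f x).
  move=> x0; have [||||d e] := @continuous_FTC1 R f (BRight 0) x (x + 1).
  - by rewrite ltrDl.
  - apply: integrableS iF => //.
    by move=> t; rewrite /= !in_itv/= andbT => /andP[].
  - by rewrite lte_fin.
  - exact: cf.
  apply: DeriveDef; first exact: d.
  by rewrite -derive1E; exact: e.
have bd x t : `|f t * (t <= x)%R%:R| <= `|f t|.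
  by rewrite normrM ler_piMr//; case: (t <= x); rewrite ?normr1 ?normr0.
have inf : mu.-integrable `]0, +oo[ (EFin \o (fun t => `|f t|)) by have := integrable_norm iF.
have [//|||||_ Fy] := @dominated_cvg_pinfty _ _ R mu `]0, +oo[
  (fun (x t : R) => f t * (t <= x)%R%:R) f (fun t => `|f t|) 0.
- by move=> x _; apply: measurable_funM => //; exact: measurable_indic_le.
- move=> t _; apply: cvg_near_cst; near=> x.
  have -> : t <= x by near: x; apply: nbhs_pinfty_ge; exact: num_real.
  by rewrite mulr1.
- by move=> x t _ _; exact: bd.
- exact: inf.
have [||||||_ F0] := @dominated_cvg_at_right _ _ R mu `]0, +oo[
  (fun (x t : R) => f t * (t <= x)%R%:R) (fun=> 0) (fun t => `|f t|) 0 1.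
- exact: ltr01.
- by [].
- by move=> x _; apply: measurable_funM => //; exact: measurable_indic_le.
- move=> t; rewrite /= in_itv/= andbT => t0; apply: cvg_near_cst; near=> x.
  have : x < t by near: x; exact: nbhs_right_lt.
  by rewrite ltNge => /negbTE ->; rewrite mulr0.
- by move=> x t _ _; exact: bd.
- exact: inf.
have Fy' : F x @[x --> +oo] --> Rintegral mu `]0, +oo[ f.
  by have -> : F = (fun x => Rintegral mu `]0, +oo[ (fun t => f t * (t <= x)%R%:R)) by apply/funext.
have F0' : F x @[x --> 0^'+] --> (0 : R).
  have -> : F = (fun x => Rintegral mu `]0, +oo[ (fun t => f t * (t <= x)%R%:R)) by apply/funext.
  by move: F0; rewrite Rintegral_cst// mul0r.
rewrite -RintegralZl// -[RHS]subr0.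
apply: (@Rintegral_FTCoy 0 _ _ (fun x => F (c * x))).
- move=> t t0; have ct0 : 0 < c * t by rewrite mulr_gt0.
  have d := dF _ ct0.
  have d2 : is_derive t 1 (fun x : R => c * x) c by der; ring.
  by rewrite mulrC; exact: (@der_comp R F (fun x : R => c * x) t _ _ d d2).
- move=> t t0; have ct0 : 0 < c * t by rewrite mulr_gt0.
  have c1 := cf _ ct0.
  have c2 : {for t, continuous (fun x : R => c * x)} by cts.
  have c3 : {for t, continuous (fun x : R => f (c * x))} by exact: (continuous_comp c2 c1).
  by cts.
- by intg.
- apply: (cvg_comp (fun x : R => c * x) F _ Fy').
  by apply/cvgryPge => A; near=> x; rewrite mulrC -ler_pdivrMr//; near: x; apply: nbhs_pinfty_ge; rewrite num_real.
- apply: (cvg_comp (fun x : R => c * x) F _ F0').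
  move=> /= A [e /= e0 eA]; exists (e / c) => /=; first by rewrite divr_gt0.
  move=> x /=; rewrite sub0r normrN => xe x0; apply: eA; rewrite /= ?mulr_gt0//.
  by rewrite sub0r normrN normrM gtr0_norm// mulrC -ltr_pdivlMr.
Unshelve. all: by end_near. Qed.

End half_line.
Section restriction.
Context d (T : measurableType d) (R : realType) (mu : {measure set T -> \bar R}).

Lemma integrable_patch (D : set T) (f : T -> R) : measurable D -> mu.-integrable D (EFin \o f) ->
  mu.-integrable setT (EFin \o patch (fun=> 0) D f).
Proof. by move=> mD; rewrite (@integrable_mkcond _ _ _ mu D (EFin \o f))// restrict_EFin. Qed.

Lemma Rintegral_subset_le (D E : set T) (f : T -> R) : measurable D -> measurable E -> D `<=` E ->
  (forall t, E t -> 0 <= f t) -> mu.-integrable E (EFin \o f) -> Rintegral mu D f <= Rintegral mu E f.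
Proof.
move=> mD mE DE f0 iE; rewrite [leLHS]Rintegral_mkcond [leRHS]Rintegral_mkcond.
have iD : mu.-integrable D (EFin \o f) by apply: integrableS iE.
apply: le_Rintegral => //; [exact: integrable_patch|exact: integrable_patch|].
move=> t _; rewrite /patch; case: ifPn => [tD|_].
  by rewrite ifT//; move: tD; rewrite !inE; exact: DE.
by case: ifPn => //; rewrite inE; exact: f0.
Qed.

End restriction.

(** * Fubini's theorem under a product bound *)

Section fubini.
Context d1 d2 (T1 : measurableType d1) (T2 : measurableType d2) (R : realType).
Variables (m1 : {sigma_finite_measure set T1 -> \bar R}) (m2 : {sigma_finite_measure set T2 -> \bar R}).

(** In the exchanges below the integrand has a bound with separated variables, which gives
    integrability on the product. Extension by 0 reduces the two domains to the whole spaces. *)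
Lemma Rintegral_fubini (D1 : set T1) (D2 : set T2) (f : T1 -> T2 -> R) (A : T1 -> R) (B : T2 -> R) :
  measurable D1 -> measurable D2 ->
  measurable_fun (D1 `*` D2) (fun p : T1 * T2 => f p.1 p.2) ->
  m1.-integrable D1 (EFin \o A) -> m2.-integrable D2 (EFin \o B) ->
  (forall x y, D1 x -> D2 y -> `|f x y| <= A x * B y) ->
  Rintegral m1 D1 (fun x => Rintegral m2 D2 (f x)) =
  Rintegral m2 D2 (fun y => Rintegral m1 D1 (f ^~ y)).
Proof.
move=> mD1 mD2 mf iA iB fAB.
pose f' (p : T1 * T2) := patch (fun=> 0) (D1 `*` D2) (fun p => f p.1 p.2) p.
have mf' : measurable_fun setT f'.
  by apply/measurable_restrict => //; [exact: measurableX|rewrite setTI].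
have f'E x y : f' (x, y) = if (x \in D1) && (y \in D2) then f x y else 0.
  by rewrite /f' /patch in_setX.
have iA' : m1.-integrable setT (EFin \o (fun x => `|patch (fun=> 0) D1 A x|)).
  by have := integrable_norm (integrable_patch mD1 iA).
have iB' : m2.-integrable setT (EFin \o (fun x => `|patch (fun=> 0) D2 B x|)).
  by have := integrable_norm (integrable_patch mD2 iB).
set A' := (fun x => `|patch (fun=> 0) D1 A x|) in iA'.
set B' := (fun x => `|patch (fun=> 0) D2 B x|) in iB'.
have bd x y : `|f' (x, y)| <= A' x * B' y.
  rewrite f'E /A' /B' /patch; case: ifP => [/andP[xD yD]|_]; last by rewrite normr0 mulr_ge0.
  rewrite xD yD -normrM; apply: le_trans (ler_norm _).
  by move: xD yD; rewrite !inE; exact: fAB.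
have i1 x : m2.-integrable setT (EFin \o (fun y => f' (x, y))).
  apply: (@integrable_dom _ _ _ m2 _ _ (fun y => A' x * B' y)) => //.
  - by apply: measurableT_comp => //; exact: pair1_measurable.
  - exact: integrable_scale.
have i2 y : m1.-integrable setT (EFin \o (fun x => f' (x, y))).
  apply: (@integrable_dom _ _ _ m1 _ _ (fun x => B' y * A' x)) => //.
  - by apply: measurableT_comp => //; exact: pair2_measurable.
  - by move=> t _; rewrite mulrC; exact: bd.
  - exact: integrable_scale.
have ii : (m1 \x m2)%E.-integrable setT (EFin \o f').
  apply/integrable12ltyP; first exact/measurable_EFinP.
  apply: (@le_lt_trans _ _ (\int[m1]_x (A' x * Rintegral m2 setT B')%:E)%E).
    apply: ge0_le_integral => //.
    - by move=> x _; apply: integral_ge0.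
    - apply: (measurable_fun_fubini_tonelli_F (fun p => `|(f' p)%:E|%E)) => //.
      by apply: measurableT_comp => //; exact/measurable_EFinP.
    - apply/measurable_EFinP; apply: measurable_funM => //.
      by apply/measurable_EFinP; exact: (measurable_int m1 iA').
    - move=> x _; rewrite EFinM /Rintegral fineK; last exact: integrable_fin_num.
      rewrite -integralZl//; apply: ge0_le_integral => //.
      + apply: measurableT_comp => //; apply/measurable_EFinP.
        by apply: measurableT_comp => //; exact: pair1_measurable.

      + apply: emeasurable_funM => //; exact: (measurable_int m2 iB').
      + by move=> y _; rewrite -EFinM lee_fin; exact: bd.
  have : m1.-integrable setT (EFin \o (fun x => Rintegral m2 setT B' * A' x)) by exact: integrable_scale.
  move=> /integrableP[_]; apply: le_lt_trans; apply: ge0_le_integral => //.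
  - by move=> x _; rewrite lee_fin mulr_ge0 /A'// Rintegral_ge0// => y _; exact: normr_ge0.
  - apply/measurable_EFinP; apply: measurable_funM => //.
    by apply/measurable_EFinP; exact: (measurable_int m1 iA').
  - apply: measurableT_comp => //; apply/measurable_EFinP; apply: measurable_funM => //.
    by apply/measurable_EFinP; exact: (measurable_int m1 iA').
  - by move=> x _ /=; rewrite lee_fin mulrC ler_norm.
have FF := Fubini ii.
have e1 : Rintegral m1 D1 (fun x => Rintegral m2 D2 (f x)) =
   fine (\int[m1]_x \int[m2]_y (f' (x, y))%:E)%E.
  rewrite Rintegral_mkcond {1}/Rintegral; congr fine; apply: eq_integral => x _ /=.
  rewrite /patch; case: ifPn => [xD|/negbTE xD].
    rewrite Rintegral_mkcond /Rintegral fineK.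
      by apply: eq_integral => y _; rewrite f'E xD /patch.
    have := integrable_fin_num measurableT (i1 x); congr (_ \is a fin_num).
    by apply: eq_integral => y _ /=; rewrite f'E xD /patch.
  by rewrite integral0_eq// => y _; rewrite f'E xD.
have e2 : Rintegral m2 D2 (fun y => Rintegral m1 D1 (f ^~ y)) =
   fine (\int[m2]_y \int[m1]_x (f' (x, y))%:E)%E.
  rewrite Rintegral_mkcond {1}/Rintegral; congr fine; apply: eq_integral => y _ /=.
  rewrite /patch; case: ifPn => [yD|/negbTE yD].
    rewrite Rintegral_mkcond /Rintegral fineK.
      by apply: eq_integral => x _; rewrite f'E yD andbT /patch.
    have := integrable_fin_num measurableT (i2 y); congr (_ \is a fin_num).
    by apply: eq_integral => x _ /=; rewrite f'E yD andbT /patch.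
  by rewrite integral0_eq// => x _; rewrite f'E yD andbF.
by rewrite e1 e2 FF.
Qed.

End fubini.

(** * The Gamma factor *)

Section gamma.
Variable R : realType.
Variable s : R.
Local Notation mu := (@lebesgue_measure R).
Implicit Types (x y t r : R).
(** [t^x e^-t] for [t > 0], as one exponential. The index is one less than the argument of Gamma, so
    that the weight is bounded as soon as [x >= 0]. *)
Definition gam x t := expR (x * ln t - t).
Lemma gam_gt0 x t : 0 < gam x t. Proof. exact: expR_gt0. Qed.

Lemma gamS x t : 0 < t -> gam (x + 1) t = t * gam x t.
Proof.
move=> t0; have e : t = expR (ln t) by rewrite lnK ?posrE.
by rewrite /gam {3}e -expRD; congr expR; ring.
Qed.

Lemma der_gam x t : 0 < t -> is_derive t 1 (gam x) ((x / t - 1) * gam x t).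
Proof.
move=> t0; rewrite /gam; der => //=; ring.
Qed.

Lemma cts_gam x t : 0 < t -> {for t, continuous (gam x)}.
Proof. by move=> t0; exact: der_cts (der_gam x t0). Qed.

Lemma cts_lnt t : 0 < t -> {for t, continuous (@ln R)}.
Proof. exact: continuous_ln. Qed.

(** Half of the exponential is kept for integrability; the other half bounds the power, through
    [ln u <= u - 1] at [u = t / (2 x)]. At [x = 0] the default value of [ln 0] is multiplied by
    0. *)
Lemma gam_dom x t : 0 <= x -> 0 < t -> gam x t <= expR (x * ln (2 * x)) * expR (- (1 / 2 * t)).
Proof.
move=> x0 t0; rewrite /gam -expRD ler_expR.
move: x0; rewrite le_eqVlt => /predU1P[<-|x0]; first by rewrite !mul0r; lra.
have h : ln (t / (2 * x)) <= t / (2 * x) - 1.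
  have u0 : 0 < t / (2 * x) by rewrite divr_gt0// mulr_gt0.
  have := @le_ln1Dx R (t / (2 * x) - 1); rewrite (_ : 1 + (_ - 1) = t / (2 * x)); last by ring.
  by apply; lra.
have e : ln (t / (2 * x)) = ln t - ln (2 * x) by rewrite ln_div ?posrE// mulr_gt0.
have h2 : x * (ln t - ln (2 * x)) <= x * (t / (2 * x) - 1) by rewrite ler_pM2l// -e.
have h3 : x * (t / (2 * x) - 1) = t / 2 - x by field; rewrite gt_eqF.
lra.
Qed.

Lemma int_expN : mu.-integrable `]0, +oo[ (EFin \o (fun t => expR (- (1 / 2 * t)))).
Proof.
have h : mu.-integrable `[0, +oo[ (EFin \o (fun t => expR (- (1 / 2 * t)))) by apply: integrable_expRN; lra.
apply: integrableS h => //.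
by move=> t; rewrite /= !in_itv/= !andbT; exact: ltW.
Qed.

Lemma int_gam x (T : R -> R) : 0 <= x -> (forall t, 0 < t -> {for t, continuous T}) ->
  (forall t, 0 < t -> `|T t| <= 1) ->
  mu.-integrable `]0, +oo[ (EFin \o (fun t => gam x t * T t)).
Proof.
move=> x0 cT T1.
apply: (@integrable_dom _ _ _ mu _ _ (fun t => expR (x * ln (2 * x)) * expR (- (1 / 2 * t)))) => //.
- apply: continuous_measurable_oy => t t0; have c1 := @cts_gam x t t0; have c2 := cT t t0; by cts.
- move=> t; rewrite /= in_itv/= andbT => t0; rewrite normrM gtr0_norm ?gam_gt0//.
  apply: le_trans (gam_dom x0 t0); rewrite ler_piMr ?T1//; exact: (ltW (gam_gt0 _ _)).
- by apply: integrable_scale => //; exact: int_expN.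
Qed.

(* [gc x + i gs x = Gamma (x + 1 + is)]. *)
Definition gm x (T : R -> R) := Rintegral mu `]0, +oo[ (fun t => gam x t * T t).

Definition one_ := (fun _ : R => 1 : R).
Definition cl t := cos (s * ln t).
Definition sl t := sin (s * ln t).
Definition g0 x := gm x one_.
Definition gc x := gm x cl.
Definition gs x := gm x sl.
Lemma cts_one t : 0 < t -> {for t, continuous one_}. Proof. by move=> _; exact: ctsC. Qed.

Lemma cts_cl t : 0 < t -> {for t, continuous cl}.
Proof. by move=> t0; have c := cts_lnt t0; rewrite /cl; cts. Qed.

Lemma cts_sl t : 0 < t -> {for t, continuous sl}.
Proof. by move=> t0; have c := cts_lnt t0; rewrite /sl; cts. Qed.

Lemma bd_one t : 0 < t -> `|one_ t| <= 1. Proof. by rewrite normr1. Qed.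
Lemma bd_cl t : 0 < t -> `|cl t| <= 1. Proof. by move=> _; exact: cos_bd. Qed.
Lemma bd_sl t : 0 < t -> `|sl t| <= 1. Proof. by move=> _; exact: sin_bd. Qed.
Definition i_one x (x0 : 0 <= x) := int_gam x0 cts_one bd_one.
Definition i_cl x (x0 : 0 <= x) := int_gam x0 cts_cl bd_cl.
Definition i_sl x (x0 : 0 <= x) := int_gam x0 cts_sl bd_sl.

(* integration by parts: [T' t = V t / t] *)
Lemma gm_rec x (T V : R -> R) : 0 <= x ->
  (forall t, 0 < t -> is_derive t 1 T (V t / t)) ->
  (forall t, 0 < t -> {for t, continuous V}) ->
  (forall t, 0 < t -> `|T t| <= 1) ->
  mu.-integrable `]0, +oo[ (EFin \o (fun t => gam x t * V t)) ->
  gm (x + 1) T = (x + 1) * gm x T + gm x V.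
Proof.
move=> x0 dT cV T1 iV.
have cT t : 0 < t -> {for t, continuous T} by move=> t0; exact: der_cts (dT t t0).
have x1 : 0 <= x + 1 by lra.
have i1 := int_gam x0 cT T1; have i2 := int_gam x1 cT T1.
have : Rintegral mu `]0, +oo[ (fun t => ((x + 1) * (gam x t * T t) + gam x t * V t) - gam (x + 1) t * T t) = 0 - 0.
  apply: (@Rintegral_FTCoy R 0 0 0 (fun t => gam (x + 1) t * T t)).
  - move=> t t0; have d1 := der_gam (x + 1) t0; have d2 := dT t t0.
    der; rewrite /= (gamS _ t0); field; rewrite gt_eqF//.
  - move=> t t0; have c1 := @cts_gam x t t0; have c2 := cT t t0; have c3 := cV t t0; have c4 := @cts_gam (x + 1) t t0.
    by cts.
  - by intg.
  - have h := cvg_expRN_pinfty (_ : 0 < 1 / 2 :> R).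
    have {}h : (fun t : R => expR ((x + 1) * ln (2 * (x + 1))) * expR (- (1 / 2 * t))) @ +oo --> (0 : R).
      rewrite -[X in _ --> X](mulr0 (expR ((x + 1) * ln (2 * (x + 1))))).
      by apply: cvgM; [exact: cvg_cst|apply: h; lra].
    apply/norm_cvg0P; apply: (squeeze_cvgr _ _ h); last exact: cvg_cst.
    near=> t; have t0 : 0 < t by near: t; apply: nbhs_pinfty_gt; exact: num_real.
    rewrite normr_ge0 /= normrM gtr0_norm ?gam_gt0//.
    by apply: le_trans (gam_dom x1 t0); rewrite ler_piMr ?T1// ltW// gam_gt0.
  - apply/norm_cvg0P; apply: (@squeeze_cvgr _ _ _ _ (fun=> 0) (fun t => t)).
    + near=> t; have t0 : 0 < t by near: t; exact: nbhs_right_gt.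
      have t1 : t <= 1 by near: t; apply: nbhs_right_le; exact: ltr01.
      rewrite normr_ge0 /= normrM gtr0_norm ?gam_gt0// (gamS _ t0) -[leRHS]mulr1 -mulrA ler_pM2l//.
      apply: mulr_ile1; rewrite ?T1//; first by rewrite ltW// gam_gt0.
      rewrite /gam -[leRHS]expR0 ler_expR.
      have : ln t <= 0 by rewrite ln_le0.
      by nra.
    + exact: cvg_cst.
    + by apply: cvg_at_right_filter; exact: cvg_id.
rewrite subrr RintegralB//; [|by intg].
rewrite RintegralD//; [|by intg].
rewrite RintegralZl// => e.
by rewrite /gm; lra.
Unshelve. all: by end_near. Qed.

Lemma g0_rec x : 0 <= x -> g0 (x + 1) = (x + 1) * g0 x.
Proof.
move=> x0; have e : gm x (fun=> 0) = 0.
  rewrite /gm; under eq_Rintegral do rewrite mulr0.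
  by rewrite Rintegral_cst// mul0r.
rewrite /g0 -[RHS]addr0 -e; apply: (@gm_rec x one_ (fun=> 0) x0).
- by move=> t t0; apply: (der_eq (derC _ _)); rewrite mul0r.
- by move=> t _; exact: ctsC.
- exact: bd_one.
- have := integrable_scale 0 _ (i_one x0) => /(_ (measurable_itv _)); congr (_.-integrable _ _).
  by apply/funext => t /=; rewrite mul0r mulr0.
Qed.

Lemma gc_rec x : 0 <= x -> gc (x + 1) = (x + 1) * gc x - s * gs x.
Proof.
move=> x0; have e : gm x (fun t => - s * sl t) = - (s * gs x).
  rewrite /gs /gm -mulNr -RintegralZl//; last exact: i_sl.
  by apply: eq_Rintegral => t _; ring.
rewrite /gc -e; apply: (@gm_rec x cl (fun t => - s * sl t) x0).
- by move=> t t0; rewrite /cl; der => //; rewrite /= /sl; field; rewrite gt_eqF.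
- by move=> t t0; have c := cts_sl t0; cts.
- exact: bd_cl.
- have := integrable_scale (- s) _ (i_sl x0) => /(_ (measurable_itv _)); congr (_.-integrable _ _).
  by apply/funext => t /=; congr EFin; ring.
Qed.

Lemma gs_rec x : 0 <= x -> gs (x + 1) = (x + 1) * gs x + s * gc x.
Proof.
move=> x0; have e : gm x (fun t => s * cl t) = s * gc x.
  rewrite /gc /gm -RintegralZl//; last exact: i_cl.
  by apply: eq_Rintegral => t _; ring.
rewrite /gs -e; apply: (@gm_rec x sl (fun t => s * cl t) x0).
- by move=> t t0; rewrite /sl; der => //; rewrite /= /cl; field; rewrite gt_eqF.
- by move=> t t0; have c := cts_cl t0; cts.
- exact: bd_sl.
- have := integrable_scale s _ (i_cl x0) => /(_ (measurable_itv _)); congr (_.-integrable _ _).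
  by apply/funext => t /=; congr EFin; ring.
Qed.

(** With [v = sqrt u] this is [|2 ln v| <= |v - v^-1|], that is [|t| <= |sinh t|] for [t = ln v]. *)
Lemma ln_sqr_le (u : R) : 0 < u -> ln u ^+ 2 <= (u - 1) ^+ 2 / u.
Proof.
move=> u0.
have key (v : R) : 1 <= v -> 2 * ln v <= v - v^-1.
  move=> v1; have v0 : 0 < v by lra.
  pose F := fun t : R => t - t^-1 - 2 * ln t.
  have : F 1 <= F v.
    move: v1; rewrite le_eqVlt => /predU1P[<-//|v1].
    have cF (t : R) : 1 <= t -> is_derive t 1 F ((1 - t^-1) ^+ 2).
      move=> t1; have t0 : 0 < t by lra.
      have tn : t != 0 by rewrite gt_eqF.
      by rewrite /F; der => //=; field.
    have [||c _] := @MVT R F (fun t => (1 - t^-1) ^+ 2) 1 v v1.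
    - move=> t; rewrite in_itv/= => /andP[t1 _]; apply: cF; exact: ltW.
    - by apply: continuous_within_itv => t; rewrite in_itv/= => /andP[t1 _]; exact: der_cts (cF t t1).
    - by move=> e; rewrite -subr_ge0 e mulr_ge0 ?sqr_ge0// subr_ge0 ltW.
  by rewrite /F ln1 invr1 mulr0; lra.
have key2 (v : R) : 1 <= v -> (2 * ln v) ^+ 2 <= (v - v^-1) ^+ 2.
  move=> v1; apply: lerXn2r; rewrite ?nnegrE; last exact: key.
  - by rewrite mulr_ge0// ln_ge0.
  - by rewrite (le_trans _ (key _ v1))// mulr_ge0// ln_ge0.
have sq : Num.sqrt u ^+ 2 = u by rewrite sqr_sqrtr// ltW.
have v0 : 0 < Num.sqrt u by rewrite sqrtr_gt0.
have e1 : ln u = 2 * ln (Num.sqrt u) by rewrite -{1}sq lnXn// mulr2n; ring.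
have e2 : (u - 1) ^+ 2 / u = (Num.sqrt u - (Num.sqrt u)^-1) ^+ 2.
  by rewrite -{1 2}sq; field; rewrite gt_eqF.
rewrite e1 e2; case: (lerP 1 (Num.sqrt u)) => h; first exact: key2.
have := key2 (Num.sqrt u)^-1; rewrite invrK lnV ?posrE// mulrN sqrrN => H.
rewrite -[leRHS]sqrrN opprB; apply: H.
by rewrite invf_ge1// ltW.
Qed.

(** The right-hand side is [gam x t] times [(u - 1)^2 / u] at [u = t / x]. Its integral is a
    combination of [g0] at [x + 1], [x], [x - 1], hence a multiple of [g0 x] by the recurrence. *)
Lemma gam_weight x t : 1 <= x -> 0 < t ->
  gam x t * ln (t / x) ^+ 2 <= x^-1 * gam (x + 1) t - 2 * gam x t + x * gam (x - 1) t.
Proof.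
move=> x1 t0; have x0 : 0 < x by lra.
have e1 := gamS x t0; have e2 := gamS (x - 1) t0.
rewrite subrK in e2.
have h := ln_sqr_le (divr_gt0 t0 x0).
have g1 := gam_gt0 (x - 1) t.
apply: (@le_trans _ _ (gam x t * ((t / x - 1) ^+ 2 / (t / x)))).
  by rewrite ler_pM2l ?gam_gt0.
rewrite e1 e2 le_eqVlt; apply/orP; left; apply/eqP; field.
by rewrite !gt_eqF.
Qed.

Lemma cos_ge (u : R) : 1 - u ^+ 2 / 2 <= cos u.
Proof.
have e : cos u = 1 - 2 * sin (u / 2) ^+ 2.
  have h : cos (u / 2) ^+ 2 = 1 - sin (u / 2) ^+ 2 by rewrite cos2sin2.
  have {1}-> : u = u / 2 + u / 2 by lra.
  by rewrite cosD -!expr2 h; ring.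
have h : sin (u / 2) ^+ 2 <= (u / 2) ^+ 2.
  rewrite -[X in X <= _]real_normK ?num_real// -[X in _ <= X]real_normK ?num_real//.
  apply: lerXn2r; rewrite ?nnegrE//.
  wlog u0 : u {e} / 0 <= u => [H|].
    have [/H//|u0] := leP 0 u; have := H (- u); rewrite mulNr sinN !normrN; apply; lra.
  have d (t : R) : is_derive t 1 (@sin R) (cos t) by exact: is_derive_sin.
  move: u0; rewrite le_eqVlt => /predU1P[<-|u0]; first by rewrite mul0r sin0 normr0.
  have u20 : 0 < u / 2 by lra.
  have [|c _] := @MVT R (@sin R) (@cos R) 0 (u / 2) u20.
  - by apply: continuous_within_itv => t _; exact: der_cts (d t).
  - rewrite sin0 !subr0 => ->; rewrite normrM ler_piMl//; exact: cos_bd.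
by rewrite e; move: h; rewrite expr_div_n; lra.
Qed.

(** [t^x e^-t] peaks at [t = x]. After rotation by the phase [s ln x] the integrand has the factor
    [cos (s ln (t / x))], and [cos u >= 1 - u^2 / 2] together with [gam_weight] bounds its integral
    below by [g0 x (1 - s^2 / (2 x))]. *)
Lemma gam_rotate x : 1 <= x -> s ^+ 2 < 2 * x -> gc x != 0 \/ gs x != 0.
Proof.
move=> x1 sx; have x0 : 0 < x by lra.
have xx0 : 0 <= x by lra.
have x10 : 0 <= x + 1 by lra.
have xm0 : 0 <= x - 1 by lra.
pose c := s * ln x.
have key : g0 x * (1 - s ^+ 2 / (2 * x)) <= cos c * gc x + sin c * gs x.
  have r0 : g0 (x + 1) = (x + 1) * g0 x by exact: g0_rec.
  have r1 : g0 x = x * g0 (x - 1) by have := g0_rec xm0; rewrite subrK.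
  have i0 := i_one xx0; have ip := i_one x10; have im := i_one xm0.
  have ic := i_cl xx0; have is_ := i_sl xx0.
  pose q := s ^+ 2 / 2.
  have -> : g0 x * (1 - s ^+ 2 / (2 * x)) =
    (1 * g0 x + (- q * x^-1) * g0 (x + 1)) + ((2 * q) * g0 x + (- q * x) * g0 (x - 1)).
    have -> : - q * x * g0 (x - 1) = - q * g0 x by rewrite r1; ring.
    by rewrite r0 /q; field; rewrite gt_eqF.
  rewrite /g0 /gc /gs /gm -Rintegral_lin4// -Rintegral_lin2//.
  apply: le_Rintegral => //; [by intg|by intg|].
  move=> t; rewrite /= in_itv/= andbT => t0; rewrite /one_ !mulr1 mul1r.
  have h := gam_weight x1 t0.
  have e : cos c * (gam x t * cl t) + sin c * (gam x t * sl t) = gam x t * cos (s * ln (t / x)).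
    rewrite ln_div ?posrE// mulrBr cosB /cl /sl /c; ring.
  rewrite e.
  have h2 : gam x t * (1 - (s * ln (t / x)) ^+ 2 / 2) <= gam x t * cos (s * ln (t / x)).
    by rewrite ler_pM2l ?gam_gt0// cos_ge.
  apply: le_trans h2.
  have q0 : 0 <= q by rewrite /q divr_ge0// sqr_ge0.
  have h3 := ler_wpM2l q0 h.
  rewrite exprMn.
  have -> : gam x t * (1 - s ^+ 2 * ln (t / x) ^+ 2 / 2) = gam x t - q * (gam x t * ln (t / x) ^+ 2) by rewrite /q; ring.
  lra.
have pos : 0 < g0 x * (1 - s ^+ 2 / (2 * x)).
  apply: mulr_gt0; last by rewrite subr_gt0 ltr_pdivrMr ?mul1r// mulr_gt0.
  have i0 := i_one xx0.
  have : Rintegral mu `[1, 2] (fun t => gam x t * one_ t) <= g0 x.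
    apply: Rintegral_subset_le => //.
    - by move=> t; rewrite /= !in_itv/= andbT => /andP[? _]; lra.
    - by move=> t _; rewrite mulr1; exact: (ltW (gam_gt0 _ _)).
  apply: lt_le_trans.
  have e2 : expR (- 2) = Rintegral mu `[1, 2] (fun=> expR (- 2) : R).
    by rewrite Rintegral_cst_itv; lra.
  apply: (@lt_le_trans _ _ (expR (- 2))); first exact: expR_gt0.
  rewrite e2; apply: le_Rintegral => //.
  - exact: Rintegrable_cst.
  - apply: integrableS i0 => //.
    by move=> t; rewrite /= !in_itv/= andbT => /andP[? _]; lra.
  - move=> t; rewrite /= in_itv/= => /andP[t1 t2]; rewrite mulr1 /gam ler_expR.
    have := ln_ge0 t1; nra.
case: (eqVneq (gc x) 0) => [e1|]; last by left.
case: (eqVneq (gs x) 0) => [e2|]; last by right.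
by move: key; rewrite e1 e2 !mulr0 addr0; lra.
Qed.

(** That is, Gamma does not vanish at [1 + is]: by the recurrence a zero there would propagate to
    every [1 + n + is], against [gam_rotate] for large [n]. *)
Lemma gam0_neq0 : gc 0 != 0 \/ gs 0 != 0.
Proof.
case: (eqVneq (gc 0) 0) => [e1|]; last by left.
case: (eqVneq (gs 0) 0) => [e2|]; last by right.
have z n : gc n%:R = 0 /\ gs n%:R = 0.
  elim: n => [//|n [h1 h2]].
  have n0 : 0 <= n%:R :> R by exact: ler0n.
  by rewrite -natr1 gc_rec// gs_rec// h1 h2 !mulr0 subrr addr0.
(* From [n > s^2 + 1] follow both conditions of [gam_rotate], [1 <= n] and [s^2 < 2 n]. *)
pose n := (Num.truncn (s ^+ 2 + 1)).+1.
have hn : s ^+ 2 + 1 < n%:R by exact: truncnS_gt.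
have s20 : 0 <= s ^+ 2 := sqr_ge0 s.
have [z1 z2] := z n.
have := @gam_rotate n%:R; rewrite z1 z2 eqxx => h.
by exfalso; case: h => //; lra.
Qed.

Lemma gam_powR x t : 0 < t -> t `^ x * expR (- t) = gam x t.
Proof. by move=> t0; rewrite /powR gt_eqF// -expRD. Qed.

End gamma.

(** * The Beta integral and the coefficient [a(s)] *)

Section gamma2.
Variable R : realType.
Variable s : R.
Local Notation mu := (@lebesgue_measure R).
Local Notation int_expN := (@int_expN R).
Implicit Types (x y t r : R).
Definition cst_gauss : R := Rintegral mu `[0, +oo[ (fun r : R => expR (- r ^+ 2)).

Lemma integrable_gauss : mu.-integrable `[0, +oo[ (EFin \o (fun r : R => expR (- r ^+ 2))).
Proof. by have := @integrableT_gauss R; apply: integrableS. Qed.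

Lemma cst_gaussE : cst_gauss = Num.sqrt pi / 2.
Proof. by rewrite /cst_gauss /Rintegral integral0y_gauss. Qed.

Lemma integrable_gauss_scale u : 0 < u ->
  mu.-integrable `[0, +oo[ (EFin \o (fun r : R => expR (- (u * r ^+ 2)))).
Proof.
move=> u0; have m0 : 0 < Num.min 1 u by rewrite lt_min ltr01.
apply: (@integrable_dom _ _ _ mu _ _ (fun r : R => (Num.min 1 u)^-1 * (1 + r ^+ 2)^-1)) => //.
- by apply: continuous_measurableT => // t; cts.
- move=> r _; rewrite ger0_norm ?expR_ge0// expRN -invfM.
  have r2 : 0 <= r ^+ 2 := sqr_ge0 r.
  rewrite lef_pV2 ?posrE ?expR_gt0 ?mulr_gt0//; last by lra.
  apply: le_trans (expR_ge1Dx _); rewrite mulrDr mulr1 lerD//.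
    by rewrite ge_min lexx.
  by rewrite ler_wpM2r// ge_min lexx orbT.
- by apply: integrable_scale => //; exact: integrable_invDsqr.
Qed.

Lemma integral_gauss_scale u : 0 < u ->
  Rintegral mu `[0, +oo[ (fun r => expR (- (u * r ^+ 2))) = cst_gauss * (Num.sqrt u)^-1.
Proof.
move=> u0; have q0 : 0 < Num.sqrt u by rewrite sqrtr_gt0.
have e2 : Num.sqrt u ^+ 2 = u by rewrite sqr_sqrtr// ltW.
have ig : mu.-integrable `]0, +oo[ (EFin \o (fun r : R => expR (- r ^+ 2))).
  apply: integrableS integrable_gauss => //.
  by move=> t; rewrite /= !in_itv/= !andbT; exact: ltW.
have igc : mu.-integrable `]0, +oo[ (EFin \o (fun r : R => expR (- (Num.sqrt u * r) ^+ 2))).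
  have -> : (fun r => expR (- (Num.sqrt u * r) ^+ 2)) = (fun r => expR (- (u * r ^+ 2))).
    by apply/funext => r; rewrite exprMn e2.
  apply: integrableS (integrable_gauss_scale u0) => //.
  by move=> t; rewrite /= !in_itv/= !andbT; exact: ltW.
have cg t : 0 < t -> {for t, continuous (fun r : R => expR (- r ^+ 2))} by move=> _; cts.
have := Rintegral_scale q0 cg ig igc.
rewrite (Rintegral_itv_obnd_cbnd ig) (Rintegral_itv_obnd_cbnd igc) => e.
rewrite /cst_gauss -e mulrC mulrA mulVf ?gt_eqF// mul1r.
by apply: eq_Rintegral => r _; rewrite exprMn e2.
Qed.

Lemma gm_scale x (T : R -> R) c : 0 <= x -> 1 <= c -> (forall t, 0 < t -> {for t, continuous T}) ->
  (forall t, 0 < t -> `|T t| <= 1) ->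
  gm x T = c * Rintegral mu `]0, +oo[ (fun t => gam x (c * t) * T (c * t)).
Proof.
move=> x0 c1 cT T1; have c0 : 0 < c by lra.
have ct t : 0 < t -> {for t, continuous (fun r : R => gam x r * T r)}.
  by move=> t0; have k1 := @cts_gam R x t t0; have k2 := cT t t0; cts.
apply/esym; apply: (Rintegral_scale c0 ct (int_gam x0 cT T1)).
apply: (@integrable_dom _ _ _ mu _ _ (fun t => expR (x * ln (2 * x)) * expR (- (1 / 2 * t)))) => //.
- apply: continuous_measurable_oy => t t0; have ct0 : 0 < c * t by rewrite mulr_gt0.
  have c2 : {for t, continuous (fun x : R => c * x)} by cts.
  exact: (continuous_comp c2 (ct _ ct0)).
- move=> t; rewrite /= in_itv/= andbT => t0; have ct0 : 0 < c * t by rewrite mulr_gt0.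
  rewrite normrM gtr0_norm ?gam_gt0//; apply: (@le_trans _ _ (gam x (c * t))).
    by rewrite ler_piMr ?T1//; exact: (ltW (gam_gt0 _ _)).
  apply: le_trans (gam_dom x0 ct0) _; rewrite ler_pM2l ?expR_gt0// ler_expR.
  have : t <= c * t by rewrite ler_peMl// ltW.
  lra.
- by apply: integrable_scale => //; exact: int_expN.
Qed.

Definition invhyp r := (1 + r ^+ 2)^-1 : R.
Definition jc := Rintegral mu `[0, +oo[ (fun r => invhyp r ^+ 2 * cos (s * lnD r)).
Definition js := Rintegral mu `[0, +oo[ (fun r => invhyp r ^+ 2 * sin (s * lnD r)).
Lemma rh_gt0 r : 0 < invhyp r. Proof. by rewrite invr_gt0; nra. Qed.
Lemma rh_le1 r : invhyp r <= 1. Proof. by rewrite invf_le1; nra. Qed.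

Lemma cts_rh r : {for r, continuous invhyp}.
Proof. by rewrite /invhyp; cts; rewrite gt_eqF//; nra. Qed.

Lemma der_rh r : is_derive r 1 invhyp (- (2 * r * invhyp r ^+ 2)).
Proof. by rewrite /invhyp; der; [rewrite gt_eqF//; nra|field; rewrite gt_eqF//; nra]. Qed.

Lemma der_lnD r : is_derive r 1 (@lnD R) (2 * r * invhyp r).
Proof. by rewrite /lnD /invhyp; der; [nra|field; rewrite gt_eqF//; nra]. Qed.

Lemma int_rh (T : R -> R) : (forall t, {for t, continuous T}) -> (forall t, `|T t| <= 1) ->
  mu.-integrable `[0, +oo[ (EFin \o (fun r => invhyp r * T r)).
Proof.
move=> cT T1; have c := cts_rh.
apply: (@integrable_dom _ _ _ mu _ _ (fun r => (1 + r ^+ 2)^-1)) => //.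
- by apply: continuous_measurableT => // t; cts.
- by move=> r _; rewrite normrM gtr0_norm ?rh_gt0// ler_piMr ?T1//; exact: (ltW (rh_gt0 r)).
- exact: integrable_invDsqr.
Qed.

Lemma int_rh2 (T : R -> R) : (forall t, {for t, continuous T}) -> (forall t, `|T t| <= 1) ->
  mu.-integrable `[0, +oo[ (EFin \o (fun r => invhyp r ^+ 2 * T r)).
Proof.
move=> cT T1; have c := cts_rh.
have -> : (fun r => invhyp r ^+ 2 * T r) = (fun r => invhyp r * (invhyp r * T r)) by apply/funext => r; rewrite mulrA expr2.
apply: int_rh.
- by move=> t; cts.
- move=> t; rewrite normrM gtr0_norm ?rh_gt0//; apply: mulr_ile1 => //; [exact: (ltW (rh_gt0 t))|exact: rh_le1].
Qed.

Lemma cts_clD t : {for t, continuous (fun r => cos (s * lnD r))}.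
Proof. by have c := der_cts (der_lnD t); cts. Qed.

Lemma cts_slD t : {for t, continuous (fun r => sin (s * lnD r))}.
Proof. by have c := der_cts (der_lnD t); cts. Qed.

Lemma rrh_cvg (T : R -> R) : (forall t, `|T t| <= 1) -> (fun r => r * invhyp r * T r) @ +oo --> (0 : R).
Proof.
move=> T1; apply/norm_cvg0P.
apply: (@squeeze_cvgr _ _ _ _ (fun=> 0) (fun r : R => r^-1)).
- near=> r; have r0 : 0 < r by near: r; apply: nbhs_pinfty_gt; exact: num_real.
  rewrite normr_ge0 /= !normrM gtr0_norm// (gtr0_norm (rh_gt0 r)).
  apply: (@le_trans _ _ (r * invhyp r)).
    by rewrite ler_piMr// mulr_ge0 ?ltW ?rh_gt0.
  rewrite -[leRHS]mul1r ler_pdivlMr//.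
  have -> : r * invhyp r * r = 1 - invhyp r by rewrite /invhyp; field; rewrite gt_eqF//; nra.
  have := rh_gt0 r; lra.
- exact: cvg_cst.
- exact: cvg_inv_pinfty.
Unshelve. all: by end_near. Qed.

(** Integrating the derivative of [r (1 + r^2)^-1] times the phase raises the exponent of
    [(1 + r^2)^-1] from 1 to 2: [b = 2 (1 + is) (jc - i js)]. With exponent 2, the Fubini argument
    of [beta_swap] meets only [gm] at the nonnegative indices 1 and 1/2. *)
Lemma b12_j : b1 s = 2 * (jc + s * js) /\ b2 s = 2 * (s * jc - js).
Proof.
have cc := cts_clD; have cs := cts_slD; have ch := cts_rh.
have ic : mu.-integrable `[0, +oo[ (EFin \o (fun r => invhyp r * cos (s * lnD r))).
  by apply: int_rh => // t; exact: cos_bd.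
have iS : mu.-integrable `[0, +oo[ (EFin \o (fun r => invhyp r * sin (s * lnD r))).
  by apply: int_rh => // t; exact: sin_bd.
have ijc : mu.-integrable `[0, +oo[ (EFin \o (fun r => invhyp r ^+ 2 * cos (s * lnD r))).
  by apply: int_rh2 => // t; exact: cos_bd.
have ijs : mu.-integrable `[0, +oo[ (EFin \o (fun r => invhyp r ^+ 2 * sin (s * lnD r))).
  by apply: int_rh2 => // t; exact: sin_bd.

have cl (t : R) : {for t, continuous (@lnD R)} by exact: der_cts (der_lnD t).
have IcE : Ic s = Rintegral mu `[0, +oo[ (fun r => invhyp r * cos (s * lnD r)) by [].
have IsE : Is s = Rintegral mu `[0, +oo[ (fun r => invhyp r * sin (s * lnD r)) by [].
have h1 : (-1 * Ic s + 2 * jc) + ((- (2 * s)) * Is s + (2 * s) * js) = 0.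
  rewrite IcE IsE /jc /js -Rintegral_lin4//.
  transitivity (0 - 0 * invhyp 0 * cos (s * lnD 0)); last by rewrite !mul0r subr0.
  apply: (@Rintegral_FTCy R 0 0 (fun r => r * invhyp r * cos (s * lnD r))).
  - move=> r _; have d1 := der_rh r; have d2 := der_lnD r.
    by der; rewrite /= /invhyp; field; rewrite gt_eqF//; nra.
  - by move=> r _; cts.
  - by intg.
  - by apply: rrh_cvg => t; exact: cos_bd.
have h2 : (-1 * Is s + 2 * js) + ((2 * s) * Ic s + (- (2 * s)) * jc) = 0.
  rewrite IcE IsE /jc /js -Rintegral_lin4//.
  transitivity (0 - 0 * invhyp 0 * sin (s * lnD 0)); last by rewrite !mul0r subr0.
  apply: (@Rintegral_FTCy R 0 0 (fun r => r * invhyp r * sin (s * lnD r))).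
  - move=> r _; have d1 := der_rh r; have d2 := der_lnD r.
    by der; rewrite /= /invhyp; field; rewrite gt_eqF//; nra.
  - by move=> r _; cts.
  - by intg.
  - by apply: rrh_cvg => t; exact: sin_bd.
by rewrite /b1 /b2; split; lra.
Qed.

(** Substitution of [(1 + r^2) t] for [t] in [gm 1]; the phase then loses [s ln (1 + r^2)]. *)
Lemma Ac_eq (T : R -> R) (r : R) : (forall t, {for t, continuous T}) -> (forall t, `|T t| <= 1) ->
  Rintegral mu `]0, +oo[ (fun t => t * expR (- t) * T (s * ln t) * expR (- (t * r ^+ 2))) =
  invhyp r ^+ 2 * gm 1 (fun t => T (s * ln t - s * lnD r)).
Proof.
move=> cT T1; have c1 : 1 <= 1 + r ^+ 2 by nra.
have c0 : 0 < 1 + r ^+ 2 by lra.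
rewrite (@gm_scale 1 _ (1 + r ^+ 2))//; last first.
- by move=> t t0; have c := cts_lnt t0; have c' := cT (s * ln t - s * lnD r); cts.
have -> (z : R) : invhyp r ^+ 2 * ((1 + r ^+ 2) * z) = invhyp r * z by rewrite /invhyp; field; rewrite gt_eqF.
pose F t := t * expR (- t) * T (s * ln t) * expR (- (t * r ^+ 2)).
have -> : Rintegral mu `]0, +oo[ (fun t => gam 1 ((1 + r ^+ 2) * t) * T (s * ln ((1 + r ^+ 2) * t) - s * lnD r)) =
  Rintegral mu `]0, +oo[ (fun t => (1 + r ^+ 2) * F t).
  apply: eq_Rintegral => t; rewrite inE/= in_itv/= andbT => t0.
  have ct0 : 0 < (1 + r ^+ 2) * t by rewrite mulr_gt0.
  have -> : s * ln ((1 + r ^+ 2) * t) - s * lnD r = s * ln t by rewrite lnM ?posrE// /lnD; ring.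
  have -> : gam 1 ((1 + r ^+ 2) * t) = (1 + r ^+ 2) * t * (expR (- t) * expR (- (t * r ^+ 2))).
    rewrite /gam mul1r expRD lnK ?posrE// -expRD; congr (_ * expR _); ring.
  rewrite /F; ring.
rewrite RintegralZl//; last first.
  apply: (@integrable_dom _ _ _ mu _ _ (fun t => gam 1 t * @one_ R t)) => //.
  - apply: continuous_measurable_oy => t t0; rewrite /F.
    have c := cts_lnt t0; have c' := cT (s * ln t); cts.
  - move=> t; rewrite /= in_itv/= andbT => t0.
    have e1 : gam 1 t = t * expR (- t) by rewrite /gam mul1r expRD lnK ?posrE.
    rewrite /F -e1 /one_ mulr1 !normrM gtr0_norm ?gam_gt0// (gtr0_norm (expR_gt0 _)) -mulrA.
    rewrite ler_piMr//; first exact: (ltW (gam_gt0 _ _)).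
    apply: mulr_ile1 => //.
    rewrite -[leRHS]expR0 ler_expR; have := sqr_ge0 r; nra.
  - exact: i_one.
by rewrite mulrA /invhyp /F; have -> (z : R) : (1 + r ^+ 2)^-1 * (1 + r ^+ 2) * z = z by rewrite mulVf ?mul1r ?gt_eqF.
Qed.

(* Fubini on [t * exp (- t (1 + r ^ 2))]: the Beta integral [int (1 + r ^ 2) ^ (- 2 - is) dr]
   times [Gamma (2 + is)] is a Gaussian constant times [Gamma (3 / 2 + is)]. *)
Lemma beta_swap (T : R -> R) : (forall t, {for t, continuous T}) -> (forall t, `|T t| <= 1) ->
  Rintegral mu `[0, +oo[ (fun r => invhyp r ^+ 2 * gm 1 (fun t => T (s * ln t - s * lnD r))) =
  cst_gauss * gm (1 / 2) (fun t => T (s * ln t)).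
Proof.
move=> cT T1.
under eq_Rintegral do rewrite -Ac_eq//.
rewrite (@Rintegral_fubini _ _ _ _ R mu mu `[0, +oo[ `]0, +oo[
  (fun r t => t * expR (- t) * T (s * ln t) * expR (- (t * r ^+ 2)))
  (fun r => 2 * (1 + r ^+ 2)^-1) (fun t => expR (- (1 / 2 * t))))//; last 4 first.
- apply: measurable_funM.
    pose H (t : R) := t * expR (- t) * T (s * ln t).
    have mH : measurable_fun (`]0, +oo[%classic : set R) H.
      apply: continuous_measurable_oy => t t0; rewrite /H.
      have c := cts_lnt t0; have c' := cT (s * ln t); cts.
    have sub : [set p.2 | p in (`[0, +oo[ : set R) `*` (`]0, +oo[ : set R)] `<=` `]0, +oo[.
      by move=> _ [[r t] /= [_ h] <-].
    exact: (measurable_comp (measurable_itv _) sub mH (measurable_funTS measurable_snd)).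
  apply: (measurableT_comp (@measurable_expR R)); apply: measurable_funN.
  have m2 : measurable_fun (setT : set R) (fun r : R => r ^+ 2) by apply: continuous_measurableT => // t; cts.
  apply: measurable_funM; first exact: (measurable_funTS measurable_snd).
  exact: (measurableT_comp m2 (measurable_funTS measurable_fst)).
- by apply: integrable_scale => //; exact: integrable_invDsqr.
- exact: int_expN.
- move=> r t _; rewrite /= in_itv/= andbT => t0; have r2 := sqr_ge0 r.
  rewrite !normrM (gtr0_norm t0) !(gtr0_norm (expR_gt0 _)).
  apply: (@le_trans _ _ (t * expR (- t) * expR (- (t * r ^+ 2)))).
    by rewrite ler_wpM2r ?expR_ge0// ler_piMr ?T1// mulr_ge0 ?expR_ge0// ltW.
  (* Splitting [t (1 + r^2)] as [t / 2 + t (1/2 + r^2)]: the first part gives integrability in [t],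
     and [v e^-v <= 1] turns the second into a bound in [r] alone. *)
  have -> : t * expR (- t) * expR (- (t * r ^+ 2)) =
    expR (- (1 / 2 * t)) * (t * expR (- (t * (1 / 2 + r ^+ 2)))).
    have -> : - t = - (1 / 2 * t) - 1 / 2 * t by lra.
    have -> : - (t * (1 / 2 + r ^+ 2)) = - (1 / 2 * t) - (t * r ^+ 2) by lra.
    by rewrite !expRD; ring.
  rewrite mulrC ler_pM2r ?expR_gt0// expRN.
  have h : t * (1 / 2 + r ^+ 2) <= expR (t * (1 / 2 + r ^+ 2)) by apply: le_trans (expR_ge1Dx _); lra.
  have k0 : 0 < 1 / 2 + r ^+ 2 by lra.
  rewrite ler_pdivrMr ?expR_gt0// mulrAC ler_pdivlMr; nra.
rewrite /gm -RintegralZl//; last first.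
  apply: int_gam; [lra|move=> t t0; have c := cts_lnt t0; have c' := cT (s * ln t); cts|by move=> *; exact: T1].
apply: eq_Rintegral => t; rewrite inE/= in_itv/= andbT => t0.
rewrite RintegralZl//; last first.
  exact: integrable_gauss_scale.
rewrite integral_gauss_scale//.
have q0 : 0 < Num.sqrt t by rewrite sqrtr_gt0.
have e1 : t * expR (- t) = gam (1 / 2) t * Num.sqrt t.
  rewrite -gam_powR// div1r powR12_sqrt ?(ltW t0)// mulrAC -expr2 sqr_sqrtr//; exact: ltW.
have -> : t * expR (- t) * T (s * ln t) * (cst_gauss * (Num.sqrt t)^-1) =
  (t * expR (- t)) * (T (s * ln t) * cst_gauss * (Num.sqrt t)^-1) by ring.
by rewrite e1; field; rewrite gt_eqF.
Qed.

(* That is, [b(s) Gamma (1 + is) = sqrt pi Gamma (3/2 + is)] with [b = b1 + i b2]. *)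
Lemma b_gamma : b1 s * gc s 0 - b2 s * gs s 0 = 2 * cst_gauss * gc s (1 / 2) /\
  b1 s * gs s 0 + b2 s * gc s 0 = 2 * cst_gauss * gs s (1 / 2).
Proof.
have cc := cts_clD; have cs := cts_slD; have ch := cts_rh.
have ijc : mu.-integrable `[0, +oo[ (EFin \o (fun r => invhyp r ^+ 2 * cos (s * lnD r))).
  by apply: int_rh2 => // t; exact: cos_bd.
have ijs : mu.-integrable `[0, +oo[ (EFin \o (fun r => invhyp r ^+ 2 * sin (s * lnD r))).
  by apply: int_rh2 => // t; exact: sin_bd.
have [-> ->] := b12_j.
have g1c : gc s 1 = gc s 0 - s * gs s 0 by have := @gc_rec R s 0 (lexx 0); rewrite add0r mul1r.
have g1s : gs s 1 = gs s 0 + s * gc s 0 by have := @gs_rec R s 0 (lexx 0); rewrite add0r mul1r.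
have i1c := @i_cl R s 1 ler01; have i1s := @i_sl R s 1 ler01.
have h1 := beta_swap (@cos_ct R) (@cos_bd R).
have h2 := beta_swap (@sin_ct R) (@sin_bd R).
have e1 r : gm 1 (fun t => cos (s * ln t - s * lnD r)) = cos (s * lnD r) * gc s 1 + sin (s * lnD r) * gs s 1.
  rewrite /gc /gs /gm -Rintegral_lin2//; apply: eq_Rintegral => t _.
  by rewrite cosB /cl /sl; ring.
have e2 r : gm 1 (fun t => sin (s * ln t - s * lnD r)) = cos (s * lnD r) * gs s 1 + (- sin (s * lnD r)) * gc s 1.
  rewrite /gc /gs /gm -Rintegral_lin2//; apply: eq_Rintegral => t _.
  by rewrite sinB /cl /sl; ring.
have k1 : gc s 1 * jc + gs s 1 * js = cst_gauss * gc s (1 / 2).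
  rewrite -[RHS]h1 /jc /js -Rintegral_lin2//; apply: eq_Rintegral => r _; rewrite e1; ring.
have k2 : gs s 1 * jc + (- gc s 1) * js = cst_gauss * gs s (1 / 2).
  rewrite -[RHS]h2 /jc /js -Rintegral_lin2//; apply: eq_Rintegral => r _; rewrite e2; ring.
rewrite -!mulrA -k1 -k2 g1c g1s; split; ring.
Qed.

Local Open Scope complex_scope.

Lemma cGammaE (x y t0 : R) : y = x + 1 -> cGamma (y +i* t0) = gc t0 x +i* gs t0 x.
Proof.
move=> ->; rewrite /cGamma /gc /gs /gm /=; congr (_ +i* _);
  apply: eq_Rintegral => t; rewrite inE/= in_itv/= andbT => tp; rewrite addrK gam_powR//.
Qed.

Lemma gcN x : gc (- s) x = gc s x.
Proof. by apply: eq_Rintegral => t _; rewrite /cl mulNr cosN. Qed.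

Lemma gsN x : 0 <= x -> gs (- s) x = - gs s x.
Proof.
move=> x0; rewrite -[RHS]mulN1r /gs /gm -RintegralZl//; last exact: i_sl.
by apply: eq_Rintegral => t _; rewrite /sl mulNr sinN; ring.
Qed.

(** By [b_gamma], [a(s)] is minus the quotient of [b] by its conjugate, that is [- b^2 / |b|^2]. *)
Lemma acoefE : s != 0 ->
  acoef s = (- (b1 s ^+ 2 - b2 s ^+ 2) / bb s) +i* (- (2 * b1 s * b2 s) / bb s).
Proof.
move=> s0; have bp := bb_gt0 s0.
have h12 : 0 <= 1 / 2 :> R by lra.
have [k1 k2] := b_gamma.
have h32 : 3 / 2 = 1 / 2 + 1 :> R by lra.
rewrite /acoef !(@cGammaE 0 1) ?add0r// !(cGammaE _ h32).
rewrite !gcN !gsN//.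
have C0 : 0 < cst_gauss by rewrite cst_gaussE divr_gt0// sqrtr_gt0 pi_gt0.
set g := gc s 0 in k1 k2 *; set h := gs s 0 in k1 k2 *.
set g' := gc s (1 / 2) in k1 k2 *; set h' := gs s (1 / 2) in k1 k2 *.
have gh : 0 < g ^+ 2 + h ^+ 2.
  have := @gam0_neq0 R s; rewrite -/g -/h => -[] z.
    by rewrite ltr_pwDl ?sqr_ge0// exprn_even_gt0.
  by rewrite ltr_wpDl ?sqr_ge0// exprn_even_gt0.
have eg : g' = (b1 s * g - b2 s * h) / (2 * cst_gauss) by rewrite k1; field; rewrite gt_eqF.
have eh : h' = (b1 s * h + b2 s * g) / (2 * cst_gauss) by rewrite k2; field; rewrite gt_eqF.
have nz (a b : R) : 0 < a ^+ 2 + b ^+ 2 -> a +i* b != 0.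
  move=> ab; apply/eqP => -[e1 e2]; move: ab; rewrite e1 e2 expr0n/= addr0; lra.
have D0 : (g +i* h) * (g' -i* h') != 0.
  rewrite mulf_neq0 ?nz//.
  have -> : g' ^+ 2 + (- h') ^+ 2 = bb s * (g ^+ 2 + h ^+ 2) / (2 * cst_gauss) ^+ 2.
    by rewrite eg eh /bb; field; rewrite gt_eqF.
  by rewrite divr_gt0 ?exprn_gt0 ?mulr_gt0.
pose z := (- (b1 s ^+ 2 - b2 s ^+ 2) / bb s) +i* (- (2 * b1 s * b2 s) / bb s).
rewrite -/z (_ : - _ = z * ((g +i* h) * (g' -i* h'))) ?mulfK//.
apply/eqP; rewrite /z eq_complex/= eg eh /bb; apply/andP; split; apply/eqP; field;
  rewrite -/(bb s) !gt_eqF//.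
Qed.

(** With [z = b w(s, y)] and [z' = b w(s, e)] the left-hand side is [(Re (conj z z') - Re (z z')) /
    |b|^2 = 2 Im z Im z' / |b|^2], and [Js] is [sqrt 2] times the imaginary part. *)
Lemma green_densityE y (e : R) : s != 0 -> 0 < y -> 0 < e ->
  complex.Re (acoef s * wfun s y * wfun s e + (wfun s y)^* * wfun s e) = Js s y * Js s e / bb s.
Proof.
move=> s0 y0 e0; have bp := bb_gt0 s0.
rewrite acoefE// !wfunE// !Js_w//=.
have r2 : Num.sqrt 2 ^+ 2 = 2 :> R by rewrite sqr_sqrtr.
have -> (a b : R) : Num.sqrt 2 * a * (Num.sqrt 2 * b) = 2 * (a * b) by rewrite -[in RHS]r2; ring.
by rewrite /bb; field; rewrite -/(bb s) gt_eqF.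
Qed.

End gamma2.

(** * The spectral density *)

Section regular_solution.
Variable R : realType.
Implicit Types (X Y y s : R).

Lemma solX_p (h h' : R -> R) (lam : R) : (forall t : R, is_derive t 1 h (h' t)) ->
  (forall t : R, is_derive t 1 h' (lam * h t)) -> h' 0 = 0 ->
  solX lam (p0 h) (p1 h h') (p2 h h' lam).
Proof.
move=> dh dh' h0 X X0; split; [exact: der_p0 dh dh' X|exact: der_p1 dh dh' X|exact: (p_ode dh dh' h0 X0)].
Qed.

(** The Wronskian is constant, so it is read at the origin, where [X q1 -> - h 0], [X q0 -> 0] and
    [p0] takes the value [pi / 2 * g 0]. *)
Lemma wrX_qp (h h' g g' : R -> R) (lam A B : R) :
  (forall t : R, is_derive t 1 h (h' t)) -> (forall t : R, is_derive t 1 h' (lam * h t)) ->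
  (forall t, 0 <= t -> `|h t| <= A) -> (forall t, 0 <= t -> `|h' t| <= B) ->
  (forall t : R, is_derive t 1 g (g' t)) -> (forall t : R, is_derive t 1 g' (lam * g t)) -> g' 0 = 0 ->
  forall X, 0 < X -> wrX (q0 h) (q1 h h') (p0 g) (p1 g g') X = - (pi / 2 * (h 0 * g 0)).
Proof.
move=> dh dh' hA hB dg dg' g0 X X0.
have sq := solX_q dh dh' hA hB; have sp := solX_p dg dg' g0.
have c0 : {for 0, continuous (p0 g)} by exact: der_cts (der_p0 dg dg' 0).
have c1 : {for 0, continuous (p1 g g')} by exact: der_cts (der_p1 dg dg' 0).
have l1 := q1_lim0 dh dh' hA hB; have l0 := q0_lim0 dh hA.
have k0 : p0 g x @[x --> 0^'+] --> p0 g 0 by apply: cvg_at_right_filter.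
have k1 : p1 g g' x @[x --> 0^'+] --> p1 g g' 0 by apply: cvg_at_right_filter.
have k2 : 1 + x ^+ 2 @[x --> 0^'+] --> (1 + 0 ^+ 2 : R).
  by apply: cvg_at_right_filter; have : {for 0, continuous (fun x : R => 1 + x ^+ 2)} by cts.
have lim : (1 + x ^+ 2) * ((x * q1 h h' x) * p0 g x - (x * q0 h x) * p1 g g' x) @[x --> 0^'+] -->
   (1 + 0 ^+ 2) * (- h 0 * p0 g 0 - 0 * p1 g g' 0).
  by apply: cvgM => //; apply: cvgB; apply: cvgM.
have lim2 : (1 + x ^+ 2) * ((x * q1 h h' x) * p0 g x - (x * q0 h x) * p1 g g' x) @[x --> 0^'+] -->
  wrX (q0 h) (q1 h h') (p0 g) (p1 g g') X.
  apply: cvg_near_cst; near=> x.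
  have x0 : 0 < x by near: x; exact: nbhs_right_gt.
  by rewrite (wrX_const sq sp X0 x0) /wrX; ring.
have -> : - (pi / 2 * (h 0 * g 0)) = (1 + 0 ^+ 2) * (- h 0 * p0 g 0 - 0 * p1 g g' 0) by rewrite p0_0; ring.
exact: (cvg_unique _ lim2 lim).
Unshelve. all: by end_near. Qed.

(** Here the constant is read at infinity, where it is [- 2 s (Ic^2 + Is^2)]; moreover
    [bb = (1 + 4 s^2) (Ic^2 + Is^2)]. *)
Lemma wrX_cs s X : 0 < X -> wrX (q0 (csn s)) (q1 (csn s) (csn' s)) (q0 (snn s)) (q1 (snn s) (snn' s)) X =
  - (2 * s * bb s / (1 + 4 * s ^+ 2)).
Proof.
move=> X0.
have n0 : 1 + 4 * s ^+ 2 != 0 by rewrite gt_eqF//; have := sqr_ge0 s; lra.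
pose W := - (2 * s * (Ic s ^+ 2 + Is s ^+ 2)).
have -> : - (2 * s * bb s / (1 + 4 * s ^+ 2)) = W by rewrite /W /bb /b1 /b2; field.
have h : (fun y => (shh y ^+ 2 * q1 (csn s) (csn' s) (shh y)) * (shh y * q0 (snn s) (shh y)) -
    (shh y * q0 (csn s) (shh y)) * (shh y ^+ 2 * q1 (snn s) (snn' s) (shh y))) @ +oo --> W.
  apply: (asy_wronskian (asy_q1c s) (asy_q0c s) (asy_q1s s) (asy_q0s s)); rewrite /W /b1 /b2; ring.
have h2 := cvgyM (cvgyM (@tt_lim R) (@tt_lim R)) h.
have h3 : (fun _ : R => wrX (q0 (csn s)) (q1 (csn s) (csn' s)) (q0 (snn s)) (q1 (snn s) (snn' s)) X) @ +oo --> W.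
  apply: (cvgy_eq h2); last by rewrite !mul1r.
  move=> y y0 /=; have s0 := shh_gt0 y0.
  have sn0 : shh y != 0 by rewrite gt_eqF.
  rewrite (wrX_const (solX_c s) (solX_s s) X0 s0) /wrX -hyp2 hyp_shh /tt; field.
  exact: sn0.
exact: (cvg_unique _ (@cvgy_cst R _) h3).
Qed.

(** The second kind solution built on [sin] has no logarithmic term, since [sin] vanishes at 0. So
    its Wronskian with the regular solution is 0 and the two are proportional. *)
Lemma q1s_p1c s X : 0 < X ->
  q1 (snn s) (snn' s) X = bb s * (4 * s / (pi * (1 + 4 * s ^+ 2))) * p1 (csn s) (csn' s) X.
Proof.
move=> X0.
have n0 : 1 + 4 * s ^+ 2 != 0 by rewrite gt_eqF//; have := sqr_ge0 s; lra.
have c0 : csn' s 0 = 0 by rewrite /csn' mulr0 sin0 mulr0.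
have w1 := wrX_qp (der_cs s) (der_cs' s) (@cs_le _ s) (@cs'_le _ s) (der_cs s) (der_cs' s) c0 X0.
have w2 := wrX_qp (der_sn s) (der_sn' s) (@sn_le _ s) (@sn'_le _ s) (der_cs s) (der_cs' s) c0 X0.
have w3 := wrX_cs s X0.
have e1 : csn s 0 = 1 by rewrite /csn mulr0 cos0.
have e2 : snn s 0 = 0 by rewrite /snn mulr0 sin0.
rewrite -/(csn s 0) e1 !mulr1 in w1; rewrite -/(snn s 0) e2 mul0r mulr0 oppr0 in w2.
change (wrX (q0 (csn s)) (q1 (csn s) (csn' s)) (p0 (csn s)) (p1 (csn s) (csn' s)) X = - (pi / 2)) in w1.
change (wrX (q0 (snn s)) (q1 (snn s) (snn' s)) (p0 (csn s)) (p1 (csn s) (csn' s)) X = 0) in w2.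
have fX : X * (1 + X ^+ 2) != 0 by rewrite mulf_neq0 ?gt_eqF//; nra.
set qc0 := q0 (csn s) X in w1 w2 w3; set qc1 := q1 (csn s) (csn' s) X in w1 w2 w3.
set qs0 := q0 (snn s) X in w1 w2 w3; set qs1 := q1 (snn s) (snn' s) X in w1 w2 w3 *.
(* The linear relation between three vectors of the plane, with Wronskians as coefficients. *)
have key : qs1 * wrX (q0 (csn s)) (q1 (csn s) (csn' s)) (p0 (csn s)) (p1 (csn s) (csn' s)) X =
  p1 (csn s) (csn' s) X * wrX (q0 (csn s)) (q1 (csn s) (csn' s)) (q0 (snn s)) (q1 (snn s) (snn' s)) X +
  qc1 * wrX (q0 (snn s)) (q1 (snn s) (snn' s)) (p0 (csn s)) (p1 (csn s) (csn' s)) X.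
  rewrite /wrX -/qc0 -/qc1 -/qs0 -/qs1; ring.
rewrite w1 w2 w3 mulr0 addr0 in key.
have pi0 : pi != 0 :> R by rewrite gt_eqF// pi_gt0.
apply: (mulIf (_ : pi / 2 != 0)); first by rewrite mulf_neq0// invr_eq0 pnatr_eq0.
have -> : qs1 * (pi / 2) = - (qs1 * - (pi / 2)) by ring.
rewrite key; move: (pi : R) pi0 => q pi0; field.
by rewrite n0 pi0.
Qed.

(** The real part in the statement, by [green_densityE], when [s] is not 0. *)
Definition Ef s y e := Js s y * Js s e / bb s.

(** Writing one factor in the regular form and the other in the second kind form cancels [|b|^2].
    What remains depends on [s] through one cosine, one sine and a rational weight, whose integrals
    are elementary. *)
Lemma Ef_pq s y e : s != 0 -> 0 < y ->
  Ef s y e = 4 * s / (pi * (1 + 4 * s ^+ 2)) * (om y * om e) * (p1 (csn s) (csn' s) (shh y) * q1 (snn s) (snn' s) (shh e)).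
Proof.
move=> s0 y0; rewrite /Ef /Js /JJ q1s_p1c ?shh_gt0//; have := bb_gt0 s0 => b0.
have pi0 : pi != 0 :> R by rewrite gt_eqF// pi_gt0.
have n0 : 1 + 4 * s ^+ 2 != 0 by rewrite gt_eqF//; have := sqr_ge0 s; lra.
have b00 : bb s != 0 by rewrite gt_eqF.
by move: (pi : R) pi0 => q pi0; field; rewrite b00 n0 pi0.
Qed.

(** A bound of [|w(s, y)|] for all [s]: each of the two series is at most [(1 - Zy y)^-1] in
    modulus, and the factor 2 covers [sqrt 2]. *)
Definition Bd y : R := 2 * (rho y * (1 - Zy y)^-1).

Lemma Zy_le a y : a <= y -> Zy y <= Zy a.
Proof. by move=> ay; rewrite ler_expR; lra. Qed.

Lemma Bd_gt0 y : 0 < y -> 0 < Bd y.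
Proof.
move=> y0; have := Zy01 y0 => /andP[_ z1].
by rewrite mulr_gt0// mulr_gt0 ?invr_gt0 ?sqrtr_gt0; lra.
Qed.

Lemma Bd_le a y : 0 < a -> a <= y -> Bd y <= Bd a.
Proof.
move=> a0 ay; have := Zy01 a0 => /andP[_ za]; have := Zy_le ay => zz.
rewrite ler_pM2l//; apply: ler_pM; rewrite ?invr_ge0 ?sqrtr_ge0//; try lra.
  by rewrite lef_pV2 ?posrE ?sqrtr_gt0; [apply: ler_wsqrtr; lra|lra..].
by rewrite lef_pV2 ?posrE; lra.
Qed.

Lemma w_bound s y : 0 < y -> w1 s y ^+ 2 + w2 s y ^+ 2 <= Bd y ^+ 2.
Proof.
move=> y0; have := Zy01 y0 => /andP[z0 z1].
have z01 : 0 <= Zy y < 1 by rewrite z1 ltW.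
have g1 : `|G1 s y| <= (1 - Zy y)^-1 by apply: psum_le => //; exact: ju_le.
have g2 : `|G2 s y| <= (1 - Zy y)^-1 by apply: psum_le => //; exact: jv_le.
have -> : w1 s y ^+ 2 + w2 s y ^+ 2 = rho y ^+ 2 * (G1 s y ^+ 2 + G2 s y ^+ 2) * (cos (s * y) ^+ 2 + sin (s * y) ^+ 2).
  by rewrite /w1 /w2; ring.
rewrite cos2Dsin2 mulr1 /Bd; set c := (1 - Zy y)^-1 in g1 g2 *.
have c0 : 0 < c by rewrite invr_gt0; lra.
have h1 : G1 s y ^+ 2 <= c ^+ 2 by rewrite -[leLHS]real_normK ?num_real//; apply: lerXn2r; rewrite ?nnegrE// ltW.
have h2 : G2 s y ^+ 2 <= c ^+ 2 by rewrite -[leLHS]real_normK ?num_real//; apply: lerXn2r; rewrite ?nnegrE// ltW.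
have -> : (2 * (rho y * c)) ^+ 2 = rho y ^+ 2 * (4 * c ^+ 2) by ring.
rewrite ler_wpM2l ?sqr_ge0//; have := sqr_ge0 c; lra.
Qed.

Lemma Js_bound s y : s != 0 -> 0 < y -> Js s y ^+ 2 <= 2 * bb s * Bd y ^+ 2.
Proof.
move=> s0 y0; rewrite Js_w// exprMn sqr_sqrtr// -mulrA ler_pM2l//.
have w := w_bound s y0; have b0 := bb_gt0 s0.
apply: (@le_trans _ _ (bb s * (w1 s y ^+ 2 + w2 s y ^+ 2))); last by rewrite ler_pM2l.
rewrite /bb; have := sqr_ge0 (b1 s * w1 s y - b2 s * w2 s y); nra.
Qed.

Lemma Js0 y : Js 0 y = 0.
Proof.
rewrite /Js /JJ /q1 (_ : (fun r => K1 _ _ _) = (fun=> 0)) ?Rintegral_cst// ?mul0r ?mulr0//.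
by apply/funext => r; rewrite /K1 /snn /snn' !mul0r sin0 !(mulr0, mul0r) subrr.
Qed.

(** Since [|Im (b w)| <= |b| |w|], division by [|b|^2] leaves a bound free of [s]. At [s = 0], where
    positivity of [bb] is not at hand, [Js] is 0. *)
Lemma Ef_bound s y e : 0 < y -> 0 < e -> `|Ef s y e| <= 2 * (Bd y * Bd e).
Proof.
move=> y0 e0; have by0 := Bd_gt0 y0; have be0 := Bd_gt0 e0.
case: (eqVneq s 0) => [->|s0].
  by rewrite /Ef Js0 !mul0r normr0 mulr_ge0// mulr_ge0// ltW.
have b0 := bb_gt0 s0.
have hy := Js_bound s0 y0; have he := Js_bound s0 e0.
have B2 : 0 <= 2 * (Bd y * Bd e) by apply: mulr_ge0 => //; exact: (mulr_ge0 (ltW by0) (ltW be0)).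
rewrite -(@ler_pXn2r _ 2) ?nnegrE//.
have b20 : 0 < bb s ^+ 2 by exact: exprn_gt0.
have -> : `|Ef s y e| ^+ 2 = (Js s y ^+ 2 * Js s e ^+ 2) / bb s ^+ 2.
  by rewrite real_normK ?num_real// /Ef expr_div_n exprMn.
rewrite ler_pdivrMr//.
have -> : (2 * (Bd y * Bd e)) ^+ 2 * bb s ^+ 2 = (2 * bb s * Bd y ^+ 2) * (2 * bb s * Bd e ^+ 2) by ring.
by apply: ler_pM; rewrite ?sqr_ge0.
Qed.

End regular_solution.

(** * Cosine transforms *)

Section poisson.
Variable R : realType.
Local Notation mu := (@lebesgue_measure R).
Implicit Types (x t k s a b : R).

Lemma dsqr_gt0 a x : 0 < a -> 0 < a ^+ 2 + x ^+ 2.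
Proof. by move=> a0; rewrite ltr_pwDl ?exprn_gt0// sqr_ge0. Qed.

Lemma expN_le1 a x : 0 <= a -> 0 <= x -> expR (- (a * x)) <= 1.
Proof. by move=> a0 x0; rewrite -[leRHS]expR0 ler_expR oppr_le0 mulr_ge0. Qed.

Lemma integrable_expcos a x : 0 < a ->
  mu.-integrable `[0, +oo[ (EFin \o (fun k : R => expR (- (a * k)) * cos (k * x))).
Proof.
move=> a0; apply: (@integrable_dom _ _ _ mu _ _ (fun k => expR (- (a * k)))) => //.
- by apply: continuous_measurableT => // t; cts.
- by move=> k _; rewrite normrM (gtr0_norm (expR_gt0 _)) ler_piMr ?expR_ge0// cos_bd.
- exact: integrable_expRN.
Qed.

Lemma Rintegral_expcos a x : 0 < a ->
  Rintegral mu `[0, +oo[ (fun k => expR (- (a * k)) * cos (k * x)) = a / (a ^+ 2 + x ^+ 2).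
Proof.
move=> a0; have n0 : a ^+ 2 + x ^+ 2 != 0 by rewrite gt_eqF// dsqr_gt0.
pose F k := expR (- (a * k)) * ((x * sin (k * x) - a * cos (k * x)) / (a ^+ 2 + x ^+ 2)).
have -> : a / (a ^+ 2 + x ^+ 2) = 0 - F 0.
  by rewrite /F mul0r sin0 cos0 mulr0 oppr0 expR0; field.
apply: (@Rintegral_FTCy R 0 0 F).
- move=> k _; rewrite /F; der => //=; field; exact: n0.
- by move=> k _; cts.
- exact: integrable_expcos.
- have h := cvg_expRN_pinfty a0.
  have h2 : expR (- (a * k)) * ((`|x| + a) / (a ^+ 2 + x ^+ 2)) @[k --> +oo] --> (0 : R).
    by rewrite -[X in _ --> X](mul0r ((`|x| + a) / (a ^+ 2 + x ^+ 2))); apply: cvgM => //; exact: cvg_cst.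
  apply/norm_cvg0P; apply: (squeeze_cvgr _ (@cvgy_cst R 0) h2); near=> k.
  rewrite normr_ge0 /= /F normrM (gtr0_norm (expR_gt0 _)) ler_pM2l ?expR_gt0//.
  rewrite normrM normfV (gtr0_norm (dsqr_gt0 x a0)) ler_pM2r ?invr_gt0 ?dsqr_gt0//.
  apply: le_trans (ler_normB _ _) _; apply: lerD; rewrite normrM.
    by rewrite ler_piMr// sin_bd.
  by rewrite (gtr0_norm a0) ler_piMr ?(ltW a0)// cos_bd.
Unshelve. all: by end_near. Qed.

Lemma integrable_cauchy_scale a : 0 < a ->
  mu.-integrable `[0, +oo[ (EFin \o (fun k : R => (a ^+ 2 + k ^+ 2)^-1)).
Proof.
move=> a0; have m0 : 0 < Num.min 1 (a ^+ 2) by rewrite lt_min ltr01 exprn_gt0.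
apply: (@integrable_dom _ _ _ mu _ _ (fun r : R => (Num.min 1 (a ^+ 2))^-1 * (1 + r ^+ 2)^-1)) => //.
- by apply: continuous_measurableT => // t; cts; rewrite gt_eqF// dsqr_gt0.
- move=> r _; rewrite gtr0_norm ?invr_gt0 ?dsqr_gt0// -invfM.
  have r2 : 0 <= r ^+ 2 := sqr_ge0 r.
  rewrite lef_pV2 ?posrE ?dsqr_gt0 ?mulr_gt0//; last by lra.
  rewrite mulrDr mulr1 lerD//; first by rewrite ge_min lexx orbT.
  by rewrite ler_piMl// ge_min lexx.
- by apply: integrable_scale => //; exact: integrable_invDsqr.
Qed.

(** The Poisson kernel of the half plane without its factor [1 / pi]: total mass [pi]. *)
Definition Pk a x : R := a / (a ^+ 2 + x ^+ 2).

Lemma Pk_gt0 a x : 0 < a -> 0 < Pk a x.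
Proof. by move=> a0; rewrite divr_gt0// dsqr_gt0. Qed.

Lemma cts_Pk a x t : 0 < a -> {for t, continuous (fun t => Pk a (t - x))}.
Proof. by move=> a0; rewrite /Pk; cts; rewrite gt_eqF// dsqr_gt0. Qed.

Lemma der_Pk a x t : 0 < a -> is_derive t 1 (fun t => atan ((t - x) / a)) (Pk a (t - x)).
Proof.
move=> a0; have n0 : a != 0 by rewrite gt_eqF.
have d : is_derive t 1 (fun t => (t - x) / a) a^-1 by der; rewrite /=; ring.
have d2 := @is_derive1_atan R ((t - x) / a).
apply: (der_eq (@der_comp R (@atan R) (fun t => (t - x) / a) t _ _ d2 d)); rewrite /Pk; field.
by rewrite n0 /= gt_eqF ?dsqr_gt0.
Qed.

Lemma Rintegral_Pk a x u v : 0 < a -> u <= v ->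
  Rintegral mu `[u, v] (fun t => Pk a (t - x)) = atan ((v - x) / a) - atan ((u - x) / a).
Proof.
move=> a0 uv; apply: (@Rintegral_FTC R u v (fun t => atan ((t - x) / a))) => //.
- by move=> t _; exact: der_Pk.
- by move=> t _; exact: cts_Pk.
Qed.

Lemma atan_scale_cvg c : 0 < c -> atan (c / a) @[a --> 0^'+] --> (pi / 2 : R).
Proof.
move=> c0; apply: (cvg_comp (fun a => c / a) (@atan R) _ (@cvgy_atan R)).
apply/cvgryPge => M; near=> a.
have a0 : 0 < a by near: a; exact: nbhs_right_gt.
have M1 : 0 < `|M| + 1 by rewrite ltr_wpDl.
have ac : a <= c / (`|M| + 1) by near: a; apply: nbhs_right_le; rewrite divr_gt0.
rewrite ler_pdivlMr// in ac; rewrite ler_pdivlMr//; apply: le_trans ac.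
by have := ler_norm M; nra.
Unshelve. all: by end_near. Qed.

Lemma integrable_Pk a x : 0 < a -> mu.-integrable `[0, +oo[ (EFin \o (fun t => Pk a (t - x))).
Proof.
(* Chosen so that [1 + t^2 <= C (a^2 + (t - x)^2)], from [t^2 <= 2 (t - x)^2 + 2 x^2]. *)
move=> a0; pose C := 2 + (1 + 2 * x ^+ 2) / a ^+ 2.
have a2 : 0 < a ^+ 2 by rewrite exprn_gt0.
have x2 := sqr_ge0 x.
apply: (@integrable_dom _ _ _ mu _ _ (fun t : R => (a * C) * (1 + t ^+ 2)^-1)) => //.
- by apply: continuous_measurableT => // t; exact: cts_Pk.
- move=> t _; rewrite gtr0_norm ?Pk_gt0// /Pk -mulrA ler_pM2l//.
  have t2 := sqr_ge0 t; have d := dsqr_gt0 (t - x) a0.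
  rewrite -[leLHS]mul1r ler_pdivrMr// mulrAC ler_pdivlMr ?mul1r; last by lra.
  have u2 := sqr_ge0 (t - x); have v2 := sqr_ge0 (t - 2 * x).
  have -> : C * (a ^+ 2 + (t - x) ^+ 2) = 2 * a ^+ 2 + (1 + 2 * x ^+ 2) + C * (t - x) ^+ 2.
    by rewrite /C; field; rewrite gt_eqF.
  have h : 2 * (t - x) ^+ 2 <= C * (t - x) ^+ 2.
    by rewrite ler_wpM2r// /C lerDl divr_ge0// ?(ltW a2)//; lra.
  nra.
- by apply: integrable_scale => //; exact: integrable_invDsqr.
Qed.

Lemma Rintegral_Pk_half a x : 0 < a ->
  Rintegral mu `[0, +oo[ (fun t => Pk a (t - x)) = pi / 2 + atan (x / a).
Proof.
move=> a0; have -> : pi / 2 + atan (x / a) = pi / 2 - atan ((0 - x) / a).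
  by rewrite sub0r mulNr atanN opprK.
apply: (@Rintegral_FTCy R 0 (pi / 2) (fun t => atan ((t - x) / a))).
- by move=> t _; exact: der_Pk.
- by move=> t _; exact: cts_Pk.
- exact: integrable_Pk.
- apply: (cvg_comp (fun t => (t - x) / a) (@atan R) _ (@cvgy_atan R)).
  apply/cvgryPge => M; near=> t; rewrite ler_pdivlMr// lerBrDr.
  by near: t; apply: nbhs_pinfty_ge; exact: num_real.
Unshelve. all: by end_near. Qed.

(** Away from its centre the kernel is [a] times a fixed integrable function, so the far part of a
    Poisson integral vanishes with [a]. *)
Lemma Pk_far a u d : 0 < a -> 0 < d -> d <= `|u| -> Pk a u <= a * (1 + d ^- 2) * Pk 1 u.
Proof.
move=> a0 d0 du; have d2 : 0 < d ^+ 2 by rewrite exprn_gt0.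
have u2 : d ^+ 2 <= u ^+ 2 by rewrite -[leRHS]real_normK ?num_real//; apply: lerXn2r; rewrite ?nnegrE// ltW.
have up : 0 < u ^+ 2 by exact: lt_le_trans u2.
rewrite /Pk -!mulrA ler_pM2l// expr1n mul1r.
apply: (@le_trans _ _ (u ^+ 2)^-1).
  by rewrite lef_pV2 ?posrE ?dsqr_gt0// lerDr sqr_ge0.
rewrite -[leLHS]mul1r ler_pdivrMr// mulrAC ler_pdivlMr ?mul1r; last by lra.
have -> : (1 + d ^- 2) * u ^+ 2 = u ^+ 2 + u ^+ 2 / d ^+ 2 by ring.
by rewrite addrC lerD2l ler_pdivlMr// mul1r.
Qed.

Lemma Pk_approx (f : R -> R) (M x : R) : 0 < x -> (forall t, 0 <= t -> {for t, continuous f}) ->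
  (forall t, 0 <= t -> `|f t| <= M) ->
  mu.-integrable `[0, +oo[ (EFin \o f) ->
  Rintegral mu `[0, +oo[ (fun t => f t * Pk a (t - x)) @[a --> 0^'+] --> pi * f x.
Proof.
move=> x0 cf fM iF.
have M0 : 0 <= M by exact: le_trans (fM 0 (lexx 0)).
have cP a : 0 < a -> forall t, {for t, continuous (fun t => Pk a (t - x))} by move=> a0 t; exact: cts_Pk.
have mf : measurable_fun (`[0, +oo[%classic : set R) f by apply/measurable_EFinP; exact: (measurable_int mu iF).
have iD a (c : R) : 0 < a -> mu.-integrable `[0, +oo[ (EFin \o (fun t => (f t - c) * Pk a (t - x))).
  move=> a0; apply: (@integrable_dom _ _ _ mu _ _ (fun t => (M + `|c|) * Pk a (t - x))) => //.
  - apply: measurable_funM; first by apply: measurable_funB.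
    by apply: continuous_measurableT => //; exact: cP.
  - move=> t; rewrite /= in_itv/= andbT => t0; rewrite normrM (gtr0_norm (Pk_gt0 _ a0)).
    rewrite ler_pM2r ?Pk_gt0//; apply: le_trans (ler_normB _ _) _; rewrite lerD2r; exact: fM.
  - by apply: integrable_scale => //; exact: integrable_Pk.
pose D a := Rintegral mu `[0, +oo[ (fun t => (f t - f x) * Pk a (t - x)).
have eD a : 0 < a -> Rintegral mu `[0, +oo[ (fun t => f t * Pk a (t - x)) = D a + f x * (pi / 2 + atan (x / a)).
  move=> a0; rewrite -(Rintegral_Pk_half x a0) -RintegralZl//; last exact: integrable_Pk.
  rewrite /D -RintegralD//; [|exact: iD|by apply: integrable_scale => //; exact: integrable_Pk].
  by apply: eq_Rintegral => t _; ring.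
have D0 : D a @[a --> 0^'+] --> (0 : R).
  apply/cvgrPdist_le => e e0.
  have cfx : {for x, continuous f} by apply: cf; exact: ltW.
  have e3 : 0 < e / 8 by lra.
  move/(@cvgrPdist_le _ _ _ _ _ _ _) : cfx => /(_ _ e3) [d /= d0 dP].
  pose d1 := d / 2.
  have d10 : 0 < d1 by rewrite /d1; lra.
  pose c := 2 * M * (1 + d1 ^- 2).
  have c0 : 0 <= c by rewrite !mulr_ge0// addr_ge0// invr_ge0 exprn_ge0// ltW.
  near=> a.
  have a0 : 0 < a by near: a; exact: nbhs_right_gt.
  have ca : a * (c + 1) <= e / 8.
    have : a <= e / 8 / (c + 1) by near: a; apply: nbhs_right_le; rewrite divr_gt0//; lra.
    by rewrite ler_pdivlMr//; lra.
  rewrite sub0r normrN /D.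
  have i1 := integrable_Pk x a0; have i2 := integrable_Pk x (@ltr01 R).
  have pi4 : pi <= 4 :> R by have := @pihalf_02 R; lra.
  apply: (@le_trans _ _ (Rintegral mu `[0, +oo[ (fun t => (e / 8) * Pk a (t - x) + (a * c) * Pk 1 (t - x)))).
    apply: normr_Rintegral_le => //; [exact: iD|by intg|].
    move=> t; rewrite /= in_itv/= andbT => t0; rewrite normrM (gtr0_norm (Pk_gt0 _ a0)).
    have p0 := Pk_gt0 (t - x) a0; have p1 := Pk_gt0 (t - x) (@ltr01 R).
    have [tx|tx] := ltP `|t - x| d.
      have h : `|f t - f x| <= e / 8 by rewrite distrC; apply: dP; rewrite /= distrC.
      apply: (@le_trans _ _ (e / 8 * Pk a (t - x))); first by rewrite ler_pM2r.
      by rewrite lerDl; exact: (mulr_ge0 (mulr_ge0 (ltW a0) c0) (ltW p1)).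
    have h : `|f t - f x| <= 2 * M.
      by apply: le_trans (ler_normB _ _) _; have := fM t t0; have := fM x (ltW x0); lra.
    have dd : d1 <= `|t - x| by rewrite /d1; lra.
    have h2 := Pk_far a0 d10 dd.
    apply: (@le_trans _ _ (2 * M * Pk a (t - x))); first by rewrite ler_pM2r.
    apply: (@le_trans _ _ (a * c * Pk 1 (t - x))); last by rewrite lerDr mulr_ge0//; lra.
    by apply: le_trans (ler_wpM2l _ h2) _; [rewrite mulr_ge0|rewrite /c; lra].
  rewrite Rintegral_lin2// !Rintegral_Pk_half//.
  have b1 : atan (x / a) <= 2 by have := atan_ltpi2 (x / a); lra.
  have b2 : atan (x / 1) <= 2 by have := atan_ltpi2 (x / 1); lra.
  have a2 : 0 <= a * c by rewrite mulr_ge0// ltW.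
  have k1 : e / 8 * (pi / 2 + atan (x / a)) <= e / 8 * 4 by rewrite ler_pM2l//; lra.
  have k2 : a * c * (pi / 2 + atan (x / 1)) <= a * c * 4 by rewrite ler_wpM2l//; lra.
  lra.
have lim : D a + f x * (pi / 2 + atan (x / a)) @[a --> 0^'+] --> 0 + f x * (pi / 2 + pi / 2).
  apply: cvgD => //; apply: cvgM; first exact: cvg_cst.
  by apply: cvgD; [exact: cvg_cst|exact: atan_scale_cvg].
have -> : pi * f x = 0 + f x * (pi / 2 + pi / 2) by lra.
apply: cvg_trans lim; apply: near_eq_cvg; near=> a.
rewrite eD//; near: a; exact: nbhs_right_gt.
Unshelve. all: by end_near. Qed.

(** Abel regularisation: [a / (a^2 + s^2)] is the cosine transform of [e^(-a t)]. With the factor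
    [e^(-d s)], Fubini gives half the Poisson integrals of [e^(-a t)] centred at [x] and at [- x];
    as [d -> 0] the first tends to [pi e^(-a x)] and the second to 0. *)
Lemma cos_transform_pos a x : 0 < a -> 0 < x ->
  Rintegral mu `[0, +oo[ (fun s => cos (s * x) / (a ^+ 2 + s ^+ 2)) = pi / (2 * a) * expR (- (a * x)).
Proof.
move=> a0 x0; have n0 : a != 0 by rewrite gt_eqF.
pose e t := expR (- (a * t)).
have ie : mu.-integrable `[0, +oo[ (EFin \o e) by exact: integrable_expRN.
have ce t : {for t, continuous e} by rewrite /e; cts.
have be t : 0 <= t -> `|e t| <= 1 by move=> t0; rewrite gtr0_norm ?expR_gt0// expN_le1// ltW.
have h1 := Pk_approx x0 (fun t _ => ce t) be ie.
have key d : 0 < d ->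
  Rintegral mu `[0, +oo[ (fun s => expR (- (d * s)) * cos (s * x) * (a / (a ^+ 2 + s ^+ 2))) =
  1 / 2 * Rintegral mu `[0, +oo[ (fun t => e t * Pk d (t - x)) + 1 / 2 * Rintegral mu `[0, +oo[ (fun t => e t * Pk d (t + x)).
  move=> d0.
  have i1 : mu.-integrable `[0, +oo[ (EFin \o (fun t => e t * Pk d (t - x))).
    apply: (@integrable_dom _ _ _ mu _ _ (fun t => 1 * Pk d (t - x))) => //.
    - by apply: continuous_measurableT => // t; have c := @cts_Pk d x t d0; cts.
    - move=> t; rewrite /= in_itv/= andbT => t0; rewrite normrM (gtr0_norm (Pk_gt0 _ d0)) ler_pM2r ?Pk_gt0//; exact: be.
    - by apply: integrable_scale => //; exact: integrable_Pk.
  have i2 : mu.-integrable `[0, +oo[ (EFin \o (fun t => e t * Pk d (t + x))).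
    apply: (@integrable_dom _ _ _ mu _ _ (fun t => 1 * Pk d (t - - x))) => //.
    - by apply: continuous_measurableT => // t; have c := @cts_Pk d (- x) t d0; rewrite opprK in c; cts.
    - move=> t; rewrite /= in_itv/= andbT opprK => t0; rewrite normrM (gtr0_norm (Pk_gt0 _ d0)) ler_pM2r ?Pk_gt0//; exact: be.
    - by apply: integrable_scale => //; exact: integrable_Pk.
  rewrite -Rintegral_lin2//.
  transitivity (Rintegral mu `[0, +oo[ (fun s => Rintegral mu `[0, +oo[ (fun t => expR (- (d * s)) * cos (s * x) * (e t * cos (t * s))))).
    apply: eq_Rintegral => s _; rewrite RintegralZl//; last exact: integrable_expcos.
    by rewrite Rintegral_expcos.
  rewrite (@Rintegral_fubini _ _ _ _ R mu mu `[0, +oo[ `[0, +oo[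
    (fun s t => expR (- (d * s)) * cos (s * x) * (e t * cos (t * s)))
    (fun s => expR (- (d * s))) e)//; last 3 first.
  - apply: measurable_funM.
      have m1 : measurable_fun (setT : set R) (fun s => expR (- (d * s)) * cos (s * x)) by apply: continuous_measurableT => // t; cts.
      exact: (measurableT_comp m1 (measurable_funTS measurable_fst)).
    apply: measurable_funM.
      have m1 : measurable_fun (setT : set R) e by apply: continuous_measurableT.
      exact: (measurableT_comp m1 (measurable_funTS measurable_snd)).
    have m1 : measurable_fun (setT : set R) (@cos R) by apply: continuous_measurableT => // t; exact: continuous_cos.
    apply: (measurableT_comp m1); apply: measurable_funM; first exact: (measurable_funTS measurable_snd).
    exact: (measurable_funTS measurable_fst).
  - exact: integrable_expRN.
  - move=> s t _ _; rewrite !normrM !(gtr0_norm (expR_gt0 _)) -mulrA ler_pM2l ?expR_gt0//.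
    rewrite mulrCA ler_piMr ?expR_ge0//; apply: mulr_ile1 => //; exact: cos_bd.
  apply: eq_Rintegral => t; rewrite inE/= in_itv/= andbT => t0.
  have i3 := integrable_expcos (t - x) d0; have i4 := integrable_expcos (t + x) d0.
  transitivity (Rintegral mu `[0, +oo[ (fun s => (e t / 2) * (expR (- (d * s)) * cos (s * (t - x))) + (e t / 2) * (expR (- (d * s)) * cos (s * (t + x))))).
    by apply: eq_Rintegral => s _; rewrite mulrBr mulrDr cosB cosD [t * s]mulrC; field.
  rewrite Rintegral_lin2// !Rintegral_expcos// /Pk; ring.
have l1 : Rintegral mu `[0, +oo[ (fun t => e t * Pk d (t + x)) @[d --> 0^'+] --> (0 : R).
  have ha : d * (x ^- 2 * a^-1) @[d --> 0^'+] --> (0 : R).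
    rewrite -[X in _ --> X](mul0r (x ^- 2 * a^-1)); apply: cvgM; last exact: cvg_cst.
    by apply: cvg_at_right_filter; exact: cvg_id.
  apply/norm_cvg0P; apply: (@squeeze_cvgr _ _ _ _ (fun=> 0) (fun d => d * (x ^- 2 * a^-1))) => //; last exact: cvg_cst.
  near=> d; have d0 : 0 < d by near: d; exact: nbhs_right_gt.
  rewrite normr_ge0 /=.
  have -> : d * (x ^- 2 * a^-1) = Rintegral mu `[0, +oo[ (fun t => (d * x ^- 2) * e t).
    rewrite RintegralZl// mulrA; congr (_ * _).
    by rewrite /Rintegral integral_expRN.
  apply: normr_Rintegral_le => //; last first.
  - move=> t; rewrite /= in_itv/= andbT => t0.
    rewrite normrM (gtr0_norm (expR_gt0 _)) (gtr0_norm (Pk_gt0 _ d0)) [leRHS]mulrC ler_pM2l ?expR_gt0//.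
    rewrite /Pk ler_pM2l// lef_pV2 ?posrE ?dsqr_gt0 ?exprn_gt0//.
    have := sqr_ge0 d; nra.
  - by apply: integrable_scale.
  - apply: (@integrable_dom _ _ _ mu _ _ (fun t => (d * x ^- 2) * e t)) => //.
    + by apply: continuous_measurableT => // t; have c := @cts_Pk d (- x) t d0; rewrite opprK in c; cts.
    + move=> t; rewrite /= in_itv/= andbT => t0.
      rewrite normrM (gtr0_norm (expR_gt0 _)) (gtr0_norm (Pk_gt0 _ d0)) [leRHS]mulrC ler_pM2l ?expR_gt0//.
      rewrite /Pk ler_pM2l// lef_pV2 ?posrE ?dsqr_gt0 ?exprn_gt0//.
      have := sqr_ge0 d; nra.
    + by apply: integrable_scale.
have L : Rintegral mu `[0, +oo[ (fun s => expR (- (d * s)) * cos (s * x) * (a / (a ^+ 2 + s ^+ 2))) @[d --> 0^'+] -->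
  1 / 2 * (pi * e x) + 1 / 2 * 0.
  have lim : 1 / 2 * Rintegral mu `[0, +oo[ (fun t => e t * Pk d (t - x)) + 1 / 2 * Rintegral mu `[0, +oo[ (fun t => e t * Pk d (t + x))
     @[d --> 0^'+] --> 1 / 2 * (pi * e x) + 1 / 2 * 0.
    by apply: cvgD; apply: cvgM => //; exact: cvg_cst.
  apply: cvg_trans lim; apply: near_eq_cvg; near=> d.
  have d0 : 0 < d by near: d; exact: nbhs_right_gt.
  by rewrite key.
have ia := integrable_cauchy_scale a0.
have [||||||_ L2] := @dominated_cvg_at_right _ _ R mu `[0, +oo[
  (fun d s => expR (- (d * s)) * cos (s * x) * (a / (a ^+ 2 + s ^+ 2)))
  (fun s => cos (s * x) * (a / (a ^+ 2 + s ^+ 2))) (fun s => a * (a ^+ 2 + s ^+ 2)^-1) 0 1.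
- exact: ltr01.
- by [].
- by move=> d _; apply: continuous_measurableT => // t; cts; rewrite gt_eqF// dsqr_gt0.
- move=> s _; rewrite -[X in _ --> X]mul1r.
  have -> : (fun d => expR (- (d * s)) * cos (s * x) * (a / (a ^+ 2 + s ^+ 2))) = (fun d => expR (- (d * s)) * (cos (s * x) * (a / (a ^+ 2 + s ^+ 2)))).
    by apply/funext => d; ring.
  apply: cvgM; last exact: cvg_cst.
  have -> : 1 = expR (- (0 * s)) :> R by rewrite mul0r oppr0 expR0.
  apply: cvg_at_right_filter; have : {for 0, continuous (fun d : R => expR (- (d * s)))} by cts.
  exact.
- move=> d s /andP[d0 _]; rewrite /= in_itv/= andbT => s0.
  rewrite !normrM normfV (gtr0_norm (expR_gt0 _)) (gtr0_norm a0) (gtr0_norm (dsqr_gt0 _ a0)).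
  rewrite ler_piMl ?mulr_ge0 ?invr_ge0 ?(ltW (dsqr_gt0 _ a0)) ?(ltW a0)//.
  apply: mulr_ile1 => //; [apply: expN_le1 => //; exact: ltW|exact: cos_bd].
- by apply: integrable_scale.
have E : Rintegral mu `[0, +oo[ (fun s => cos (s * x) * (a / (a ^+ 2 + s ^+ 2))) = 1 / 2 * (pi * e x) + 1 / 2 * 0.
  exact: (cvg_unique _ L2 L).
have E2 : Rintegral mu `[0, +oo[ (fun s => cos (s * x) * (a / (a ^+ 2 + s ^+ 2))) =
  a * Rintegral mu `[0, +oo[ (fun s => cos (s * x) / (a ^+ 2 + s ^+ 2)).
  rewrite -RintegralZl//; first by apply: eq_Rintegral => s _; ring.
  apply: (@integrable_dom _ _ _ mu _ _ (fun s => (a ^+ 2 + s ^+ 2)^-1)) => //.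
  - by apply: continuous_measurableT => // t; cts; rewrite gt_eqF// dsqr_gt0.
  - by move=> s _; rewrite normrM normfV (gtr0_norm (dsqr_gt0 _ a0)) ler_piMl ?cos_bd// invr_ge0 ltW// dsqr_gt0.
apply: (mulfI n0); rewrite -E2 E -/(e x); move: (pi : R) => q; field; exact: n0.
Unshelve. all: by end_near. Qed.

Lemma Rintegral_cauchy a : 0 < a ->
  Rintegral mu `[0, +oo[ (fun s => (a ^+ 2 + s ^+ 2)^-1) = pi / (2 * a).
Proof.
move=> a0; have n0 : a != 0 by rewrite gt_eqF.
have i := integrable_Pk 0 a0; have e := Rintegral_Pk_half 0 a0.
rewrite mul0r atan0 addr0 in e.
apply: (mulfI n0); rewrite -RintegralZl//; last exact: integrable_cauchy_scale.
transitivity (pi / 2 : R); last by move: (pi : R) => q; field.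
by rewrite -e; apply: eq_Rintegral => s _; rewrite /Pk subr0.
Qed.

Lemma cos_transform a x : 0 < a -> 0 <= x ->
  Rintegral mu `[0, +oo[ (fun s => cos (s * x) / (a ^+ 2 + s ^+ 2)) = pi / (2 * a) * expR (- (a * x)).
Proof.
move=> a0; rewrite le_eqVlt => /predU1P[<-|x0]; last exact: cos_transform_pos.
rewrite mulr0 oppr0 expR0 mulr1 -Rintegral_cauchy//; apply: eq_Rintegral => s _.
by rewrite mulr0 cos0 mul1r.
Qed.

Lemma integrable_cos_cauchy a x : 0 < a ->
  mu.-integrable `[0, +oo[ (EFin \o (fun s => cos (s * x) / (a ^+ 2 + s ^+ 2))).
Proof.
move=> a0; apply: (@integrable_dom _ _ _ mu _ _ (fun s => (a ^+ 2 + s ^+ 2)^-1)) => //.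
- by apply: continuous_measurableT => // t; cts; rewrite gt_eqF// dsqr_gt0.
- by move=> s _; rewrite normrM normfV (gtr0_norm (dsqr_gt0 _ a0)) ler_piMl ?cos_bd// invr_ge0 ltW// dsqr_gt0.
- exact: integrable_cauchy_scale.
Qed.

(** At [a = 1/2] the first denominator comes from the factor [4 s / (1 + 4 s^2)] of [Ef_pq]; the
    second, with [b = kap], is the resolvent. *)
Definition wgt a b s : R := s / ((a ^+ 2 + s ^+ 2) * (b ^+ 2 + s ^+ 2)).

(** The weight can pay for one factor [|s| + 1], the growth of a single derivative [p1] or [q1], and
    still be dominated by an integrable function. *)
Lemma wgt_sqr_le a b s : 0 < a -> 0 < b -> (`|s| + 1) * `|wgt a b s| <= (1 + a^-1) * (b ^+ 2 + s ^+ 2)^-1.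
Proof.
move=> a0 b0; have da := dsqr_gt0 s a0; have db := dsqr_gt0 s b0.
have n0 : a != 0 by rewrite gt_eqF.
have -> : `|wgt a b s| = `|s| / (a ^+ 2 + s ^+ 2) * (b ^+ 2 + s ^+ 2)^-1.
  by rewrite /wgt normrM normfV (gtr0_norm (mulr_gt0 da db)) invfM mulrA.
rewrite mulrA ler_pM2r ?invr_gt0// mulrA ler_pdivrMr//.
have e : s ^+ 2 = `|s| ^+ 2 by rewrite real_normK ?num_real.
rewrite e; have s0 := normr_ge0 s; set t := `|s| in s0 *.
have -> : (1 + a^-1) * (a ^+ 2 + t ^+ 2) = (t + 1) * t + (a ^+ 2 + a + t * (t / a - 1)) by field.
rewrite lerDl.
have -> : a ^+ 2 + a + t * (t / a - 1) = a ^+ 2 + ((t - a / 2) ^+ 2 + 3 / 4 * a ^+ 2) / a by field.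
have := sqr_ge0 (t - a / 2); have := sqr_ge0 a => h1 h2.
by rewrite addr_ge0// divr_ge0 ?(ltW a0)//; lra.
Qed.

Lemma cts_wgt a b s : 0 < a -> 0 < b -> {for s, continuous (wgt a b)}.
Proof.
move=> a0 b0; rewrite /wgt; cts.
by rewrite gt_eqF// mulr_gt0// dsqr_gt0.
Qed.

Lemma integrable_wgt a b (f : R -> R) (M : R) : 0 < a -> 0 < b -> measurable_fun (`[0, +oo[%classic : set R) f ->
  (forall s, 0 <= s -> `|f s| <= M * (s + 1)) ->
  mu.-integrable `[0, +oo[ (EFin \o (fun s => wgt a b s * f s)).
Proof.
move=> a0 b0 mf fM.
have M0 : 0 <= M by have := le_trans (normr_ge0 _) (fM 0 (lexx 0)); rewrite add0r mulr1.
apply: (@integrable_dom _ _ _ mu _ _ (fun s => (M * (1 + a^-1)) * (b ^+ 2 + s ^+ 2)^-1)) => //.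
- by apply: measurable_funM => //; apply: continuous_measurableT => // t; exact: cts_wgt.
- move=> s; rewrite /= in_itv/= andbT => s0; rewrite normrM.
  apply: (@le_trans _ _ (`|wgt a b s| * (M * (s + 1)))); first by rewrite ler_wpM2l// fM.
  have := wgt_sqr_le s a0 b0; rewrite (ger0_norm s0) => h.
  by rewrite mulrCA -[leRHS]mulrA; apply: ler_wpM2l => //; rewrite mulrC.
- by apply: integrable_scale => //; exact: integrable_cauchy_scale.
Qed.

(** Minus the derivative in [x] of the cosine transform of [1 / ((a^2 + s^2) (b^2 + s^2))], which
    partial fractions reduce to [cos_transform]. *)
Lemma sin_transform a b x : 0 < a -> 0 < b -> a != b -> 0 <= x ->
  Rintegral mu `[0, +oo[ (fun s => wgt a b s * sin (s * x)) =
  pi / (2 * (b ^+ 2 - a ^+ 2)) * (expR (- (a * x)) - expR (- (b * x))).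
Proof.
move=> a0 b0 ab; have na : a != 0 by rewrite gt_eqF.
have nb : b != 0 by rewrite gt_eqF.
have nab : b ^+ 2 - a ^+ 2 != 0.
  rewrite subr_sqr mulf_neq0//; first by rewrite subr_eq0 eq_sym.
  by rewrite gt_eqF// addr_gt0.
rewrite le_eqVlt => /predU1P[<-|x0].
  rewrite !mulr0 subrr mulr0; under eq_Rintegral do rewrite mulr0 sin0 mulr0.
  by rewrite Rintegral_cst// mul0r.
pose Q s := ((a ^+ 2 + s ^+ 2) * (b ^+ 2 + s ^+ 2))^-1.
pose F t := pi / (2 * (b ^+ 2 - a ^+ 2)) * (a^-1 * expR (- (a * t)) - b^-1 * expR (- (b * t))).
have eF t : 0 < t -> Rintegral mu `[0, +oo[ (fun s => Q s * cos (s * t)) = F t.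
  move=> t0.
  have ia := integrable_cos_cauchy t a0; have ib := integrable_cos_cauchy t b0.
  transitivity (Rintegral mu `[0, +oo[ (fun s => (b ^+ 2 - a ^+ 2)^-1 * (cos (s * t) / (a ^+ 2 + s ^+ 2)) +
     (- (b ^+ 2 - a ^+ 2)^-1) * (cos (s * t) / (b ^+ 2 + s ^+ 2)))).
    apply: eq_Rintegral => s _; rewrite /Q; field.
    by rewrite nab !gt_eqF ?dsqr_gt0.
  rewrite Rintegral_lin2// !cos_transform// ?(ltW t0)// /F; move: (pi : R) => q; field.
  by rewrite na nb nab.
have d1 : is_derive x 1 F (- (pi / (2 * (b ^+ 2 - a ^+ 2)) * (expR (- (a * x)) - expR (- (b * x))))).
  rewrite /F; der => //=; move: (pi : R) => q; field; by rewrite na nb nab.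
have sinint t : mu.-integrable `[0, +oo[ (EFin \o (fun s => wgt a b s * sin (s * t))).
  apply: (@integrable_wgt _ _ _ 1) => //.
  - by apply: continuous_measurableT => // s; cts.
  - by move=> s s0; rewrite mul1r; apply: le_trans (sin_bd _) _; lra.
have Q0 s : 0 < Q s by rewrite invr_gt0 mulr_gt0// dsqr_gt0.
have d2 : is_derive x 1 (fun t => Rintegral mu `[0, +oo[ (fun s => Q s * cos (s * t)))
   (Rintegral mu `[0, +oo[ (fun s => - (wgt a b s * sin (s * x)))).
  apply: (@der_under_integral _ _ R mu `[0, +oo[ (fun t s => Q s * cos (s * t))
    (fun t s => - (wgt a b s * sin (s * t))) (fun s => (1 + a^-1) * (b ^+ 2 + s ^+ 2)^-1) x (x - 1) (x + 1)) => //.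
  - lra.
  - move=> t _; apply: (@integrable_dom _ _ _ mu _ _ (fun s => a ^- 2 * (b ^+ 2 + s ^+ 2)^-1)) => //.
    + apply: continuous_measurableT => // s; rewrite /Q; cts.
      by rewrite gt_eqF// mulr_gt0// dsqr_gt0.
    + move=> s _; rewrite normrM (gtr0_norm (Q0 s)).
      apply: (@le_trans _ _ (Q s)); first by rewrite ler_piMr ?cos_bd// ltW.
      rewrite /Q invfM ler_pM2r ?invr_gt0 ?dsqr_gt0// lef_pV2 ?posrE ?dsqr_gt0 ?exprn_gt0//.
      by rewrite lerDl sqr_ge0.
    + by apply: integrable_scale => //; exact: integrable_cauchy_scale.
  - move=> t s _ _; der; rewrite /= /Q /wgt; ring.
  - by apply: integrable_scale => //; exact: integrable_cauchy_scale.
  - move=> t s _ _; rewrite normrN normrM; apply: le_trans (wgt_sqr_le s a0 b0).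
    apply: (@le_trans _ _ `|wgt a b s|); first by rewrite ler_piMr// sin_bd.
    by rewrite ler_peMl//; have := normr_ge0 s; lra.
have e2 : Rintegral mu `[0, +oo[ (fun s => - (wgt a b s * sin (s * x))) =
  - (pi / (2 * (b ^+ 2 - a ^+ 2)) * (expR (- (a * x)) - expR (- (b * x)))).
  have [_ <-] := d1; have [_ <-] := d2.
  apply: (@near_eq_derive _ _ _ _ F); near=> t; apply: eF; near: t; exact: lt_nbhsr.
apply: oppr_inj; rewrite -e2 -mulN1r -RintegralZl//.
by apply: eq_Rintegral => s _; rewrite mulN1r.
Unshelve. all: by end_near. Qed.

(** The product is half the sum of sines of [x + t] and [x - t]. The condition [t <= x] makes both
    arguments nonnegative; it is the source of the ordering [y < e] in the resolvent kernel. *)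
Lemma cossin_transform a b t x : 0 < a -> 0 < b -> a != b -> 0 <= t <= x ->
  Rintegral mu `[0, +oo[ (fun s => wgt a b s * (cos (s * t) * sin (s * x))) =
  pi / (2 * (b ^+ 2 - a ^+ 2)) *
  (expR (- (a * x)) * ((expR (a * t) + expR (- (a * t))) / 2) -
   expR (- (b * x)) * ((expR (b * t) + expR (- (b * t))) / 2)).
Proof.
move=> a0 b0 ab /andP[t0 tx].
have nab : b ^+ 2 - a ^+ 2 != 0.
  rewrite subr_sqr mulf_neq0//; first by rewrite subr_eq0 eq_sym.
  by rewrite gt_eqF// addr_gt0.
have si z : mu.-integrable `[0, +oo[ (EFin \o (fun s => wgt a b s * sin (s * z))).
  apply: (@integrable_wgt _ _ _ 1) => //.
  - by apply: continuous_measurableT => // s; cts.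
  - by move=> s s0; rewrite mul1r; apply: le_trans (sin_bd _) _; lra.
transitivity (Rintegral mu `[0, +oo[ (fun s => 1 / 2 * (wgt a b s * sin (s * (x + t))) + 1 / 2 * (wgt a b s * sin (s * (x - t))))).
  by apply: eq_Rintegral => s _; rewrite mulrBr mulrDr sinB sinD; field.
rewrite Rintegral_lin2// !sin_transform//; try lra.
have e (c : R) : expR (- (c * (x + t))) = expR (- (c * x)) * expR (- (c * t)) by rewrite -expRD; congr expR; ring.
have e' (c : R) : expR (- (c * (x - t))) = expR (- (c * x)) * expR (c * t) by rewrite -expRD; congr expR; ring.
by rewrite !e !e'; move: (pi : R) => q; field.
Qed.

End poisson.

(** * The resolvent kernel *)

Section parametric_measurability.
Context d (T : measurableType d) (R : realType).
Local Notation mu := (@lebesgue_measure R).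

(** The integral is the [fine] part of a difference of two Tonelli integrals, each measurable in the
    parameter, finite or not. *)
Lemma measurable_Rintegral (D : set R) (f : T * R -> R) : measurable D -> measurable_fun setT f ->
  measurable_fun setT (fun x => Rintegral mu D (fun r => f (x, r))).
Proof.
move=> mD mf.
pose F (p : T * R) := (f p * \1_D p.2)%:E.
have mF : measurable_fun setT F.
  apply/measurable_EFinP; apply: measurable_funM => //.
  have m1 : measurable_fun (setT : set R) (\1_D : R -> R) by exact: measurable_indic.
  exact: (measurableT_comp m1 measurable_snd).
have -> : (fun x => Rintegral mu D (fun r => f (x, r))) =
  fine \o (fun x => \int[mu]_r (F^\+ (x, r)) - \int[mu]_r (F^\- (x, r)))%E.
  apply/funext => x /=; rewrite Rintegral_mkcond /Rintegral; congr fine.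
  rewrite (_ : (\int[mu]_r _)%E = (\int[mu]_r (F (x, r)))%E); last first.
    apply: eq_integral => r _; rewrite /F /patch indicE.
    by case: ifPn => rD; rewrite ?mulr1 ?mulr0.
  by rewrite integralE; congr (_ - _)%E; apply: eq_integral => r _; rewrite ?funeposE ?funenegE.
apply: (measurableT_comp (fine_measurable (@measurableT _ _))).
apply: emeasurable_funB.
  by apply: (@measurable_fun_fubini_tonelli_F _ _ T _ R mu (F^\+)%E) => //; exact: measurable_funepos.
by apply: (@measurable_fun_fubini_tonelli_F _ _ T _ R mu (F^\-)%E) => //; exact: measurable_funeneg.
Qed.

Lemma measurable_cts1 (g : R -> R) (f : T -> R) : (forall t, {for t, continuous g}) ->
  measurable_fun setT f -> measurable_fun setT (fun p => g (f p)).
Proof.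
move=> cg mf; have m1 : measurable_fun (setT : set R) g by exact: continuous_measurableT.
exact: (measurableT_comp m1 mf).
Qed.

End parametric_measurability.

Lemma cts_hypVn (R : realType) n (v : R) : {for v, continuous (fun v => (hyp v ^+ n)^-1)}.
Proof.
have c := @cts_hyp R; cts.
by rewrite expf_neq0// hyp_neq0.
Qed.

Lemma cts_hypV (R : realType) (v : R) : {for v, continuous (fun v => (hyp v)^-1)}.
Proof. by have c := @cts_hyp R; cts; exact: hyp_neq0. Qed.

Ltac meas := lazymatch goal with
 | |- measurable_fun _ (fun _ => ?c) => exact: measurable_cst
 | |- measurable_fun _ (fun p => @?f p + @?g p)%R => apply: (@measurable_funD _ _ _ _ f g); meas
 | |- measurable_fun _ (fun p => @?f p * @?g p)%R => apply: (@measurable_funM _ _ _ _ f g); meas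
 | |- measurable_fun _ (fun p => - (@?f p))%R => apply: (@measurable_funN _ _ _ _ f); meas
 | |- measurable_fun _ (fun p => (hyp (@?f p) ^+ ?n)^-1)%R =>
     apply: (@measurable_cts1 _ _ _ (fun v => (hyp v ^+ n)^-1) f); [exact: cts_hypVn|meas]
 | |- measurable_fun _ (fun p => (hyp (@?f p))^-1)%R =>
     apply: (@measurable_cts1 _ _ _ (fun v => (hyp v)^-1) f); [exact: cts_hypV|meas]
 | |- measurable_fun _ (fun p => ash (@?f p))%R => apply: (@measurable_cts1 _ _ _ (@ash _) f); [exact: cts_ash|meas]
 | |- measurable_fun _ (fun p => hyp (@?f p))%R => apply: (@measurable_cts1 _ _ _ (@hyp _) f); [exact: cts_hyp|meas]
 | |- measurable_fun _ (fun p => sin (@?f p))%R => apply: (@measurable_cts1 _ _ _ (@sin _) f); [exact: continuous_sin|meas]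
 | |- measurable_fun _ (fun p => cos (@?f p))%R => apply: (@measurable_cts1 _ _ _ (@cos _) f); [exact: continuous_cos|meas]
 | |- measurable_fun _ (fun p => expR (@?f p))%R => apply: (@measurable_cts1 _ _ _ (@expR _) f); [exact: continuous_expR|meas]
 | |- measurable_fun _ (fun p => (p.1).1) => exact: (measurableT_comp measurable_fst measurable_fst)
 | |- measurable_fun _ (fun p => (p.1).2) => exact: (measurableT_comp measurable_snd measurable_fst)
 | |- measurable_fun _ (fun p => p.1) => exact: measurable_fst
 | |- measurable_fun _ (fun p => p.2) => exact: measurable_snd
 | _ => idtac
 end.

Section resolvent.
Variable R : realType.
Local Notation mu := (@lebesgue_measure R).
Implicit Types (X Y y s t x : R).
Definition eh a t : R := expR (- (a * t)).
Definition eh' a t : R := - a * expR (- (a * t)).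
Definition ch a t : R := (expR (a * t) + expR (- (a * t))) / 2.
Definition ch' a t : R := a * ((expR (a * t) - expR (- (a * t))) / 2).

Lemma der_eh a t : is_derive t 1 (eh a) (eh' a t).
Proof. by rewrite /eh /eh'; der; rewrite /=; ring. Qed.

Lemma der_eh' a t : is_derive t 1 (eh' a) (a ^+ 2 * eh a t).
Proof. by rewrite /eh /eh'; der; rewrite /=; ring. Qed.

Lemma der_ch a t : is_derive t 1 (ch a) (ch' a t).
Proof. by rewrite /ch /ch'; der => //=; field. Qed.

Lemma der_ch' a t : is_derive t 1 (ch' a) (a ^+ 2 * ch a t).
Proof. by rewrite /ch /ch'; der => //=; field. Qed.

Lemma eh_le a t : 0 < a -> 0 <= t -> `|eh a t| <= 1.
Proof. by move=> a0 t0; rewrite gtr0_norm ?expR_gt0// expN_le1// ltW. Qed.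

Lemma eh'_le a t : 0 < a -> 0 <= t -> `|eh' a t| <= a.
Proof. by move=> a0 t0; rewrite normrM normrN (gtr0_norm a0) ler_piMr ?(ltW a0)//; exact: eh_le. Qed.

Lemma ch'0 a : ch' a 0 = 0.
Proof. by rewrite /ch' !mulr0 oppr0 subrr mul0r mulr0. Qed.

Lemma q0_le (h h' : R -> R) (A : R) X : (forall t : R, is_derive t 1 h (h' t)) ->
  (forall t, 0 <= t -> `|h t| <= A) -> 0 < X -> `|q0 h X| <= A / X * (pi / 2).
Proof.
move=> dh hA X0; rewrite -Rintegral_invDsqr -RintegralZl//; last exact: integrable_invDsqr.
apply: normr_Rintegral_le => //; [exact: (int_q0 dh hA X0)|exact: int_cauchy|].
by move=> r _; exact: q0_dom.
Qed.

Lemma q1_le (h h' : R -> R) (lam A B : R) X : (forall t : R, is_derive t 1 h (h' t)) ->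
  (forall t : R, is_derive t 1 h' (lam * h t)) ->
  (forall t, 0 <= t -> `|h t| <= A) -> (forall t, 0 <= t -> `|h' t| <= B) ->
  0 < X -> `|q1 h h' X| <= (2 * B + A) / X ^+ 2 * (pi / 2).
Proof.
move=> dh dh' hA hB X0; rewrite -Rintegral_invDsqr -RintegralZl//; last exact: integrable_invDsqr.
apply: normr_Rintegral_le => //; [exact: (int_q1 dh dh' hA hB X0)|exact: int_cauchy|].
by move=> r _; exact: q1_dom.
Qed.

Lemma sin_pihalf_ge0 (f : R) : 0 <= f <= pi / 2 -> 0 <= sin f.
Proof. by move=> /andP[f0 f1]; apply: sin_ge0_pi; rewrite f0 /=; have := @pi_gt0 R; lra. Qed.

Lemma p0_le (h h' : R -> R) (A : R) Y : (forall t : R, is_derive t 1 h (h' t)) ->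
  (forall t, 0 <= t -> `|h t| <= A) -> 0 <= Y -> `|p0 h Y| <= A * (pi / 2).
Proof.
move=> dh hA Y0; have pi0 : 0 <= pi / 2 :> R by rewrite divr_ge0// pi_ge0.
have A0 := A_ge0 hA.
rewrite -[X in A * X]subr0 -Rintegral_cst_itv//.
have ck := cts_K0 dh; have cs := @cts_sin R.
apply: normr_Rintegral_le => //; [|exact: Rintegrable_cst|].
  by apply: continuous_integrable_itv => t _; cts.
move=> f; rewrite /= in_itv/= => f01; have s0 := sin_pihalf_ge0 f01.
apply: le_trans (K0_le hA (mulr_ge0 Y0 s0)) _.
by rewrite ler_pdivrMr ?hyp_gt0// ler_peMr// hyp_ge1.
Qed.

Lemma measurable_q0s X : measurable_fun (setT : set R) (fun s => q0 (snn s) X).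
Proof.
rewrite /q0 /K0 /snn.
apply: (@measurable_Rintegral _ R R `[0, +oo[ (fun p : R * R => sin (p.1 * (2 * ash (X * hyp p.2))) / hyp (X * hyp p.2) / hyp p.2)) => //.
by meas.
Qed.

Lemma measurable_q1s2 : measurable_fun (setT : set (R * R)) (fun p : R * R => q1 (snn p.1) (snn' p.1) p.2).
Proof.
rewrite /q1 /K1 /snn /snn'.
apply: (@measurable_Rintegral _ _ R `[0, +oo[ (fun p : (R * R) * R =>
  2 * (p.1.1 * cos (p.1.1 * (2 * ash (p.1.2 * hyp p.2)))) / hyp (p.1.2 * hyp p.2) ^+ 2 -
  p.1.2 * hyp p.2 * sin (p.1.1 * (2 * ash (p.1.2 * hyp p.2))) / hyp (p.1.2 * hyp p.2) ^+ 3)) => //.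
by meas.
Qed.

Lemma measurable_q1s X : measurable_fun (setT : set R) (fun s => q1 (snn s) (snn' s) X).
Proof. exact: (measurableT_comp measurable_q1s2 (pair2_measurable X)). Qed.

Lemma measurable_p0c Y : measurable_fun (setT : set R) (fun s => p0 (csn s) Y).
Proof.
rewrite /p0 /K0 /csn.
apply: (@measurable_Rintegral _ R R `[0, pi / 2] (fun p : R * R => cos (p.1 * (2 * ash (Y * sin p.2))) / hyp (Y * sin p.2))) => //.
by meas.
Qed.

Lemma measurable_p1c Y : measurable_fun (setT : set R) (fun s => p1 (csn s) (csn' s) Y).
Proof.
rewrite /p1 /K1 /csn /csn'.
apply: (@measurable_Rintegral _ R R `[0, pi / 2] (fun p : R * R =>
  (2 * (- p.1 * sin (p.1 * (2 * ash (Y * sin p.2)))) / hyp (Y * sin p.2) ^+ 2 -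
   Y * sin p.2 * cos (p.1 * (2 * ash (Y * sin p.2))) / hyp (Y * sin p.2) ^+ 3) * sin p.2)) => //.
by meas.
Qed.

Lemma ash_le (u v : R) : u <= v -> ash u <= ash v.
Proof.
rewrite le_eqVlt => /predU1P[->//|uv].
have d x : is_derive x 1 (@ash R) (hyp x)^-1 by exact: der_ash.
have [|c _ e] := @MVT R (@ash R) (fun x => (hyp x)^-1) u v uv.
  by apply: continuous_within_itv => t _; exact: der_cts (d t).
by rewrite -subr_ge0 e mulr_ge0// ?subr_ge0 ?(ltW uv)// invr_ge0 ltW// hyp_gt0.
Qed.

Variable kap : R.
Hypothesis k12 : 1 / 2 < kap.
Local Notation a := (1 / 2 : R).
Let kap0 : 0 < kap. Proof. by apply: lt_trans k12; lra. Qed.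
Let a0 : 0 < a. Proof. lra. Qed.
Let ak : a != kap. Proof. by rewrite lt_eqF. Qed.
Definition kk : R := pi / (2 * (kap ^+ 2 - (1 / 2) ^+ 2)).

(** Inside the integral over [r], the integral over [s] is [cossin_transform] at
    [x = 2 ash (X * hyp r)], which is at least [2 ash X], hence at least [t]. *)
Lemma resolvent_q0 t X : 0 < X -> 0 <= t <= 2 * ash X ->
  Rintegral mu `[0, +oo[ (fun s => wgt a kap s * (cos (s * t) * q0 (snn s) X)) =
  kk * (ch a t * q0 (eh a) X - ch kap t * q0 (eh kap) X).
Proof.
move=> X0 tX.
have ia := int_q0 (der_eh a) (fun t => @eh_le a t a0) X0.
have ik := int_q0 (der_eh kap) (fun t => @eh_le kap t kap0) X0.
have mus s : mu.-integrable `[0, +oo[ (EFin \o (fun r => K0 (snn s) (X * hyp r) / hyp r)).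
  exact: (int_q0 (der_sn s) (@sn_le _ s) X0).
transitivity (Rintegral mu `[0, +oo[ (fun s => Rintegral mu `[0, +oo[ (fun r =>
   wgt a kap s * cos (s * t) * (K0 (snn s) (X * hyp r) / hyp r)))).
  by apply: eq_Rintegral => s _; rewrite RintegralZl// -mulrA.
rewrite (@Rintegral_fubini _ _ _ _ R mu mu `[0, +oo[ `[0, +oo[
  (fun s r => wgt a kap s * cos (s * t) * (K0 (snn s) (X * hyp r) / hyp r))
  (fun s => (1 + a^-1) * (kap ^+ 2 + s ^+ 2)^-1) (fun r => 1 / X * (1 + r ^+ 2)^-1))//; last 4 first.
- apply: measurable_funTS; rewrite /K0 /snn; apply: measurable_funM; last by meas.
  apply: measurable_funM; last by meas.
  by apply: (@measurable_cts1 _ _ _ (wgt a kap)); [move=> z; exact: cts_wgt|exact: measurable_fst].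
- by apply: integrable_scale => //; exact: integrable_cauchy_scale.
- exact: int_cauchy.
- move=> s r; rewrite /= in_itv/= andbT => s0 _; rewrite normrM; apply: ler_pM => //.
    rewrite normrM; apply: le_trans (wgt_sqr_le s a0 kap0).
    apply: (@le_trans _ _ `|wgt a kap s|); first by rewrite ler_piMr// cos_bd.
    by rewrite ler_peMl//; have := normr_ge0 s; lra.
  exact: (q0_dom (@sn_le _ s) r X0).
rewrite mulrBr !mulrA -!RintegralZl// -RintegralB//; [|exact: integrable_scale..].
apply: eq_Rintegral => r _.
have tr : 0 <= t <= 2 * ash (X * hyp r).
  have /andP[t0 tx] := tX; rewrite t0 /=; apply: le_trans tx _; rewrite ler_pM2l//; apply: ash_le.
  by rewrite ler_peMr ?hyp_ge1// ltW.
have e := cossin_transform a0 kap0 ak tr.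
transitivity (Rintegral mu `[0, +oo[ (fun s => (hyp (X * hyp r))^-1 / hyp r * (wgt a kap s * (cos (s * t) * sin (s * (2 * ash (X * hyp r))))))).
  by apply: eq_Rintegral => s _; rewrite /K0 /snn; ring.
rewrite RintegralZl//; last first.
  apply: (@integrable_wgt _ _ _ _ 1) => //.
  - by apply: continuous_measurableT => // s; cts.
  - move=> s s0; rewrite mul1r normrM; apply: (@le_trans _ _ 1); last lra.
    by apply: mulr_ile1 => //; [exact: cos_bd|exact: sin_bd].
rewrite e /kk /K0 /eh /ch; ring.
Qed.

(** The same exchange for the angle [f], with [t = 2 ash (Y * sin f)]; it is at most [2 ash X]
    because [Y < X]. *)
Lemma resolvent_p0q0 X Y : 0 < Y -> Y < X ->
  Rintegral mu `[0, +oo[ (fun s => wgt a kap s * (p0 (csn s) Y * q0 (snn s) X)) =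
  kk * (p0 (ch a) Y * q0 (eh a) X - p0 (ch kap) Y * q0 (eh kap) X).
Proof.
move=> Y0 YX; have X0 : 0 < X by lra.
have cs := @cts_sin R.
have ck (h h' : R -> R) : (forall t : R, is_derive t 1 h (h' t)) -> mu.-integrable `[0, pi / 2] (EFin \o (fun f => K0 h (Y * sin f))).
  by move=> dh; have c := cts_K0 dh; apply: continuous_integrable_itv => t _; cts.
transitivity (Rintegral mu `[0, +oo[ (fun s => Rintegral mu `[0, pi / 2] (fun f =>
   wgt a kap s * q0 (snn s) X * K0 (csn s) (Y * sin f)))).
  by apply: eq_Rintegral => s _; rewrite RintegralZl ?mulrA ?[_ * p0 _ _]mulrC ?mulrA//; exact: (ck _ _ (der_cs s)).
rewrite (@Rintegral_fubini _ _ _ _ R mu mu `[0, +oo[ `[0, pi / 2]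
  (fun s f => wgt a kap s * q0 (snn s) X * K0 (csn s) (Y * sin f))
  (fun s => (1 / X * (pi / 2) * (1 + a^-1)) * (kap ^+ 2 + s ^+ 2)^-1) (fun=> 1))//; last 4 first.
- apply: measurable_funTS; apply: measurable_funM; last by rewrite /K0 /csn; meas.
  apply: measurable_funM; last exact: (measurableT_comp (measurable_q0s X) measurable_fst).
  by apply: (@measurable_cts1 _ _ _ (wgt a kap)); [move=> z; exact: cts_wgt|exact: measurable_fst].
- by apply: integrable_scale => //; exact: integrable_cauchy_scale.
- exact: Rintegrable_cst.
- move=> s f; rewrite /= !in_itv/= andbT => s0 f01; rewrite normrM; apply: ler_pM => //.
    rewrite normrM mulrC -mulrA; apply: ler_pM => //.
      exact: (q0_le (der_sn s) (@sn_le _ s) X0).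
    apply: le_trans (wgt_sqr_le s a0 kap0); rewrite ler_peMl//; have := normr_ge0 s; lra.
  have sf := sin_pihalf_ge0 f01.
  apply: le_trans (K0_le (@cs_le _ s) (mulr_ge0 (ltW Y0) sf)) _.
  by rewrite div1r invf_le1 ?hyp_gt0// hyp_ge1.
transitivity (Rintegral mu `[0, pi / 2] (fun f => kk * (q0 (eh a) X * K0 (ch a) (Y * sin f)) - kk * (q0 (eh kap) X * K0 (ch kap) (Y * sin f)))).
  apply: eq_Rintegral => f; rewrite inE/= in_itv/= => f01.
  have sf := sin_pihalf_ge0 f01.
  have tX : 0 <= 2 * ash (Y * sin f) <= 2 * ash X.
    have y0 : 0 <= Y * sin f by rewrite mulr_ge0// ltW.
    rewrite mulr_ge0 ?ash_ge0//= ler_pM2l// ash_le//; apply: le_trans (ltW YX).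
    by rewrite ler_piMr ?(ltW Y0)// sin_le1.
  have e := resolvent_q0 X0 tX.
  transitivity (Rintegral mu `[0, +oo[ (fun s => (hyp (Y * sin f))^-1 * (wgt a kap s * (cos (s * (2 * ash (Y * sin f))) * q0 (snn s) X)))).
    by apply: eq_Rintegral => s _; rewrite /K0 /csn; ring.
  rewrite RintegralZl//; last first.
    apply: (@integrable_wgt _ _ _ _ (1 / X * (pi / 2))) => //.
    - apply: measurable_funTS; apply: measurable_funM; last exact: measurable_q0s.
      by apply: continuous_measurableT => // s; cts.
    - move=> s s0; have h := q0_le (der_sn s) (@sn_le _ s) X0.
      rewrite normrM; apply: (@le_trans _ _ (1 / X * (pi / 2))).
        by apply: le_trans h; rewrite ler_piMl// cos_bd.
      by rewrite ler_peMr ?(le_trans _ h)//; lra.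
  rewrite e /K0; ring.
rewrite RintegralB//; [|by apply: integrable_scale => //; apply: integrable_scale => //; apply: ck; exact: der_ch..].
rewrite !RintegralZl//; [rewrite /p0; ring|..]; try (by apply: ck; exact: der_ch).
all: by apply: integrable_scale => //; apply: ck; exact: der_ch.
Qed.

End resolvent.

(** * Differentiation in both variables and the kernel of the resolvent *)

Section resolvent_kernel.
Variable R : realType.
Local Notation mu := (@lebesgue_measure R).
Implicit Types (X Y y s t x : R).

Lemma expR_ash (v : R) : expR (ash v) = v + hyp v.
Proof. by rewrite /ash lnK// posrE ash_arg_gt0. Qed.

Lemma expRN_ash (v : R) : expR (- ash v) = hyp v - v.
Proof.
rewrite expRN expR_ash; have h := ash_arg_gt0 v.
apply: (mulIf (_ : v + hyp v != 0)); rewrite ?gt_eqF// mulVf ?gt_eqF//.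
have := hyp2 v; set z := hyp v => e.
have -> : (z - v) * (v + z) = z ^+ 2 - v ^+ 2 by ring.
by rewrite e; ring.
Qed.

Lemma shh_2ash (v : R) : shh (2 * ash v) = v.
Proof. by rewrite /shh (_ : 2 * ash v / 2 = ash v) ?expR_ash ?expRN_ash; [field|field]. Qed.

Lemma ash_gt0 (v : R) : 0 < v -> 0 < ash v.
Proof. by move=> v0; rewrite ln_gt0//; have := hyp_ge1 v; lra. Qed.

Lemma K1_ch_half (v : R) : K1 (ch (1 / 2)) (ch' (1 / 2)) v = 0.
Proof.
have h0 := hyp_neq0 v.
rewrite /K1 /ch /ch' (_ : 1 / 2 * (2 * ash v) = ash v); last by field.
by rewrite expR_ash expRN_ash; field.
Qed.

Lemma om_2ash_ge (u v : R) : 0 < u -> u <= v -> Num.sqrt u <= om (2 * ash v).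
Proof.
move=> u0 uv; have v0 : 0 < v by lra.
have h1 := hyp_ge1 v.
rewrite /om /snh -hyp_shh shh_2ash -[leLHS]mulr1; apply: ler_pM => //.
by apply: ler_wsqrtr; nra.
Qed.

Lemma der_lin2 (f g : R -> R) (f' g' k c1 c2 x : R) : is_derive x 1 f f' -> is_derive x 1 g g' ->
  is_derive x 1 (fun x => k * (f x * c1 - g x * c2)) (k * (f' * c1 - g' * c2)).
Proof. by move=> df dg; der; rewrite /=; ring. Qed.

Lemma der_lin2l (f g : R -> R) (f' g' k c1 c2 x : R) : is_derive x 1 f f' -> is_derive x 1 g g' ->
  is_derive x 1 (fun x => k * (c1 * f x - c2 * g x)) (k * (c1 * f' - c2 * g')).
Proof. by move=> df dg; der; rewrite /=; ring. Qed.

Lemma frac_bound (E B q k oy oe su : R) : 0 <= q -> 0 <= k -> 0 < oe -> 0 < su -> su <= oy -> `|E| <= B ->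
  `|q * (E * k) / (oy * oe)| <= q * B / (su * oe) * k.
Proof.
move=> q0 k0 oe0 su0 suo EB; have oy0 : 0 < oy by exact: lt_le_trans suo.
have B0 : 0 <= B by exact: le_trans EB.
have o1 : 0 < oy * oe by exact: mulr_gt0.
have o2 : 0 < su * oe by exact: mulr_gt0.
rewrite normrM normfV (gtr0_norm o1) normrM (ger0_norm q0) normrM (ger0_norm k0).
have -> : q * B / (su * oe) * k = q * (B * k) / (su * oe) by ring.
apply: ler_pM; rewrite ?mulr_ge0 ?invr_ge0 ?(ltW o1)//.
  by rewrite ler_wpM2l// ler_wpM2r.
by rewrite lef_pV2 ?posrE// ler_pM2r.
Qed.

Variable kap : R.
Hypothesis k12 : 1 / 2 < kap.
Local Notation a := (1 / 2 : R).
Let kap0 : 0 < kap. Proof. by apply: lt_trans k12; lra. Qed.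
Let a0 : 0 < a. Proof. lra. Qed.
Local Notation kk := (kk kap).

Lemma derive_unique (f g : R -> R) (x l m : R) : is_derive x 1 f l -> is_derive x 1 g m ->
  (\forall t \near x, f t = g t) -> l = m.
Proof.
move=> [_ <-] [_ <-] h; exact: near_eq_derive.
Qed.

(** The derivative in [X] of [resolvent_p0q0]; [wgt_sqr_le] pays for the linear growth in [s] of the
    bound on [q1]. *)
Lemma resolvent_p0q1 X Y : 0 < Y -> Y < X ->
  Rintegral mu `[0, +oo[ (fun s => wgt a kap s * (p0 (csn s) Y * q1 (snn s) (snn' s) X)) =
  kk * (p0 (ch a) Y * q1 (eh a) (eh' a) X - p0 (ch kap) Y * q1 (eh kap) (eh' kap) X).
Proof.
move=> Y0 YX; have X0 : 0 < X by lra.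
pose u := (Y + X) / 2; have u0 : 0 < u by rewrite /u; lra.
have pi0 : 0 <= pi / 2 :> R by rewrite divr_ge0// pi_ge0.
pose G s := (pi / 2 * (2 / u ^+ 2 * (pi / 2))) * ((1 + a^-1) * (kap ^+ 2 + s ^+ 2)^-1).
have pb s : `|p0 (csn s) Y| <= pi / 2.
  by have := p0_le (der_cs s) (@cs_le _ s) (ltW Y0); rewrite mul1r.
have d1 : is_derive X 1 (fun X => Rintegral mu `[0, +oo[ (fun s => wgt a kap s * (p0 (csn s) Y * q0 (snn s) X)))
  (Rintegral mu `[0, +oo[ (fun s => wgt a kap s * (p0 (csn s) Y * q1 (snn s) (snn' s) X))).
  apply: (@der_under_integral _ _ R mu `[0, +oo[ (fun X s => wgt a kap s * (p0 (csn s) Y * q0 (snn s) X))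
    (fun X s => wgt a kap s * (p0 (csn s) Y * q1 (snn s) (snn' s) X)) G X u (X + 1)) => //.
  - by rewrite /u; lra.
  - move=> X' /andP[uX _]; have X'0 : 0 < X' by lra.
    apply: (@integrable_wgt _ _ _ _ (pi / 2 * (1 / X' * (pi / 2)))) => //.
    + by apply: measurable_funTS; apply: measurable_funM; [exact: measurable_p0c|exact: measurable_q0s].
    + move=> s s0; rewrite normrM; have h := q0_le (der_sn s) (@sn_le _ s) X'0.
      apply: (@le_trans _ _ (pi / 2 * (1 / X' * (pi / 2)))); first by apply: ler_pM.
      have X'1 : 0 <= 1 / X' by rewrite divr_ge0// ltW.
      by rewrite ler_peMr ?(mulr_ge0 pi0 (mulr_ge0 X'1 pi0))//; lra.
  - move=> X' s /andP[uX _] _; have X'0 : 0 < X' by lra.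
    have d := der_q0 (der_sn s) (@sn_le _ s) (@sn'_le _ s) X'0.
    by der; rewrite /=; ring.
  - by apply: integrable_scale => //; apply: integrable_scale => //; exact: integrable_cauchy_scale.
  - move=> X' s /andP[uX _] _; have X'0 : 0 < X' by lra.
    have h := q1_le (der_sn s) (der_sn' s) (@sn_le _ s) (@sn'_le _ s) X'0.
    have h2 : `|q1 (snn s) (snn' s) X'| <= 2 / u ^+ 2 * (pi / 2) * (`|s| + 1).
      apply: le_trans h _; rewrite [leRHS]mulrAC; apply: ler_wpM2r => //.
      have -> : 2 / u ^+ 2 * (`|s| + 1) = (2 * (`|s| + 1)) / u ^+ 2 by ring.
      apply: ler_pM; rewrite ?invr_ge0 ?exprn_ge0 ?(ltW X'0)//; try by have := normr_ge0 s; lra.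
      rewrite lef_pV2 ?posrE ?exprn_gt0//; apply: lerXn2r; rewrite ?nnegrE; lra.
    have e3 (w p q : R) : `|w * (p * q)| = (`|p| * `|q|) * `|w| by rewrite !normrM; ring.
    rewrite e3 /G.
    apply: (@le_trans _ _ (pi / 2 * (2 / u ^+ 2 * (pi / 2) * (`|s| + 1)) * `|wgt a kap s|)).
      by apply: ler_wpM2r => //; apply: ler_pM.
    have e4 (p q r w : R) : p * (q * r) * w = p * q * (r * w) by ring.
    rewrite e4; apply: ler_wpM2l; last exact: wgt_sqr_le.
    apply: (mulr_ge0 pi0 (mulr_ge0 _ pi0)).
    by rewrite divr_ge0// exprn_ge0// ltW.
have e1 := der_q0 (der_eh a) (fun t => @eh_le _ a t a0) (fun t => @eh'_le _ a t a0) X0.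
have e2 := der_q0 (der_eh kap) (fun t => @eh_le _ kap t kap0) (fun t => @eh'_le _ kap t kap0) X0.
have d2 : is_derive X 1 (fun X => kk * (p0 (ch a) Y * q0 (eh a) X - p0 (ch kap) Y * q0 (eh kap) X))
  (kk * (p0 (ch a) Y * q1 (eh a) (eh' a) X - p0 (ch kap) Y * q1 (eh kap) (eh' kap) X)).
  exact: (der_lin2l _ _ _ e1 e2).
apply: (derive_unique d1 d2); near=> t; apply: resolvent_p0q0 => //.
by near: t; exact: lt_nbhsr.
Unshelve. all: by end_near. Qed.

Lemma wgt_Ef s y e : 0 < y -> 0 < e ->
  wgt a kap s * (p1 (csn s) (csn' s) (shh y) * q1 (snn s) (snn' s) (shh e)) * (om y * om e) =
  pi * (Ef s y e * (kap ^+ 2 + s ^+ 2)^-1).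
Proof.
move=> y0 e0; have pi0 : pi != 0 :> R by rewrite gt_eqF// pi_gt0.
case: (eqVneq s 0) => [->|s0].
  by rewrite /Ef Js0 /wgt !mul0r mulr0.
rewrite Ef_pq// /wgt.
have s2 := sqr_ge0 s.
have k2 : kap ^+ 2 + s ^+ 2 != 0 by rewrite gt_eqF// dsqr_gt0.
have n0 : 1 + 4 * s ^+ 2 != 0 by rewrite gt_eqF//; lra.
have n1 : (1 / 2) ^+ 2 + s ^+ 2 != 0 by rewrite gt_eqF//; exact: dsqr_gt0.
have -> : (1 / 2) ^+ 2 + s ^+ 2 = (1 + 4 * s ^+ 2) / 4 by field.
move: (pi : R) pi0 => q pi0; field.
by rewrite n0 k2 pi0.
Qed.

(** Separate bounds on [p1] and [q1] would cost [(|s| + 1)^2], too much for [wgt]. The domination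
    comes instead from the product: by [wgt_Ef] it is the density [Ef] over [kap^2 + s^2], and [Ef]
    is bounded uniformly in [s]. *)
Lemma resolvent_p1q1 X Y : 0 < Y -> Y < X ->
  Rintegral mu `[0, +oo[ (fun s => wgt a kap s * (p1 (csn s) (csn' s) Y * q1 (snn s) (snn' s) X)) =
  - (kk * (p1 (ch kap) (ch' kap) Y * q1 (eh kap) (eh' kap) X)).
Proof.
move=> Y0 YX; have X0 : 0 < X by lra.
pose u := Y / 2; pose v := (Y + X) / 2; have u0 : 0 < u by rewrite /u; lra.
pose e := 2 * ash X; have e0 : 0 < e by rewrite mulr_gt0// ash_gt0.
have eX : shh e = X by exact: shh_2ash.
have ome : 0 < om e by exact: om_gt0.
pose yu := 2 * ash u; have yu0 : 0 < yu by rewrite mulr_gt0// ash_gt0.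
pose C := pi * (2 * (Bd yu * Bd e)) / (Num.sqrt u * om e).
have su : 0 < Num.sqrt u by rewrite sqrtr_gt0.
have bd Y' s : u < Y' -> `|wgt a kap s * (p1 (csn s) (csn' s) Y' * q1 (snn s) (snn' s) X)| <= C * (kap ^+ 2 + s ^+ 2)^-1.
  move=> uY; have Y'0 : 0 < Y' by lra.
  pose y := 2 * ash Y'; have y0 : 0 < y by rewrite mulr_gt0// ash_gt0.
  have omy : Num.sqrt u <= om y by apply: om_2ash_ge => //; exact: ltW.
  have omy0 : 0 < om y by exact: lt_le_trans omy.
  have := wgt_Ef s y0 e0; rewrite eX (shh_2ash Y') => E.
  have yy : yu <= y by rewrite ler_pM2l// ash_le// ltW.
  have oo : 0 < om y * om e by exact: mulr_gt0.
  have -> : wgt a kap s * (p1 (csn s) (csn' s) Y' * q1 (snn s) (snn' s) X) =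
    pi * (Ef s y e * (kap ^+ 2 + s ^+ 2)^-1) / (om y * om e) by rewrite -E mulfK// gt_eqF.
  have k2 := dsqr_gt0 s kap0.
  have h := Ef_bound s y0 e0.
  have h2 : `|Ef s y e| <= 2 * (Bd yu * Bd e).
    apply: le_trans h _; rewrite ler_pM2l// ler_pM2r ?Bd_gt0//; exact: Bd_le.
  rewrite /C; apply: frac_bound => //; rewrite ?invr_ge0 ?(ltW k2)//; exact: pi_ge0.
have d1 : is_derive Y 1 (fun Y => Rintegral mu `[0, +oo[ (fun s => wgt a kap s * (p0 (csn s) Y * q1 (snn s) (snn' s) X)))
  (Rintegral mu `[0, +oo[ (fun s => wgt a kap s * (p1 (csn s) (csn' s) Y * q1 (snn s) (snn' s) X))).
  apply: (@der_under_integral _ _ R mu `[0, +oo[ (fun Y s => wgt a kap s * (p0 (csn s) Y * q1 (snn s) (snn' s) X))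
    (fun Y s => wgt a kap s * (p1 (csn s) (csn' s) Y * q1 (snn s) (snn' s) X)) (fun s => C * (kap ^+ 2 + s ^+ 2)^-1) Y u v) => //.
  - by rewrite /u /v; lra.
  - move=> Y' /andP[uY _]; have Y'0 : 0 < Y' by lra.
    have pi0 : 0 <= pi / 2 :> R by rewrite divr_ge0// pi_ge0.
    have x20 : 0 < X ^+ 2 by rewrite exprn_gt0.
    apply: (@integrable_wgt _ _ _ _ (pi / 2 * (2 / X ^+ 2 * (pi / 2)))) => //.
    + by apply: measurable_funTS; apply: measurable_funM; [exact: measurable_p0c|exact: measurable_q1s].
    + move=> s s0; rewrite normrM; have h := q1_le (der_sn s) (der_sn' s) (@sn_le _ s) (@sn'_le _ s) X0.
      have h1 := p0_le (der_cs s) (@cs_le _ s) (ltW Y'0); rewrite mul1r in h1.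
      rewrite -mulrA; apply: ler_pM => //; apply: le_trans h _.
      rewrite (ger0_norm s0) -[leRHS]mulrA [leRHS]mulrCA mulrC ler_wpM2l//.
      have -> : 2 / X ^+ 2 * (s + 1) = (2 * (s + 1)) / X ^+ 2 by ring.
      by rewrite ler_pM2r ?invr_gt0//; lra.
  - move=> Y' s /andP[uY _] _; have d := der_p0 (der_cs s) (der_cs' s) Y'.
    by der; rewrite /=; ring.
  - by apply: integrable_scale => //; exact: integrable_cauchy_scale.
  - by move=> Y' s /andP[uY _] _; exact: bd.
have e1 := der_p0 (@der_ch R a) (@der_ch' R a) Y.
have e2 := der_p0 (@der_ch R kap) (@der_ch' R kap) Y.
have d2 : is_derive Y 1 (fun Y => kk * (p0 (ch a) Y * q1 (eh a) (eh' a) X - p0 (ch kap) Y * q1 (eh kap) (eh' kap) X))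
  (kk * (p1 (ch a) (ch' a) Y * q1 (eh a) (eh' a) X - p1 (ch kap) (ch' kap) Y * q1 (eh kap) (eh' kap) X)).
  exact: (der_lin2 _ _ _ e1 e2).
have -> : - (kk * (p1 (ch kap) (ch' kap) Y * q1 (eh kap) (eh' kap) X)) =
  kk * (p1 (ch a) (ch' a) Y * q1 (eh a) (eh' a) X - p1 (ch kap) (ch' kap) Y * q1 (eh kap) (eh' kap) X).
  have -> : p1 (ch a) (ch' a) Y = 0.
    rewrite /p1; under eq_Rintegral do rewrite K1_ch_half mul0r.
    by rewrite Rintegral_cst// mul0r.
  by rewrite mul0r sub0r mulrN.
apply: (derive_unique d1 d2); near=> t; apply: resolvent_p0q1.
  by near: t; exact: lt_nbhsr.
by near: t; exact: lt_nbhsl.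
Unshelve. all: by end_near. Qed.

Definition Jp := JJ (p1 (ch kap) (ch' kap)).
Definition Jq := JJ (q1 (eh kap) (eh' kap)).

Lemma integrable_Ef y e : 0 < y -> 0 < e ->
  mu.-integrable `[0, +oo[ (EFin \o (fun s => Ef s y e * (kap ^+ 2 + s ^+ 2)^-1)).
Proof.
move=> y0 e0.
apply: (@integrable_dom _ _ _ mu _ _ (fun s => (2 * (Bd y * Bd e)) * (kap ^+ 2 + s ^+ 2)^-1)) => //.
- apply: measurable_funTS.
  have -> : (fun s => Ef s y e * (kap ^+ 2 + s ^+ 2)^-1) =
    (fun s => (om y * om e / pi) * (wgt a kap s * (p1 (csn s) (csn' s) (shh y) * q1 (snn s) (snn' s) (shh e)))).
    apply/funext => s; have E := wgt_Ef s y0 e0.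
    apply: (mulfI (_ : pi != 0)); first by rewrite gt_eqF// pi_gt0.
    rewrite -E; have : pi != 0 :> R by rewrite gt_eqF// pi_gt0.
    by move: (pi : R) => q q0; field.
  apply: measurable_funM; first exact: measurable_cst.
  apply: measurable_funM; first by apply: continuous_measurableT => // s; exact: cts_wgt.
  by apply: measurable_funM; [exact: measurable_p1c|exact: measurable_q1s].
- move=> s _; rewrite normrM normfV (gtr0_norm (dsqr_gt0 _ kap0)) ler_pM2r ?invr_gt0 ?dsqr_gt0//; exact: Ef_bound.
- by apply: integrable_scale => //; exact: integrable_cauchy_scale.
Qed.

Lemma resolvent_Ef y e : 0 < y -> y < e ->
  Rintegral mu `[0, +oo[ (fun s => Ef s y e * (kap ^+ 2 + s ^+ 2)^-1) =
  - (2 * (kap ^+ 2 - 1 / 4))^-1 * (Jp y * Jq e).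
Proof.
move=> y0 ye; have e0 : 0 < e by lra.
have pi0 : pi != 0 :> R by rewrite gt_eqF// pi_gt0.
have sY := shh_gt0 y0.
have sYX : shh y < shh e.
  have l1 : expR (y / 2) < expR (e / 2) by rewrite ltr_expR; lra.
  have l2 : expR (- (e / 2)) < expR (- (y / 2)) by rewrite ltr_expR; lra.
  by rewrite /shh; lra.
have h := resolvent_p1q1 sY sYX.
apply: (mulfI pi0); rewrite -RintegralZl//; last exact: integrable_Ef.
transitivity ((om y * om e) * Rintegral mu `[0, +oo[ (fun s => wgt a kap s * (p1 (csn s) (csn' s) (shh y) * q1 (snn s) (snn' s) (shh e)))).
  rewrite -RintegralZl//; last first.
    have oy : om y != 0 by rewrite gt_eqF// om_gt0.
    have oe : om e != 0 by rewrite gt_eqF// om_gt0.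
    have oo : om y * om e != 0 by rewrite mulf_neq0.
    have -> : (fun s => wgt a kap s * (p1 (csn s) (csn' s) (shh y) * q1 (snn s) (snn' s) (shh e))) =
      (fun s => (pi / (om y * om e)) * (Ef s y e * (kap ^+ 2 + s ^+ 2)^-1)).
      by apply/funext => s; apply: (mulIf oo); rewrite wgt_Ef//; move: (pi : R) (Ef s y e) (kap ^+ 2 + s ^+ 2)^-1 => q E k; field; rewrite oy oe.
    by apply: integrable_scale => //; exact: integrable_Ef.
  by apply: eq_Rintegral => s _; rewrite -wgt_Ef// mulrC.
have k0 : kap ^+ 2 - 1 / 4 != 0.
  have -> : kap ^+ 2 - 1 / 4 = (kap - 1 / 2) * (kap + 1 / 2) by field.
  by rewrite gt_eqF// mulr_gt0 ?subr_gt0 ?addr_gt0.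
have e4 : kk = pi / (2 * (kap ^+ 2 - 1 / 4)) by rewrite /kk; congr (_ / (2 * (_ - _))); field.
rewrite h e4 /Jp /Jq /JJ; clear h e4.
by move: (kap ^+ 2 - 1 / 4) k0 => K k0; move: (pi : R) => q; field.
Qed.

End resolvent_kernel.

(** * The inhomogeneous separated equation *)

Section inhomogeneous.
Variable R : realType.
Local Notation mu := (@lebesgue_measure R).
Implicit Types (X Y y s t x e : R).

(** Unlike [K1_le], it keeps the values of [h] and [h'] at the point, so the exponential decay of
    [eh] survives in [Jq_le]. *)
Lemma K1_pointwise (h h' : R -> R) (v : R) :
  `|K1 h h' v| <= (2 * `|h' (2 * ash v)| + `|h (2 * ash v)|) / hyp v ^+ 2.
Proof.
have h0 := hyp_gt0 v; have hv := le_hyp v; have hn := hyp_neq0 v.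
rewrite /K1 [leRHS]mulrDl; apply: le_trans (ler_normB _ _) _; apply: lerD.
  by rewrite normrM normfV (gtr0_norm (exprn_gt0 2 h0)) normrM ger0_norm.
rewrite normrM normfV (gtr0_norm (exprn_gt0 3 h0)) normrM ler_pdivrMr ?exprn_gt0//.
have -> : `|h (2 * ash v)| / hyp v ^+ 2 * hyp v ^+ 3 = hyp v * `|h (2 * ash v)| by field.
by rewrite ler_wpM2r.
Qed.

Variable kap : R.
Hypothesis k12 : (1 / 2 : R) < kap.
Let kap0 : 0 < kap. Proof. by apply: lt_trans k12; lra. Qed.
Local Notation Jp := (Jp kap).
Local Notation Jq := (Jq kap).
Definition Jp' := JJ' (kap ^+ 2) (p0 (ch kap)) (p1 (ch kap) (ch' kap)).
Definition Jq' := JJ' (kap ^+ 2) (q0 (eh kap)) (q1 (eh kap) (eh' kap)).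

Let sXp : solX (kap ^+ 2) (p0 (ch kap)) (p1 (ch kap) (ch' kap)) (p2 (ch kap) (ch' kap) (kap ^+ 2)).
Proof. exact: (solX_p (@der_ch R kap) (@der_ch' R kap) (@ch'0 R kap)). Qed.

Let sXq : solX (kap ^+ 2) (q0 (eh kap)) (q1 (eh kap) (eh' kap)) (q2 (eh kap) (eh' kap) (kap ^+ 2)).
Proof. exact: (solX_q (@der_eh R kap) (@der_eh' R kap) (fun t => @eh_le _ kap t kap0) (fun t => @eh'_le _ kap t kap0)). Qed.

Let sp : solY (kap ^+ 2) Jp Jp'. Proof. exact: solY_JJ sXp. Qed.
Let sq : solY (kap ^+ 2) Jq Jq'. Proof. exact: solY_JJ sXq. Qed.

(** The Wronskian in [y] is [4 kap^2 - 1] times the constant [wrX], known from [wrX_qp]. *)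
Lemma wr_pq y : 0 < y -> Jp' y * Jq y - Jp y * Jq' y = - (2 * pi * (kap ^+ 2 - 1 / 4)).
Proof.
move=> y0; have X0 := shh_gt0 y0.
have W := wrX_qp (@der_eh R kap) (@der_eh' R kap) (fun t => @eh_le _ kap t kap0) (fun t => @eh'_le _ kap t kap0)
  (@der_ch R kap) (@der_ch' R kap) (@ch'0 R kap) X0.
have e1 : eh kap 0 = 1 by rewrite /eh mulr0 oppr0 expR0.
have e2 : ch kap 0 = 1 by rewrite /ch mulr0 oppr0 expR0; field.
rewrite e1 e2 !mulr1 in W.
have -> : - (2 * pi * (kap ^+ 2 - 1 / 4)) = (4 * kap ^+ 2 - 1) * - (pi / 2) by move: (pi : R) => q; field.
rewrite -W /wrX -hyp2 hyp_shh /Jp' /Jq' /JJ' /Jp /Jq /JJ /om.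
have s2 : Num.sqrt (snh y) ^+ 2 = 2 * shh y * chh y by rewrite sqr_sqrtr// ltW// snh_gt0.
set q := Num.sqrt (snh y) in s2 *.
set P0 := p0 _ _; set P1 := p1 _ _ _; set Q0 := q0 _ _; set Q1 := q1 _ _ _.
transitivity ((4 * kap ^+ 2 - 1) / 2 * (q ^+ 2 * chh y * (Q1 * P0 - Q0 * P1))); first by field.
by rewrite s2; field.
Qed.

Variables (beta : R -> R) (al be : R).
Hypothesis cb : forall t, {for t, continuous beta}.
Hypothesis al0 : 0 < al.
Hypothesis alb : al < be.
Hypothesis b_lo : forall t, t < al -> beta t = 0.
Hypothesis b_hi : forall t, be < t -> beta t = 0.
(** Since [beta] vanishes below [al], starting at [al / 2] loses nothing and keeps the integrand
    away from the singularity at 0. *)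
Definition prim (f : R -> R) y := Rintegral mu `[al / 2, y] (fun t => f t * beta t).

Lemma prim_lo f y : y < al -> prim f y = 0.
Proof.
move=> ya; rewrite /prim; transitivity (Rintegral mu `[al / 2, y] (fun=> 0 : R)).
  apply: eq_Rintegral => t; rewrite inE/= in_itv/= => /andP[_ ty].
  by rewrite b_lo ?mulr0//; exact: le_lt_trans ya.
by rewrite Rintegral_cst// mul0r.
Qed.

Lemma prim_hi f y : be <= y -> prim f y = prim f be.
Proof.
move=> yb; rewrite /prim Rintegral_mkcond [RHS]Rintegral_mkcond; apply: eq_Rintegral => t _.
rewrite /patch !mem_setE !in_itv/=; case: (leP (al / 2) t) => //= _.
case: (leP t be) => tb; first by rewrite (le_trans tb yb).
by case: ifP => // _; rewrite b_hi// mulr0.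
Qed.

Lemma der_prim (f : R -> R) y : (forall t, 0 < t -> {for t, continuous f}) -> 0 < y ->
  is_derive y 1 (prim f) (f y * beta y).
Proof.
move=> cf y0; have [ya|ya] := ltP y al.
  rewrite b_lo// mulr0.
  apply: (near_eq_is_derive _ (@derC R 0 y)).
  near=> t; rewrite prim_lo//; near: t; exact: lt_nbhsl.
have al0' := al0; have yal : al / 2 < y by lra.
have cfb t : al / 2 <= t -> {for t, continuous (fun t => f t * beta t)}.
  by move=> t0; apply: ctsM; [apply: cf; lra|exact: cb].
have [||||d e] := @continuous_FTC1_closed R (fun t => f t * beta t) (al / 2) y (y + 1).
- by rewrite ltrDl.
- by apply: continuous_integrable_itv => t /andP[t0 _]; exact: cfb.
- exact: yal.
- by apply: cfb; exact: ltW.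
apply: DeriveDef; first exact: d.
by rewrite -derive1E; exact: e.
Unshelve. all: by end_near. Qed.

Definition cW : R := - (2 * pi * (kap ^+ 2 - 1 / 4))^-1.

(* Variation of constants: the bounded solution of [u'' = (kap^2 + 3 / (4 sinh^2 y)) u - beta]. *)
Definition uk y := cW * (Jq y * prim Jp y + Jp y * (prim Jq be - prim Jq y)).

Definition uk' y := cW * (Jq' y * prim Jp y + Jp' y * (prim Jq be - prim Jq y)).

Let k0 : 0 < kap ^+ 2 - 1 / 4.
Proof.
have -> : kap ^+ 2 - 1 / 4 = (kap - 1 / 2) * (kap + 1 / 2) by field.
by rewrite mulr_gt0 ?subr_gt0 ?addr_gt0.
Qed.

Let cJp t : 0 < t -> {for t, continuous Jp}.
Proof. by move=> t0; have [d _] := sp t0; exact: der_cts d. Qed.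

Let cJq t : 0 < t -> {for t, continuous Jq}.
Proof. by move=> t0; have [d _] := sq t0; exact: der_cts d. Qed.

Lemma der_uk y : 0 < y -> is_derive y 1 uk (uk' y).
Proof.
move=> y0; have [d1 _] := sp y0; have [d2 _] := sq y0.
have d3 := der_prim cJp y0; have d4 := der_prim cJq y0.
rewrite /uk /uk'; move: (cW) (prim Jq be) => c b.
move: (prim Jp) (prim Jq) d3 d4 => P Q d3 d4.
by der; rewrite /=; ring.
Qed.

Lemma der_uk' y : 0 < y -> is_derive y 1 uk' ((kap ^+ 2 + 3 / (4 * snh y ^+ 2)) * uk y - beta y).
Proof.
move=> y0; have [_ d1] := sp y0; have [_ d2] := sq y0.
have d3 := der_prim cJp y0; have d4 := der_prim cJq y0.
have W := wr_pq y0.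
have W2 : cW * (Jp' y * Jq y - Jp y * Jq' y) = 1.
  by rewrite W /cW mulrNN mulVf// gt_eqF// (mulr_gt0 (mulr_gt0 _ (pi_gt0 R)) k0).
rewrite /uk' /uk; move: (cW) (prim Jq be) W2 => c b W2.
move: (prim Jp) (prim Jq) d3 d4 => P Q d3 d4.
der; rewrite /= -[X in _ = _ - X](mul1r (beta y)) -W2; ring.
Qed.

Lemma uk_lo y : y < al -> uk y = cW * prim Jq be * Jp y.
Proof. by move=> ya; rewrite /uk (prim_lo Jp ya) (prim_lo Jq ya) mulr0 add0r subr0 mulrA mulrAC. Qed.

Lemma uk_hi y : be <= y -> uk y = cW * prim Jp be * Jq y.
Proof. by move=> ya; rewrite /uk (prim_hi Jp ya) (prim_hi Jq ya) subrr mulr0 addr0 mulrA mulrAC. Qed.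

Lemma Jp_cvg0 : Jp y @[y --> 0^'+] --> (0 : R).
Proof.
have c1 : {for 0, continuous (p1 (ch kap) (ch' kap))} by exact: der_cts (der_p1 (@der_ch R kap) (@der_ch' R kap) 0).
have s0 : shh 0 = 0 :> R by rewrite /shh mul0r oppr0 subrr mul0r.
have c2 : {for 0, continuous (@shh R)} by exact: der_cts (der_shh 0).
have c3 : {for 0, continuous (fun y => p1 (ch kap) (ch' kap) (shh y))}.
  by apply: (@continuous_comp _ _ _ (@shh R)); rewrite ?s0.
have c4 : {for 0, continuous (@om R)}.
  have c5 : {for 0, continuous (@chh R)} by exact: der_cts (der_chh 0).
  have c6 : {for 0, continuous (@snh R)} by rewrite /snh; cts.
  by rewrite /om; cts.
have J0 : Jp 0 = 0 by rewrite /Jp /JJ /om /snh s0 mulr0 mul0r sqrtr0 !mul0r.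
have c : {for 0, continuous Jp} by rewrite /Jp /JJ; exact: ctsM.
by rewrite -[X in _ --> X]J0; apply: cvg_at_right_filter.
Qed.

(** In the integral of [q1] the argument of [eh kap] is at least [y], so [e^(- kap y)] factors out;
    the growth [om y <= 4 shh y ^ 2] is cancelled by the [1 / X^2] of [q1]. For [y >= 4] one has
    [shh y >= 1]. *)
Lemma Jq_le y : 4 <= y -> `|Jq y| <= (2 * kap + 1) * (2 * pi) * expR (- (kap * y)).
Proof.
move=> y2; have y0 : 0 < y by lra.
have X0 := shh_gt0 y0.
have X1 : 1 <= shh y.
  rewrite /shh; have h := expR_ge1Dx (y / 2).
  have h2 : expR (- (y / 2)) <= 1 by rewrite -[leRHS]expR0 ler_expR; lra.
  by lra.
have X2 : 0 < shh y ^+ 2 by rewrite exprn_gt0.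
have q1b : `|q1 (eh kap) (eh' kap) (shh y)| <= (2 * kap + 1) * expR (- (kap * y)) / shh y ^+ 2 * (pi / 2).
  rewrite -Rintegral_invDsqr -RintegralZl//; last exact: integrable_invDsqr.
  apply: normr_Rintegral_le => //; [|exact: int_cauchy|].
    exact: (int_q1 (@der_eh R kap) (@der_eh' R kap) (fun t => @eh_le _ kap t kap0) (fun t => @eh'_le _ kap t kap0) X0).
  move=> r _; apply: le_trans (K1_pointwise _ _ _) _.
  set v := shh y * hyp r.
  have vX : shh y <= v by rewrite ler_peMr ?hyp_ge1// ltW.
  have v0 : 0 < v by lra.
  have ay : y <= 2 * ash v by have := ash_le vX; rewrite ash_shh; lra.
  have E : expR (- (kap * (2 * ash v))) <= expR (- (kap * y)) by rewrite ler_expR lerN2 ler_pM2l.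
  have h2 : 0 < hyp v ^+ 2 by rewrite exprn_gt0// hyp_gt0.
  rewrite -[leRHS]mulrA; apply: ler_pM.
  - by rewrite addr_ge0// mulr_ge0.
  - by rewrite invr_ge0 ltW.
  - rewrite /eh' /eh normrM normrN (gtr0_norm kap0) !(gtr0_norm (expR_gt0 _)).
    have -> : 2 * (kap * expR (- (kap * (2 * ash v)))) + expR (- (kap * (2 * ash v))) = (2 * kap + 1) * expR (- (kap * (2 * ash v))) by ring.
    by rewrite ler_pM2l//; have := kap0; lra.
  - rewrite -invfM lef_pV2 ?posrE//; last by rewrite mulr_gt0// ltr_pwDl// sqr_ge0.
    by rewrite -hyp2 -exprMn -/v [hyp v ^+ 2]hyp2 lerDr.
have omb : om y <= 4 * shh y ^+ 2.
  have c0 := chh_gt0 y; have c2 := chh2 y.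
  have Xc : shh y <= chh y by rewrite -hyp_shh; apply: le_trans (ler_norm _) (le_hyp _).
  have sb : Num.sqrt (snh y) <= 2 * chh y.
    have -> : 2 * chh y = Num.sqrt ((2 * chh y) ^+ 2) by rewrite sqrtr_sqr ger0_norm// mulr_ge0// ltW.
    by apply: ler_wsqrtr; rewrite /snh; nra.
  apply: (@le_trans _ _ (2 * chh y * chh y)); first by rewrite ler_pM2r.
  by rewrite -mulrA -expr2 c2; nra.
rewrite /Jq /JJ normrM (gtr0_norm (om_gt0 y0)).
have piq : 0 <= pi / 2 :> R by rewrite divr_ge0// pi_ge0.
apply: (@le_trans _ _ (4 * shh y ^+ 2 * ((2 * kap + 1) * expR (- (kap * y)) / shh y ^+ 2 * (pi / 2)))).
  by apply: ler_pM => //; exact: (ltW (om_gt0 y0)).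
rewrite le_eqVlt; apply/orP; left; apply/eqP.
move: (pi : R) (expR _) => q E; field; rewrite gt_eqF//.
Qed.

Lemma Jq_cvg0 : Jq y @[y --> +oo] --> (0 : R).
Proof.
have h : (2 * kap + 1) * (2 * pi) * expR (- (kap * y)) @[y --> +oo] --> (0 : R).
  rewrite -[X in _ --> X](mulr0 ((2 * kap + 1) * (2 * pi))); apply: cvgM; first exact: cvg_cst.
  exact: cvg_expRN_pinfty.
apply/norm_cvg0P; apply: (squeeze_cvgr _ (@cvgy_cst R 0) h); near=> y.
rewrite normr_ge0 /=; apply: Jq_le; near: y; apply: nbhs_pinfty_ge; exact: num_real.
Unshelve. all: by end_near. Qed.

Lemma uk_small (e : R) : 0 < e -> exists2 d : R, 0 < d & forall y, 0 < y -> y < d \/ d^-1 < y -> `|uk y| <= e.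
Proof.
move=> e0.
have h1 : cW * prim Jq be * Jp y @[y --> 0^'+] --> (0 : R).
  rewrite -[X in _ --> X](mulr0 (cW * prim Jq be)); apply: cvgM; [exact: cvg_cst|exact: Jp_cvg0].
have h2 : cW * prim Jp be * Jq y @[y --> +oo] --> (0 : R).
  rewrite -[X in _ --> X](mulr0 (cW * prim Jp be)); apply: cvgM; [exact: cvg_cst|exact: Jq_cvg0].
move/cvgrPdist_le : h1 => /(_ _ e0)[d1 /= d10 P1].
move/cvgrPdist_le : h2 => /(_ _ e0)[M [_ P2]].
pose d := Num.min (Num.min d1 al) (Num.min be^-1 (`|M| + 1)^-1).
have be0 : 0 < be by exact: lt_trans alb.
have M1 : 0 < `|M| + 1 by rewrite ltr_wpDl.
have d0 : 0 < d by rewrite !lt_min d10 al0 !invr_gt0 be0 M1.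
exists d => // y y0 [yd|yd].
  have := yd; rewrite !lt_min => /andP[/andP[yd1 ya] _].
  rewrite uk_lo//; have := P1 y; rewrite /= !sub0r !normrN; apply => //.
  by rewrite gtr0_norm.
have : be < y /\ `|M| + 1 < y.
  have h3 : d <= be^-1 by rewrite !ge_min lexx orbT.
  have h4 : d <= (`|M| + 1)^-1 by rewrite !ge_min lexx !orbT.
  split; apply: le_lt_trans yd.
    by rewrite -[leLHS]invrK lef_pV2 ?posrE ?invr_gt0.
  by rewrite -[leLHS]invrK lef_pV2 ?posrE ?invr_gt0.
move=> [yb yM]; rewrite uk_hi ?(ltW yb)//; have := P2 y; rewrite sub0r normrN; apply.
by have := ler_norm M; lra.
Qed.

(** [uk_small] treats [y < d] and [y > 1 / d]; in between it is compactness, applied to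
    [uk (max y d)], which is continuous on the whole line. *)
Lemma uk_bounded : exists M : R, forall y, 0 < y -> `|uk y| <= M.
Proof.
have [d d0 P] := uk_small (@ltr01 R).
pose F y := uk (Num.max y d).
have cm t : {for t, continuous (fun y : R => Num.max y d)}.
  by apply: continuous_max; [exact: cvg_id|exact: cvg_cst].
have cF t : {for t, continuous F}.
  have m0 : 0 < Num.max t d by rewrite lt_max d0 orbT.
  exact: (continuous_comp (cm t) (der_cts (der_uk m0))).
have [M M0 H] := @continuous_bounded_itv R F d d^-1 cF.
exists (Num.max 1 M) => y y0; rewrite le_max.
have [yd|yd] := ltP y d; first by rewrite P//; left.
have [yd2|yd2] := ltP d^-1 y; first by rewrite P//; right.
by apply/orP; right; have := H y; rewrite /F max_l//; apply; rewrite yd yd2.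
Qed.

(** For [y] outside the support of [beta] the order of [y] and [e] is the same for all [e] in the
    support, so one case of [resolvent_Ef] covers the whole integral. *)
Lemma uk_E y : 0 < y -> y < al \/ be < y ->
  uk y = pi^-1 * Rintegral mu `[al / 2, be] (fun e => beta e * Rintegral mu `[0, +oo[ (fun s => Ef s y e * (kap ^+ 2 + s ^+ 2)^-1)).
Proof.
move=> y0 H.
have pi0 : pi != 0 :> R by rewrite gt_eqF// pi_gt0.
have iJ (f : R -> R) : (forall t, 0 < t -> {for t, continuous f}) -> mu.-integrable `[al / 2, be] (EFin \o (fun e => f e * beta e)).
  by move=> cf; apply: continuous_integrable_itv => t /andP[t0 _]; apply: ctsM; [apply: cf; have := al0; lra|exact: cb].
have EfC s e : Ef s y e = Ef s e y := congr1 (fun z => z / bb s) (mulrC (Js s y) (Js s e)).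
have cE : cW = pi^-1 * - (2 * (kap ^+ 2 - 1 / 4))^-1.
  rewrite /cW; move: (kap ^+ 2 - 1 / 4) k0 => K K0; have K1 : K != 0 by rewrite gt_eqF.
  by move: (pi : R) pi0 => q pi0; field; rewrite pi0 K1.
case: H => ya.
  rewrite uk_lo// cE -!mulrA; congr (_ * _); rewrite mulrA mulrAC /prim -RintegralZl//; last exact: iJ.
  apply: eq_Rintegral => e; rewrite inE/= in_itv/= => /andP[e1 e2].
  have [ea|ea] := ltP e al; first by rewrite b_lo// mulr0 mul0r mulr0.
  by rewrite resolvent_Ef//; [ring|exact: lt_le_trans ea].
rewrite uk_hi ?(ltW ya)// cE -!mulrA; congr (_ * _); rewrite mulrA mulrAC /prim -RintegralZl//; last exact: iJ.
apply: eq_Rintegral => e; rewrite inE/= in_itv/= => /andP[e1 e2].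
under eq_Rintegral do rewrite EfC.
by rewrite resolvent_Ef//; [ring|have := al0; lra|exact: le_lt_trans ya].
Qed.

End inhomogeneous.

(** * Smooth functions and the maximum principle *)

Section smooth_functions.
Variable R : realType.
Implicit Types (f g : R -> R -> R) (x y t : R) (k : nat).
Definition cont2 f := forall p : R * R, {for p, continuous (fun q : R * R => f q.1 q.2)}.

Lemma within_setT f : {within setT, continuous (fun q : R * R => f q.1 q.2)} <-> cont2 f.
Proof.
have [h1 h2] := @continuous_subspace_setT _ _ (fun q : R * R => f q.1 q.2).
by split => h; [move=> p; exact: (h2 h p)|apply: h1 => p; exact: h].
Qed.

Lemma Ck0 f : cont2 f -> Ck_on 0 setT f.
Proof. by move=> cf; split; [exact/within_setT|]. Qed.

Lemma cont2_fst : cont2 (fun x _ => x).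
Proof. by move=> p; exact: cvg_fst. Qed.

Lemma cont2_snd : cont2 (fun _ y => y).
Proof. by move=> p; exact: cvg_snd. Qed.

Lemma cont2_cst (c : R) : cont2 (fun _ _ => c).
Proof. by move=> p; exact: cvg_cst. Qed.

Lemma cont2D f g : cont2 f -> cont2 g -> cont2 (fun x y => f x y + g x y).
Proof. by move=> cf cg p; apply: cvgD; [exact: cf|exact: cg]. Qed.

Lemma cont2M f g : cont2 f -> cont2 g -> cont2 (fun x y => f x y * g x y).
Proof. by move=> cf cg p; apply: cvgM; [exact: cf|exact: cg]. Qed.

Lemma cont2_comp (h : R -> R) f : cont2 f -> (forall x y, {for f x y, continuous h}) ->
  cont2 (fun x y => h (f x y)).
Proof.
move=> cf ch p; exact: (continuous_comp (cf p) (ch p.1 p.2)).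
Qed.

Lemma CkS k f fx fy : cont2 f ->
  (forall x y, is_derive x 1 (fun t => f t y) (fx x y)) ->
  (forall x y, is_derive y 1 (fun t => f x t) (fy x y)) ->
  Ck_on k setT fx -> Ck_on k setT fy -> Ck_on k.+1 setT f.
Proof.
move=> cf dfx dfy cx cy.
have ex : dx f = fx.
  by apply/funext => x; apply/funext => y; rewrite /dx derive1E; have [_ ->] := dfx x y.
have ey : dy f = fy.
  by apply/funext => x; apply/funext => y; rewrite /dy derive1E; have [_ ->] := dfy x y.
split; first exact/within_setT.
split; last by rewrite ex ey.
by move=> p _; split; [have [] := dfx p.1 p.2|have [] := dfy p.1 p.2].
Qed.

Lemma Ck_cont k f : Ck_on k setT f -> cont2 f.
Proof. by case: k => [|k] [h _]; exact/within_setT. Qed.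

Lemma Ck_der k f : Ck_on k.+1 setT f ->
  [/\ forall x y, is_derive x 1 (fun t => f t y) (dx f x y),
      forall x y, is_derive y 1 (fun t => f x t) (dy f x y),
      Ck_on k setT (dx f) & Ck_on k setT (dy f)].
Proof.
move=> [_ [d [cx cy]]]; split => // x y.
  by have [d1 _] := d (x, y) Logic.I; apply: DeriveDef => //; rewrite /dx derive1E.
by have [_ d1] := d (x, y) Logic.I; apply: DeriveDef => //; rewrite /dy derive1E.
Qed.

Lemma Ck_pred k f : Ck_on k.+1 setT f -> Ck_on k setT f.
Proof.
elim: k f => [|k IH] f [c [d [cx cy]]]; first exact: (conj c).
exact: (conj c (conj d (conj (IH _ cx) (IH _ cy)))).
Qed.

Lemma Ck_cst k (c : R) : Ck_on k setT (fun _ _ => c).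
Proof.
elim: k c => [|k IH] c; first exact: (Ck0 (f := fun _ _ => c) (@cont2_cst c)).
have hx (x y : R) : is_derive x (1 : R) (fun=> c) 0 by exact: derC.
exact: (@CkS k (fun _ _ => c) (fun _ _ => 0) (fun _ _ => 0) (@cont2_cst c) hx (fun x y => hx y x) (IH 0) (IH 0)).
Qed.

Lemma Ck_x k : Ck_on k setT (fun x _ : R => x).
Proof.
case: k => [|k]; first exact: (@Ck0 (fun x _ => x) cont2_fst).
have hx (x y : R) : is_derive x (1 : R) (fun t => t) 1 by exact: derI.
have hy (x y : R) : is_derive y (1 : R) (fun=> x) 0 by exact: derC.
exact: (@CkS k (fun x _ => x) (fun _ _ => 1) (fun _ _ => 0) cont2_fst hx hy (Ck_cst k 1) (Ck_cst k 0)).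
Qed.

Lemma Ck_y k : Ck_on k setT (fun _ y : R => y).
Proof.
case: k => [|k]; first exact: (@Ck0 (fun _ y => y) cont2_snd).
have hx (x y : R) : is_derive x (1 : R) (fun=> y) 0 by exact: derC.
have hy (x y : R) : is_derive y (1 : R) (fun t => t) 1 by exact: derI.
exact: (@CkS k (fun _ y => y) (fun _ _ => 0) (fun _ _ => 1) cont2_snd hx hy (Ck_cst k 0) (Ck_cst k 1)).
Qed.

Lemma CkD k f g : Ck_on k setT f -> Ck_on k setT g -> Ck_on k setT (fun x y => f x y + g x y).
Proof.
elim: k f g => [|k IH] f g cf cg.
  exact: (Ck0 (cont2D (Ck_cont cf) (Ck_cont cg))).
have [fx fy cfx cfy] := Ck_der cf; have [gx gy cgx cgy] := Ck_der cg.
exact: (@CkS k (fun x y => f x y + g x y) (fun x y => dx f x y + dx g x y) (fun x y => dy f x y + dy g x y)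
  (cont2D (Ck_cont cf) (Ck_cont cg)) (fun x y => derD (fx x y) (gx x y)) (fun x y => derD (fy x y) (gy x y))
  (IH _ _ cfx cgx) (IH _ _ cfy cgy)).
Qed.

Lemma CkM k f g : Ck_on k setT f -> Ck_on k setT g -> Ck_on k setT (fun x y => f x y * g x y).
Proof.
elim: k f g => [|k IH] f g cf cg.
  exact: (Ck0 (cont2M (Ck_cont cf) (Ck_cont cg))).
have [fx fy cfx cfy] := Ck_der cf; have [gx gy cgx cgy] := Ck_der cg.
have cf' := Ck_pred cf; have cg' := Ck_pred cg.
exact: (@CkS k (fun x y => f x y * g x y) (fun x y => dx f x y * g x y + f x y * dx g x y)
  (fun x y => dy f x y * g x y + f x y * dy g x y)
  (cont2M (Ck_cont cf) (Ck_cont cg)) (fun x y => derM (fx x y) (gx x y)) (fun x y => derM (fy x y) (gy x y))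
  (CkD (IH _ _ cfx cg') (IH _ _ cf' cgx)) (CkD (IH _ _ cfy cg') (IH _ _ cf' cgy))).
Qed.

(** One-variable functions with [k] continuous derivatives at the points of [D]; the set [D] lets
    [ln] and inverse powers be composed with positive functions. *)
Fixpoint C1k k (D : set R) (g : R -> R) : Prop :=
  (forall t, D t -> {for t, continuous g}) /\
  match k with
  | 0 => True
  | k'.+1 => exists g' : R -> R, (forall t, D t -> is_derive t 1 g (g' t)) /\ C1k k' D g'
  end.

Lemma Ck_comp k D (h : R -> R) f : C1k k D h -> (forall x y, D (f x y)) -> Ck_on k setT f ->
  Ck_on k setT (fun x y => h (f x y)).
Proof.
elim: k h => [|k IH] h ch Df cf.
  by apply: (@Ck0 (fun x y => h (f x y)) (cont2_comp (Ck_cont cf) _)) => x y; exact: ch.1.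
have [c [h' [dh ch']]] := ch; have [fx fy cfx cfy] := Ck_der cf.
have cf' := Ck_pred cf.
have ih := IH _ ch' Df cf'.
apply: (@CkS k (fun x y => h (f x y)) (fun x y => h' (f x y) * dx f x y) (fun x y => h' (f x y) * dy f x y)
  _ _ _ (CkM ih cfx) (CkM ih cfy)).
- by apply: (cont2_comp (Ck_cont cf)) => x y; exact: c.
- by move=> x y; exact: (der_comp (dh _ (Df x y)) (fx x y)).
- by move=> x y; exact: (der_comp (dh _ (Df x y)) (fy x y)).
Qed.

Lemma C1kD k D (g h : R -> R) : C1k k D g -> C1k k D h -> C1k k D (fun t => g t + h t).
Proof.
elim: k g h => [|k IH] g h cg ch.
  split => // t Dt; apply: ctsD; [exact: cg.1|exact: ch.1].
have [c1 [g' [dg cg']]] := cg; have [c2 [h' [dh ch']]] := ch.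
split; first by move=> t Dt; apply: ctsD; [exact: c1|exact: c2].
exists (fun t => g' t + h' t); split; last exact: IH.
by move=> t Dt; apply: derD; [exact: dg|exact: dh].
Qed.

Lemma C1kZ k D (c : R) (g : R -> R) : C1k k D g -> C1k k D (fun t => c * g t).
Proof.
elim: k g => [|k IH] g cg.
  by split => // t Dt; have c1 : {for t, continuous g} := cg.1 t Dt; cts.
have [c1 [g' [dg cg']]] := cg.
split; first by move=> t Dt; have c2 : {for t, continuous g} := c1 t Dt; cts.
exists (fun t => c * g' t); split; last exact: IH.
by move=> t Dt; have d := dg t Dt; der; rewrite /=; ring.
Qed.

(* The derivative of [Fm m] is [Fm m.+2 - m Fm m.+1], so these functions generate all derivatives of the standard bump. *)
Definition Fm m t : R := if 0 < t then t ^- m * expR (- t^-1) else 0.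

Lemma Fm_pos m t : 0 < t -> Fm m t = t ^- m * expR (- t^-1). Proof. by rewrite /Fm => ->. Qed.
Lemma Fm_neg m t : t <= 0 -> Fm m t = 0. Proof. by rewrite /Fm ltNge => ->. Qed.

Lemma Fm_ge0 m t : 0 <= Fm m t.
Proof. by rewrite /Fm; case: ifP => // t0; rewrite mulr_ge0 ?expR_ge0// invr_ge0 exprn_ge0// ltW. Qed.

(** From [e^(1/t) >= t^-(m+2) / (m+2)!]. The quadratic bound gives the derivative 0 at the origin
    through [der_quad]. *)
Lemma Fm_small m t : `|Fm m t| <= (m.+2)`!%:R * t ^+ 2.
Proof.
have [t0|t0] := ltP 0 t; last by rewrite Fm_neg// normr0 mulr_ge0// sqr_ge0.
rewrite ger0_norm ?Fm_ge0// Fm_pos//.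
have f0 : 0 < (m.+2)`!%:R :> R by rewrite ltr0n fact_gt0.
have tn : t != 0 by rewrite gt_eqF.
have h : (t^-1) ^+ m.+2 <= (m.+2)`!%:R * expR (t^-1).
  have ti : 0 <= t^-1 by rewrite invr_ge0 ltW.
  have := @expR_ge1Dxn R t^-1 m.+1 ti => e.
  rewrite mulrC -ler_pdivrMr//; lra.
rewrite expRN -ler_pdivlMr ?invr_gt0 ?expR_gt0// invrK.
have -> : t ^- m = (t^-1) ^+ m.+2 * t ^+ 2 by rewrite -exprVn -[m.+2]addn2 exprD -mulrA -exprMn mulVf// expr1n mulr1.
by rewrite [leRHS]mulrAC ler_pM2r ?exprn_gt0.
Qed.

Lemma der_quad (h : R -> R) (C : R) : h 0 = 0 -> (forall t, `|h t| <= C * t ^+ 2) -> is_derive (0 : R) (1 : R) h 0.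
Proof.
move=> h0 hC.
have C0 : 0 <= C by have := le_trans (normr_ge0 _) (hC 1); rewrite expr1n mulr1.
have key : (fun u => u^-1 *: (h (u *: (1 : R) + 0) - h 0)) @ 0^' --> (0 : R).
  apply/cvgrPdist_le => e e0; exists (e / (C + 1)) => /=; first by rewrite divr_gt0//; lra.
  move=> u /=; rewrite sub0r normrN => ue u0.
  rewrite h0 subr0 addr0 sub0r normrN normrM normfV /GRing.scale/= mulr1.
  have un : 0 < `|u| by rewrite normr_gt0.
  rewrite mulrC ler_pdivrMr//; apply: le_trans (hC u) _.
  rewrite -real_normK ?num_real// expr2 mulrA ler_pM2r//.
  move: ue; rewrite ltr_pdivlMr; last lra.
  by move=> ue; rewrite mulrC; nra.
apply: DeriveDef; first by apply/cvg_ex; exists 0.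
exact/cvg_lim.
Qed.

Lemma FmS m t : 0 < t -> Fm m.+1 t = t^-1 * Fm m t.
Proof. by move=> t0; rewrite !Fm_pos// exprS invfM mulrA. Qed.

Lemma Fm_exp m t : 0 < t -> Fm m t = expR (- (m%:R * ln t) - t^-1).
Proof.
by move=> t0; rewrite Fm_pos// expRD [in RHS]expRN expRM_natl lnK ?posrE.
Qed.

Lemma der_Fm m t : is_derive t 1 (Fm m) (Fm m.+2 t - m%:R * Fm m.+1 t).
Proof.
have [t0|t0|t0] := ltgtP t 0.
- rewrite !Fm_neg ?(ltW t0)// mulr0 subrr.
  apply: (near_eq_is_derive _ (@derC R 0 t)).
  near=> u; rewrite Fm_neg//; apply/ltW; near: u; exact: lt_nbhsl.
- have tn : t != 0 by rewrite gt_eqF.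
  have d : is_derive t 1 (fun t => expR (- (m%:R * ln t) - t^-1)) (Fm m.+2 t - m%:R * Fm m.+1 t).
    by der => //; rewrite /= !FmS// Fm_exp//; field.
  apply: (near_eq_is_derive _ d).
  near=> u; rewrite Fm_exp//; near: u; exact: lt_nbhsr.
- rewrite t0 !Fm_neg// mulr0 subrr; apply: (@der_quad _ (m.+2)`!%:R); first by rewrite Fm_neg.
  exact: Fm_small.
Unshelve. all: by end_near. Qed.

Lemma C1k_Fm k m : C1k k setT (Fm m).
Proof.
elim: k m => [|k IH] m; first by split => // t _; exact: der_cts (der_Fm m t).
split; first by move=> t _; exact: der_cts (der_Fm m t).
exists (fun t => Fm m.+2 t - m%:R * Fm m.+1 t); split; first by move=> t _; exact: der_Fm.
have -> : (fun t => Fm m.+2 t - m%:R * Fm m.+1 t) = (fun t => Fm m.+2 t + (- m%:R) * Fm m.+1 t).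
  by apply/funext => t; rewrite mulNr.
by apply: C1kD; [exact: IH|apply: C1kZ; exact: IH].
Qed.

Lemma C1k_Vn k m : C1k k [set t : R | 0 < t] (fun t => t ^- m.+1).
Proof.
elim: k m => [|k IH] m.
  split => // t /= t0; have c : {for t, continuous (fun x : R => x ^+ m.+1)} by cts.
  by cts; rewrite expf_neq0// gt_eqF.
have d (t : R) : 0 < t -> is_derive t 1 (fun t => t ^- m.+1) (- m.+1%:R * t ^- m.+2).
  move=> t0; have tn : t != 0 by rewrite gt_eqF.
  have d0 : is_derive t 1 (fun t : R => t^-1) (- (t^-1) ^+ 2) by der => //; rewrite /=; field.
  have -> : (fun t : R => t ^- m.+1) = (fun t => (t^-1) ^+ m.+1) by apply/funext => u; rewrite exprVn.
  by apply: (der_eq (derX m.+1 d0)); rewrite -exprVn -[m.+2]addn2 exprD /=; ring.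
split; first by move=> t /= t0; exact: der_cts (d t t0).
by exists (fun t => - m.+1%:R * t ^- m.+2); split => //; apply: C1kZ; exact: IH.
Qed.

Lemma C1k_ln k : C1k k [set t : R | 0 < t] (@ln R).
Proof.
case: k => [|k]; first by split => // t /= t0; exact: continuous_ln.
split; first by move=> t /= t0; exact: continuous_ln.
exists (fun t => t ^- 1); split; last exact: C1k_Vn.
by move=> t /= t0; rewrite expr1; exact: is_derive1_ln.
Qed.

Lemma C1k_trig k (a : R) : C1k k setT (fun t => cos (a * t)) /\ C1k k setT (fun t => sin (a * t)).
Proof.
elim: k => [|k [IHc IHs]]; first by split; split => // t _; cts.
split; (split; first by move=> t _; cts).
  exists (fun t => - a * sin (a * t)); split; last exact: C1kZ.
  by move=> t _; der; rewrite /=; ring.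
exists (fun t => a * cos (a * t)); split; last exact: C1kZ.
by move=> t _; der; rewrite /=; ring.
Qed.

End smooth_functions.

(** * The maximum principle *)

Section maximum_principle.
Variable R : realType.
Implicit Types (x y t : R) (u W : R -> R -> R).

(** If [l > 0], then [f1] vanishes at [x] and is positive just to its right, and the mean value
    theorem gives a value of [f] above the maximum. *)
Lemma max_second_der (f f1 : R -> R) (x l d : R) : 0 < d ->
  (forall t, `|t - x| < d -> is_derive t 1 f (f1 t)) -> is_derive x 1 f1 l ->
  (forall t, `|t - x| < d -> f t <= f x) -> l <= 0.
Proof.
move=> d0 df df1 fmax; rewrite leNgt; apply/negP => l0.
have xx : `|x - x| < d by rewrite subrr normr0.
have ball_itv t : x - d < t < x + d -> `|t - x| < d by rewrite ltr_norml; lra.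
have f10 : f1 x = 0.
  have xd : x \in `]x - d, x + d[ by rewrite in_itv/=; lra.
  have h := @derive1_at_max R f (x - d) (x + d) x _ _ xd.
  have [] := h; first by lra.
  - by move=> t; rewrite in_itv/= => /ball_itv td; have [] := df t td.
  - by move=> t; rewrite in_itv/= => /ball_itv; exact: fmax.
  - by move=> _; have [_ ->] := df x xx.
have [dd ed] := df1.
have cv : (fun h => h^-1 *: (f1 (h *: (1 : R) + x) - f1 x)) @ 0^' --> l.
  by rewrite -ed; exact: dd.
have l2 : 0 < l / 2 by lra.
move/cvgrPdist_lt : cv => /(_ _ l2)[e /= e0 P].
pose h := Num.min (d / 2) (e / 2).
have h0 : 0 < h by rewrite lt_min; apply/andP; split; lra.
have hd : h <= d / 2 by rewrite ge_min lexx.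
have he : h <= e / 2 by rewrite ge_min lexx orbT.
have pos c : x < c <= x + h -> 0 < f1 c.
  move=> /andP[xc ch].
  have c0 : 0 < c - x by lra.
  have := P (c - x); rewrite /= sub0r normrN gtr0_norm// f10 subr0 /GRing.scale/= mulr1 subrK.
  have ce : c - x < e by lra.
  move=> /(_ ce); rewrite gt_eqF// => /(_ isT); rewrite ltr_norml => /andP[_ k].
  have : 0 < (c - x)^-1 * f1 c by lra.
  by rewrite pmulr_rgt0// invr_gt0.
have xh : x < x + h by lra.
have [||c cI e1] := @MVT R f f1 x (x + h) xh.
- move=> t; rewrite in_itv/= => /andP[t1 t2]; apply: df; apply: ball_itv; lra.
- apply: continuous_within_itv => t; rewrite in_itv/= => /andP[t1 t2].
  by apply: der_cts; apply: df; apply: ball_itv; lra.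
move: cI; rewrite in_itv/= => /andP[c1 c2].
have := fmax (x + h); rewrite (_ : x + h - x = h); last by ring.
rewrite gtr0_norm// => /(_ _) k.
have hd2 : h < d by lra.
have fc : 0 < f1 c by apply: pos; lra.
have : 0 < f1 c * (x + h - x) by rewrite mulr_gt0//; lra.
by rewrite -e1; have := k hd2; lra.
Qed.

Lemma Pconf_gt0 y : 0 < y -> 0 < Pconf y.
Proof.
move=> y0; rewrite /Pconf divr_gt0//.
rewrite mulr_gt0// exprn_gt0// subr_gt0 -[X in X < _]expR0 ltr_expR; lra.
Qed.

Lemma is_derive_dx u x y : derivable (fun t => u t y) x 1 -> is_derive x 1 (fun t => u t y) (dx u x y).
Proof. by move=> h; apply: DeriveDef; [exact: h|rewrite /dx derive1E]. Qed.

Lemma is_derive_dy u x y : derivable (fun t => u x t) y 1 -> is_derive y 1 (fun t => u x t) (dy u x y).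
Proof. by move=> h; apply: DeriveDef; [exact: h|rewrite /dy derive1E]. Qed.

(** At an interior positive maximum of [u - W] both second derivatives are nonpositive and
    [P (u - W) > 0], so [- L u > - L W], against the supersolution inequality. The boundary
    condition on [W] is only an asymptotic lower bound, so that [W] may be the solution of a larger
    domain or a barrier. *)
Lemma comparison (O : set (R * R)) u W (Wx Wy Wxx Wyy phi : R -> R -> R) :
  open O -> compact (closure O) -> closure O `<=` @Sigma R ->
  Ck_on 2 O u ->
  (forall b, (closure O `\` O) b -> (fun p : R * R => u p.1 p.2) @ within O (nbhs b) --> (0 : R)) ->
  (forall p, O p -> - Lop u p.1 p.2 = phi p.1 p.2) ->
  (forall p : R * R, O p -> {for p, continuous (fun q : R * R => W q.1 q.2)}) ->
  (forall x y, O (x, y) -> is_derive x 1 (fun t => W t y) (Wx x y)) ->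
  (forall x y, O (x, y) -> is_derive x 1 (fun t => Wx t y) (Wxx x y)) ->
  (forall x y, O (x, y) -> is_derive y 1 (fun t => W x t) (Wy x y)) ->
  (forall x y, O (x, y) -> is_derive y 1 (fun t => Wy x t) (Wyy x y)) ->
  (forall x y, O (x, y) -> phi x y <= Pconf y * W x y - (Wxx x y + Wyy x y)) ->
  (forall b (e : R), (closure O `\` O) b -> 0 < e -> \forall p \near within O (nbhs b), - e <= W p.1 p.2) ->
  forall x y, O (x, y) -> u x y <= W x y.
Proof.
move=> oO cO OS [cu [du [[cux [dux _]] [cuy [duy _]]]]] bu Lu cW dWx dWxx dWy dWyy sup bW x0 y0 O0.
rewrite leNgt; apply/negP => uW.
pose v (p : R * R) := u p.1 p.2 - W p.1 p.2.
pose m := u x0 y0 - W x0 y0.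
have m0 : 0 < m by rewrite /m subr_gt0.
pose f (p : R * R) := if p \in O then Num.max (v p) (m / 2) else m / 2.
have cu' p : O p -> {for p, continuous (fun q : R * R => u q.1 q.2)}.
  by move=> Op; move: cu; rewrite continuous_open_subspace// => /(_ p); rewrite inE; apply.
have cf : {within closure O, continuous f}.
  apply/subspace_continuousP => p cp.
  have [Op|Op] := pselect (O p).
    have cv : {for p, continuous v} by apply: cvgB; [exact: cu'|exact: cW].
    have cfp : f @ p --> f p.
      have -> : f p = Num.max (v p) (m / 2) by rewrite /f mem_set.
      have cm : (fun q => Num.max (v q) (m / 2)) @ p --> Num.max (v p) (m / 2).
        by apply: (@continuous_max R _ v (cst (m / 2)) p) => //; exact: cvg_cst.
      apply: cvg_trans cm; apply: near_eq_cvg; near=> q.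
      rewrite /f mem_set//; near: q; exact: (open_nbhs_nbhs (conj oO Op)).
    exact: cvg_within_filter cfp.
  have fp : f p = m / 2 by rewrite /f memNset.
  change (f x @[x --> within (closure O) (nbhs p)] --> f p).
  rewrite fp; apply: cvg_near_cst.
  have bp : (closure O `\` O) p by [].
  have m4 : 0 < m / 4 by lra.
  have h1 := bW p (m / 4) bp m4.
  have h2 : \forall q \near within O (nbhs p), u q.1 q.2 < m / 4.
    have := bu p bp => /cvgrPdist_lt /(_ _ m4); apply: filterS => q /=.
    by rewrite sub0r normrN; exact: le_lt_trans (ler_norm _).
  have h3 : \forall q \near nbhs p, O q -> - (m / 4) <= W q.1 q.2 /\ u q.1 q.2 < m / 4.
    by near=> q => Oq; split; move: Oq; near: q; [exact: h1|exact: h2].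
  have h4 : \forall q \near nbhs p, closure O q -> f q = m / 2.
    apply: filterS h3 => q h3 _; rewrite /f; case: ifPn => // /set_mem Oq.
    by have [k1 k2] := h3 Oq; rewrite max_r// /v; lra.
  exact: h4.
have cne : closure O !=set0 by exists (x0, y0); exact: subset_closure.
have [c cO1 cmax] := @compact_EVT_max _ R f (closure O) cne cO cf.
have f0 : m <= f (x0, y0) by rewrite /f mem_set// le_max /v lexx.
have fc : m <= f c by apply: le_trans f0 _; apply: cmax; rewrite inE; exact: subset_closure.
have Oc : O c.
  by apply: contrapT => nO; move: fc; rewrite /f memNset//; lra.
have fcv : f c = v c.
  by move: fc; rewrite /f mem_set// le_max => /orP[mv|]; [rewrite max_l//; lra|lra].
have vmax p : O p -> v p <= v c.
  move=> Op; rewrite -fcv; apply: le_trans (cmax p _); last by rewrite inE; exact: subset_closure.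
  by rewrite /f mem_set// le_max lexx.
have vc0 : 0 < v c by rewrite -fcv; lra.
case: c => [c1 c2] in cO1 cmax fc Oc fcv vmax vc0 *.
have : nbhs (c1, c2) O by exact: (open_nbhs_nbhs (conj oO Oc)).
move=> /nbhs_ballP[d /= d0 dO].
have Ox t : `|t - c1| < d -> O (t, c2).
  move=> td; apply: dO; split => /=; last exact: ballxx.
  by rewrite /ball/= distrC.
have Oy t : `|t - c2| < d -> O (c1, t).
  move=> td; apply: dO; split => /=; first exact: ballxx.
  by rewrite /ball/= distrC.
have hx : dx (dx u) c1 c2 - Wxx c1 c2 <= 0.
  apply: (@max_second_der (fun t => u t c2 - W t c2) (fun t => dx u t c2 - Wx t c2) c1 _ d d0).
  - move=> t td; have Ot := Ox t td; apply: derB; last exact: dWx.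
    exact: (is_derive_dx (du (t, c2) Ot).1).
  - apply: derB; last exact: dWxx.
    exact: (is_derive_dx (dux (c1, c2) Oc).1).
  - by move=> t td; exact: (vmax (t, c2) (Ox t td)).
have hy : dy (dy u) c1 c2 - Wyy c1 c2 <= 0.
  apply: (@max_second_der (fun t => u c1 t - W c1 t) (fun t => dy u c1 t - Wy c1 t) c2 _ d d0).
  - move=> t td; have Ot := Oy t td; apply: derB; last exact: dWy.
    exact: (is_derive_dy (du (c1, t) Ot).2).
  - apply: derB; last exact: dWyy.
    exact: (is_derive_dy (duy (c1, c2) Oc).2).
  - by move=> t td; exact: (vmax (c1, t) (Oy t td)).
have L := Lu (c1, c2) Oc; rewrite /Lop /= in L.
have S := sup c1 c2 Oc.
have P0 : 0 < Pconf c2 by apply: Pconf_gt0; exact: (OS _ (subset_closure Oc)).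
have : 0 < Pconf c2 * (u c1 c2 - W c1 c2) by rewrite mulr_gt0.
rewrite mulrBr; lra.
Unshelve. all: by end_near. Qed.

End maximum_principle.

(** * Convergence of the Green's functions *)

Section test_functions.
Variable R : realType.
Implicit Types (O K : set (R * R)) (phi psi : R -> R -> R).

Lemma smooth_cont phi : smooth phi -> cont2 phi.
Proof. by move=> s; exact: (Ck_cont (s 0%N)). Qed.

Lemma smooth_dx phi : smooth phi -> smooth (dx phi).
Proof. by move=> s k; have [_ _ ? _] := Ck_der (s k.+1). Qed.

Lemma smooth_dy phi : smooth phi -> smooth (dy phi).
Proof. by move=> s k; have [_ _ _ ?] := Ck_der (s k.+1). Qed.

Lemma smoothD phi psi : smooth phi -> smooth psi -> smooth (fun x y => phi x y + psi x y).
Proof. by move=> s1 s2 k; exact: CkD (s1 k) (s2 k). Qed.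

Lemma smoothM phi psi : smooth phi -> smooth psi -> smooth (fun x y => phi x y * psi x y).
Proof. by move=> s1 s2 k; exact: CkM (s1 k) (s2 k). Qed.

Lemma smoothN phi : smooth phi -> smooth (fun x y => - phi x y).
Proof.
move=> s; have -> : (fun x y => - phi x y) = (fun x y => (-1) * phi x y).
  by apply/funext => x; apply/funext => y; rewrite mulN1r.
by apply: (smoothM (phi := fun _ _ => -1)) => // k; exact: Ck_cst.
Qed.

Lemma smooth_derx phi : smooth phi -> forall x y : R, is_derive x 1 (fun t => phi t y) (dx phi x y).
Proof. by move=> s; have [] := Ck_der (s 1%N). Qed.

Lemma smooth_dery phi : smooth phi -> forall x y : R, is_derive y 1 (fun t => phi x t) (dy phi x y).
Proof. by move=> s; have [] := Ck_der (s 1%N). Qed.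

Lemma testfun_mono O O' phi : O `<=` O' -> testfun O phi -> testfun O' phi.
Proof. by move=> OO [s [K [cK KO h]]]; split => //; exists K; split => //; exact: subset_trans OO. Qed.

Lemma testfunN O phi : testfun O phi -> testfun O (fun x y => - phi x y).
Proof.
move=> [s [K [cK KO h]]]; split; first exact: smoothN.
by exists K; split => // p Kp; rewrite h// oppr0.
Qed.

Lemma testfunD O phi psi : testfun O phi -> testfun O psi -> testfun O (fun x y => phi x y + psi x y).
Proof.
move=> [s [K [cK KO h]]] [s' [K' [cK' KO' h']]]; split; first exact: smoothD.
exists (K `|` K'); split; first exact: compactU.
- by rewrite subUset.
- by move=> p /not_orP[Kp K'p]; rewrite h// h'// addr0.
Qed.

Lemma dx_eq0 K phi : compact K -> (forall p, ~ K p -> phi p.1 p.2 = 0) ->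
  forall p, ~ K p -> dx phi p.1 p.2 = 0 /\ dy phi p.1 p.2 = 0.
Proof.
move=> cK h [a b] Kp /=.
have oK : open (~` K).
  by rewrite openC; apply: compact_closed => //; exact: norm_hausdorff.
have := open_nbhs_nbhs (conj oK Kp : open_nbhs (a, b) (~` K)).
move=> /nbhs_ballP[d /= d0 dK].
have hx : is_derive a 1 (fun t => phi t b) 0.
  apply: (near_eq_is_derive _ (@derC R 0 a)).
  by exists d => //= t td; apply/esym/(h (t, b)); apply: dK; split => //=; exact: ballxx.
have hy : is_derive b 1 (fun t => phi a t) 0.
  apply: (near_eq_is_derive _ (@derC R 0 b)).
  by exists d => //= t td; apply/esym/(h (a, t)); apply: dK; split => //=; exact: ballxx.
by rewrite /dx /dy !derive1E; split; [have [_ ->] := hx|have [_ ->] := hy].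
Qed.

Lemma testfun_lap O phi : testfun O phi -> testfun O (fun x y => - (dx (dx phi) x y + dy (dy phi) x y)).
Proof.
move=> [s [K [cK KO h]]]; split.
  by apply: smoothN; apply: smoothD; [exact: smooth_dx (smooth_dx s)|exact: smooth_dy (smooth_dy s)].
exists K; split => // p Kp.
have hx q : ~ K q -> dx phi q.1 q.2 = 0 by move=> Kq; exact: (dx_eq0 cK h Kq).1.
have hy q : ~ K q -> dy phi q.1 q.2 = 0 by move=> Kq; exact: (dx_eq0 cK h Kq).2.
by rewrite (dx_eq0 cK hx Kp).1 (dx_eq0 cK hy Kp).2 addr0 oppr0.
Qed.

(** An open set is a countable union of open squares with rational centre and rational half width,
    which belong to the product sigma-algebra. *)
Lemma open_measurable2 (A : set (R * R)) : open A -> measurable A.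
Proof.
move=> oA.
pose sq (a b r : R) : set (R * R) := `]a - r, a + r[%classic `*` `]b - r, b + r[%classic.
pose F (a b r : rat) := if `[<sq (ratr a) (ratr b) (ratr r) `<=` A>] then sq (ratr a) (ratr b) (ratr r) else set0.
have -> : A = \bigcup_a \bigcup_b \bigcup_r F a b r.
  apply/seteqP; split => [[x y] Ap|p [a _ [b _ [r _]]]]; last first.
    by rewrite /F; case: asboolP => // h; exact: h.
  have := open_nbhs_nbhs (conj oA Ap : open_nbhs (x, y) A).
  move=> /nbhs_ballP[d /= d0 dA].
  have d4 : 0 < d / 4 by lra.
  have d42 : d / 4 < d / 2 by lra.
  have [r] := rat_in_itvoo d42; rewrite in_itv/= => /andP[r1 r2].
  have xd : x - d / 4 < x + d / 4 by lra.
  have yd : y - d / 4 < y + d / 4 by lra.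
  have [a] := rat_in_itvoo xd; rewrite in_itv/= => /andP[a1 a2].
  have [b] := rat_in_itvoo yd; rewrite in_itv/= => /andP[b1 b2].
  exists a => //; exists b => //; exists r => //; rewrite /F asboolT.
    by split; rewrite /= in_itv/=; lra.
  move=> [x' y'] [/=]; rewrite !in_itv/= => /andP[h1 h2] /andP[h3 h4].
  by apply: dA; split; rewrite /ball /= ltr_norml; lra.
apply: bigcupT_measurable_rat => a; apply: bigcupT_measurable_rat => b; apply: bigcupT_measurable_rat => r.
by rewrite /F; case: asboolP => // _; apply: measurableX; exact: measurable_itv.
Qed.

Lemma measurable_open_cont (D : set (R * R)) (f : R * R -> R) : open D ->
  (forall p, D p -> {for p, continuous f}) -> measurable_fun D f.
Proof.
move=> oD cf _; apply: (measurability _ (RGenOInfty.measurableE R)) => //.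
  move=> /= _ [_ [x ->] <-]; apply: open_measurable2.
  rewrite openE => p [Dp /=]; rewrite in_itv/= andbT => fp.
  apply: filterI; first exact: (open_nbhs_nbhs (conj oD Dp)).
  have := cf p Dp => c; have : nbhs (f p) [set z | x < z].
    by apply: (open_nbhs_nbhs (conj (@open_gt R x) _)).
  by move=> /c; apply: filterS => q /=; rewrite in_itv/= andbT.
exact: open_measurable2.
Qed.

Lemma measurable_cont2 (f : R -> R -> R) : cont2 f ->
  measurable_fun (setT : set (R * R)) (fun q : R * R => f q.1 q.2).
Proof. by move=> c; apply: measurable_open_cont; [exact: openT|move=> p _; exact: c]. Qed.

Lemma Pconf_snh (y : R) : 0 < y -> Pconf y = 1 / 4 + 3 / (4 * snh y ^+ 2).
Proof.
move=> y0; rewrite /Pconf /snh /shh /chh.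
have e2 : expR (2 * y) = expR (y / 2) ^+ 4 by rewrite -expRM_natl; congr expR; field.
have e4 : expR (4 * y) = expR (y / 2) ^+ 8 by rewrite -expRM_natl; congr expR; field.
rewrite e2 e4 expRN.
have h1 : 1 < expR (y / 2) by rewrite -[X in X < _]expR0 ltr_expR; lra.
move: (expR (y / 2)) h1 => E h1.
have h4 : 1 < E ^+ 4 by rewrite exprn_egt1.
have h2 : 1 < E ^+ 2 by rewrite exprn_egt1.
have h3 : (E - E^-1) * (E + E^-1) = (E ^+ 4 - 1) / E ^+ 2 by field; rewrite gt_eqF; lra.
have -> : 2 * ((E - E^-1) / 2) * ((E + E^-1) / 2) = (E ^+ 4 - 1) / (2 * E ^+ 2).
  by transitivity ((E - E^-1) * (E + E^-1) / 2); [field|rewrite h3; field]; rewrite gt_eqF; lra.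
by field; rewrite !gt_eqF//; lra.
Qed.

Lemma Pconf_ge (y : R) : 0 < y -> 1 / 4 <= Pconf y.
Proof. by move=> y0; rewrite Pconf_snh// lerDl divr_ge0// mulr_ge0// sqr_ge0. Qed.

End test_functions.

(** * Potentials on an exhaustion: positivity, monotonicity, bounds *)

Section green_family.
Variable R : realType.
Variables (Om : nat -> set (R * R)) (G : nat -> R -> R -> R -> R -> R).
Hypothesis exh : exhaustion Om.
Hypothesis dg : forall n, dirichlet_green (Om n) (G n).
Implicit Types (K : set (R * R)) (phi psi W : R -> R -> R).

Lemma Om_mono n m : (n <= m)%N -> Om n `<=` Om m.
Proof.
have [_ h _] := exh.
move=> /subnKC <-; elim: (m - n)%N => [|k IH]; first by rewrite addn0.
by rewrite addnS; apply: subset_trans IH _; apply: subset_trans (h _); exact: subset_closure.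
Qed.

Lemma Om_open n : open (Om n). Proof. by have [h _ _] := exh; have [] := h n. Qed.

Lemma Om_Sigma n : closure (Om n) `<=` @Sigma R.
Proof. by have [h _ _] := exh; have [_ _ _ []] := h n. Qed.

(** Otherwise the sets [K] minus [Om n] generate a proper filter; its cluster point in [K] lies in
    some open [Om n], a contradiction. *)
Lemma Om_compact K : compact K -> K `<=` @Sigma R -> exists n, K `<=` Om n.
Proof.
move=> cK KS; have [_ _ U] := exh.
apply: contrapT => /forallNP nK.
pose F := filter_from (setT : set nat) (fun n => K `\` Om n).
have FF : ProperFilter F.
  apply: filter_from_proper.
    apply: filter_from_filter; first by exists 0%N.
    move=> i j _ _; exists (maxn i j) => // p [Kp Op].
    by split; split => //; apply: contra_not Op; apply: Om_mono; rewrite leq_max leqnn ?orbT.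
  move=> i _; have := nK i => /existsNP[p /not_implyP[Kp Op]]; by exists p.
have FK : F K by exists 0%N => // p [].
have [p [Kp cp]] := cK F FF FK.
have : @Sigma R p by exact: KS.
rewrite -U => -[n _ h].
have FO : F (K `\` Om n) by exists n.
have nO : nbhs p (Om n) by exact: (open_nbhs_nbhs (conj (@Om_open n) h)).
by have [q [[_ h1] h2]] := cp _ _ FO nO.
Qed.

Lemma testfun_Sigma phi : testfun (@Sigma R) phi -> exists n, testfun (Om n) phi.
Proof.
move=> [s [K [cK KS h]]]; have [n Kn] := Om_compact cK KS.
by exists n; split => //; exists K; split.
Qed.

Definition un n phi x y := Rintegral (@leb2 R) (Om n) (fun q : R * R => G n x y q.1 q.2 * phi q.1 q.2).

Lemma mOm n : measurable (Om n).
Proof. by apply: open_measurable2; exact: Om_open. Qed.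

Lemma integrable_un n phi x y : testfun (Om n) phi -> Om n (x, y) ->
  (@leb2 R).-integrable (Om n) (EFin \o (fun q : R * R => G n x y q.1 q.2 * phi q.1 q.2)).
Proof. by move=> t Oxy; have [_ /(_ phi t)[h _]] := dg n; exact: h. Qed.

Lemma unN n phi x y : testfun (Om n) phi -> Om n (x, y) -> un n (fun x y => - phi x y) x y = - un n phi x y.
Proof.
move=> t Oxy; rewrite /un -[RHS]mulN1r -RintegralZl; [|exact: mOm|exact: integrable_un].
by apply: eq_Rintegral => q _; rewrite mulrN mulN1r.
Qed.

Lemma unE n phi : testfun (Om n) phi ->
  [/\ Ck_on 2 (Om n) (un n phi),
      forall b, (closure (Om n) `\` Om n) b ->
          (fun p : R * R => un n phi p.1 p.2) @ within (Om n) (nbhs b) --> (0 : R) &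
      forall p, Om n p -> - Lop (un n phi) p.1 p.2 = phi p.1 p.2].
Proof. by move=> t; have [_ /(_ phi t)[_ h]] := dg n. Qed.

(** Comparison with a supersolution on all of [Sigma] that is nonnegative off a compact [K]. As [K]
    lies in [Om n], each boundary point has a neighbourhood off [K]. *)
Lemma cmp_W n phi K W (Wx Wy Wxx Wyy : R -> R -> R) : testfun (Om n) phi -> compact K -> K `<=` Om n ->
  (forall p : R * R, @Sigma R p -> {for p, continuous (fun q : R * R => W q.1 q.2)}) ->
  (forall x y : R, 0 < y -> is_derive x 1 (fun t => W t y) (Wx x y)) ->
  (forall x y : R, 0 < y -> is_derive x 1 (fun t => Wx t y) (Wxx x y)) ->
  (forall x y : R, 0 < y -> is_derive y 1 (fun t => W x t) (Wy x y)) ->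
  (forall x y : R, 0 < y -> is_derive y 1 (fun t => Wy x t) (Wyy x y)) ->
  (forall x y, 0 < y -> phi x y <= Pconf y * W x y - (Wxx x y + Wyy x y)) ->
  (forall x y, 0 < y -> ~ K (x, y) -> 0 <= W x y) ->
  forall x y, Om n (x, y) -> un n phi x y <= W x y.
Proof.
move=> t cK KO cW dWx dWxx dWy dWyy sup bW.
have [C bd eqn] := unE t.
have [rc _ _] := exh; have [oO _ _ [cO OS] _] := rc n.
have OS' p : Om n p -> 0 < p.2 by move=> Op; exact: (OS _ (subset_closure Op)).
apply: (comparison (phi := phi) (Wx := Wx) (Wy := Wy) (Wxx := Wxx) (Wyy := Wyy) oO cO OS C bd eqn).
- by move=> p Op; apply: cW; exact: OS'.
- by move=> x y Op; apply: dWx; exact: (OS' _ Op).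
- by move=> x y Op; apply: dWxx; exact: (OS' _ Op).
- by move=> x y Op; apply: dWy; exact: (OS' _ Op).
- by move=> x y Op; apply: dWyy; exact: (OS' _ Op).
- by move=> x y Op; apply: sup; exact: (OS' _ Op).
- move=> b e [cb nb] e0.
  have oK : open (~` K).
    by rewrite openC; apply: compact_closed => //; exact: norm_hausdorff.
  have Kb : ~ K b by move=> /KO.
  have := open_nbhs_nbhs (conj oK Kb : open_nbhs b (~` K)).
  move=> h; suff : \forall p \near nbhs b, Om n p -> - e <= W p.1 p.2 by [].
  apply: filterS h => -[p1 p2] Kp Op.
  have := bW p1 p2 (OS' _ Op) Kp; rewrite /=; lra.
Qed.

Lemma cmp_nm n m phi : (n <= m)%N -> testfun (Om n) phi ->
  (forall b (e : R), (closure (Om n) `\` Om n) b -> 0 < e ->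
     \forall p \near within (Om n) (nbhs b), - e <= un m phi p.1 p.2) ->
  forall x y, Om n (x, y) -> un n phi x y <= un m phi x y.
Proof.
move=> nm t bW.
have [C bd eqn] := unE t.
have [[cu [du [[cux [dux _]] [cuy [duy _]]]]] bd' eqn'] := unE (testfun_mono (Om_mono nm) t).
have [rc _ _] := exh; have [oO _ _ [cO OS] _] := rc n.
have Omm := Om_mono nm.
apply: (comparison (phi := phi) (Wx := dx (un m phi)) (Wy := dy (un m phi))
  (Wxx := dx (dx (un m phi))) (Wyy := dy (dy (un m phi))) oO cO OS C bd eqn _ _ _ _ _ _ bW).
- move=> p /Omm Op; move: cu; rewrite continuous_open_subspace; last exact: Om_open.
  by move=> /(_ p); rewrite inE; apply.
- by move=> x y /Omm Op; exact: (is_derive_dx (du _ Op).1).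
- by move=> x y /Omm Op; exact: (is_derive_dx (dux _ Op).1).
- by move=> x y /Omm Op; exact: (is_derive_dy (du _ Op).2).
- by move=> x y /Omm Op; exact: (is_derive_dy (duy _ Op).2).
- by move=> x y /Omm Op; have := eqn' _ Op; rewrite /Lop /=; lra.
Qed.

(** The constant [4 M] is a supersolution because [P >= 1/4]; the bound does not depend on [n]. *)
Lemma un_le n phi (M : R) : testfun (Om n) phi -> 0 <= M -> (forall x y, phi x y <= M) ->
  forall x y, Om n (x, y) -> un n phi x y <= 4 * M.
Proof.
move=> t M0 h.
apply: (@cmp_W n phi set0 (fun _ _ => 4 * M) (fun _ _ => 0) (fun _ _ => 0) (fun _ _ => 0) (fun _ _ => 0)) => //.
- exact: compact0.
- by move=> p _; exact: cvg_cst.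
- by move=> x y _; exact: derC.
- by move=> x y _; exact: derC.
- by move=> x y _; exact: derC.
- by move=> x y _; exact: derC.
- move=> x y y0; apply: le_trans (h x y) _; have := Pconf_ge y0; nra.
- by move=> x y _ _; rewrite mulr_ge0.
Qed.

Lemma un_ge0 n phi : testfun (Om n) phi -> (forall x y, 0 <= phi x y) ->
  forall x y, Om n (x, y) -> 0 <= un n phi x y.
Proof.
move=> t h x y Oxy; have := @un_le n _ 0 (testfunN t) (lexx _) _ x y Oxy.
by rewrite mulr0 unN// oppr_le0; apply => *; rewrite oppr_le0.
Qed.

Lemma un_mono n m phi : (n <= m)%N -> testfun (Om n) phi -> (forall x y, 0 <= phi x y) ->
  forall x y, Om n (x, y) -> un n phi x y <= un m phi x y.
Proof.
move=> nm t h; apply: cmp_nm => // b e bb e0.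
near=> p.
have : 0 <= un m phi p.1 p.2.
  apply: un_ge0 => //; first exact: (testfun_mono (Om_mono nm) t).
  by apply: (Om_mono nm); rewrite -surjective_pairing; near: p; exact: withinT.
lra.
Unshelve. all: by end_near. Qed.

(** Weak subharmonicity of [G m - G n], tested on [psi >= 0]. As [psi] is a supersolution for
    [- Delta psi], the potential on [Om m] is at most [psi], which vanishes on the boundary of
    [Om n]; comparison on [Om n] then applies to the opposite potentials. *)
Lemma un_lap n m psi : (n <= m)%N -> testfun (Om n) psi -> (forall x y, 0 <= psi x y) ->
  forall x y, Om n (x, y) ->
  un m (fun x y => - (dx (dx psi) x y + dy (dy psi) x y)) x y <=
  un n (fun x y => - (dx (dx psi) x y + dy (dy psi) x y)) x y.
Proof.
move=> nm t h x y Oxy.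
set phi := (fun x y => _).
have tl : testfun (Om n) phi := testfun_lap t.
have tm := testfun_mono (Om_mono nm) tl.
have s : smooth psi by case: t.
have um x' y' : Om m (x', y') -> un m phi x' y' <= psi x' y'.
  apply: (@cmp_W m phi set0 psi (dx psi) (dy psi) (dx (dx psi)) (dy (dy psi)) tm).
  - exact: compact0.
  - exact: sub0set.
  - by move=> p _; exact: (smooth_cont s).
  - by move=> a b _; exact: smooth_derx.
  - by move=> a b _; exact: (smooth_derx (smooth_dx s)).
  - by move=> a b _; exact: smooth_dery.
  - by move=> a b _; exact: (smooth_dery (smooth_dy s)).
  - by move=> a b b0; rewrite lerDr mulr_ge0//; exact: ltW (Pconf_gt0 b0).
  - by move=> a b _ _; exact: h.
have e1 := unN tl Oxy; have e2 := unN tm (Om_mono nm Oxy).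
suff : un n (fun x y => - phi x y) x y <= un m (fun x y => - phi x y) x y by rewrite e1 e2 lerN2.
apply: (@cmp_nm n m _ nm (testfunN tl)) => // b e [cb nb] e0.
have cpsi := @smooth_cont R psi s b.
have pb : psi b.1 b.2 = 0 by case: t => _ [K [_ KO hK]]; apply: hK => /KO.
move/cvgrPdist_lt : cpsi => /(_ _ e0) hb.
suff : \forall p \near nbhs b, Om n p -> - e <= un m (fun x y => - phi x y) p.1 p.2 by [].
apply: filterS hb => -[p1 p2] /=; rewrite pb sub0r normrN => hp Op.
have Op' := Om_mono nm Op.
rewrite unN//; have := um _ _ Op'; have := ler_norm (psi p1 p2); lra.
Qed.

End green_family.

(** * Square bumps and testing of continuous functions *)

Section bumps.
Variable R : realType.
Local Notation mu2 := (@leb2 R).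
Implicit Types (q : R * R) (d e : R) (phi : R -> R -> R).
Lemma smooth_cst (c : R) : smooth (fun _ _ => c). Proof. by move=> k; exact: Ck_cst. Qed.
Lemma smooth_x : smooth (fun x _ : R => x). Proof. by move=> k; exact: Ck_x. Qed.
Lemma smooth_y : smooth (fun _ y : R => y). Proof. by move=> k; exact: Ck_y. Qed.

Lemma smooth_comp (D : set R) (h : R -> R) phi : (forall k, C1k k D h) -> (forall x y, D (phi x y)) ->
  smooth phi -> smooth (fun x y => h (phi x y)).
Proof. by move=> ch Dh s k; exact: Ck_comp (ch k) Dh (s k). Qed.

Definition sqr q d : set (R * R) := `[q.1 - d, q.1 + d]%classic `*` `[q.2 - d, q.2 + d]%classic.

Lemma sqrP q d (z : R * R) : sqr q d z <-> `|z.1 - q.1| <= d /\ `|z.2 - q.2| <= d.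
Proof.
rewrite /sqr /= !in_itv/= !ler_norml.
by split => -[/andP[h1 h2] /andP[h3 h4]]; split; lra.
Qed.

Lemma compact_sqr q d : compact (sqr q d).
Proof. by apply: compact_setX; exact: segment_compact. Qed.

Lemma measurable_sqr q d : measurable (sqr q d).
Proof. by apply: measurableX; exact: measurable_itv. Qed.

Lemma leb2_sqr q d : 0 < d -> leb2 (sqr q d) = (4 * d ^+ 2)%:E.
Proof.
move=> d0; rewrite /leb2 /sqr product_measure1E; [|exact: measurable_itv|exact: measurable_itv].
rewrite /= !lebesgue_measure_itv/= !lte_fin !ifT; [|lra|lra].
by rewrite -EFinM; congr EFin; ring.
Qed.

Lemma leb2_set1 (q : R * R) : leb2 [set q] = 0%E.
Proof.
have -> : [set q] = [set q.1] `*` [set q.2].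
  by apply/seteqP; split => [_ ->//|[a b] [/= -> ->]]; case: q.
rewrite /leb2 product_measure1E; [|exact: measurable_set1|exact: measurable_set1].
by rewrite [X in (X * _)%E]lebesgue_measure_set1 mul0e.
Qed.

Lemma sqr_small q (A : set (R * R)) : nbhs q A -> exists2 d, 0 < d & sqr q d `<=` A.
Proof.
move=> /nbhs_ballP[d /= d0 dA]; exists (d / 2); first lra.
move=> z /sqrP[h1 h2]; apply: dA; split; rewrite /ball/= distrC; lra.
Qed.

Lemma nbhs_sqr q d : 0 < d -> nbhs q (sqr q d).
Proof.
move=> d0; apply/nbhs_ballP; exists d => // z [h1 h2]; apply/sqrP.
by split; rewrite distrC; exact: ltW.
Qed.

Lemma Rintegral_sqr_ge (f : R * R -> R) q d (c : R) : 0 < d -> mu2.-integrable setT (EFin \o f) ->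
  (forall z, 0 <= f z) -> (forall z, sqr q d z -> c <= f z) -> c * (4 * d ^+ 2) <= Rintegral mu2 setT f.
Proof.
move=> d0 iF f0 fc.
have mS := measurable_sqr q d.
apply: (@le_trans _ _ (Rintegral mu2 (sqr q d) f)); last exact: Rintegral_subset_le.
have e : Rintegral mu2 (sqr q d) (fun=> c) = c * (4 * d ^+ 2).
  rewrite (@Rintegral_cst _ _ _ mu2 (sqr q d) mS c).
  by congr (_ * _); exact: (congr1 fine (@leb2_sqr q d d0)).
rewrite -e; apply: le_Rintegral => //.
- apply/integrableP; split; first exact: measurable_cst.
  have -> : (\int[mu2]_(x in sqr q d) `|(EFin \o (fun=> c)) x| = `|c|%:E * mu2 (sqr q d))%E.
    exact: (@integral_cst _ _ _ mu2 (sqr q d) mS `|c|%:E).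
  by rewrite leb2_sqr// -EFinM ltry.
- by apply: (@integrableS _ _ _ mu2 setT).
Qed.

Definition bmp q d : R -> R -> R := fun x y => Fm 0 (1 - ((x - q.1) / d) ^+ 2) * Fm 0 (1 - ((y - q.2) / d) ^+ 2).

Lemma Fm0_le1 (t : R) : Fm 0 t <= 1.
Proof.
have [t0|t0] := ltP 0 t; last by rewrite Fm_neg.
by rewrite Fm_pos// expr0 invr1 mul1r -[leRHS]expR0 ler_expR oppr_le0 invr_ge0 ltW.
Qed.

Lemma Fm0_ge (a t : R) : 0 < a -> a <= t -> expR (- a^-1) <= Fm 0 t.
Proof.
move=> a0 at_; have t0 : 0 < t by lra.
by rewrite Fm_pos// expr0 invr1 mul1r ler_expR lerN2 lef_pV2// posrE.
Qed.

Lemma Fm_le m (t : R) : Fm m t <= m`!%:R.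
Proof.
have [t0|t0] := ltP 0 t; last by rewrite Fm_neg.
have ti : 0 <= t^-1 by rewrite invr_ge0 ltW.
have f0 : 0 < m`!%:R :> R by rewrite ltr0n fact_gt0.
rewrite Fm_pos// expRN ler_pdivrMr ?expR_gt0// -exprVn mulrC -ler_pdivrMr//.
case: m f0 => [|m] f0; last by have := @expR_ge1Dxn R t^-1 m ti; lra.
rewrite expr0 fact0 divr1 -[X in X <= _]expR0 ler_expR//.
Qed.

Lemma bmp_ge0 q d x y : 0 <= bmp q d x y. Proof. by rewrite mulr_ge0// Fm_ge0. Qed.

Lemma bmp_le1 q d x y : bmp q d x y <= 1.
Proof. by rewrite -[leRHS]mulr1; apply: ler_pM; rewrite ?Fm_ge0 ?Fm0_le1. Qed.

Lemma div_sqr_le (u d : R) : 0 < d -> `|u| <= d -> (u / d) ^+ 2 <= 1.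
Proof.
move=> d0 ud; rewrite -real_normK ?num_real// normf_div (gtr0_norm d0).
by rewrite expr_le1// ?divr_ge0 ?ler_pdivrMr ?mul1r// ltW.
Qed.

Lemma div_sqr_ge (u d : R) : 0 < d -> d < `|u| -> 1 - (u / d) ^+ 2 <= 0.
Proof.
move=> d0 ud; rewrite subr_le0 -real_normK ?num_real// normf_div (gtr0_norm d0).
by rewrite exprn_ege1// ler_pdivlMr// mul1r ltW.
Qed.

(** On the half square each factor is at least [Fm 0 (3/4) = e^(-4/3)]. *)
Lemma bmp_ge q d x y : 0 < d -> sqr q (d / 2) (x, y) -> expR (- (8 / 3)) <= bmp q d x y.
Proof.
move=> d0 /sqrP[/= h1 h2].
have k (u : R) : `|u| <= d / 2 -> 3 / 4 <= 1 - (u / d) ^+ 2.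
  move=> h; have d2 : 0 < d / 2 by lra.
  have := div_sqr_le d2 h; rewrite (_ : u / (d / 2) = 2 * (u / d)); last by field; rewrite gt_eqF.
  by rewrite exprMn; lra.
have a0 : 0 < 3 / 4 :> R by lra.
have := ler_pM (expR_ge0 _) (expR_ge0 _) (Fm0_ge a0 (k _ h1)) (Fm0_ge a0 (k _ h2)).
by rewrite -expRD; congr (expR _ <= _); field.
Qed.

Lemma smooth_bmp q d : smooth (bmp q d).
Proof.
apply: smoothM; apply: (smooth_comp (D := setT)) => //; try by move=> k; exact: C1k_Fm.
  apply: smoothD; first exact: smooth_cst.
  apply: smoothN; apply: (@smoothM _ (fun x _ => (x - q.1) / d) (fun x _ => (x - q.1) / d));
  apply: (@smoothM _ (fun x _ => x - q.1) (fun _ _ => d^-1)); try exact: smooth_cst;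
  apply: (@smoothD _ (fun x _ => x) (fun _ _ => - q.1)); [exact: smooth_x|exact: smooth_cst|exact: smooth_x|exact: smooth_cst].
apply: smoothD; first exact: smooth_cst.
apply: smoothN; apply: (@smoothM _ (fun _ x => (x - q.2) / d) (fun _ x => (x - q.2) / d));
apply: (@smoothM _ (fun _ x => x - q.2) (fun _ _ => d^-1)); try exact: smooth_cst;
apply: (@smoothD _ (fun _ x => x) (fun _ _ => - q.2)); [exact: smooth_y|exact: smooth_cst|exact: smooth_y|exact: smooth_cst].
Qed.

Lemma bmp_supp q d z : 0 < d -> ~ sqr q d z -> bmp q d z.1 z.2 = 0.
Proof.
move=> d0 nz; rewrite /bmp.
have [h1|h1] := leP `|z.1 - q.1| d; last by rewrite (Fm_neg _ (div_sqr_ge d0 h1)) mul0r.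
have [h2|h2] := leP `|z.2 - q.2| d; last by rewrite (Fm_neg _ (div_sqr_ge d0 h2)) mulr0.
by exfalso; apply: nz; apply/sqrP.
Qed.

Lemma testfun_bmp (O : set (R * R)) q d : 0 < d -> sqr q d `<=` O -> testfun O (bmp q d).
Proof.
move=> d0 sO; split; first exact: smooth_bmp.
by exists (sqr q d); split => //; [exact: compact_sqr|move=> z; exact: bmp_supp].
Qed.

Lemma testfunZ (O : set (R * R)) (c : R) phi : testfun O phi -> testfun O (fun x y => c * phi x y).
Proof.
move=> [s [K [cK KO h]]]; split; first by apply: smoothM => //; exact: smooth_cst.
by exists K; split => // p Kp; rewrite h// mulr0.
Qed.

(** Recovers pointwise signs from integrals: a negative value at [q] persists on a small square by
    continuity, and a bump there would give a negative integral. *)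
Lemma nonneg_of_tests (O : set (R * R)) (f : R * R -> R) q : open O -> O q -> {for q, continuous f} ->
  (forall phi, testfun O phi -> (forall x y, 0 <= phi x y) ->
    mu2.-integrable setT (EFin \o (fun z => f z * phi z.1 z.2)) /\
    0 <= Rintegral mu2 setT (fun z => f z * phi z.1 z.2)) -> 0 <= f q.
Proof.
move=> oO Oq cf h; rewrite leNgt; apply/negP => fq.
have nO : nbhs q O by exact: (open_nbhs_nbhs (conj oO Oq)).
have nf : nbhs q [set z | f z <= f q / 2].
  have e0 : 0 < - f q / 2 by lra.
  move/cvgrPdist_le : cf => /(_ _ e0); apply: filterS => z /=.
  by rewrite ler_distl; lra.
have [d d0 sd] := sqr_small (filterI nO nf).
have [|//|iF I0] := h (bmp q d) (@testfun_bmp O q d d0 _).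
- by move=> z /sd[].
- exact: bmp_ge0.
have d2 : 0 < d / 2 by lra.
have := @Rintegral_sqr_ge (fun z => - 1 * (f z * bmp q d z.1 z.2)) q (d / 2) (- (f q / 2) * expR (- (8 / 3))) d2.
rewrite RintegralZl// => /(_ _ _ _) H.
have : - (f q / 2) * expR (- (8 / 3)) * (4 * (d / 2) ^+ 2) <= - 1 * Rintegral mu2 setT (fun z => f z * bmp q d z.1 z.2).
  apply: H.
  - exact: integrable_scale.
  - move=> z; have [zS|zS] := pselect (sqr q d z); last by rewrite bmp_supp// !mulr0.
    have [_ /=] := sd _ zS; have := bmp_ge0 q d z.1 z.2; nra.
  - move=> z zS; have zS' : sqr q d z by move/sqrP : zS => [? ?]; apply/sqrP; split; lra.
    have [_ /=] := sd _ zS'.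
    have : expR (- (8 / 3)) <= bmp q d z.1 z.2 by apply: bmp_ge => //; rewrite -surjective_pairing.
    have := expR_gt0 (- (8 / 3 : R)); nra.
have : 0 < - (f q / 2) * expR (- (8 / 3)) * (4 * (d / 2) ^+ 2).
  by rewrite !mulr_gt0 ?expR_gt0 ?exprn_gt0//; lra.
lra.
Qed.

End bumps.

(** * The bump adapted to the logarithmic singularity *)

Section log_bump.
Variable R : realType.
Variables (q : R * R) (de e : R).
Hypothesis de0 : 0 < de.
Hypothesis e0 : 0 < e.
Hypothesis e1 : e <= 1.
Definition rsq (x y : R) : R := ((x - q.1) ^+ 2 + (y - q.2) ^+ 2) / de ^+ 2.
(** [ln (1 + e) - ln (e + r)] regularises [- ln r] and vanishes at [r = 1]. With [r] the scaled
    squared distance to [q], its Laplacian is [- e / (e + r)^2] times [4 / de^2], a negative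
    approximate identity; the factor [Fm 0 (1 - r)] gives smoothness and compact support. *)
Let Th (r : R) : R := Fm 0 (1 - r) * (ln (1 + e) - ln (e + r)).
Let Th1 (r : R) : R := - Fm 2 (1 - r) * (ln (1 + e) - ln (e + r)) - Fm 0 (1 - r) * (e + r)^-1.

Let Th2 (r : R) : R := (Fm 4 (1 - r) - 2 * Fm 3 (1 - r)) * (ln (1 + e) - ln (e + r)) + 2 * Fm 2 (1 - r) * (e + r)^-1
  + Fm 0 (1 - r) * (e + r) ^- 2.

Let rsq0 x y : 0 <= rsq x y.
Proof. by rewrite divr_ge0 ?sqr_ge0// addr_ge0// sqr_ge0. Qed.

Let der_Th (r : R) : 0 <= r -> is_derive r 1 Th (Th1 r).
Proof.
move=> r0; have h0 := e0; have er : 0 < e + r by lra.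
have d0 := der_Fm 0 (1 - r).
have d1 : is_derive r 1 (fun r => Fm 0 (1 - r)) ((Fm 2 (1 - r) - 0%:R * Fm 1 (1 - r)) * -1).
  by apply: (@der_comp R (Fm 0) (fun r => 1 - r) r _ (-1) d0); der; rewrite /=; ring.
rewrite /Th; der; rewrite ?gt_eqF//= /Th1; field; by rewrite gt_eqF.
Qed.

Let der_Th1 (r : R) : 0 <= r -> is_derive r 1 Th1 (Th2 r).
Proof.
move=> r0; have h0 := e0; have er : 0 < e + r by lra.
have d0 := der_Fm 0 (1 - r); have d2 := der_Fm 2 (1 - r).
have d1 : is_derive r 1 (fun r => Fm 0 (1 - r)) ((Fm 2 (1 - r) - 0%:R * Fm 1 (1 - r)) * -1).
  by apply: (@der_comp R (Fm 0) (fun r => 1 - r) r _ (-1) d0); der; rewrite /=; ring.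
have d3 : is_derive r 1 (fun r => Fm 2 (1 - r)) ((Fm 4 (1 - r) - 2%:R * Fm 3 (1 - r)) * -1).
  by apply: (@der_comp R (Fm 2) (fun r => 1 - r) r _ (-1) d2); der; rewrite /=; ring.
rewrite /Th1; der; rewrite ?gt_eqF//= /Th2; field; by rewrite gt_eqF.
Qed.

Definition lbump (x y : R) : R := Th (rsq x y).

Let rsqx (x y : R) : is_derive x 1 (fun t => rsq t y) (2 * (x - q.1) / de ^+ 2).
Proof. by rewrite /rsq; der; rewrite /=; ring. Qed.

Let rsqy (x y : R) : is_derive y 1 (fun t => rsq x t) (2 * (y - q.2) / de ^+ 2).
Proof. by rewrite /rsq; der; rewrite /=; ring. Qed.

Lemma lbump_lap x y : dx (dx lbump) x y + dy (dy lbump) x y =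
  4 / de ^+ 2 * (rsq x y * Th2 (rsq x y) + Th1 (rsq x y)).
Proof.
have den : de != 0 by rewrite gt_eqF.
have ex : dx lbump = fun x y => Th1 (rsq x y) * (2 * (x - q.1) / de ^+ 2).
  apply/funext => a; apply/funext => b; rewrite /dx derive1E.
  by have [_ ->] := @der_comp R Th (rsq^~ b) a _ _ (der_Th (rsq0 a b)) (rsqx a b).
have ey : dy lbump = fun x y => Th1 (rsq x y) * (2 * (y - q.2) / de ^+ 2).
  apply/funext => a; apply/funext => b; rewrite /dy derive1E.
  by have [_ ->] := @der_comp R Th (rsq a) b _ _ (der_Th (rsq0 a b)) (rsqy a b).
have hx : is_derive x 1 (fun t => Th1 (rsq t y) * (2 * (t - q.1) / de ^+ 2))
   (Th2 (rsq x y) * (2 * (x - q.1) / de ^+ 2) ^+ 2 + Th1 (rsq x y) * (2 / de ^+ 2)).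
  have d := @der_comp R Th1 (rsq^~ y) x _ _ (der_Th1 (rsq0 x y)) (rsqx x y).
  by der; rewrite /=; ring.
have hy : is_derive y 1 (fun t => Th1 (rsq x t) * (2 * (t - q.2) / de ^+ 2))
   (Th2 (rsq x y) * (2 * (y - q.2) / de ^+ 2) ^+ 2 + Th1 (rsq x y) * (2 / de ^+ 2)).
  have d := @der_comp R Th1 (rsq x) y _ _ (der_Th1 (rsq0 x y)) (rsqy x y).
  by der; rewrite /=; ring.
have e1' : dx (dx lbump) x y = Th2 (rsq x y) * (2 * (x - q.1) / de ^+ 2) ^+ 2 + Th1 (rsq x y) * (2 / de ^+ 2).
  by rewrite ex /dx derive1E; have [_ ->] := hx.
have e2' : dy (dy lbump) x y = Th2 (rsq x y) * (2 * (y - q.2) / de ^+ 2) ^+ 2 + Th1 (rsq x y) * (2 / de ^+ 2).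
  by rewrite ey /dy derive1E; have [_ ->] := hy.
rewrite e1' e2'; have er : rsq x y = ((x - q.1) ^+ 2 + (y - q.2) ^+ 2) / de ^+ 2 by [].
by move: (Th1 _) (Th2 _) => t1 t2; rewrite er; field.
Qed.

(** The terms with derivatives of the cut-off factor are bounded uniformly in [e]: the only positive
    ones contribute at most [4! + 2 * 2! = 28], by [Fm_le] and [r ln ((1 + e) / (e + r)) <= 1]. *)
Lemma lbump_lap_le x y : dx (dx lbump) x y + dy (dy lbump) x y <=
  4 / de ^+ 2 * (28 * (rsq x y <= 1)%R%:R - e * Fm 0 (1 - rsq x y) * (e + rsq x y) ^- 2).
Proof.
rewrite lbump_lap ler_pM2l ?divr_gt0 ?exprn_gt0//.
move: (rsq x y) (rsq0 x y) => r r0; have h0 := e0; have er : 0 < e + r by lra.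
have [r1|r1] := leP r 1; last first.
  have n1 : 1 - r <= 0 by lra.
  rewrite /Th1 /Th2 !(Fm_neg _ n1); move: ((e + r)^-1) ((e + r) ^- 2) (ln _ - ln _) => a b c.
  by rewrite le_eqVlt; apply/orP; left; apply/eqP; rewrite /=; ring.
have l0 : 0 <= ln (1 + e) - ln (e + r) by rewrite subr_ge0 ler_ln ?posrE; lra.
have l1 : r * (ln (1 + e) - ln (e + r)) <= 1.
  rewrite -ln_div ?posrE; [|lra|lra].
  have -> : (1 + e) / (e + r) = 1 + (1 - r) / (e + r) by field; rewrite gt_eqF.
  have : ln (1 + (1 - r) / (e + r)) <= (1 - r) / (e + r).
    apply: le_ln1Dx; apply: lt_le_trans (_ : 0 <= _); first lra.
    by rewrite divr_ge0; lra.
  have : r * ((1 - r) / (e + r)) <= 1.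
    rewrite mulrA ler_pdivrMr// mul1r; nra.
  nra.
have -> : r * Th2 r + Th1 r = r * (ln (1 + e) - ln (e + r)) * Fm 4 (1 - r) - 2 * Fm 3 (1 - r) * (r * (ln (1 + e) - ln (e + r)))
   + 2 * Fm 2 (1 - r) * (r / (e + r)) - Fm 2 (1 - r) * (ln (1 + e) - ln (e + r)) - e * Fm 0 (1 - r) * (e + r) ^- 2.
  by rewrite /Th1 /Th2; field; rewrite gt_eqF.
have f4 : Fm 4 (1 - r) <= 24 := Fm_le 4 (1 - r).
have f2 : Fm 2 (1 - r) <= 2 := Fm_le 2 (1 - r).
have f40 := Fm_ge0 4 (1 - r); have f20 := Fm_ge0 2 (1 - r); have f30 := Fm_ge0 3 (1 - r).
have r2 : r / (e + r) <= 1 by rewrite ler_pdivrMr//; lra.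
have r3 : 0 <= r / (e + r) by rewrite divr_ge0//; lra.
have a1 : r * (ln (1 + e) - ln (e + r)) * Fm 4 (1 - r) <= 24 by nra.
have a2 : 0 <= Fm 3 (1 - r) * (r * (ln (1 + e) - ln (e + r))) by rewrite !mulr_ge0.
have a3 : Fm 2 (1 - r) * (r / (e + r)) <= 2 by nra.
have a4 : 0 <= Fm 2 (1 - r) * (ln (1 + e) - ln (e + r)) by rewrite mulr_ge0.
rewrite mulr1; lra.
Qed.

Lemma smooth_lbump : smooth lbump.
Proof.
have sr : smooth rsq.
  apply: (@smoothM _ (fun x y => (x - q.1) ^+ 2 + (y - q.2) ^+ 2) (fun _ _ => (de ^+ 2)^-1)); last exact: smooth_cst.
  apply: (@smoothD _ (fun x y => (x - q.1) ^+ 2) (fun x y => (y - q.2) ^+ 2)).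
    by apply: (@smoothM _ (fun x _ => x - q.1) (fun x _ => x - q.1));
    (apply: (@smoothD _ (fun x _ => x) (fun _ _ => - q.1)); [exact: smooth_x|exact: smooth_cst]).
  by apply: (@smoothM _ (fun _ x => x - q.2) (fun _ x => x - q.2));
    (apply: (@smoothD _ (fun _ x => x) (fun _ _ => - q.2)); [exact: smooth_y|exact: smooth_cst]).
apply: (@smoothM _ (fun x y => Fm 0 (1 - rsq x y)) (fun x y => ln (1 + e) - ln (e + rsq x y))).
  apply: (smooth_comp (D := setT)) => //; first by move=> k; exact: C1k_Fm.
  by apply: (@smoothD _ (fun _ _ => 1)); [exact: smooth_cst|exact: smoothN].
apply: (@smoothD _ (fun _ _ => ln (1 + e))); first exact: smooth_cst.
apply: smoothN; apply: (smooth_comp (D := [set t : R | 0 < t])).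
- by move=> k; exact: C1k_ln.
- by move=> x y /=; have := rsq0 x y; have := e0; lra.
- by apply: (@smoothD _ (fun _ _ => e)) => //; exact: smooth_cst.
Qed.

Lemma rh_sqr z : rsq z.1 z.2 <= 1 -> sqr q de z.
Proof.
rewrite /rsq ler_pdivrMr ?exprn_gt0// mul1r => h.
have h1 := sqr_ge0 (z.1 - q.1); have h2 := sqr_ge0 (z.2 - q.2).
have k (u : R) : u ^+ 2 <= de ^+ 2 -> `|u| <= de.
  by move=> k; rewrite -(@ler_pXn2r _ 2)// ?nnegrE// ?real_normK ?num_real//; exact: ltW.
by apply/sqrP; split; apply: k; lra.
Qed.

Lemma lbump_ge0 x y : 0 <= lbump x y.
Proof.
rewrite /lbump /Th; have := rsq0 x y; move: (rsq x y) => r r0; have h0 := e0.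
have [r1|r1] := leP r 1; last by rewrite Fm_neg ?mul0r//; lra.
by rewrite mulr_ge0 ?Fm_ge0// subr_ge0 ler_ln ?posrE; lra.
Qed.

Lemma testfun_lbump (O : set (R * R)) : sqr q de `<=` O -> testfun O lbump.
Proof.
move=> sO; split; first exact: smooth_lbump.
exists (sqr q de); split => //; first exact: compact_sqr.
move=> z nz; rewrite /lbump /Th Fm_neg ?mul0r// subr_le0 leNgt; apply/negP => h.
by apply: nz; apply: rh_sqr; exact: ltW.
Qed.

(* The weight is an approximate identity at scale [de * sqrt e]. *)
Lemma lbump_core x y : `|x - q.1| <= de * Num.sqrt e / 2 -> `|y - q.2| <= de * Num.sqrt e / 2 ->
  expR (- 2) / (4 * e) <= e * Fm 0 (1 - rsq x y) * (e + rsq x y) ^- 2.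
Proof.
move=> hx hy; have h0 := e0; have h1 := e1.
have dn : de != 0 by rewrite gt_eqF.
have k (u : R) : `|u| <= de * Num.sqrt e / 2 -> u ^+ 2 <= de ^+ 2 * e / 4.
  move=> hu; rewrite -real_normK ?num_real//.
  have -> : de ^+ 2 * e / 4 = (de * Num.sqrt e / 2) ^+ 2.
    by rewrite -[in LHS](sqr_sqrtr (ltW h0)); field.
  by rewrite ler_pXn2r ?nnegrE ?normr_ge0// (le_trans _ hu).
have r1 : rsq x y <= e / 2.
  rewrite /rsq ler_pdivrMr ?exprn_gt0//; have kx := k _ hx; have ky := k _ hy.
  by have -> : e / 2 * de ^+ 2 = de ^+ 2 * e / 4 + de ^+ 2 * e / 4; [field|exact: lerD].
have r0 := rsq0 x y; move: (rsq x y) r0 r1 => r r0 r1.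
have a0 : 0 < 1 / 2 :> R by lra.
have f0 : expR (- 2) <= Fm 0 (1 - r).
  have := @Fm0_ge R (1 / 2) (1 - r) a0; rewrite (_ : (1 / 2)^-1 = 2 :> R); last by field.
  by apply; lra.
have v : (4 * e)^-1 <= e * (e + r) ^- 2.
  rewrite -div1r ler_pdivrMr; last lra.
  rewrite mulrAC -mulrA mulrA ler_pdivlMr ?exprn_gt0//; [nra|lra].
have E0 := expR_gt0 (- 2 : R).
have -> : e * Fm 0 (1 - r) * (e + r) ^- 2 = Fm 0 (1 - r) * (e * (e + r) ^- 2) by ring.
have i0 : 0 <= (4 * e)^-1 by rewrite invr_ge0; lra.
exact: (ler_pM (ltW E0) i0 f0 v).
Qed.

End log_bump.

Lemma nondecr_cvg (R : realType) (u : nat -> R) (n0 : nat) (M : R) :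
  (forall n m, (n0 <= n)%N -> (n <= m)%N -> u n <= u m) -> (forall n, (n0 <= n)%N -> u n <= M) ->
  exists l : R, u @ \oo --> l /\ forall n, (n0 <= n)%N -> u n <= l.
Proof.
move=> nd bd; pose v k := u (k + n0)%N.
have ndv : nondecreasing_seq v by move=> i j ij; apply: nd; rewrite ?leq_addl// leq_add2r.
have cv : cvgn v.
  apply: nondecreasing_is_cvgn => //; exists M => _ [k _ <-]; apply: bd; exact: leq_addl.
exists (limn v); split; first by rewrite -(cvg_shiftn n0); exact: cv.
move=> n n0n; have := nondecreasing_cvgn_le ndv cv (n - n0).
by rewrite /v subnK.
Qed.

(** * Local uniform convergence off the pole *)

Section green_limit.
Variable R : realType.
Variables (Om : nat -> set (R * R)) (G : nat -> R -> R -> R -> R -> R).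
Hypothesis exh : exhaustion Om.
Hypothesis dg : forall n, dirichlet_green (Om n) (G n).
Variable p : R * R.
Hypothesis Op0 : Om 0 p.
Local Notation mu2 := (@leb2 R).
Local Notation un := (un Om G).
Implicit Types (phi : R -> R -> R) (q z : R * R).
Lemma Opn n : Om n p. Proof. exact: (Om_mono exh (leq0n n) Op0). Qed.
Let Op n : Om n (p.1, p.2). Proof. by rewrite -surjective_pairing; exact: Opn. Qed.
(** The kernel with pole [p], extended by 0 off [Om n]. The value at the pole is replaced by 0 as
    well, which changes no integral since a point is null. *)
Definition Gt n : R * R -> R := patch (fun=> 0) (Om n `\ p) (fun q => G n p.1 p.2 q.1 q.2).

Lemma Gt_in n q : Om n q -> q <> p -> Gt n q = G n p.1 p.2 q.1 q.2.
Proof. by move=> Oq qp; rewrite /Gt /patch mem_set. Qed.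

Lemma Gt_out n q : ~ (Om n q /\ q <> p) -> Gt n q = 0.
Proof. by move=> h; rewrite /Gt /patch memNset. Qed.

Lemma open_D1 n : open (Om n `\ p).
Proof.
apply: openI; first exact: Om_open.
rewrite openC; apply: compact_closed; [exact: norm_hausdorff|exact: compact_set1].
Qed.

Lemma Gt_int n phi : testfun (Om n) phi ->
  mu2.-integrable setT (EFin \o (fun q => Gt n q * phi q.1 q.2)) /\
  Rintegral mu2 setT (fun q => Gt n q * phi q.1 q.2) = un n phi p.1 p.2.
Proof.
move=> t; have i := integrable_un dg t (@Op n).
pose f (q : R * R) := G n p.1 p.2 q.1 q.2 * phi q.1 q.2.
pose D := Om n `\ p.
have mD : measurable D by apply: open_measurable2; exact: open_D1.
have mO := mOm exh n.
have e : (fun q => Gt n q * phi q.1 q.2) = patch (fun=> 0) D f.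
  by apply/funext => q; rewrite /Gt /patch; case: ifP => // _; rewrite mul0r.
have iD : mu2.-integrable D (EFin \o f) by apply: (@integrableS _ _ _ mu2 (Om n)) => // q [].
rewrite e; split; first exact: integrable_patch.
rewrite -Rintegral_mkcond /un /Rintegral; congr fine.
have m1 : measurable [set p].
  by rewrite -[[set p]]setCK; apply: measurableC; apply: open_measurable2; rewrite openC;
     apply: compact_closed; [exact: norm_hausdorff|exact: compact_set1].
exact: (esym (@negligible_integral _ _ _ mu2 (Om n) [set p] (EFin \o f) m1 mO i (leb2_set1 p))).
Qed.

Lemma Gt_cont n q : Om n q -> q <> p -> {for q, continuous (Gt n)}.
Proof.
move=> Oq qp; have [h _] := dg n; have := h _ _ (@Op n); rewrite -surjective_pairing.
rewrite continuous_open_subspace; last exact: open_D1.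
have Dq : (Om n `\ p) q by split.
move=> /(_ q); rewrite inE => /(_ Dq) c.
rewrite /prop_for /continuous_at Gt_in//; apply: cvg_trans c; apply: near_eq_cvg.
have : nbhs q (Om n `\ p) by exact: (open_nbhs_nbhs (conj (@open_D1 n) Dq)).
by apply: filterS => z [Oz zp]; rewrite Gt_in.
Qed.

Lemma Gt_ge0 n q : 0 <= Gt n q.
Proof.
have [[Oq qp]|h] := pselect (Om n q /\ q <> p); last by rewrite Gt_out.
apply: (@nonneg_of_tests R (Om n `\ p) (Gt n) q (@open_D1 n)) => //; first exact: Gt_cont.
move=> phi t phi0.
have t' : testfun (Om n) phi by apply: testfun_mono t => z [].
have [i ->] := Gt_int t'; split => //; exact: un_ge0.
Qed.

Lemma Gt_diff n m phi : (n <= m)%N -> testfun (Om n) phi ->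
  mu2.-integrable setT (EFin \o (fun q => (Gt m q - Gt n q) * phi q.1 q.2)) /\
  Rintegral mu2 setT (fun q => (Gt m q - Gt n q) * phi q.1 q.2) = un m phi p.1 p.2 - un n phi p.1 p.2.
Proof.
move=> nm t.
have [i1 <-] := Gt_int t; have [i2 <-] := Gt_int (testfun_mono (Om_mono exh nm) t).
have e : (fun q => (Gt m q - Gt n q) * phi q.1 q.2) = (fun q => Gt m q * phi q.1 q.2 - Gt n q * phi q.1 q.2).
  by apply/funext => q; rewrite mulrBl.
rewrite e; split; first exact: integrable_diff.
by rewrite RintegralB.
Qed.

Lemma Gt_le n m q : (n <= m)%N -> Gt n q <= Gt m q.
Proof.
move=> nm; have [[Oq qp]|h] := pselect (Om n q /\ q <> p); last by rewrite Gt_out// Gt_ge0.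
rewrite -subr_ge0.
apply: (@nonneg_of_tests R (Om n `\ p) (fun q => Gt m q - Gt n q) q (@open_D1 n)) => //.
  by apply: cvgB; apply: Gt_cont => //; exact: (Om_mono exh nm).
move=> phi t phi0.
have t' : testfun (Om n) phi by apply: testfun_mono t => z [].
have [i ->] := Gt_diff nm t'; split => //; rewrite subr_ge0; exact: un_mono.
Qed.

(** Testing the nonnegative weakly subharmonic [Gt m - Gt n] against [lbump] compares its mass near
    [q], weighted by the approximate identity, with 28 times its mass on the square, itself at most
    its integral against [phi]. Here [112 = 4 * 28], and [expR 2] inverts the lower bound in
    [lbump_core]. *)
Lemma harnack n m q (d : R) phi : (n <= m)%N -> 0 < d -> sqr q d `<=` Om n -> q <> p ->
  testfun (Om n) phi -> (forall x y, 0 <= phi x y) -> (forall z, sqr q d z -> 1 <= phi z.1 z.2) ->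
  Gt m q - Gt n q <= expR 2 * (112 / d ^+ 2) * (un m phi p.1 p.2 - un n phi p.1 p.2).
Proof.
move=> nm d0 sO qp t phi0 phi1.
pose h q := Gt m q - Gt n q.
have h0 z : 0 <= h z by rewrite subr_ge0 Gt_le.
have Oq : Om n q by apply: sO; apply/sqrP; rewrite !subrr normr0 ltW.
have [ih eh] := Gt_diff nm t.
set I := un m phi p.1 p.2 - un n phi p.1 p.2 in eh *.
have I0 : 0 <= I by rewrite subr_ge0; apply: un_mono.
have d20 : 0 < d ^+ 2 by rewrite exprn_gt0.
have C0 : 0 <= expR 2 * (112 / d ^+ 2) :> R by rewrite mulr_ge0 ?expR_ge0// divr_ge0// ltW.
apply/ler_addgt0Pr => eta eta0.
have [c0|c0] := ltP (h q - eta) 0.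
  have : 0 <= expR 2 * (112 / d ^+ 2) * I by rewrite mulr_ge0.
  by move: c0; rewrite /h; lra.
have ch : {for q, continuous h} by apply: cvgB; apply: Gt_cont => //; exact: (Om_mono exh nm).
have nh : nbhs q [set z | h q - eta <= h z].
  move/cvgrPdist_le : ch => /(_ _ eta0); apply: filterS => z /=; rewrite ler_distl; lra.
have [d1 d10 sd1] := sqr_small nh.
(* Small enough for the core of the bump, of half width [d sqrt e / 2], to lie in the square where
   the difference exceeds its value at [q] minus [eta]. *)
pose e := Num.min 1 ((2 * d1 / d) ^+ 2).
have e0 : 0 < e by rewrite lt_min ltr01/= exprn_gt0// divr_gt0// mulr_gt0.
have e1 : e <= 1 by rewrite ge_min lexx.
pose r := d * Num.sqrt e / 2.
have r0 : 0 < r by rewrite /r divr_gt0// mulr_gt0// sqrtr_gt0.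
have rd1 : r <= d1.
  have : Num.sqrt e <= 2 * d1 / d.
    have D0 : 0 < 2 * d1 / d by rewrite divr_gt0// mulr_gt0.
    rewrite -(@ler_pXn2r _ 2) ?nnegrE ?sqrtr_ge0 ?(ltW D0)// sqr_sqrtr ?(ltW e0)//.
    by rewrite ge_min lexx orbT.
  by rewrite ler_pdivlMr// /r; lra.
pose psi := lbump q d e.
have tpsi : testfun (Om n) psi by exact: testfun_lbump.
have [il el] := Gt_diff nm (testfun_lap tpsi).
have pg x y : 0 <= psi x y by exact: lbump_ge0.
have le0 := un_lap exh dg nm tpsi pg (@Op n).
pose lap x y := dx (dx psi) x y + dy (dy psi) x y.
have key : (4 / d ^+ 2) * ((h q - eta) * (expR (- 2) / (4 * e))) * (4 * r ^+ 2) <=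
   Rintegral mu2 setT (fun z => 112 / d ^+ 2 * (h z * phi z.1 z.2) + h z * - lap z.1 z.2).
  have pw z : 4 / d ^+ 2 * (h z * (e * Fm 0 (1 - rsq q d z.1 z.2) * (e + rsq q d z.1 z.2) ^- 2)) <=
      112 / d ^+ 2 * (h z * phi z.1 z.2) + h z * - lap z.1 z.2.
    have l := @lbump_lap_le R q d e d0 e0 z.1 z.2.
    have b : (rsq q d z.1 z.2 <= 1)%R%:R <= phi z.1 z.2.
      case: (boolP (rsq q d z.1 z.2 <= 1)) => [/rh_sqr zs|_]; last exact: phi0.
      by apply: phi1; exact: zs.
    have hz := h0 z.
    have k0 : 0 < 4 / d ^+ 2 by rewrite divr_gt0.
    have -> : 112 / d ^+ 2 = 4 / d ^+ 2 * 28 by field; rewrite gt_eqF.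
    move: l b hz k0; rewrite -/psi -/(lap z.1 z.2).
    move: (e * Fm 0 _ * _) (lap _ _) (_ <= 1)%R%:R (phi _ _) (h z) (4 / d ^+ 2) => w la ind f hz k l b hz0 k0.
    have b1 : k * (28 * hz * ind) <= k * (28 * hz * f) by rewrite ler_pM2l//; apply: ler_wpM2l => //; lra.
    have b2 : hz * la <= hz * (k * (28 * ind - w)) by exact: ler_wpM2l.
    lra.
  have w0 z : 0 <= e * Fm 0 (1 - rsq q d z.1 z.2) * (e + rsq q d z.1 z.2) ^- 2.
    by rewrite !mulr_ge0 ?Fm_ge0 ?invr_ge0 ?sqr_ge0// ltW.
  apply: (@Rintegral_sqr_ge R _ q r) => //.
  - by apply: integrable_sum => //; exact: integrable_scale.
  - move=> z; apply: le_trans (pw z); exact: (mulr_ge0 (divr_ge0 (ler0n _ 4) (ltW d20)) (mulr_ge0 (h0 z) (w0 z))).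
  - move=> z zs; apply: le_trans (pw z).
    have k0 : 0 < 4 / d ^+ 2 by rewrite divr_gt0.
    rewrite ler_pM2l//.
    have [z1 z2] := (sqrP q r z).1 zs.
    have b := lbump_core d0 e0 e1 z1 z2.
    have hz : h q - eta <= h z by apply: sd1; apply/sqrP; split; lra.
    apply: ler_pM => //; rewrite divr_ge0 ?expR_ge0//; lra.
rewrite RintegralD// in key; last exact: integrable_scale.
rewrite RintegralZl// in key.
have e2 : Rintegral mu2 setT (fun z => h z * - lap z.1 z.2) <= 0 by rewrite [leLHS]el subr_le0.
have r2 : 4 * r ^+ 2 = d ^+ 2 * e.
  by rewrite /r -[in RHS](sqr_sqrtr (ltW e0)); field.
have k1 : (4 / d ^+ 2) * ((h q - eta) * (expR (- 2) / (4 * e))) * (4 * r ^+ 2) = (h q - eta) * expR (- 2).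
  by rewrite r2; field; rewrite !gt_eqF.
have k2 : (h q - eta) * expR (- 2) <= 112 / d ^+ 2 * I by move: key; rewrite k1 eh; lra.
rewrite expRN in k2; move: k2; rewrite ler_pdivrMr ?expR_gt0//.
have -> : expR 2 * (112 / d ^+ 2) * I = 112 / d ^+ 2 * I * expR 2 by rewrite -mulrA mulrC.
by rewrite lerBlDr.
Qed.

Lemma un_cvg phi : testfun (@Sigma R) phi -> (forall x y, 0 <= phi x y) ->
  (exists M : R, forall x y, phi x y <= M) ->
  exists n0 : nat, testfun (Om n0) phi /\ exists l : R, (fun n => un n phi p.1 p.2) @ \oo --> l /\
    forall n, (n0 <= n)%N -> un n phi p.1 p.2 <= l.
Proof.
move=> t phi0 [M hM]; have [n0 tn0] := testfun_Sigma exh t; exists n0; split => //.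
have tn n : (n0 <= n)%N -> testfun (Om n) phi by move=> h; exact: testfun_mono (Om_mono exh h) tn0.
apply: (@nondecr_cvg R _ n0 (4 * M)).
- by move=> n m n0n nm; apply: un_mono => //; exact: tn.
- move=> n n0n; apply: un_le => //; first exact: tn.
  exact: le_trans (phi0 0 0) (hM 0 0).
Qed.

Lemma open_Sigma : open (@Sigma R).
Proof. by have [_ _ <-] := exh; apply: bigcup_open => n _; exact: Om_open. Qed.

(** A Harnack bound with constant and test function common to all [z] near [q]:
    [expR (8 / 3) * bmp q D] is at least 1 on the square of half width [D / 2], which contains every
    square of half width [D / 4] centred within [D / 4] of [q]. *)
Lemma Gt_local q : @Sigma R q -> q <> p -> exists (C d : R) (n0 : nat) (phi : R -> R -> R),
  [/\ 0 <= C, 0 < d, testfun (@Sigma R) phi /\ testfun (Om n0) phi, forall x y, 0 <= phi x y <= expR (8 / 3) &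
   forall z, sqr q d z -> z <> p -> Om n0 z /\ forall n m, (n0 <= n)%N -> (n <= m)%N ->
     Gt m z - Gt n z <= C * (un m phi p.1 p.2 - un n phi p.1 p.2)].
Proof.
move=> Sq qp.
have [D D0 sD] := sqr_small (open_nbhs_nbhs (conj open_Sigma Sq : open_nbhs q (@Sigma R))).
have [n0 sn0] := Om_compact exh (@compact_sqr R q D) sD.
pose phi x y := expR (8 / 3) * bmp q D x y.
have tS : testfun (@Sigma R) phi by apply: testfunZ; exact: testfun_bmp.
have t0 : testfun (Om n0) phi by apply: testfunZ; exact: testfun_bmp.
exists (expR 2 * (112 / (D / 4) ^+ 2)), (D / 4), n0, phi; split => //.
- by rewrite mulr_ge0 ?expR_ge0// divr_ge0// exprn_ge0//; lra.
- by lra.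
- move=> x y; have := bmp_ge0 q D x y; have := bmp_le1 q D x y; have := expR_gt0 (8 / 3 : R).
  by rewrite /phi; nra.
- move=> z /sqrP[z1 z2] zp; split.
    by apply: sn0; apply/sqrP; split; lra.
  move=> n m n0n nm.
  have sz w : sqr z (D / 4) w -> sqr q (D / 2) w.
    move=> /sqrP[w1 w2]; apply/sqrP.
    have -> : w.1 - q.1 = (w.1 - z.1) + (z.1 - q.1) by ring.
    have -> : w.2 - q.2 = (w.2 - z.2) + (z.2 - q.2) by ring.
    by split; apply: le_trans (ler_normD _ _) _; lra.
  apply: harnack => //.
  - by lra.
  - move=> w /sz /sqrP[w1 w2]; apply: (Om_mono exh n0n); apply: sn0; apply/sqrP; split; lra.
  - exact: testfun_mono (Om_mono exh n0n) t0.
  - by move=> x y; rewrite mulr_ge0 ?expR_ge0 ?bmp_ge0.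
  - move=> w /sz; rewrite {1}(surjective_pairing w) => /(bmp_ge D0) h.
    have := ler_wpM2l (expR_ge0 (8 / 3)) h; by rewrite -expRD subrr expR0.
Qed.

Definition gl q : R := limn (fun n => Gt n q).

Lemma gl_cvg q : (fun n => Gt n q) @ \oo --> gl q.
Proof.
suff : cvgn (fun n => Gt n q) by [].
have [[Sq qp]|h] := pselect (@Sigma R q /\ q <> p); last first.
  have -> : (fun n => Gt n q) = (fun=> 0).
    apply/funext => n; apply: Gt_out => -[Oq qp]; apply: h; split => //.
    by apply: (Om_Sigma exh); apply: subset_closure Oq.
  exact: is_cvg_cst.
have [C [d [n0 [phi [C0 d0 [tS t0] phib]]]]] := Gt_local Sq qp.
have qs : sqr q d q by apply/sqrP; rewrite !subrr normr0 ltW.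
move=> /(_ q qs qp)[Oq H].
have [||n1 [t1 [l [_ ul]]]] := @un_cvg phi tS.
- by move=> x y; case/andP: (phib x y).
- by exists (expR (8 / 3)) => x y; case/andP: (phib x y).
pose N := maxn n0 n1.
have [|n|l' [h _]] := @nondecr_cvg R (fun n => Gt n q) N (Gt N q + C * (l - un N phi p.1 p.2)).
- by move=> n m _ nm; exact: Gt_le.
- move=> Nn; have := H N n (leq_maxl _ _) Nn.
  have : un n phi p.1 p.2 <= l by apply: ul; exact: leq_trans (leq_maxr _ _) Nn.
  by move: C0; nra.
- by apply/cvg_ex; exists l'.
Qed.

Lemma Gt_gl n q : Gt n q <= gl q.
Proof.
apply: nondecreasing_cvgn_le; first by move=> i j; exact: Gt_le.
by apply/cvg_ex; exists (gl q); exact: gl_cvg.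
Qed.

Lemma gl_ge0 q : 0 <= gl q. Proof. exact: le_trans (Gt_ge0 0 q) (Gt_gl 0 q). Qed.

Lemma gl_out q : ~ (@Sigma R q /\ q <> p) -> gl q = 0.
Proof.
move=> h; rewrite /gl; have -> : (fun n => Gt n q) = (fun=> 0); last by rewrite lim_cst.
apply/funext => n; apply: Gt_out => -[Oq qp]; apply: h; split => //.
by apply: (Om_Sigma exh); apply: subset_closure Oq.
Qed.

(** By [Gt_local] the distance of [Gt N] to the limit is at most [C] times the remainder of one
    convergent numerical sequence, uniformly near [q]; so continuity passes from [Gt N] to the
    limit. *)
Lemma gl_cont q : @Sigma R q -> q <> p -> {for q, continuous gl}.
Proof.
move=> Sq qp; have [C [d [n0 [phi [C0 d0 [tS t0] phib H]]]]] := Gt_local Sq qp.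
have [||n1 [t1 [l [cl ul]]]] := @un_cvg phi tS.
- by move=> x y; case/andP: (phib x y).
- by exists (expR (8 / 3)) => x y; case/andP: (phib x y).
apply/cvgrPdist_le => /= e e0.
have C1 : 0 < e / 3 / (C + 1) by rewrite divr_gt0//; lra.
move/cvgrPdist_le : cl => /(_ _ C1)[n2 _ h2].
pose N := maxn n0 (maxn n1 n2).
have N0 : (n0 <= N)%N by exact: leq_maxl.
have N1 : (n1 <= N)%N by rewrite !leq_max leqnn !orbT.
have N2 : (n2 <= N)%N by rewrite !leq_max leqnn !orbT.
have uN : C * (l - un N phi p.1 p.2) <= e / 3.
  have := h2 N N2; rewrite ger0_norm ?subr_ge0; last exact: ul.
  rewrite ler_pdivlMr; last lra.
  by have := ul N N1; nra.
have close z : sqr q d z -> z <> p -> gl z - Gt N z <= e / 3.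
  move=> zs zp; have [_ Hz] := H z zs zp.
  suff : gl z <= Gt N z + e / 3 by lra.
  apply: limr_le; first by apply/cvg_ex; exists (gl z); exact: gl_cvg.
  exists N => // m /= Nm; have := Hz N m N0 Nm.
  have := ul m (leq_trans N1 Nm); by move: uN C0; nra.
have qs : sqr q d q by apply/sqrP; rewrite !subrr normr0 ltW.
have Oq : Om N q by apply: (Om_mono exh N0); have [] := H q qs qp.
have e3 : 0 < e / 3 by lra.
have := @Gt_cont N q Oq qp => /cvgrPdist_le /(_ _ e3) c.
have ns := nbhs_sqr q d0.
have np : nbhs q [set z | z <> p].
  have o : open (~` [set p]) by rewrite openC; apply: compact_closed; [exact: norm_hausdorff|exact: compact_set1].
  exact: (open_nbhs_nbhs (conj o qp)).
near=> z.
have zs : sqr q d z by near: z; exact: ns.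
have zp : z <> p by near: z; exact: np.
have cz : `|Gt N q - Gt N z| <= e / 3 by near: z; exact: c.
have a1 := close z zs zp; have a2 := close q qs qp; have a3 := Gt_gl N z; have a4 := Gt_gl N q.
by move: cz; rewrite !ler_norml; lra.
Unshelve. all: by end_near. Qed.

Lemma measurable_gl : measurable_fun (setT : set (R * R)) gl.
Proof.
pose D := @Sigma R `\ p.
have oD : open D.
  apply: openI; first exact: open_Sigma.
  by rewrite openC; apply: compact_closed; [exact: norm_hausdorff|exact: compact_set1].
have -> : gl = patch (fun=> 0) D gl.
  by apply/funext => q; rewrite /patch; case: ifPn => //; rewrite notin_setE => h; exact: gl_out.
apply/measurable_restrict; [exact: open_measurable2|exact: measurableT|rewrite setTI].
by apply: measurable_open_cont => // q [Sq qp]; exact: gl_cont.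
Qed.

Lemma gl_int phi : testfun (@Sigma R) phi -> (forall x y, 0 <= phi x y) ->
  (exists M : R, forall x y, phi x y <= M) ->
  mu2.-integrable setT (EFin \o (fun q => gl q * phi q.1 q.2)) /\
  (fun n => un n phi p.1 p.2) @ \oo --> Rintegral mu2 setT (fun q => gl q * phi q.1 q.2).
Proof.
move=> t phi0 bphi; have [n0 [t0 [l [cl ul]]]] := un_cvg t phi0 bphi.
have tn k : testfun (Om (k + n0)) phi by apply: testfun_mono t0; apply: (Om_mono exh); exact: leq_addl.
pose f k (q : R * R) := (Gt (k + n0) q * phi q.1 q.2)%:E.
have mf k : measurable_fun setT (f k) by have [/integrableP[]] := Gt_int (tn k).
have f0 k q : setT q -> (0 <= f k q)%E by move=> _; rewrite lee_fin mulr_ge0// Gt_ge0.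
have nd q : setT q -> nondecreasing_seq (f ^~ q).
  by move=> _ i j ij; rewrite lee_fin ler_wpM2r// Gt_le// leq_add2r.
have cf q : limn (f ^~ q) = (gl q * phi q.1 q.2)%:E.
  apply/cvg_lim => //; apply: cvg_EFin; first by exists 0%N.
  apply: cvgM; last exact: cvg_cst.
  by rewrite (cvg_shiftn n0 (fun n => Gt n q)); exact: gl_cvg.
have := @cvg_monotone_convergence _ _ _ mu2 setT measurableT f mf f0 nd.
under [X in _ --> X]eq_integral do rewrite cf.
have eI k : (\int[mu2]_(x in setT) f k x = (un (k + n0) phi p.1 p.2)%:E)%E.
  have [i <-] := Gt_int (tn k).
  by rewrite /Rintegral fineK//; exact: integrable_fin_num.
move=> cI0.
have cI : (fun k => (un (k + n0) phi p.1 p.2)%:E) @ \oo --> (\int[mu2]_(x in setT) (gl x * phi x.1 x.2)%:E)%E.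
  by rewrite -(funext eI); exact: cI0.
have cl' : (fun k => (un (k + n0) phi p.1 p.2)%:E) @ \oo --> l%:E.
  by apply: cvg_EFin; [exists 0%N|rewrite (cvg_shiftn n0 (fun n => un n phi p.1 p.2))].
have eg : (\int[mu2]_(x in setT) (gl x * phi x.1 x.2)%:E = l%:E)%E := cvg_unique (@ereal_hausdorff R) cI cl'.
have mg : measurable_fun (setT : set (R * R)) (fun q => gl q * phi q.1 q.2).
  by apply: measurable_funM; [exact: measurable_gl|apply: measurable_cont2; exact: smooth_cont t.1].
split; last by rewrite /Rintegral eg.
apply/integrableP; split; first exact/measurable_EFinP.
under eq_integral do rewrite gee0_abs ?lee_fin ?mulr_ge0 ?gl_ge0//.
by rewrite [X in (X < _)%E](_ : _ = l%:E) ?ltry//; exact: eg.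
Qed.

End green_limit.

(** * Cosine transform of the limit *)

Section cutoff.
Variable R : realType.
Implicit Types j t u : R.
(** The factor [expR 1] normalises the value at 0 to 1. *)
Definition chi j t : R := expR 1 * Fm 0 (1 - (t / j) ^+ 2).

Lemma chi_ge0 j t : 0 <= chi j t.
Proof. by rewrite mulr_ge0 ?expR_ge0 ?Fm_ge0. Qed.

Lemma chi_pos u : u < 1 -> expR 1 * Fm 0 (1 - u) = expR (- (u / (1 - u))).
Proof.
move=> u1; have h : 0 < 1 - u by lra.
rewrite Fm_pos// expr0 invr1 mul1r -expRD; congr expR; field; lra.
Qed.

Lemma chi_le1 j t : chi j t <= 1.
Proof.
rewrite /chi; have := sqr_ge0 (t / j); move: ((t / j) ^+ 2) => u u0.
have [u1|u1] := ltP u 1; last by rewrite Fm_neg ?mulr0//; lra.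
by rewrite chi_pos// -[leRHS]expR0 ler_expR oppr_le0 divr_ge0//; lra.
Qed.

(** The error of the cut-off is quadratic in [t], so that the term in [x^2] of the barrier in
    [strip_barrier] can absorb it. *)
Lemma chi_ge j t : 1 - chi j t <= 2 * (t / j) ^+ 2.
Proof.
rewrite /chi; have := sqr_ge0 (t / j); move: ((t / j) ^+ 2) => u u0.
have [u2|u2] := ltP u (1 / 2); last first.
  have : 0 <= expR 1 * Fm 0 (1 - u) by rewrite mulr_ge0 ?expR_ge0 ?Fm_ge0.
  by lra.
have u1 : u < 1 by lra.
rewrite chi_pos//.
have := expR_ge1Dx (- (u / (1 - u))).
have : u / (1 - u) <= 2 * u by rewrite ler_pdivrMr; [nra|lra].
lra.
Qed.

Lemma Fm0_mono u t : u <= t -> Fm 0 u <= Fm 0 t.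
Proof.
move=> ut; have [u0|u0] := ltP 0 u; last by rewrite Fm_neg// Fm_ge0.
have t0 : 0 < t by lra.
by rewrite (Fm_pos _ u0) expr0 invr1 mul1r; apply: Fm0_ge.
Qed.

Lemma chi_mono i j t : 0 < i -> i <= j -> chi i t <= chi j t.
Proof.
move=> i0 ij; have j0 : 0 < j by lra.
rewrite /chi ler_pM2l ?expR_gt0//; apply: Fm0_mono; rewrite lerD2l lerN2 !exprMn.
apply: ler_wpM2l; first exact: sqr_ge0.
rewrite !exprVn lef_pV2 ?posrE ?exprn_gt0//.
by rewrite ler_pXn2r ?nnegrE// ltW.
Qed.

Lemma chi_supp j t : 0 < j -> j < `|t| -> chi j t = 0.
Proof. by move=> j0 jt; rewrite /chi (Fm_neg _ (div_sqr_ge j0 jt)) mulr0. Qed.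

Lemma chi_cvg t : (fun n : nat => chi n.+1%:R t) @ \oo --> (1 : R).
Proof.
have h : (fun n : nat => 1 - 2 * (t * (n.+1%:R)^-1) ^+ 2 : R) @ \oo --> (1 : R).
  have c0 : (fun n : nat => (n.+1%:R)^-1 : R) @ \oo --> (0 : R) by exact: cvg_harmonic.
  have e : 1 = 1 - 2 * (t * 0) ^+ 2 :> R by ring.
  rewrite [X in _ --> X]e.
  apply: cvgB; first exact: cvg_cst.
  apply: cvgM; first exact: cvg_cst.
  by rewrite expr2; apply: cvgM; apply: cvgM => //; exact: cvg_cst.
apply: (squeeze_cvgr _ h (cvg_cst (1 : R))); near=> n.
by rewrite chi_le1 andbT lerBlDr -lerBlDl; exact: chi_ge.
Unshelve. all: by end_near. Qed.

Lemma smooth_chi j : smooth (fun x _ : R => chi j x).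
Proof.
apply: (@smoothM _ (fun _ _ => expR 1) (fun x _ => Fm 0 (1 - (x / j) ^+ 2))); first exact: smooth_cst.
apply: (smooth_comp (D := setT) (phi := fun x _ => 1 - (x / j) ^+ 2)) => //; first by move=> k; exact: C1k_Fm.
apply: (@smoothD _ (fun _ _ => 1) (fun x _ => - (x / j) ^+ 2)); first exact: smooth_cst.
apply: (@smoothN _ (fun x _ => (x / j) ^+ 2)); apply: (@smoothM _ (fun x _ => x / j) (fun x _ => x / j));
apply: (@smoothM _ (fun x _ => x) (fun _ _ => j^-1)); by [exact: smooth_cst|exact: smooth_x].
Qed.

Lemma smooth_cosx (k x0 : R) : smooth (fun x _ : R => cos (k * (x - x0))).
Proof.
apply: (smooth_comp (D := setT) (h := fun t => cos (k * t)) (phi := fun x _ => x - x0)) => //.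
  by move=> n; exact: (C1k_trig n k).1.
by apply: (@smoothD _ (fun x _ => x) (fun _ _ => - x0)); [exact: smooth_x|exact: smooth_cst].
Qed.

End cutoff.

Lemma abs3 (R : realType) (a s b : R) : 0 <= a -> 0 <= b -> `|s| <= 1 -> `|a * s * b| <= a * b.
Proof.
move=> a0 b0 s1; rewrite !normrM (ger0_norm a0) (ger0_norm b0); apply: ler_wpM2r => //.
by rewrite ler_piMr.
Qed.

(** * Testing the limit against [cos (k (x - x0)) beta(y)] *)

Section strip.
Variable R : realType.
Variables (Om : nat -> set (R * R)) (G : nat -> R -> R -> R -> R -> R).
Hypothesis exh : exhaustion Om.
Hypothesis dg : forall n, dirichlet_green (Om n) (G n).
Variable p : R * R.
Hypothesis Op0 : Om 0 p.
Local Notation mu2 := (@leb2 R).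
Local Notation un := (un Om G).
Local Notation gl := (gl Om G p).
Implicit Types (phi psi : R -> R -> R).
Let Op n : Om n (p.1, p.2). Proof. by rewrite -surjective_pairing; exact: (Opn exh Op0). Qed.

Lemma unD n phi psi : testfun (Om n) phi -> testfun (Om n) psi ->
  un n (fun x y => phi x y + psi x y) p.1 p.2 = un n phi p.1 p.2 + un n psi p.1 p.2.
Proof.
move=> t1 t2; have [i1 <-] := Gt_int exh dg Op0 t1; have [i2 <-] := Gt_int exh dg Op0 t2.
have [_ <-] := Gt_int exh dg Op0 (testfunD t1 t2).
rewrite -RintegralD//; apply: eq_Rintegral => q _; by rewrite /= mulrDr.
Qed.

(** A signed [phi] is the difference of the nonnegative [phi + psi] and [psi], to which [gl_int]
    applies. *)
Lemma gl_int2 phi psi : testfun (@Sigma R) phi -> testfun (@Sigma R) psi ->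
  (forall x y, `|phi x y| <= psi x y) -> (exists M : R, forall x y, psi x y <= M) ->
  mu2.-integrable setT (EFin \o (fun q => gl q * phi q.1 q.2)) /\
  (fun n => un n phi p.1 p.2) @ \oo --> Rintegral mu2 setT (fun q => gl q * phi q.1 q.2).
Proof.
move=> t1 t2 h [M hM].
have h1 x y : - psi x y <= phi x y <= psi x y by rewrite -ler_norml.
have p0 x y : 0 <= psi x y by have := h1 x y; lra.
have p1 x y : 0 <= phi x y + psi x y by have := h1 x y; lra.
have [i1 c1] := gl_int exh dg Op0 t2 p0 (ex_intro _ M hM).
have [|i2 c2] := gl_int exh dg Op0 (testfunD t1 t2) p1.
  by exists (2 * M) => x y; have := h1 x y; have := hM x y; lra.
have e : (fun q => gl q * phi q.1 q.2) = (fun q => gl q * (phi q.1 q.2 + psi q.1 q.2) - gl q * psi q.1 q.2).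
  by apply/funext => q; ring.
rewrite e; split; first exact: integrable_diff.
rewrite RintegralB//.
have [n0 tn0] := testfun_Sigma exh t1; have [n1 tn1] := testfun_Sigma exh t2.
have c3 : (fun n => un n (fun x y => phi x y + psi x y) p.1 p.2 - un n psi p.1 p.2) @ \oo -->
  Rintegral mu2 setT (fun q => gl q * (phi q.1 q.2 + psi q.1 q.2)) - Rintegral mu2 setT (fun q => gl q * psi q.1 q.2).
  exact: cvgB c2 c1.
apply: cvg_trans c3; apply: near_eq_cvg.
exists (maxn n0 n1) => // n /=; rewrite geq_max => /andP[h0' h1'].
have tn := testfun_mono (Om_mono exh h0') tn0; have tn' := testfun_mono (Om_mono exh h1') tn1.
by rewrite [X in X - _]unD// addrK.
Qed.

Variables (beta : R -> R) (al be M : R).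
Hypothesis sb : smooth (fun _ y => beta y).
Hypothesis cb : forall t, {for t, continuous beta}.
Hypothesis al0 : 0 < al.
Hypothesis alb : al < be.
Hypothesis b_lo : forall t, t < al -> beta t = 0.
Hypothesis b_hi : forall t, be < t -> beta t = 0.
Hypothesis b0 : forall t, 0 <= beta t.
Hypothesis bM : forall t, beta t <= M.
Hypothesis M0 : 0 < M.

Lemma testfun_strip (j : R) (f : R -> R) : 0 < j -> smooth (fun x _ => f x) ->
  testfun (@Sigma R) (fun x y => chi j x * f x * beta y).
Proof.
move=> j0 sf; split.
  by apply: (@smoothM _ (fun x _ => chi j x * f x)) => //; apply: (@smoothM _ (fun x _ => chi j x)) => //; exact: smooth_chi.
exists (`[- j, j]%classic `*` `[al, be]%classic); split.
- by apply: compact_setX; exact: segment_compact.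
- by move=> q [_ /=]; rewrite in_itv/= /Sigma/=; have := al0; lra.
- move=> q nq; have [h1|h1] := leP `|q.1| j; last by rewrite chi_supp// !mul0r.
  have [h2|h2] := ltP q.2 al; first by rewrite b_lo// mulr0.
  have [h3|h3] := ltP be q.2; first by rewrite b_hi// mulr0.
  by exfalso; apply: nq; split; rewrite /= in_itv/= ?h2 ?h3// -ler_norml.
Qed.

Let A (q : R * R) := gl q * beta q.2.

(** The integrals against [chi n * beta] increase with [n] and are at most [4 M] by [un_le];
    monotone convergence gives integrability on the whole unbounded strip. *)
Lemma strip_integrable : mu2.-integrable setT (EFin \o A).
Proof.
have j0 n : 0 < n.+1%:R :> R by rewrite ltr0n.
have t n : testfun (@Sigma R) (fun x y => chi n.+1%:R x * 1 * beta y).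
  by apply: (@testfun_strip _ (fun=> 1)) => //; exact: smooth_cst.
have p0 n x y : 0 <= chi n.+1%:R x * 1 * beta y by rewrite mulr1 mulr_ge0// chi_ge0.
have pM n x y : chi n.+1%:R x * 1 * beta y <= M.
  by rewrite mulr1; apply: le_trans (bM y); rewrite ler_piMl// chi_le1.
pose f n (q : R * R) := (gl q * (chi n.+1%:R q.1 * 1 * beta q.2))%:E.
have int n := gl_int exh dg Op0 (t n) (p0 n) (ex_intro _ M (pM n)).
have mf n : measurable_fun setT (f n) by have [/integrableP[]] := int n.
have f0 k q : setT q -> (0 <= f k q)%E by move=> _; rewrite lee_fin mulr_ge0// gl_ge0.
have nd q : setT q -> nondecreasing_seq (f ^~ q).
  move=> _ i j ij; rewrite lee_fin ler_wpM2l ?(gl_ge0 exh dg Op0)// !mulr1 ler_wpM2r//.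
  by apply: chi_mono => //; rewrite ler_nat.
have cf q : limn (f ^~ q) = (A q)%:E.
  apply/cvg_lim => //; apply: cvg_EFin; first by exists 0%N.
  apply: cvgM; first exact: cvg_cst.
  rewrite -[X in _ --> X]mul1r; apply: cvgM; last exact: cvg_cst.
  by under eq_fun do rewrite mulr1; exact: chi_cvg.
have c := @cvg_monotone_convergence _ _ _ mu2 setT measurableT f mf f0 nd.
have bd n : (\int[mu2]_(q in setT) f n q <= (4 * M)%:E)%E.
  have [i c1] := int n.
  have -> : (\int[mu2]_(q in setT) f n q = (Rintegral mu2 setT (fun q => gl q * (chi n.+1%:R q.1 * 1 * beta q.2)))%:E)%E.
    by rewrite /Rintegral fineK//; exact: integrable_fin_num.
  rewrite lee_fin -(cvg_lim _ c1)//; apply: limr_le; first by apply/cvg_ex; eexists; exact: c1.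
  have [n0 tn0] := testfun_Sigma exh (t n).
  exists n0 => // m /= nm; apply: (un_le exh dg) => //; last exact: ltW.
  exact: testfun_mono (Om_mono exh nm) tn0.
have mA : measurable_fun (setT : set (R * R)) A.
  apply: measurable_funM; first exact: (measurable_gl exh dg Op0).
  by apply: (@measurable_cont2 _ (fun _ y => beta y)); exact: smooth_cont sb.
have A0 q : 0 <= A q by rewrite mulr_ge0// gl_ge0.
apply/integrableP; split; first exact/measurable_EFinP.
rewrite (_ : (\int[mu2]_(x in setT) `|(EFin \o A) x|)%E = (\int[mu2]_(x in setT) limn (f ^~ x))%E); last first.
  by apply: eq_integral => q _; rewrite /= cf ger0_norm.
have := c => /cvg_lim <-//; apply: (@le_lt_trans _ _ (4 * M)%:E); last exact: ltry.
apply: lime_le; first by apply/cvg_ex; eexists; exact: c.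
by exists 0%N => // n _; exact: bd.
Qed.

Variables (k x0 kap : R).
Hypothesis k0 : 0 < k.
Hypothesis k12 : 1 / 2 < kap.
Hypothesis kapE : kap ^+ 2 = k ^+ 2 + 1 / 4.
Local Notation u := (uk kap beta al be).

(* The barrier is the separated solution, corrected by a multiple of x^2 + 16 that absorbs the cut-off. *)
Lemma strip_barrier (sg j e : R) : sg ^+ 2 = 1 -> 0 < j -> 0 < e ->
  Rintegral mu2 setT (fun q => gl q * (chi j q.1 * (sg * cos (k * (q.1 - x0))) * beta q.2)) <=
  sg * (cos (k * (p.1 - x0)) * u p.2) + 8 * M / j ^+ 2 * (p.1 ^+ 2 + 16) + e.
Proof.
move=> sg2 j0 e0; have hk12 := k12; have hM0 := M0.
have sg1 : `|sg| <= 1 by rewrite -(@ler_pXn2r _ 2) ?nnegrE// real_normK ?num_real// sg2 expr1n.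
have j20 : 0 < j ^+ 2 by rewrite exprn_gt0.
(* The cut-off error is at most [2 (x / j)^2 M = C x^2 / 4]. As [P >= 1/4], the operator [- L] sends
   [C (x^2 + 16)] to at least that; the 16 outweighs the 2 from the second derivative of [x^2]. *)
set C := 8 * M / j ^+ 2.
have C0 : 0 < C by rewrite divr_gt0//; lra.
pose phi x y := chi j x * (sg * cos (k * (x - x0))) * beta y.
have tphi : testfun (@Sigma R) phi.
  apply: (@testfun_strip j (fun x => sg * cos (k * (x - x0)))) => //.
  by apply: (@smoothM _ (fun _ _ => sg)); [exact: smooth_cst|exact: smooth_cosx].
have tpsi : testfun (@Sigma R) (fun x y => chi j x * 1 * beta y).
  by apply: (@testfun_strip _ (fun=> 1)) => //; exact: smooth_cst.
have sc x : `|sg * cos (k * (x - x0))| <= 1.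
  by rewrite normrM -[leRHS]mulr1 ler_pM// ler_norml cos_geN1 cos_le1.
have [||_ c] := @gl_int2 phi _ tphi tpsi.
- by move=> x y; rewrite mulr1; apply: abs3 => //; exact: chi_ge0.
- by exists M => x y; rewrite mulr1; apply: le_trans (bM y); rewrite ler_piMl// chi_le1.
rewrite -(cvg_lim _ c)//; apply: limr_le; first by apply/cvg_ex; eexists; exact: c.
have [Mu hMu] := uk_bounded k12 cb al0 alb b_lo b_hi.
have [d d0 hd] := uk_small k12 al0 alb b_lo b_hi e0.
have Mu0 : 0 <= Mu by exact: le_trans (normr_ge0 _) (hMu 1 ltr01).
(* For [|x| > X] the term [C x^2] exceeds the bound [Mu] of the separated solution. For [|x| <= X]
   and [y] outside [[d, 1/d]] that solution is at most [e]. So the barrier is nonnegative off the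
   compact [K]. *)
pose X := Mu / C + 1.
have X1 : 1 <= X by rewrite lerDr divr_ge0// ltW.
pose K : set (R * R) := `[- X, X]%classic `*` `[d, d^-1]%classic.
have cK : compact K by apply: compact_setX; exact: segment_compact.
have KS : K `<=` @Sigma R by move=> q [_ /=]; rewrite in_itv/= /Sigma/=; move: d0; lra.
have [n0 Kn0] := Om_compact exh cK KS; have [n1 tn1] := testfun_Sigma exh tphi.
exists (maxn n0 n1) => // n /=; rewrite geq_max => /andP[h0 h1].
have tn := testfun_mono (Om_mono exh h1) tn1.
have du (y : R) : 0 < y -> is_derive y 1 u (uk' kap beta al be y) by exact: der_uk.
have du' (y : R) : 0 < y -> is_derive y 1 (uk' kap beta al be) ((kap ^+ 2 + 3 / (4 * snh y ^+ 2)) * u y - beta y).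
  exact: der_uk'.
pose cx x := cos (k * (x - x0)).
pose W x y := sg * (cx x * u y) + C * (x ^+ 2 + 16) + e.
apply: (@cmp_W R Om G exh dg n phi K W (fun x y => sg * (- k * sin (k * (x - x0)) * u y) + C * (2 * x))
  (fun x y => sg * (cx x * uk' kap beta al be y))
  (fun x y => sg * (- k ^+ 2 * cx x * u y) + C * 2)
  (fun x y => sg * (cx x * ((kap ^+ 2 + 3 / (4 * snh y ^+ 2)) * u y - beta y))) tn cK).
- exact: subset_trans Kn0 (Om_mono exh h0).
- move=> q Sq; have cu : {for q.2, continuous u} by exact: der_cts (du _ Sq).
  have c1 : {for q.1, continuous cx} by rewrite /cx; cts.
  have c1' : {for q, continuous (fun z : R * R => cx z.1)} := continuous_comp (@cont2_fst R q) c1.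
  have cu' : {for q, continuous (fun z : R * R => u z.2)} := continuous_comp (@cont2_snd R q) cu.
  have c2 : {for q, continuous (fun z : R * R => z.1)} by exact: cont2_fst.
  apply: cvgD; last exact: cvg_cst.
  apply: cvgD; first by apply: cvgM; [exact: cvg_cst|exact: cvgM].
  apply: cvgM; first exact: cvg_cst.
  by apply: cvgD; [rewrite expr2; apply: (cvgM c2 c2)|exact: cvg_cst].
- by move=> x y y0; rewrite /W /cx; der; rewrite /=; ring.
- by move=> x y y0; rewrite /cx; der; rewrite /=; ring.
- by move=> x y y0; have d1 := du y y0; rewrite /W; der; rewrite /=; ring.
- by move=> x y y0; have d1 := du' y y0; der; rewrite /=; ring.
- move=> x y y0.
  have P4 := Pconf_ge y0.
  have eP : kap ^+ 2 + 3 / (4 * snh y ^+ 2) = k ^+ 2 + Pconf y by rewrite Pconf_snh// kapE; ring.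
  rewrite eP /W /phi -/(cx x).
  have ch := chi_ge j x; have ch1 := chi_le1 j x; have bb := b0 y; have bbM := bM y.
  have s1 : `|sg * cx x| <= 1 by exact: sc.
  have -> : chi j x * (sg * cx x) * beta y = sg * cx x * beta y - (1 - chi j x) * (sg * cx x) * beta y by ring.
  have k1 : - ((1 - chi j x) * (sg * cx x) * beta y) <= 2 * (x / j) ^+ 2 * M.
    have c0 : 0 <= 1 - chi j x by rewrite subr_ge0.
    apply: le_trans (ler_norm _) _; rewrite normrN; apply: le_trans (abs3 c0 bb s1) _.
    exact: (ler_pM c0 bb ch bbM).
  have k2 : 2 * (x / j) ^+ 2 * M = C * x ^+ 2 / 4 by rewrite /C; field; rewrite gt_eqF.
  have x20 := sqr_ge0 x.
  have k3 : C * (x ^+ 2 / 4) <= C * (Pconf y * (x ^+ 2 + 16) - 2) by rewrite ler_pM2l//; nra.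
  have k4 : 0 <= Pconf y * e by rewrite mulr_ge0 ?(ltW e0)//; lra.
  lra.
- move=> x y y0 nK; rewrite /W.
  have bnd : `|sg * (cx x * u y)| <= `|u y|.
    by rewrite mulrA normrM ler_piMl//; exact: sc.
  have lb := ler_norm (- (sg * (cx x * u y))); rewrite normrN in lb.
  have x20 := sqr_ge0 x.
  have [hx|hx] := leP `|x| X.
    have hu : `|u y| <= e.
      apply: hd => //; have [yd|yd] := ltP y d; first by left.
      have [yd'|yd'] := ltP d^-1 y; first by right.
      by exfalso; apply: nK; split; rewrite /= in_itv/= ?yd ?yd'// -ler_norml.
    have : 0 <= C * (x ^+ 2 + 16) by rewrite mulr_ge0 ?(ltW C0)//; lra.
    lra.
  have hu := hMu y y0.
  have : X <= x ^+ 2.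
    have : X ^+ 2 <= `|x| ^+ 2 by rewrite ler_pXn2r ?nnegrE ?(ltW hx)//; lra.
    by rewrite real_normK ?num_real//; nra.
  have : Mu <= C * X by rewrite /X mulrDr mulr1 mulrCA divff ?gt_eqF// mulr1; lra.
  by move: C0 e0; nra.
- exact: Op.
Qed.

(** The separated solution times the cosine solves the equation with right-hand side [cos * beta],
    and its value at the pole is the integral of the Green's function against that side. Letting the
    cut-off go to infinity in [strip_barrier] makes the corrections vanish. *)
Lemma strip_identity :
  Rintegral mu2 setT (fun q => A q * cos (k * (q.1 - x0))) = cos (k * (p.1 - x0)) * u p.2.
Proof.
set L := Rintegral _ _ _.
have lim (sg : R) : sg ^+ 2 = 1 ->
  (fun n : nat => Rintegral mu2 setT (fun q => gl q * (chi n.+1%:R q.1 * (sg * cos (k * (q.1 - x0))) * beta q.2))) @ \oo --> sg * L.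
  move=> sg2.
  have sg1 : `|sg| <= 1 by rewrite -(@ler_pXn2r _ 2) ?nnegrE// real_normK ?num_real// sg2 expr1n.
  have sc x : `|sg * cos (k * (x - x0))| <= 1.
    by rewrite normrM -[leRHS]mulr1 ler_pM// ler_norml cos_geN1 cos_le1.
  have mA : measurable_fun (setT : set (R * R)) A by have /integrableP[/measurable_EFinP] := strip_integrable.
  have mc : measurable_fun (setT : set (R * R)) (fun q : R * R => cos (k * (q.1 - x0))).
    by apply: (@measurable_cont2 _ (fun x _ => cos (k * (x - x0)))); apply: smooth_cont; exact: smooth_cosx.
  have -> : sg * L = Rintegral mu2 setT (fun q => A q * (sg * cos (k * (q.1 - x0)))).
    rewrite /L -RintegralZl//; first by apply: eq_Rintegral => q _; rewrite /=; ring.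
    apply: (@integrable_dom _ _ _ mu2 setT _ (fun q => A q)) => //; first exact: measurable_funM.
      move=> q _; rewrite normrM ger0_norm ?mulr_ge0 ?(gl_ge0 exh dg Op0)// ler_piMr//.
        by rewrite mulr_ge0// (gl_ge0 exh dg Op0).
      by rewrite ler_norml cos_geN1 cos_le1.
    exact: strip_integrable.
  have [||||_ //] := @dominated_cvg_seq _ _ R mu2 setT
    (fun n q => gl q * (chi n.+1%:R q.1 * (sg * cos (k * (q.1 - x0))) * beta q.2))
    (fun q => A q * (sg * cos (k * (q.1 - x0)))) A measurableT.
  - move=> n; have -> : (fun q => gl q * (chi n.+1%:R q.1 * (sg * cos (k * (q.1 - x0))) * beta q.2)) =
      (fun q => A q * (chi n.+1%:R q.1 * (sg * cos (k * (q.1 - x0))))) by apply/funext => q; rewrite /A; ring.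
    apply: measurable_funM => //; apply: measurable_funM.
      by apply: (@measurable_cont2 _ (fun x _ => chi n.+1%:R x)); apply: smooth_cont; exact: smooth_chi.
    by apply: measurable_funM => //; exact: measurable_cst.
  - move=> q _; have -> : A q * (sg * cos (k * (q.1 - x0))) = gl q * (1 * (sg * cos (k * (q.1 - x0))) * beta q.2).
      by rewrite /A; ring.
    apply: cvgM; first exact: cvg_cst.
    apply: cvgM; last exact: cvg_cst.
    by apply: cvgM; [exact: chi_cvg|exact: cvg_cst].
  - move=> n q _; rewrite normrM (ger0_norm (gl_ge0 exh dg Op0 _)) ler_wpM2l ?(gl_ge0 exh dg Op0)//.
    apply: le_trans (abs3 (chi_ge0 _ _) (b0 _) (sc _)) _.
    by rewrite ler_piMl// chi_le1.
  - exact: strip_integrable.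
(* The signs [sg = 1] and [sg = -1] give the two inequalities. *)
have up (sg : R) : sg ^+ 2 = 1 -> sg * L <= sg * (cos (k * (p.1 - x0)) * u p.2).
  move=> sg2; apply/ler_addgt0Pr => e e0.
  have e2 : 0 < e by [].
  have cB : (fun n : nat => sg * (cos (k * (p.1 - x0)) * u p.2) + 8 * M * (p.1 ^+ 2 + 16) * ((n.+1%:R)^-1 * (n.+1%:R)^-1) + e) @ \oo
     --> sg * (cos (k * (p.1 - x0)) * u p.2) + 8 * M * (p.1 ^+ 2 + 16) * (0 * 0) + e.
    have c0 : (fun n : nat => (n.+1%:R)^-1 : R) @ \oo --> (0 : R) by exact: cvg_harmonic.
    apply: cvgD; last exact: cvg_cst.
    apply: cvgD; first exact: cvg_cst.
    by apply: cvgM; [exact: cvg_cst|exact: cvgM].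
  have := lim sg sg2 => cL.
  have -> : sg * (cos (k * (p.1 - x0)) * u p.2) + e = sg * (cos (k * (p.1 - x0)) * u p.2) + 8 * M * (p.1 ^+ 2 + 16) * (0 * 0) + e.
    by ring.
  apply: (ler_cvg_to cL cB); near=> n.
  have n0 : 0 < n.+1%:R :> R by rewrite ltr0n.
  apply: le_trans (@strip_barrier sg n.+1%:R e sg2 n0 e0) _.
  rewrite le_eqVlt; apply/orP; left; apply/eqP.
  by move: (n.+1%:R : R) n0 => N N0; field; rewrite gt_eqF.
have u1 := up 1 (expr1n _ _); have u2 : -1 * L <= -1 * (cos (k * (p.1 - x0)) * u p.2) by apply: up; rewrite sqrrN expr1n.
by apply/eqP; rewrite eq_le; apply/andP; split; lra.
Unshelve. all: by end_near. Qed.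

End strip.

(** * Abel inversion *)

Section abel_kernel.
Variable R : realType.
Local Notation mu := (@lebesgue_measure R).
Local Notation Rp := (`[0, +oo[%classic : set R).
Implicit Types (s k y e d : R).
Definition rr s : R := Num.sqrt (s ^+ 2 + 1 / 4).

Lemma rr2 s : rr s ^+ 2 = s ^+ 2 + 1 / 4.
Proof. by rewrite sqr_sqrtr// addr_ge0 ?sqr_ge0//; lra. Qed.

Lemma rr_gt0 s : 0 < rr s.
Proof. by rewrite sqrtr_gt0; have := sqr_ge0 s; lra. Qed.

Lemma cts_rr s : {for s, continuous rr}.
Proof. by rewrite /rr; cts. Qed.

Lemma rr_ge s : 0 <= s -> s <= rr s.
Proof. by move=> s0; rewrite -(@ler_pXn2r _ 2) ?nnegrE ?(ltW (rr_gt0 s))// rr2; lra. Qed.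

(** The denominator is both [rr k ^ 2 + s ^ 2], the resolvent at [kap = rr k], and
    [rr s ^ 2 + k ^ 2], whose cosine transform in [k] is known. *)
Definition hk s k : R := (k ^+ 2 + 1 / 4 + s ^+ 2)^-1.

Lemma hk_gt0 s k : 0 < hk s k.
Proof. by rewrite invr_gt0; have := sqr_ge0 s; have := sqr_ge0 k; lra. Qed.

Lemma hk_le s k : hk s k <= ((1 / 2) ^+ 2 + s ^+ 2)^-1.
Proof.
have := sqr_ge0 s; have := sqr_ge0 k => k2 s2.
by rewrite /hk lef_pV2 ?posrE; lra.
Qed.

Lemma cont2_hk : cont2 hk.
Proof.
apply: (@cont2_comp R (fun t => t^-1) (fun s k => k ^+ 2 + 1 / 4 + s ^+ 2)).
  apply: (@cont2D R (fun s k => k ^+ 2 + 1 / 4) (fun s k => s ^+ 2)).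
    apply: (@cont2D R (fun s k => k ^+ 2) (fun s k => 1 / 4)); last exact: cont2_cst.
    by apply: (@cont2M R (fun s k => k) (fun s k => k)); exact: cont2_snd.
  by apply: (@cont2M R (fun s k => s) (fun s k => s)); exact: cont2_fst.
move=> s k; have h : k ^+ 2 + 1 / 4 + s ^+ 2 != 0.
  by have := hk_gt0 s k; rewrite invr_gt0 => /gt_eqF ->.
by cts.
Qed.

Lemma cts_hk s k : {for k, continuous (hk s)}.
Proof.
have h : k ^+ 2 + 1 / 4 + s ^+ 2 != 0.
  by have := hk_gt0 s k; rewrite invr_gt0 => /gt_eqF ->.
by rewrite /hk; cts.
Qed.

Lemma measurable_hk : measurable_fun (setT : set (R * R)) (fun z : R * R => hk z.1 z.2).
Proof. exact: measurable_cont2 cont2_hk. Qed.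

Lemma measurable_Ef2 y : 0 < y -> measurable_fun (setT : set (R * R)) (fun z : R * R => Ef z.1 y z.2).
Proof.
move=> y0.
have -> : (fun z : R * R => Ef z.1 y z.2) = (fun z => (4 * z.1 / (pi * (1 + 4 * z.1 ^+ 2)) * om y * p1 (csn z.1) (csn' z.1) (shh y)) *
    (om z.2 * q1 (snn z.1) (snn' z.1) (shh z.2))).
  apply/funext => -[s e] /=; have [->|s0] := eqVneq s 0; last by rewrite Ef_pq//; ring.
  by rewrite /Ef Js0 !mul0r mulr0 !mul0r.
apply: measurable_funM.
  have m1 : measurable_fun (setT : set R) (fun s => 4 * s / (pi * (1 + 4 * s ^+ 2)) * om y * p1 (csn s) (csn' s) (shh y)).
    apply: measurable_funM; last exact: measurable_p1c.
    apply: continuous_measurableT => // s.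
    have h : pi * (1 + 4 * s ^+ 2) != 0 :> R.
      by rewrite gt_eqF// mulr_gt0 ?pi_gt0//; have := sqr_ge0 s; lra.
    by cts.
  exact: (measurableT_comp m1 measurable_fst).
apply: measurable_funM.
  have m1 : measurable_fun (setT : set R) (@om R).
    apply: continuous_measurableT => // t.
    have c1 : {for t, continuous (@shh R)} by exact: der_cts (der_shh t).
    have c2 : {for t, continuous (@chh R)} by exact: der_cts (der_chh t).
    by rewrite /om /snh; cts.
  exact: (measurableT_comp m1 measurable_snd).
have ms : measurable_fun (setT : set R) (@shh R).
  by apply: continuous_measurableT => // t; exact: der_cts (der_shh t).
have mp : measurable_fun (setT : set (R * R)) (fun z : R * R => (z.1, shh z.2)).
  by apply: measurable_fun_pair; [exact: measurable_fst|exact: (measurableT_comp ms measurable_snd)].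
exact: (measurableT_comp (@measurable_q1s2 R) mp).
Qed.

Lemma measurable_Ef y e : 0 < y -> measurable_fun (setT : set R) (fun s => Ef s y e).
Proof.
move=> y0; have mp : measurable_fun (setT : set R) (fun s : R => (s, e)).
  by apply: measurable_fun_pair; [exact: measurable_id|exact: measurable_cst].
exact: (measurableT_comp (measurable_Ef2 y0) mp).
Qed.

Variable X : R.
Hypothesis X0 : 0 < X.
Definition Cd d s : R := Rintegral mu Rp (fun k => expR (- (d * k)) * cos (k * X) * hk s k).
Definition C0 s : R := pi / (2 * rr s) * expR (- (rr s * X)).

Lemma expcos_le d k : 0 <= d -> 0 <= k -> `|expR (- (d * k)) * cos (k * X)| <= 1.
Proof.
move=> d0 k0; rewrite normrM -[leRHS]mulr1; apply: ler_pM => //.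
  by rewrite ger0_norm ?expR_ge0 ?expN_le1.
by rewrite ler_norml cos_geN1 cos_le1.
Qed.

Lemma rrD s k : rr s ^+ 2 + k ^+ 2 = k ^+ 2 + 1 / 4 + s ^+ 2.
Proof. by rewrite rr2; ring. Qed.

Lemma integrable_hk s : mu.-integrable Rp (EFin \o hk s).
Proof.
have := integrable_cauchy_scale (rr_gt0 s).
by apply: eq_integrable => // k _; rewrite /= /hk rrD.
Qed.

Lemma integrable_Cd d s : 0 <= d -> mu.-integrable Rp (EFin \o (fun k => expR (- (d * k)) * cos (k * X) * hk s k)).
Proof.
move=> d0; apply: (@integrable_dom _ _ _ mu Rp _ (hk s)) => //; last exact: integrable_hk.
  by apply: continuous_measurableT => // k; have c := @cts_hk s; cts.
move=> k; rewrite /= in_itv/= andbT => k0.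
by rewrite normrM (gtr0_norm (hk_gt0 _ _)) ler_piMl ?(ltW (hk_gt0 _ _))// expcos_le.
Qed.

(* The function bounded below is monotone up to the factor 1 - sg sin, so one integration by parts suffices. *)
Lemma Cd_half d s (sg : R) : 0 < d -> sg ^+ 2 = 1 -> sg * Cd d s <= (X * ((1 / 2) ^+ 2 + s ^+ 2))^-1.
Proof.
move=> d0 sg2; have hX := X0.
pose Ph k := expR (- (d * k)) * hk s k.
have nz k : k ^+ 2 + 1 / 4 + s ^+ 2 != 0.
  by have := hk_gt0 s k; rewrite invr_gt0 => /gt_eqF ->.
pose Ph' k := - (d * expR (- (d * k)) * hk s k) - expR (- (d * k)) * (2 * k * hk s k ^+ 2).
have dPh k : is_derive k 1 Ph (Ph' k).
  have dd : is_derive k 1 (fun k : R => k ^+ 2 + 1 / 4 + s ^+ 2) (2 * k) by der; rewrite /=; ring.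
  have dh : is_derive k 1 (hk s) (- (2 * k) * hk s k ^+ 2).
    by apply: (der_eq (@derV R (fun k : R => k ^+ 2 + 1 / 4 + s ^+ 2) k _ (nz k) dd)); rewrite /hk exprVn.
  by rewrite /Ph; der; rewrite /Ph' /=; ring.
pose F k := - (Ph k * (1 - sg * sin (k * X)) / X).
pose f k := - (Ph' k * (1 - sg * sin (k * X)) / X) + sg * (Ph k * cos (k * X)).
have dF k : is_derive k 1 F (f k).
  by have dd := dPh k; rewrite /F; der; rewrite ?gt_eqF// /f /=; field; rewrite gt_eqF.
have chk := @cts_hk s.
have cf k : {for k, continuous f}.
  by rewrite /f /Ph /Ph'; cts.
have sn k : 0 <= 1 - sg * sin (k * X).
  have : `|sg * sin (k * X)| <= 1.
    have sg1 : `|sg| <= 1 by rewrite -(@ler_pXn2r _ 2) ?nnegrE// real_normK ?num_real// sg2 expr1n.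
    by rewrite normrM -[leRHS]mulr1 ler_pM// ler_norml sin_geN1 sin_le1.
  by rewrite ler_norml; lra.
have ineq T : 0 <= T -> Rintegral mu `[0, T] (fun k => sg * (expR (- (d * k)) * cos (k * X) * hk s k)) <= (X * ((1 / 2) ^+ 2 + s ^+ 2))^-1.
  move=> T0; apply: (@le_trans _ _ (Rintegral mu `[0, T] f)).
    apply: le_Rintegral => //.
    - by apply: continuous_integrable_itv => k _; cts.
    - by apply: continuous_integrable_itv => k _.
    - move=> k; rewrite /= in_itv/= => /andP[k0 kT].
      have -> : sg * (expR (- (d * k)) * cos (k * X) * hk s k) = sg * (Ph k * cos (k * X)) by rewrite /Ph; ring.
      rewrite /f lerDr -mulrA -mulNr mulr_ge0//; last by rewrite divr_ge0// ltW.
      have E := expR_gt0 (- (d * k)); have H := hk_gt0 s k.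
      rewrite /Ph' opprB opprK addr_ge0// !mulr_ge0 ?(ltW E) ?(ltW H) ?(ltW d0) ?exprn_ge0 ?(ltW H)//.
  rewrite (@Rintegral_FTC R 0 T F f T0 (fun k _ => dF k) (fun k _ => cf k)).
  have FT : F T <= 0 by rewrite oppr_le0 divr_ge0 ?(ltW hX)// mulr_ge0// mulr_ge0 ?expR_ge0 ?(ltW (hk_gt0 _ _)).
  have F0 : - F 0 = (X * ((1 / 2) ^+ 2 + s ^+ 2))^-1.
    have h := nz 0; rewrite /F /Ph /hk mulr0 oppr0 expR0 mul0r sin0 !mulr0 subr0 mulr1 mul1r opprK.
    have h2 : (1 / 2) ^+ 2 + s ^+ 2 != 0 by rewrite gt_eqF//; have := sqr_ge0 s; lra.
    have h3 : 0 ^+ 2 + 1 / 4 + s ^+ 2 = (1 / 2) ^+ 2 + s ^+ 2 :> R by field.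
    by rewrite h3 invfM mulrC.
  by rewrite -F0; lra.
have i := integrable_Cd s (ltW d0).
have e : sg * Cd d s = Rintegral mu Rp (fun k => sg * (expR (- (d * k)) * cos (k * X) * hk s k)).
  by rewrite /Cd -RintegralZl.
rewrite e; have c := @Rintegral_itvcy_cvg R 0 _ (@integrable_scale _ _ _ mu Rp _ sg (measurable_itv _) i).
apply: (ler_cvg_to c (cvg_cst _)); near=> T; apply: ineq; near: T; exact: nbhs_pinfty_ge.
Unshelve. all: by end_near. Qed.

(** Dropping the cosine would give only order [1 / s], which is not integrable at infinity. The gain
    to order [s^-2], uniform in [d], is what lets [d -> 0] pass through the integral over [s]. *)
Lemma Cd_bound d s : 0 < d -> `|Cd d s| <= (X * ((1 / 2) ^+ 2 + s ^+ 2))^-1.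
Proof.
move=> d0; have h1 := @Cd_half d s 1 d0 (expr1n _ _).
have h2 : -1 * Cd d s <= (X * ((1 / 2) ^+ 2 + s ^+ 2))^-1 by apply: Cd_half; rewrite ?sqrrN ?expr1n.
by rewrite ler_norml; lra.
Qed.

Lemma Cd_cvg s : Cd d s @[d --> 0^'+] --> C0 s.
Proof.
have -> : C0 s = Rintegral mu Rp (fun k => cos (k * X) * hk s k).
  have := cos_transform (rr_gt0 s) (ltW X0); rewrite /C0 => <-.
  by apply: eq_Rintegral => k _; rewrite /hk rrD.
have [||||_ //] := @dominated_cvg_at_right _ _ R mu Rp (fun d k => expR (- (d * k)) * cos (k * X) * hk s k)
  (fun k => cos (k * X) * hk s k) (hk s) 0 1 ltr01 (measurable_itv _).
- by move=> d _; apply: continuous_measurableT => // k; have c := @cts_hk s; cts.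
- move=> k _; apply: cvg_at_right_filter.
  have c : {for 0, continuous (fun d => expR (- (d * k)) * cos (k * X) * hk s k)} by cts.
  by move: c; rewrite /prop_for /continuous_at mul0r oppr0 expR0 mul1r.
- move=> d k /andP[d0 _]; rewrite /= in_itv/= andbT => k0.
  by rewrite normrM (gtr0_norm (hk_gt0 _ _)) ler_piMl ?(ltW (hk_gt0 _ _))// expcos_le// ltW.
- exact: integrable_hk.
Qed.

Lemma C0_bound s : `|C0 s| <= (X * ((1 / 2) ^+ 2 + s ^+ 2))^-1.
Proof.
have c : `|Cd d s| @[d --> 0^'+] --> `|C0 s| by apply: cvg_norm; exact: Cd_cvg.
apply: (ler_cvg_to c (cvg_cst _)); near=> d; apply: Cd_bound; near: d; exact: nbhs_right_gt.
Unshelve. all: by end_near. Qed.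

Lemma measurable_Cd d : measurable_fun (setT : set R) (Cd d).
Proof.
apply: (@measurable_Rintegral _ R R Rp (fun z : R * R => expR (- (d * z.2)) * cos (z.2 * X) * hk z.1 z.2)) => //.
apply: measurable_funM; last exact: measurable_hk.
by meas.
Qed.

Lemma cts_C0 s : {for s, continuous C0}.
Proof.
have c := cts_rr; have h : 2 * rr s != 0 by rewrite gt_eqF// mulr_gt0// rr_gt0.
by rewrite /C0; cts.
Qed.

Lemma measurable_C0 : measurable_fun (setT : set R) C0.
Proof. by apply: continuous_measurableT => // s; exact: cts_C0. Qed.

Let B s := (X * ((1 / 2) ^+ 2 + s ^+ 2))^-1.

Lemma integrable_CB : mu.-integrable Rp (EFin \o B).
Proof.
have -> : B = (fun s => X^-1 * ((1 / 2) ^+ 2 + s ^+ 2)^-1) by apply/funext => s; rewrite /B invfM.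
by apply: integrable_scale => //; apply: integrable_cauchy_scale; lra.
Qed.

Lemma Cd_L1_cvg : Rintegral mu Rp (fun s => `|Cd d s - C0 s|) @[d --> 0^'+] --> (0 : R).
Proof.
have e0 : 0 = Rintegral mu Rp (fun=> 0 : R) :> R by rewrite Rintegral_cst// mul0r.
rewrite [X in _ --> X]e0.
have [||||_ //] := @dominated_cvg_at_right _ _ R mu Rp (fun d s => `|Cd d s - C0 s|)
  (fun=> 0) (fun s => 2 * B s) 0 1 ltr01 (measurable_itv _).
- move=> d _; apply: measurable_funTS; apply: (measurableT_comp (@normr_measurable R setT)).
  by apply: measurable_funB; [exact: measurable_Cd|exact: measurable_C0].
- move=> s _; have c : Cd d s - C0 s @[d --> 0^'+] --> C0 s - C0 s by apply: cvgB; [exact: Cd_cvg|exact: cvg_cst].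
  have c2 := cvg_norm c; rewrite subrr normr0 in c2; exact: c2.
- move=> d s /andP[d0 _] _; rewrite normr_id; apply: le_trans (ler_normB _ _) _.
  by have := Cd_bound s d0; have := C0_bound s; rewrite -/(B s); lra.
- by apply: integrable_scale => //; exact: integrable_CB.
Qed.

Variable y : R.
Hypothesis y0 : 0 < y.
Definition Kf e : R := Rintegral mu Rp (fun s => Ef s y e * C0 s).

Lemma integrable_EfC e (c : R -> R) : 0 < e -> measurable_fun (setT : set R) c ->
  (forall s, `|c s| <= B s) -> mu.-integrable Rp (EFin \o (fun s => Ef s y e * c s)).
Proof.
move=> e0 mc cB; apply: (@integrable_dom _ _ _ mu Rp _ (fun s => 2 * (Bd y * Bd e) * B s)) => //.
- by apply: measurable_funTS; apply: measurable_funM => //; exact: measurable_Ef.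
- by move=> s _; rewrite normrM; apply: ler_pM => //; exact: Ef_bound.
- by apply: integrable_scale => //; exact: integrable_CB.
Qed.

(** The dependence on [e] sits in [Bd e] alone, so the convergence is uniform in [e] away from 0. *)
Lemma Kf_diff d e : 0 < d -> 0 < e ->
  `|Rintegral mu Rp (fun s => Ef s y e * Cd d s) - Kf e| <= 2 * (Bd y * Bd e) * Rintegral mu Rp (fun s => `|Cd d s - C0 s|).
Proof.
move=> d0 e0.
have i1 := integrable_EfC e0 (@measurable_Cd d) (fun s => Cd_bound s d0).
have i2 := integrable_EfC e0 measurable_C0 C0_bound.
rewrite /Kf -RintegralB//.
have iD : mu.-integrable Rp (EFin \o (fun s => `|Cd d s - C0 s|)).
  apply: (@integrable_dom _ _ _ mu Rp _ (fun s => 2 * B s)) => //.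
  - apply: measurable_funTS; apply: (measurableT_comp (@normr_measurable R setT)).
    by apply: measurable_funB; [exact: measurable_Cd|exact: measurable_C0].
  - move=> s _; rewrite normr_id; apply: le_trans (ler_normB _ _) _.
    by have := Cd_bound s d0; have := C0_bound s; rewrite -/(B s); lra.
  - by apply: integrable_scale => //; exact: integrable_CB.
rewrite -RintegralZl//; apply: normr_Rintegral_le => //.
- exact: integrable_diff.
- exact: integrable_scale.
- move=> s _; rewrite -mulrBr normrM ler_wpM2r//; exact: Ef_bound.
Qed.

End abel_kernel.

Lemma rr_gt_half (R : realType) (k : R) : 0 < k -> 1 / 2 < rr k.
Proof.
move=> k0; rewrite ltNge; apply/negP => h; have := rr2 k; have := rr_gt0 k; nra.
Qed.

(** * Regularised cosine transform of the resolvent solution *)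

Section resolvent_transform.
Variable R : realType.
Local Notation mu := (@lebesgue_measure R).
Local Notation Rp := (`[0, +oo[%classic : set R).
Local Notation Rpo := (`]0, +oo[%classic : set R).
Variables (X y : R) (beta : R -> R) (al be M : R).
Hypothesis X0 : 0 < X.
Hypothesis y0 : 0 < y.
Hypothesis cb : forall t, {for t, continuous beta}.
Hypothesis al0 : 0 < al.
Hypothesis alb : al < be.
Hypothesis b_lo : forall t, t < al -> beta t = 0.
Hypothesis b_hi : forall t, be < t -> beta t = 0.
Hypothesis b0 : forall t, 0 <= beta t.
Hypothesis bM : forall t, beta t <= M.
Hypothesis yab : y < al \/ be < y.
Local Notation D2 := (`[al / 2, be]%classic : set R).
Let EB := 2 * (Bd y * Bd (al / 2)).
Let al2 : 0 < al / 2. Proof. by have := al0; lra. Qed.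

Lemma Ef_D2 s e : D2 e -> 0 < e /\ `|Ef s y e| <= EB.
Proof.
rewrite /= in_itv/= => /andP[e1 _]; have e0 : 0 < e by have := al2; lra.
split => //; apply: le_trans (Ef_bound s y0 e0) _; rewrite /EB ler_pM2l// ler_pM2l ?Bd_gt0//.
by apply: Bd_le => //; have := al2.
Qed.

Let EB0 : 0 <= EB. Proof. by have h1 := Bd_gt0 y0; have h2 := Bd_gt0 al2; rewrite /EB mulr_ge0// mulr_ge0// ltW. Qed.
Let J := Rintegral mu Rp (fun s : R => ((1 / 2) ^+ 2 + s ^+ 2)^-1).
Let F e k := Rintegral mu Rp (fun s => Ef s y e * hk s k).

Let iJ : mu.-integrable Rp (EFin \o (fun s : R => ((1 / 2) ^+ 2 + s ^+ 2)^-1)).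
Proof. by apply: integrable_cauchy_scale; lra. Qed.

Let bndF s e k : D2 e -> `|Ef s y e * hk s k| <= EB * ((1 / 2) ^+ 2 + s ^+ 2)^-1.
Proof.
move=> De; have [_ h] := Ef_D2 s De; rewrite normrM (gtr0_norm (hk_gt0 _ _)).
by apply: ler_pM => //; [exact: ltW (hk_gt0 _ _)|exact: hk_le].
Qed.

Let mEh e k : measurable_fun (setT : set R) (fun s => Ef s y e * hk s k).
Proof.
apply: measurable_funM; first exact: measurable_Ef.
have mp : measurable_fun (setT : set R) (fun s : R => (s, k)).
  by apply: measurable_fun_pair; [exact: measurable_id|exact: measurable_cst].
exact: (measurableT_comp (@measurable_hk R) mp).
Qed.

Let iEh e k : D2 e -> mu.-integrable Rp (EFin \o (fun s => Ef s y e * hk s k)).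
Proof.
move=> De; apply: (@integrable_dom _ _ _ mu Rp _ (fun s => EB * ((1 / 2) ^+ 2 + s ^+ 2)^-1)) => //.
- by apply: measurable_funTS; exact: mEh.
- by move=> s _; exact: bndF.
- exact: integrable_scale.
Qed.

Let F_le e k : D2 e -> `|F e k| <= EB * J.
Proof.
move=> De; rewrite /F /J -RintegralZl//; apply: normr_Rintegral_le => //; first exact: iEh.
- exact: integrable_scale.
- by move=> s _; exact: bndF.
Qed.

Let mF : measurable_fun (setT : set (R * R)) (fun z : R * R => F z.1 z.2).
Proof.
apply: (@measurable_Rintegral _ _ R Rp (fun z : (R * R) * R => Ef z.2 y z.1.1 * hk z.2 z.1.2)) => //.
have m11 : measurable_fun (setT : set ((R * R) * R)) (fun z => z.1.1) := measurableT_comp measurable_fst measurable_fst.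
have m12 : measurable_fun (setT : set ((R * R) * R)) (fun z => z.1.2) := measurableT_comp measurable_snd measurable_fst.
apply: measurable_funM.
  have mp : measurable_fun (setT : set ((R * R) * R)) (fun z => (z.2, z.1.1)).
    by apply: measurable_fun_pair => //; exact: measurable_snd.
  exact: (measurableT_comp (measurable_Ef2 y0) mp).
have mp : measurable_fun (setT : set ((R * R) * R)) (fun z => (z.2, z.1.2)).
  by apply: measurable_fun_pair => //; exact: measurable_snd.
exact: (measurableT_comp (@measurable_hk R) mp).
Qed.

Let mbeta : measurable_fun (setT : set R) beta.
Proof. by apply: continuous_measurableT => // t; exact: cb. Qed.

Let iD2 (c : R) : mu.-integrable D2 (EFin \o (fun=> c)).
Proof. by apply: continuous_integrable_itv => t _; cts. Qed.

Let ibF (f : R -> R) (C : R) : measurable_fun (setT : set R) f -> (forall e, D2 e -> `|f e| <= C) ->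
  mu.-integrable D2 (EFin \o (fun e => beta e * f e)).
Proof.
move=> mf fC; apply: (@integrable_dom _ _ _ mu D2 _ (fun=> M * C)) => //.
- by apply: measurable_funTS; exact: measurable_funM.
- by move=> e De; rewrite normrM (ger0_norm (b0 _)); apply: ler_pM => //; exact: fC.
Qed.

Lemma integrable_bint (c : R -> R) : measurable_fun (setT : set R) c ->
  (forall s, `|c s| <= (X * ((1 / 2) ^+ 2 + s ^+ 2))^-1) ->
  mu.-integrable D2 (EFin \o (fun e => beta e * Rintegral mu Rp (fun s => Ef s y e * c s))).
Proof.
move=> mc hc.
have mEf : measurable_fun (setT : set (R * R)) (fun z : R * R => Ef z.2 y z.1).
  have mp : measurable_fun (setT : set (R * R)) (fun z => (z.2, z.1)).
    by apply: measurable_fun_pair; [exact: measurable_snd|exact: measurable_fst].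
  exact: (measurableT_comp (measurable_Ef2 y0) mp).
have mi : measurable_fun (setT : set R) (fun e => Rintegral mu Rp (fun s => Ef s y e * c s)).
  apply: (@measurable_Rintegral _ R R Rp (fun z : R * R => Ef z.2 y z.1 * c z.2)) => //.
  by apply: measurable_funM => //; exact: (measurableT_comp mc measurable_snd).
apply: (@ibF _ (EB * Rintegral mu Rp (fun s => (X * ((1 / 2) ^+ 2 + s ^+ 2))^-1)) mi) => e De.
rewrite -RintegralZl//; last exact: integrable_CB.
have [e0 _] := Ef_D2 0 De.
apply: normr_Rintegral_le => //.
- by apply: integrable_EfC.
- by apply: integrable_scale => //; exact: integrable_CB.
- move=> s _; rewrite normrM; apply: ler_pM => //; by have [] := Ef_D2 s De.
Qed.

Lemma integrable_bKf : mu.-integrable D2 (EFin \o (fun e => beta e * Kf X y e)).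
Proof. exact: (integrable_bint (@measurable_C0 R X) (@C0_bound R X X0)). Qed.

Let sub_Rp : Rpo `<=` Rp.
Proof. by move=> t /=; rewrite !in_itv/= !andbT; exact: ltW. Qed.

Let iE (d : R) : 0 < d -> mu.-integrable Rpo (EFin \o (fun k => expR (- (d * k)))).
Proof. by move=> d0; apply: (@integrableS _ _ _ mu Rp) (integrable_expRN d0). Qed.

Let inner d e : 0 < d -> D2 e ->
  Rintegral mu Rpo (fun k => expR (- (d * k)) * cos (k * X) * F e k) = Rintegral mu Rp (fun s => Ef s y e * Cd X d s).
Proof.
move=> d0 De.
transitivity (Rintegral mu Rpo (fun k => Rintegral mu Rp (fun s => expR (- (d * k)) * cos (k * X) * (Ef s y e * hk s k)))).
  by apply: eq_Rintegral => k _; rewrite /F -RintegralZl//; exact: iEh.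
rewrite (@Rintegral_fubini _ _ _ _ R mu mu Rpo Rp _ (fun k => expR (- (d * k))) (fun s => EB * ((1 / 2) ^+ 2 + s ^+ 2)^-1)) //.
- apply: eq_Rintegral => s _; rewrite /Cd -RintegralZl//; last exact: integrable_Cd (ltW d0).
  rewrite -Rintegral_itv_obnd_cbnd.
    by apply: eq_Rintegral => k _; ring.
  apply: (@integrable_scale _ _ _ mu Rpo) => //.
  by apply: (@integrableS _ _ _ mu Rp) (integrable_Cd X s (ltW d0)).
- apply: measurable_funTS; apply: measurable_funM; first by meas.
  have mp : measurable_fun (setT : set (R * R)) (fun z => (z.2, z.1)).
    by apply: measurable_fun_pair; [exact: measurable_snd|exact: measurable_fst].
  apply: measurable_funM; last exact: (measurableT_comp (@measurable_hk R) mp).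
  exact: (measurableT_comp (@measurable_Ef R y e y0) measurable_snd).
- exact: iE.
- exact: integrable_scale.
- move=> k s _ _; rewrite normrM; apply: ler_pM => //; last exact: bndF.
  by rewrite normrM (ger0_norm (expR_ge0 _)) ler_piMr ?expR_ge0// ler_norml cos_geN1 cos_le1.
Qed.

(** The factor [e^(- d k)] makes both exchanges, of [k] with [e] and with [s], absolutely
    convergent. The half line is open because at [k = 0] one has [rr k = 1/2], where [cW] has a
    vanishing denominator. *)
Lemma uk_transform d : 0 < d ->
  Rintegral mu Rpo (fun k => expR (- (d * k)) * cos (k * X) * uk (rr k) beta al be y) =
  pi^-1 * Rintegral mu D2 (fun e => beta e * Rintegral mu Rp (fun s => Ef s y e * Cd X d s)).
Proof.
move=> d0.
have mFe k : measurable_fun (setT : set R) (fun e => F e k).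
  have mp : measurable_fun (setT : set R) (fun e : R => (e, k)).
    by apply: measurable_fun_pair; [exact: measurable_id|exact: measurable_cst].
  exact: (measurableT_comp mF mp).
transitivity (Rintegral mu Rpo (fun k => Rintegral mu D2 (fun e => pi^-1 * (expR (- (d * k)) * cos (k * X)) * (beta e * F e k)))).
  apply: eq_Rintegral => k; rewrite inE /= in_itv/= andbT => k0.
  have k12 := rr_gt_half k0.
  rewrite uk_E// RintegralZl//; last exact: (ibF (mFe k) (fun e => @F_le e k)).
  rewrite -[RHS]mulrA [RHS]mulrCA; congr (_ * (_ * _)).
  by apply: eq_Rintegral => e _; congr (_ * _); apply: eq_Rintegral => s _; rewrite rr2.
rewrite (@Rintegral_fubini _ _ _ _ R mu mu Rpo D2 _ (fun k => expR (- (d * k))) (fun=> pi^-1 * (M * (EB * J)))) //.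
- rewrite -RintegralZl//.
    apply: eq_Rintegral => e; rewrite inE => De; rewrite -(inner d0 De).
    have -> : (fun k => pi^-1 * (expR (- (d * k)) * cos (k * X)) * (beta e * F e k)) =
      (fun k => (pi^-1 * beta e) * (expR (- (d * k)) * cos (k * X) * F e k)) by apply/funext => k; ring.
    rewrite RintegralZl//; first by rewrite mulrA.
    apply: (@integrable_dom _ _ _ mu Rpo _ (fun k => (EB * J) * expR (- (d * k)))) => //.
    + apply: measurable_funTS; apply: measurable_funM.
        by apply: continuous_measurableT => // k; cts.
      have mp : measurable_fun (setT : set R) (fun k : R => (e, k)).
        by apply: measurable_fun_pair; [exact: measurable_cst|exact: measurable_id].
      exact: (measurableT_comp mF mp).
    + move=> k _; rewrite normrM mulrC; apply: ler_pM => //; first exact: F_le.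
      by rewrite normrM (ger0_norm (expR_ge0 _)) ler_piMr ?expR_ge0// ler_norml cos_geN1 cos_le1.
    + by apply: integrable_scale => //; exact: iE.
  exact: (integrable_bint (@measurable_Cd R X d) (fun s => @Cd_bound R X X0 d s d0)).
- apply: measurable_funTS; apply: measurable_funM; first by meas.
  apply: measurable_funM; first exact: (measurableT_comp mbeta measurable_snd).
  have mp : measurable_fun (setT : set (R * R)) (fun z => (z.2, z.1)).
    by apply: measurable_fun_pair; [exact: measurable_snd|exact: measurable_fst].
  exact: (measurableT_comp mF mp).
- exact: iE.
- move=> k e _ De; have h := F_le k De; have hb := b0 e; have hM := bM e.
  have p0 : 0 <= pi^-1 :> R by rewrite invr_ge0 pi_ge0.
  rewrite normrM [X in X * _]normrM (ger0_norm p0).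
  have a1 : `|expR (- (d * k)) * cos (k * X)| <= expR (- (d * k)).
    by rewrite normrM (ger0_norm (expR_ge0 _)) ler_piMr ?expR_ge0// ler_norml cos_geN1 cos_le1.
  have a2 : `|beta e * F e k| <= M * (EB * J) by rewrite normrM (ger0_norm hb); apply: ler_pM.
  rewrite -mulrA [leRHS]mulrCA; apply: ler_wpM2l => //.
  by apply: ler_pM.
Qed.

Lemma uk_transform_cvg :
  Rintegral mu Rpo (fun k => expR (- (d * k)) * cos (k * X) * uk (rr k) beta al be y) @[d --> 0^'+] -->
  pi^-1 * Rintegral mu D2 (fun e => beta e * Kf X y e).
Proof.
have ib := integrable_bint.
pose L d := Rintegral mu Rp (fun s => `|Cd X d s - C0 X s|).
pose W := Rintegral mu D2 (fun e => beta e * EB).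
have cL : pi^-1 * (W * L d) @[d --> 0^'+] --> pi^-1 * (W * 0).
  by apply: cvgM; [exact: cvg_cst|apply: cvgM; [exact: cvg_cst|exact: Cd_L1_cvg]].
rewrite !mulr0 in cL.
apply/cvgrPdist_le => eps eps0; move/cvgrPdist_le : cL => /(_ _ eps0) h.
near=> d.
have d0 : 0 < d by near: d; exact: nbhs_right_gt.
rewrite uk_transform// distrC -mulrBr normrM (ger0_norm (_ : 0 <= pi^-1)) ?invr_ge0 ?pi_ge0//.
have L0 : 0 <= L d by apply: Rintegral_ge0 => s _.
have hd : `|0 - pi^-1 * (W * L d)| <= eps by near: d; exact: h.
apply: le_trans hd; rewrite sub0r normrN; apply: le_trans (ler_norm _).
rewrite ler_wpM2l ?invr_ge0 ?pi_ge0//.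
have i1 := ib (Cd X d) (@measurable_Cd R X d) (fun s => @Cd_bound R X X0 d s d0).
have i2 := ib (C0 X) (@measurable_C0 R X) (@C0_bound R X X0).
have iW : mu.-integrable D2 (EFin \o (fun e => beta e * EB)).
  apply: (@ibF (fun=> EB) EB); first exact: measurable_cst.
  by move=> e _; rewrite ger0_norm.
have eW : W * L d = Rintegral mu D2 (fun e => L d * (beta e * EB)) by rewrite mulrC /W -RintegralZl.
rewrite eW -RintegralB//; apply: (@normr_Rintegral_le _ _ R mu D2) => //.
- exact: integrable_diff.
- exact: integrable_scale.
- move=> e De; rewrite -mulrBr normrM (ger0_norm (b0 _)) mulrCA; apply: ler_wpM2l => //.
  have [e0 _] := Ef_D2 0 De.
  apply: le_trans (Kf_diff X0 y0 d0 e0) _; rewrite -/(L d) mulrC; apply: ler_wpM2l => //.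
  rewrite /EB ler_pM2l// ler_pM2l ?Bd_gt0//; apply: Bd_le => //.
  by move: De; rewrite /= in_itv/= => /andP[].
Unshelve. all: by end_near. Qed.

End resolvent_transform.
(* The library's sigma-finite instance on a product measure is shadowed by the one for probabilities. *)
Section leb2_sigma_finite.
Variable R : realType.

Definition leb2s : set (measurableTypeR R * measurableTypeR R) -> \bar R :=
  ((@lebesgue_measure R) \x (@lebesgue_measure R))%E.

HB.instance Definition _ := Measure.copy leb2s ((@lebesgue_measure R) \x (@lebesgue_measure R))%E.

Let leb2s_sigma_finite : sigma_finite setT leb2s.
Proof.
exists (fun n : nat => sqr (0, 0) n.+1%:R).
  apply/seteqP; split => // -[a b] _.
  have ab0 : 0 <= `|a : R| + `|b : R| by rewrite addr_ge0.
  exists (Num.bound (`|a : R| + `|b : R|)) => //; apply/sqrP; rewrite /= !subr0 -natr1.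
  have := archi_boundP ab0; have := normr_ge0 (a : R); have := normr_ge0 (b : R).
  by move: (Num.bound _)%:R => N; lra.
move=> n; split; first exact: measurable_sqr.
have n0 : 0 < n.+1%:R :> R by rewrite ltr0n.
by have := leb2_sqr (0, 0) n0; rewrite /leb2 /leb2s => ->; rewrite ltry.
Qed.

HB.instance Definition _ := Measure_isSigmaFinite.Build _ _ _ leb2s leb2s_sigma_finite.
End leb2_sigma_finite.
Section product_integral.
Variable R : realType.
Local Notation mu := (@lebesgue_measure R).
Local Notation mu2 := (@leb2 R).

Lemma Rintegral_prod (f b : R -> R) : (forall t, 0 <= f t) -> (forall t, 0 <= b t) ->
  mu.-integrable setT (EFin \o f) -> mu.-integrable setT (EFin \o b) ->
  mu2.-integrable setT (EFin \o (fun q : R * R => f q.1 * b q.2)) /\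
  Rintegral mu2 setT (fun q => f q.1 * b q.2) = Rintegral mu setT f * Rintegral mu setT b.
Proof.
move=> f0 b0 fi bi.
have mf : measurable_fun (setT : set R) f by move/integrableP : (fi) => [/measurable_EFinP].
have mb : measurable_fun (setT : set R) b by move/integrableP : (bi) => [/measurable_EFinP].
have m : measurable_fun (setT : set (R * R)) (fun q : R * R => f q.1 * b q.2).
  by apply: measurable_funM; [exact: (measurableT_comp mf measurable_fst)|exact: (measurableT_comp mb measurable_snd)].
have e : (\int[mu2]_(q in setT) (f q.1 * b q.2)%:E = (Rintegral mu setT f * Rintegral mu setT b)%:E)%E.
  rewrite /leb2 (@fubini_tonelli1 _ _ _ _ R mu mu (fun q : R * R => (f q.1 * b q.2)%:E)).
  - rewrite /fubini_F.
    transitivity (\int[mu]_x (f x * Rintegral mu setT b)%:E)%E.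
      apply: eq_integral => x _ /=.
      transitivity (\int[mu]_y ((f x)%:E * (b y)%:E))%E; first by apply: eq_integral => y _; rewrite EFinM.
      rewrite ge0_integralZl_EFin//; [|by move=> y _; rewrite lee_fin|exact/measurable_EFinP].
      by rewrite EFinM; congr (_ * _)%E; rewrite /Rintegral fineK//; exact: integrable_fin_num.
    transitivity (\int[mu]_x ((Rintegral mu setT b)%:E * (f x)%:E))%E.
      by apply: eq_integral => x _; rewrite -EFinM mulrC.
    rewrite ge0_integralZl_EFin//; [|by move=> y _; rewrite lee_fin|exact/measurable_EFinP|exact: Rintegral_ge0].
    by rewrite mulrC EFinM; congr (_ * _)%E; rewrite [in RHS]/Rintegral fineK//; exact: integrable_fin_num.
  - exact/measurable_EFinP.
  - by move=> q; rewrite lee_fin mulr_ge0.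
split; last by rewrite {1}/Rintegral e.
apply/integrableP; split; first exact/measurable_EFinP.
rewrite [X in (X < _)%E](_ : _ = (Rintegral mu setT f * Rintegral mu setT b)%:E) ?ltry//.
by rewrite -e; apply: eq_integral => q _; rewrite /= ger0_norm// mulr_ge0.
Qed.

Lemma Rintegral_itv_setT (a b : R) (f : R -> R) : (forall t, t < a -> f t = 0) -> (forall t, b < t -> f t = 0) ->
  Rintegral mu setT f = Rintegral mu `[a, b] f.
Proof.
move=> fa fb; rewrite [RHS]Rintegral_mkcond; apply: eq_Rintegral => t _; rewrite /patch; case: ifPn => //.
rewrite notin_setE /= in_itv/= => /negP; rewrite negb_and -!ltNge => /orP[/fa|/fb] //.
Qed.

(** The final algebra, with [w] for [pi] and [I] for the mass of the bump: the two factors [w^-1]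
    come from the resolvent kernel and from the Poisson kernel. *)
Lemma scale_pi (w I A B : R) : 0 < w -> 0 < I ->
  (A * (2 * (w / 2) * I) <= w^-1 * (B * I) -> A <= w^-1 * (w^-1 * B)) /\
  (w^-1 * (B * I) <= A * (2 * (w / 2) * I) -> w^-1 * (w^-1 * B) <= A).
Proof.
move=> w0 I0.
have -> : A * (2 * (w / 2) * I) = w * A * I by field.
rewrite [w^-1 * (B * I)]mulrA !ler_pM2r//.
have -> : w^-1 * (w^-1 * B) = w^-1 * B / w by rewrite mulrC.
by rewrite ler_pdivlMr// ler_pdivrMr// [A * w]mulrC.
Qed.

Lemma cos_norm (t : R) : cos `|t| = cos t.
Proof. by have [t0|t0] := leP 0 t; [rewrite ger0_norm|rewrite ltr0_norm// cosN]. Qed.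

End product_integral.

(** * Identification of the limit off the vertical line through the pole *)

Section identification.
Variable R : realType.
Variables (Om : nat -> set (R * R)) (G : nat -> R -> R -> R -> R -> R).
Hypothesis exh : exhaustion Om.
Hypothesis dg : forall n, dirichlet_green (Om n) (G n).
Variable p : R * R.
Hypothesis Op0 : Om 0 p.
Local Notation mu := (@lebesgue_measure R).
Local Notation mu2 := (@leb2 R).
Local Notation gl := (gl Om G p).
Local Notation Rp := (`[0, +oo[%classic : set R).
Local Notation Rpo := (`]0, +oo[%classic : set R).
Let p20 : 0 < p.2. Proof. by apply: (Om_Sigma exh (subset_closure Op0)). Qed.

(** The Poisson kernel is the cosine transform of [e^(- d k)]; after Fubini, [strip_identity]
    evaluates the inner integral for each [k > 0]. *)
Lemma poisson_strip (beta : R -> R) (al be M x0 d : R) :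
  smooth (fun _ y => beta y) -> (forall t, {for t, continuous beta}) -> 0 < al -> al < be ->
  (forall t, t < al -> beta t = 0) -> (forall t, be < t -> beta t = 0) ->
  (forall t, 0 <= beta t) -> (forall t, beta t <= M) -> 0 < M -> 0 < d ->
  Rintegral mu2 setT (fun q => gl q * beta q.2 * Pk d (q.1 - x0)) =
  Rintegral mu Rpo (fun k => expR (- (d * k)) * cos (k * `|p.1 - x0|) * uk (rr k) beta al be p.2).
Proof.
move=> sb cb al0 alb b_lo b_hi b0 bM M0 d0.
have iA : mu2.-integrable setT (EFin \o (fun q => gl q * beta q.2)).
  exact: (strip_integrable exh dg Op0 sb al0 b_lo b_hi b0 bM M0).
have sub_Rp : Rpo `<=` Rp by move=> t /=; rewrite !in_itv/= !andbT; exact: ltW.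
have iE : mu.-integrable Rpo (EFin \o (fun k => expR (- (d * k)))).
  by apply: (@integrableS _ _ _ mu Rp) (integrable_expRN d0).
have iec u : mu.-integrable Rpo (EFin \o (fun k => expR (- (d * k)) * cos (k * u))).
  by apply: (@integrableS _ _ _ mu Rp) (integrable_expcos u d0).
have mA : measurable_fun (setT : set (R * R)) (fun q => gl q * beta q.2) by move/integrableP : (iA) => [/measurable_EFinP].
have A0 q : 0 <= gl q * beta q.2 by rewrite mulr_ge0// (gl_ge0 exh dg Op0).
transitivity (Rintegral mu2 setT (fun q => Rintegral mu Rpo (fun k => gl q * beta q.2 * (expR (- (d * k)) * cos (k * (q.1 - x0)))))).
  apply: eq_Rintegral => q _; rewrite RintegralZl//; congr (_ * _).
  by rewrite Rintegral_itv_obnd_cbnd// Rintegral_expcos.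
have FF := @Rintegral_fubini _ _ _ _ R (@leb2s R) mu setT Rpo
  (fun (q : R * R) k => gl q * beta q.2 * (expR (- (d * k)) * cos (k * (q.1 - x0))))
  (fun q : R * R => gl q * beta q.2) (fun k => expR (- (d * k))) measurableT (measurable_itv _).
apply: etrans; first apply: FF => //.
- apply: measurable_funTS; apply: measurable_funM; first exact: (measurableT_comp mA measurable_fst).
  by meas.
- move=> q k _ _; rewrite normrM (ger0_norm (A0 q)) ler_wpM2l// normrM (ger0_norm (expR_ge0 _)) ler_piMr ?expR_ge0//.
  by rewrite ler_norml cos_geN1 cos_le1.
- apply: eq_Rintegral => k; rewrite inE /= in_itv/= andbT => k0.
  have e : (fun q : R * R => gl q * beta q.2 * (expR (- (d * k)) * cos (k * (q.1 - x0)))) =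
    (fun q => expR (- (d * k)) * (gl q * beta q.2 * cos (k * (q.1 - x0)))) by apply/funext => q; ring.
  rewrite e RintegralZl//.
    rewrite -mulrA; congr (_ * _).
    have := @strip_identity R Om G exh dg p Op0 beta al be M sb cb al0 alb b_lo b_hi b0 bM M0 k x0 (rr k).
    rewrite /leb2 => ->//; last exact: rr2; last exact: rr_gt_half.
    by congr (_ * _); rewrite -[RHS]cos_norm normrM normr_id -normrM cos_norm.
  apply: (@integrable_dom _ _ _ mu2 setT _ (fun q => gl q * beta q.2)) => //.
    apply: measurable_funM => //.
    by apply: (@measurable_cont2 _ (fun x _ => cos (k * (x - x0)))); apply: smooth_cont; exact: smooth_cosx.
  by move=> q _; rewrite normrM (ger0_norm (A0 q)) ler_piMr// ler_norml cos_geN1 cos_le1.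
Qed.

(** A limit from the right is enough for bumps placed above [e0]; on that side [Bd e0] dominates
    [Bd e], since [Bd] decreases. *)
Lemma Kf_right (X e0 : R) : 0 < X -> 0 < e0 -> Kf X p.2 e @[e --> e0^'+] --> Kf X p.2 e0.
Proof.
move=> X0 h0; have h1 : e0 < e0 + 1 by lra.
have [||||_ //] := @dominated_cvg_at_right _ _ R mu Rp (fun e s => Ef s p.2 e * C0 X s)
  (fun s => Ef s p.2 e0 * C0 X s) (fun s => 2 * (Bd p.2 * Bd e0) * (X * ((1 / 2) ^+ 2 + s ^+ 2))^-1) e0 (e0 + 1) h1 (measurable_itv _).
- move=> e _; apply: measurable_funTS; apply: measurable_funM; [exact: measurable_Ef|exact: measurable_C0].
- move=> s _; apply: cvg_at_right_filter.
  have c : {for e0, continuous (Js s)}.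
    by have [d _] := @solY_JJ R _ _ _ _ (@solX_s R s) e0 h0; exact: der_cts d.
  apply: cvgM; last exact: cvg_cst.
  apply: cvgM; last exact: cvg_cst.
  by apply: cvgM; [exact: cvg_cst|exact: c].
- move=> e s /andP[e1 _] _; rewrite normrM; apply: ler_pM => //; last exact: C0_bound.
  have e2 : 0 < e by lra.
  apply: le_trans (Ef_bound s p20 e2) _; rewrite ler_pM2l// ler_pM2l ?Bd_gt0//.
  by apply: Bd_le => //; exact: ltW.
- by apply: integrable_scale => //; exact: integrable_CB.
Qed.

(** The Poisson integral of [gl * beta] is computed in two ways as [d -> 0]: by [uk_transform_cvg],
    and by concentration of the kernel at [x0]. For a bump [beta] close above [e0], continuity of
    [gl] and of [Kf] brings both within [ep] of their values at [(x0, e0)]. *)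
Lemma gl_kernel (x0 e0 : R) : 0 < e0 -> x0 <> p.1 ->
  gl (x0, e0) = pi^-1 * (pi^-1 * Kf `|p.1 - x0| p.2 e0).
Proof.
move=> h0 xp; set X := `|p.1 - x0|.
have X0 : 0 < X by rewrite normr_gt0 subr_eq0; apply/eqP => h; apply: xp.
set c := gl (x0, e0); set K := Kf X p.2 e0.
have pi0 : 0 < pi :> R := pi_gt0 R.
have ipi0 : 0 < pi^-1 :> R by rewrite invr_gt0.
have qp : (x0, e0) <> p by move=> h; apply: xp; rewrite -h.
have cg : {for (x0, e0), continuous gl} by apply: (gl_cont exh dg Op0).
suff key (ep : R) : 0 < ep -> `|c - pi^-1 * (pi^-1 * K)| <= (1 + pi^-1 * pi^-1) * ep.
  apply/eqP; rewrite -subr_eq0 -normr_le0; apply/ler_addgt0Pr => ep e0'; rewrite add0r.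
  have D0 : 0 < 1 + pi^-1 * pi^-1 :> R by rewrite addr_gt0// mulr_gt0.
  have := key (ep / (1 + pi^-1 * pi^-1)); rewrite divr_gt0// => /(_ isT).
  move: (1 + pi^-1 * pi^-1) D0 => D D0; suff -> : D * (ep / D) = ep by [].
  by rewrite mulrCA mulfV ?mulr1// gt_eqF.
move=> ep0.
have n1 : nbhs (x0, e0) [set z | `|c - gl z| <= ep] by move/cvgrPdist_le : cg => /(_ _ ep0).
have [a1 a10 s1] := sqr_small n1.
have := @Kf_right X e0 X0 h0 => /cvgrPdist_le /(_ _ ep0)[a2 /= a20 s2].
(* Keeps the height of the pole out of the support of the bump, as [uk_E] asks; if [p.2 <= e0] it
   already lies below the bump. *)
pose a3 := if e0 < p.2 then (p.2 - e0) / 2 else 1.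
have a30 : 0 < a3 by rewrite /a3; case: ifP => [h|_]; lra.
pose a := Num.min a1 (Num.min (a2 / 2) a3).
have a0 : 0 < a by rewrite !lt_min a10 a30 divr_gt0.
have aa1 : a <= a1 by rewrite ge_min lexx.
have aa2 : a <= a2 / 2 by rewrite !ge_min lexx orbT.
have aa3 : a <= a3 by rewrite !ge_min lexx !orbT.
pose al := e0 + a / 4; pose be := e0 + 3 * a / 4.
have al0 : 0 < al by rewrite /al; lra.
have alb : al < be by rewrite /al /be; lra.
have yab : p.2 < al \/ be < p.2.
  have [h|h] := ltP e0 p.2; last by left; rewrite /al; lra.
  by right; move: aa3; rewrite /be /a3 h; lra.
pose beta t := Fm 0 (1 - ((t - (e0 + a / 2)) / (a / 4)) ^+ 2).
have a4 : 0 < a / 4 by lra.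
have supp t : a / 4 < `|t - (e0 + a / 2)| -> beta t = 0 by move=> h; rewrite /beta (Fm_neg _ (div_sqr_ge a4 h)).
have b_lo t : t < al -> beta t = 0.
  by rewrite /al => h; apply: supp; rewrite ltr0_norm; lra.
have b_hi t : be < t -> beta t = 0.
  by rewrite /be => h; apply: supp; rewrite gtr0_norm; lra.
have b0 t : 0 <= beta t by exact: Fm_ge0.
have bM t : beta t <= 1 by exact: Fm0_le1.
have sb : smooth (fun _ y => beta y).
  apply: (smooth_comp (D := setT) (h := Fm 0) (phi := fun _ t => 1 - ((t - (e0 + a / 2)) / (a / 4)) ^+ 2)) => //.
    by move=> k; exact: C1k_Fm.
  apply: (@smoothD _ (fun _ _ => 1) (fun _ t => - ((t - (e0 + a / 2)) / (a / 4)) ^+ 2)); first exact: smooth_cst.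
  apply: (@smoothN _ (fun _ t => ((t - (e0 + a / 2)) / (a / 4)) ^+ 2)).
  by apply: (@smoothM _ (fun _ t => (t - (e0 + a / 2)) / (a / 4)) (fun _ t => (t - (e0 + a / 2)) / (a / 4)));
    (apply: (@smoothM _ (fun _ t => t - (e0 + a / 2)) (fun _ _ => (a / 4)^-1)); last exact: smooth_cst);
    (apply: (@smoothD _ (fun _ t => t) (fun _ _ => - (e0 + a / 2))); [exact: smooth_y|exact: smooth_cst]).
have cb t : {for t, continuous beta}.
  have c1 : {for 1 - ((t - (e0 + a / 2)) / (a / 4)) ^+ 2, continuous (Fm 0 : R -> R)} by exact: der_cts (der_Fm _ _).
  have c2 : {for t, continuous (fun t => 1 - ((t - (e0 + a / 2)) / (a / 4)) ^+ 2)} by cts.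
  exact: (@cts_comp R (Fm 0) (fun t => 1 - ((t - (e0 + a / 2)) / (a / 4)) ^+ 2) t).
have ibeta : mu.-integrable setT (EFin \o beta).
  have ic : mu.-integrable `[al, be] (EFin \o beta) by apply: continuous_integrable_itv => t _; exact: cb.
  have ip : mu.-integrable setT (EFin \o patch (fun=> 0) `[al, be] beta) by apply: integrable_patch.
  move: ip; apply: eq_integrable => // t _; rewrite /= /patch; case: ifPn => //.
  by rewrite notin_setE /= in_itv/= => /negP; rewrite negb_and -!ltNge => /orP[/b_lo|/b_hi] ->.
pose Ib := Rintegral mu setT beta.
have IbE : Ib = Rintegral mu `[al / 2, be] beta.
  by apply: Rintegral_itv_setT => t ht; [apply: b_lo; lra|exact: b_hi].
have Ib0 : 0 < Ib.
  pose J := `[e0 + a * 3 / 8, e0 + a * 5 / 8]%classic : set R.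
  have iJ : mu.-integrable J (EFin \o (fun=> expR (- (3 / 4)^-1))) by apply: continuous_integrable_itv => t _; cts.
  apply: (@lt_le_trans _ _ (Rintegral mu J (fun=> expR (- (3 / 4)^-1)))).
    set E := expR _; have E0 : 0 < E by exact: expR_gt0.
    have ab : e0 + a * 3 / 8 <= e0 + a * 5 / 8 by lra.
    have dE (t : R) : is_derive t 1 (fun t => E * t) E by der; rewrite /=; ring.
    have cE (t : R) : {for t, continuous (fun=> E)} by cts.
    rewrite (@Rintegral_FTC R _ _ (fun t => E * t) (fun=> E) ab (fun t _ => dE t) (fun t _ => cE t)).
    by have -> : E * (e0 + a * 5 / 8) - E * (e0 + a * 3 / 8) = E * (a / 4); [field|rewrite mulr_gt0].
  apply: (@le_trans _ _ (Rintegral mu J beta)).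
    have iJb : mu.-integrable J (EFin \o beta) by apply: continuous_integrable_itv => t _; exact: cb.
    apply: le_Rintegral => //; first exact: measurable_itv.
    move=> t; rewrite /J /= in_itv/= => /andP[t1 t2]; apply: Fm0_ge; first lra.
    have h8 : 0 < a / 8 by lra.
    have h : `|t - (e0 + a / 2)| <= a / 8 by rewrite ler_norml; lra.
    have := div_sqr_le h8 h; rewrite (_ : (t - (e0 + a / 2)) / (a / 8) = 2 * ((t - (e0 + a / 2)) / (a / 4))); last by field; rewrite gt_eqF.
    by rewrite exprMn; lra.
  by apply: Rintegral_subset_le => //; exact: measurable_itv.
pose L d := Rintegral mu2 setT (fun q => gl q * beta q.2 * Pk d (q.1 - x0)).
have cL : L d @[d --> 0^'+] --> pi^-1 * Rintegral mu `[al / 2, be] (fun e => beta e * Kf X p.2 e).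
  have c1 := @uk_transform_cvg R X p.2 beta al be 1 X0 p20 cb al0 b_lo b_hi b0 bM yab.
  apply: cvg_trans c1; apply: near_eq_cvg; near=> d.
  have d0 : 0 < d by near: d; exact: nbhs_right_gt.
  by apply/esym; rewrite /L (@poisson_strip beta al be 1 x0 d).
pose V := Rintegral mu `[al / 2, be] (fun e => beta e * Kf X p.2 e).
have iKf := @integrable_bKf R X p.2 beta al be 1 X0 p20 cb al0 b0 bM.
have ibD : mu.-integrable `[al / 2, be] (EFin \o beta) by apply: continuous_integrable_itv => t _; exact: cb.
have Kb e : `[al / 2, be]%classic e -> (K - ep) * beta e <= beta e * Kf X p.2 e <= (K + ep) * beta e.
  move=> _; have [h|h] := ltP e al; first by rewrite b_lo// !mulr0 mul0r lexx.
  have [h'|h'] := ltP be e; first by rewrite b_hi// !mulr0 mul0r lexx.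
  have : `|K - Kf X p.2 e| <= ep.
    by apply: s2; rewrite /= ?ltr0_norm; move: h h'; rewrite /al /be; lra.
  by rewrite ler_norml; have := b0 e; nra.
have [V1 V2] : (K - ep) * Ib <= V /\ V <= (K + ep) * Ib.
  split; rewrite IbE -RintegralZl//; apply: le_Rintegral => //; try exact: integrable_scale.
    by move=> e /Kb /andP[].
  by move=> e /Kb /andP[].
(* The part of the Poisson kernel near [x0], of mass [2 atan (a / d) -> pi]. Dropping the rest gives
   the lower bound, because [gl * beta >= 0]; in the upper bound the rest costs at most [d / a^2]
   times a finite mass. *)
pose box d (t : R) := if `|t - x0| <= a then Pk d (t - x0) else 0.
have box0 d t : 0 < d -> 0 <= box d t by move=> d0; rewrite /box; case: ifP => // _; exact: ltW (Pk_gt0 _ _).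
have boxE d : 0 < d -> mu.-integrable setT (EFin \o box d) /\ Rintegral mu setT (box d) = 2 * atan (a / d).
  move=> d0; have -> : box d = patch (fun=> 0) `[x0 - a, x0 + a] (fun t => Pk d (t - x0)).
    apply/funext => t; rewrite /box /patch; have -> : (`|t - x0| <= a) = (t \in `[x0 - a, x0 + a]%classic).
      by apply/idP/idP; rewrite inE /= in_itv/= ler_norml; lra.
    by [].
  split.
    apply: integrable_patch; first exact: measurable_itv.
    by apply: continuous_integrable_itv => t _; exact: cts_Pk.
  rewrite -Rintegral_mkcond Rintegral_Pk//; last lra.
  have -> : (x0 + a - x0) / d = a / d by congr (_ / _); ring.
  have -> : (x0 - a - x0) / d = - (a / d) by field; rewrite gt_eqF.
  by rewrite atanN; ring.
have iA : mu2.-integrable setT (EFin \o (fun q => gl q * beta q.2)).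
  exact: (strip_integrable exh dg Op0 sb al0 b_lo b_hi b0 bM ltr01).
have A0 q : 0 <= gl q * beta q.2 by rewrite mulr_ge0// (gl_ge0 exh dg Op0).
have iL d : 0 < d -> mu2.-integrable setT (EFin \o (fun q => gl q * beta q.2 * Pk d (q.1 - x0))).
  move=> d0; apply: (@integrable_dom _ _ _ mu2 setT _ (fun q => d^-1 * (gl q * beta q.2))) => //.
  - apply: measurable_funM; first by move/integrableP : (iA) => [/measurable_EFinP].
    have mP : measurable_fun (setT : set R) (fun t => Pk d (t - x0)) by apply: continuous_measurableT => // t; exact: cts_Pk.
    exact: (measurableT_comp mP measurable_fst).
  - move=> q _; rewrite normrM (ger0_norm (A0 q)) mulrC ler_wpM2r// gtr0_norm ?Pk_gt0//.
    rewrite /Pk ler_pdivrMr ?dsqr_gt0// mulrDr expr2 mulKf ?gt_eqF// lerDl mulr_ge0 ?sqr_ge0// invr_ge0 ltW//.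
  - exact: integrable_scale.
have pb d : 0 < d -> mu2.-integrable setT (EFin \o (fun q : R * R => box d q.1 * beta q.2)) /\
    Rintegral mu2 setT (fun q => box d q.1 * beta q.2) = 2 * atan (a / d) * Ib.
  move=> d0; have [ib eb] := boxE d d0.
  by have := @Rintegral_prod R (box d) beta (fun t => box0 d t d0) b0 ib ibeta; rewrite eb.
have near_c q : `|q.1 - x0| <= a -> beta q.2 = 0 \/ `|c - gl q| <= ep.
  move=> h1; have [h|h] := ltP q.2 al; first by left; exact: b_lo.
  have [h'|h'] := ltP be q.2; first by left; exact: b_hi.
  right; apply: s1; apply/sqrP => /=; split; first lra.
  by rewrite ger0_norm; move: h h'; rewrite /al /be; lra.
have lo d : 0 < d -> (c - ep) * (2 * atan (a / d) * Ib) <= L d.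
  move=> d0; have [i1 <-] := pb d d0; rewrite -RintegralZl//.
  apply: le_Rintegral => //; [exact: integrable_scale|exact: iL|move=> q _].
  have P0 := Pk_gt0 (q.1 - x0) d0.
  rewrite /box; case: ifPn => [h|_]; last by rewrite mul0r mulr0 mulr_ge0// ltW.
  have [->|] := near_c q h; first by rewrite !mulr0 mul0r.
  rewrite ler_norml => /andP[h1 h2].
  have -> : (c - ep) * (Pk d (q.1 - x0) * beta q.2) = (c - ep) * beta q.2 * Pk d (q.1 - x0) by ring.
  by rewrite ler_pM2r// ler_wpM2r//; lra.
have hi d : 0 < d -> L d <= (c + ep) * (2 * atan (a / d) * Ib) + d / a ^+ 2 * Rintegral mu2 setT (fun q => gl q * beta q.2).
  move=> d0; have [i1 <-] := pb d d0; rewrite -!RintegralZl// -RintegralD//; [|exact: integrable_scale|exact: integrable_scale].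
  apply: le_Rintegral => //; [exact: iL|by apply: integrable_sum => //; exact: integrable_scale|move=> q _].
  have P0 := Pk_gt0 (q.1 - x0) d0; have Aq := A0 q.
  have da : 0 <= d / a ^+ 2 by rewrite divr_ge0 ?sqr_ge0// ltW.
  have dA : 0 <= d / a ^+ 2 * (gl q * beta q.2) by rewrite mulr_ge0.
  rewrite /box; case: ifPn => [h|].
    have [->|] := near_c q h; first by rewrite !mulr0 mul0r addr0.
    rewrite ler_norml => /andP[h1 h2].
    have -> : (c + ep) * (Pk d (q.1 - x0) * beta q.2) = (c + ep) * beta q.2 * Pk d (q.1 - x0) by ring.
    have : gl q * beta q.2 * Pk d (q.1 - x0) <= (c + ep) * beta q.2 * Pk d (q.1 - x0).
      by rewrite ler_pM2r// ler_wpM2r//; lra.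
    lra.
  rewrite -ltNge => h; rewrite mul0r mulr0 add0r mulrC ler_wpM2r//.
  rewrite /Pk ler_pM2l// lef_pV2 ?posrE ?dsqr_gt0 ?exprn_gt0//.
  have : a ^+ 2 <= (q.1 - x0) ^+ 2.
    by rewrite -[leRHS]real_normK ?num_real// ler_pXn2r ?nnegrE ?(ltW a0) ?(ltW h).
  have := sqr_ge0 d; lra.
set IA := Rintegral mu2 setT _ in hi.
have cat : atan (a / d) @[d --> 0^'+] --> (pi / 2 : R) by exact: atan_scale_cvg.
have cid : (d : R) @[d --> 0^'+] --> (0 : R) by apply: cvg_at_right_filter; exact: cvg_id.
have c1 : (c - ep) * (2 * atan (a / d) * Ib) @[d --> 0^'+] --> (c - ep) * (2 * (pi / 2) * Ib).
  by apply: cvgM; [exact: cvg_cst|apply: cvgM; [apply: cvgM; [exact: cvg_cst|]|exact: cvg_cst]].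
have c2 : (c + ep) * (2 * atan (a / d) * Ib) + d / a ^+ 2 * IA @[d --> 0^'+] --> (c + ep) * (2 * (pi / 2) * Ib) + 0 / a ^+ 2 * IA.
  apply: cvgD; first by apply: cvgM; [exact: cvg_cst|apply: cvgM; [apply: cvgM; [exact: cvg_cst|]|exact: cvg_cst]].
  by apply: cvgM; [apply: cvgM; [|exact: cvg_cst]|exact: cvg_cst].
have f1 : (c - ep) * (2 * (pi / 2) * Ib) <= pi^-1 * V.
  by apply: (ler_cvg_to c1 cL); near=> d; apply: lo; near: d; exact: nbhs_right_gt.
have f2 : pi^-1 * V <= (c + ep) * (2 * (pi / 2) * Ib) + 0 / a ^+ 2 * IA.
  by apply: (ler_cvg_to cL c2); near=> d; apply: hi; near: d; exact: nbhs_right_gt.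
have g1 : c - ep <= pi^-1 * (pi^-1 * (K + ep)).
  have : (c - ep) * (2 * (pi / 2) * Ib) <= pi^-1 * ((K + ep) * Ib) by apply: le_trans f1 _; rewrite ler_pM2l.
  exact: (scale_pi _ _ pi0 Ib0).1.
have g2 : pi^-1 * (pi^-1 * (K - ep)) <= c + ep.
  have : pi^-1 * ((K - ep) * Ib) <= (c + ep) * (2 * (pi / 2) * Ib) + 0 / a ^+ 2 * IA by apply: le_trans f2; rewrite ler_pM2l.
  by rewrite !mul0r addr0; exact: (scale_pi _ _ pi0 Ib0).2.
move: g1 g2; rewrite ler_norml; move: (pi^-1) => w; lra.
Unshelve. all: by end_near. Qed.

End identification.

(** * The Tauberian theorem *)

Section tauberian.
Variable R : realType.
Local Notation mu := (@lebesgue_measure R).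
Local Notation Rp := (`[0, +oo[%classic : set R).

(* Cut-off profile: [1 - (1 - e^-u)^N] is a polynomial in [e^-u] vanishing at 0 that drops from 1 to 0 around
   [u = ln N] within a bounded distance, i.e. within a relative distance [1 / ln N]. *)
Definition cutoff N (u : R) : R := 1 - (1 - expR (- u)) ^+ N.

(** One factor is bounded by [u], which cancels the singularity of [C / rr s] at small [s]; the
    other [n] give the very small constant [exp (- n e^(- L/2))]. *)
Lemma cutoff_lo n (u L : R) : 0 <= u -> u <= L / 2 ->
  (1 - expR (- u)) ^+ n.+1 <= u * expR (- (n%:R * expR (- (L / 2)))).
Proof.
move=> u0 uL; have e0 := expR_gt0 (- u).
have h1 : 1 - expR (- u) <= u by have := expR_ge1Dx (- u); lra.
have h0 : 0 <= 1 - expR (- u) by rewrite subr_ge0 -[leRHS]expR0 ler_expR oppr_le0.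
rewrite exprS; apply: ler_pM => //; first exact: exprn_ge0.
have h2 : 1 - expR (- u) <= expR (- expR (- u)) by have := expR_ge1Dx (- expR (- u)); lra.
apply: (@le_trans _ _ (expR (- expR (- u)) ^+ n)); first by rewrite lerXn2r ?nnegrE// expR_ge0.
rewrite -expRM_natl ler_expR mulrN lerN2; apply: ler_wpM2l => //.
by rewrite ler_expR; lra.
Qed.

(** By [1 - x <= e^-x] twice: the power is at most [exp (- N e^-u) = exp (- e^(L - u))], and
    [e^(L - u) >= L - u]. *)
Lemma cutoff_mid N (u L : R) : N%:R = expR L :> R -> 0 <= u -> (1 - expR (- u)) ^+ N <= expR (- (L - u)).
Proof.
move=> NL u0.
have h0 : 0 <= 1 - expR (- u) by rewrite subr_ge0 -[leRHS]expR0 ler_expR oppr_le0.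
have h2 : 1 - expR (- u) <= expR (- expR (- u)) by have := expR_ge1Dx (- expR (- u)); lra.
apply: (@le_trans _ _ (expR (- expR (- u)) ^+ N)); first by rewrite lerXn2r ?nnegrE// expR_ge0.
rewrite -expRM_natl NL ler_expR mulrN -expRD lerN2.
by have := expR_ge1Dx (L - u); lra.
Qed.

(** Bernoulli's inequality: the profile is at most [N e^-u = e^(L - u)]. *)
Lemma cutoff_hi N (u L : R) : N%:R = expR L :> R -> 0 <= u -> 0 <= cutoff N u <= expR (L - u).
Proof.
move=> NL u0; rewrite /cutoff.
have e0 := expR_gt0 (- u).
have h0 : 0 <= 1 - expR (- u) by rewrite subr_ge0 -[leRHS]expR0 ler_expR oppr_le0.
have h1 : 1 - expR (- u) <= 1 by lra.
rewrite subr_ge0 exprn_ile1//=.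
have : 1 - N%:R * expR (- u) <= (1 - expR (- u)) ^+ N.
  elim: N {NL} => [|n IH]; first by rewrite expr0 mul0r subr0.
  have p1 : (1 - expR (- u)) ^+ n <= 1 by exact: exprn_ile1.
  rewrite exprS -natr1; move: (expR (- u)) e0 h0 h1 p1 IH => E E0 H0 H1 p1 IH.
  have : E * (1 - E) ^+ n <= E by rewrite ler_piMr// ltW.
  by rewrite mulrBl mul1r mulrDl mul1r; lra.
by rewrite NL -expRD; lra.
Qed.

(** The slope of [rr] vanishes at 0, but a chord ending at [T >= 1] has slope at least 1/4: the
    difference of squares is [(T - s) (T + s)] and [rr T + rr s <= 4 T]. *)
Lemma rr_lip (T s : R) : 1 <= T -> 0 <= s -> s <= T -> (T - s) / 4 <= rr T - rr s.
Proof.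
move=> T1 s0 sT; have a := rr2 T; have b := rr2 s; have ra := rr_gt0 T; have rb := rr_gt0 s.
have h1 : rr T <= 2 * T by nra.
have h2 : rr s <= rr T by nra.
have e : (rr T - rr s) * (rr T + rr s) = (T - s) * (T + s) by lra.
have : (T - s) * T <= (rr T - rr s) * (4 * T).
  apply: (@le_trans _ _ ((T - s) * (T + s))); first by apply: ler_wpM2l; lra.
  by rewrite -e; apply: ler_wpM2l; lra.
have T0 : 0 < T by lra.
by rewrite mulrA ler_pM2r//; lra.
Qed.

Lemma rr_lip_hi (T s : R) : 1 <= T -> T <= s -> (s - T) / 4 <= rr s - rr T.
Proof. by move=> T1 Ts; apply: rr_lip => //; lra. Qed.

Variables (f : R -> R) (C A : R).
Hypothesis mf : measurable_fun (setT : set R) f.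
Hypothesis fC : forall s, 0 <= s -> `|f s| <= C / rr s.
Hypothesis abel : Rintegral mu Rp (fun s => f s * expR (- (rr s * X))) @[X --> 0^'+] --> A.

Let C_ge0 : 0 <= C.
Proof.
have := fC (lexx 0) => h; have := le_trans (normr_ge0 _) h.
by rewrite pmulr_lge0// invr_gt0 rr_gt0.
Qed.

Lemma rr_ge_half (s : R) : 1 / 2 <= rr s.
Proof. by have := rr2 s; have := rr_gt0 s; have := sqr_ge0 s; nra. Qed.

Let mrr : measurable_fun (setT : set R) (@rr R).
Proof. by apply: continuous_measurableT => // s; exact: cts_rr. Qed.

(** Karamata's method: the profiles [w] for which the Abel mean converges, with [c] in the role of
    [w 0]. The class contains [e^(- j u)] for [j >= 1], by rescaling [X], and is stable under
    combinations, so it contains the cut-off profiles. *)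
Definition good (w : R -> R) (c : R) := [/\ forall t, {for t, continuous w},
  exists M : R, forall u, 0 <= u -> `|w u| <= M * expR (- u) &
  Rintegral mu Rp (fun s => f s * w (rr s * X)) @[X --> 0^'+] --> c * A].

Lemma good_int w c (X : R) : good w c -> 0 < X -> mu.-integrable Rp (EFin \o (fun s => f s * w (rr s * X))).
Proof.
move=> [cw [M hM] _] X0.
have M0 : 0 <= M by have := hM 0 (lexx _); rewrite oppr0 expR0 mulr1; exact: le_trans.
have mw : measurable_fun (setT : set R) (fun s => w (rr s * X)).
  apply: continuous_measurableT => // s; have c1 := @cts_rr R.
  have c2 : {for s, continuous (fun s => rr s * X)} by cts.
  exact: (@cts_comp R w (fun s => rr s * X) s (cw _) c2).
apply: (@integrable_dom _ _ _ mu Rp _ (fun s => M * ((2 * C) * expR (- (X * s))))) => //.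
- by apply: measurable_funTS; exact: measurable_funM.
- move=> s; rewrite /= in_itv/= andbT => s0; rewrite normrM mulrCA; apply: ler_pM => //.
    apply: le_trans (fC s0) _; rewrite ler_pdivrMr ?rr_gt0//.
    by have := rr_ge_half s; have := C_ge0; nra.
  have u0 : 0 <= rr s * X by rewrite mulr_ge0 ?ltW// rr_gt0.
  apply: le_trans (hM _ u0) _; apply: ler_wpM2l => //; rewrite ler_expR lerN2 mulrC ler_wpM2r ?(ltW X0)//; exact: rr_ge.
- by apply: integrable_scale => //; apply: integrable_scale => //; exact: integrable_expRN.
Qed.

Lemma good_comb w v c d (b : R) : good w c -> good v d -> good (fun u => w u + b * v u) (c + b * d).
Proof.
move=> gw gv; have [cw [M hM] lw] := gw; have [cv [N hN] lv] := gv; split.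
- by move=> t; have c1 := cw t; have c2 := cv t; cts.
- exists (M + `|b| * N) => u u0; apply: le_trans (ler_normD _ _) _; rewrite mulrDl; apply: lerD; first exact: hM.
  by rewrite normrM -mulrA ler_wpM2l//; exact: hN.
have h : Rintegral mu Rp (fun s => f s * w (rr s * X)) + b * Rintegral mu Rp (fun s => f s * v (rr s * X)) @[X --> 0^'+] -->
    c * A + b * (d * A).
  by apply: cvgD => //; apply: cvgM => //; exact: cvg_cst.
have -> : (c + b * d) * A = c * A + b * (d * A) by ring.
apply: cvg_trans h; apply: near_eq_cvg; near=> X.
have X0 : 0 < X by near: X; exact: nbhs_right_gt.
have i1 := good_int gw X0; have i2 := good_int gv X0.
rewrite -RintegralZl// -RintegralD//; last exact: integrable_scale.
by apply: eq_Rintegral => s _; ring.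
Unshelve. all: by end_near. Qed.

Lemma good_exp j : good (fun u => expR (- (j.+1%:R * u))) 1.
Proof.
have j0 : 0 < j.+1%:R :> R by rewrite ltr0n.
have j1 : 1 <= j.+1%:R :> R by rewrite ler1n.
split.
- by move=> t; cts.
- exists 1 => u u0; rewrite mul1r ger0_norm ?expR_ge0// ler_expR lerN2.
  by move: (j.+1%:R : R) j1 => J; nra.
rewrite mul1r; apply/cvgrPdist_le => e e0; move/cvgrPdist_le : abel => /(_ _ e0)[d /= d0 h].
exists (d / j.+1%:R); first by rewrite /= divr_gt0.
move=> X /=; rewrite sub0r normrN => Xd X0; rewrite (gtr0_norm X0) ltr_pdivlMr// in Xd.
have Xd' : j.+1%:R * X < d by rewrite mulrC.
have := h (j.+1%:R * X); rewrite /= sub0r normrN gtr0_norm ?mulr_gt0// => /(_ Xd' isT).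
have -> : Rintegral mu Rp (fun s => f s * expR (- (rr s * (j.+1%:R * X)))) =
   Rintegral mu Rp (fun s => f s * expR (- (j.+1%:R * (rr s * X)))) by apply: eq_Rintegral => s _; rewrite mulrCA.
by [].
Qed.

Lemma good_pow n j : good (fun u => (1 - expR (- u)) ^+ n * expR (- (j.+1%:R * u))) (n == 0%N)%:R.
Proof.
elim: n j => [|n IH] j.
  by have := good_exp j; under [X in _ -> good X _]eq_fun do rewrite expr0 mul1r.
have := good_comb (-1) (IH j) (IH j.+1); rewrite mulN1r subrr /=.
congr (good _ _); apply/funext => u; rewrite exprS.
have -> : expR (- (j.+2%:R * u)) = expR (- (j.+1%:R * u)) * expR (- u).
  by rewrite -expRD -[j.+2%:R]natr1; congr expR; rewrite mulrDl mul1r opprD.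
by move: (expR (- u)) ((1 - expR (- u)) ^+ n) (expR (- (j.+1%:R * u))) => c b a; ring.
Qed.

Lemma good_cutoff N : good (cutoff N.+1) 1.
Proof.
elim: N => [|N IH].
  have := good_exp 0; congr (good _ _); apply/funext => u; rewrite /cutoff expr1 mul1r; ring.
have := good_comb 1 IH (good_pow N.+1 0); rewrite mulr0 addr0.
congr (good _ _); apply/funext => u; rewrite /cutoff !mul1r [in RHS]exprS; ring.
Qed.

(** With [X = L / rr T] the profile drops at [s = T]. Against [|f| <= C / rr s] the error is [8 / L]
    from the [s < T] with [rr s * X > L / 2], [4 / L] from [s > T], and the last term from small
    [s]. *)
Lemma tauber_error n (L T : R) : 0 < L -> n.+1%:R = expR L :> R -> 1 <= T ->
  `|Rintegral mu `[0, T] f - Rintegral mu Rp (fun s => f s * cutoff n.+1 (rr s * (L / rr T)))| <=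
  C * (12 / L + expR (- (n%:R * expR (- (L / 2)))) * L).
Proof.
move=> L0 NL T1; have T0 : 0 <= T by lra.
set X := L / rr T; have X0 : 0 < X by rewrite divr_gt0 ?rr_gt0.
set ka := expR (- (n%:R * _)); have ka0 : 0 < ka by exact: expR_gt0.
have XT : rr T * X = L by rewrite /X mulrCA mulfV ?mulr1// gt_eqF// rr_gt0.
pose w s := cutoff n.+1 (rr s * X).
have iw := good_int (good_cutoff n) X0.
have hC := C_ge0.
have mrw : measurable_fun (setT : set R) (fun s => f s * w s).
  apply: measurable_funM => //; apply: continuous_measurableT => // s.
  by have c1 := @cts_rr R; rewrite /w /cutoff; cts.
have i0T : mu.-integrable `[0, T] (EFin \o (fun s => f s * w s)).
  by apply: (@integrableS _ _ _ mu Rp) iw => // s /=; rewrite !in_itv/= andbT => /andP[].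
have iT : mu.-integrable `]T, +oo[ (EFin \o (fun s => f s * w s)).
  by apply: (@integrableS _ _ _ mu Rp) iw => // s /=; rewrite !in_itv/= !andbT; lra.
have if0T : mu.-integrable `[0, T] (EFin \o f).
  apply: (@integrable_dom _ _ _ mu _ _ (fun=> 2 * C)) => //.
  - exact: measurable_funTS.
  - move=> s; rewrite /= in_itv/= => /andP[s0 _]; apply: le_trans (fC s0) _; rewrite ler_pdivrMr ?rr_gt0//.
    by have := rr_ge_half s; nra.
  - by apply: continuous_integrable_itv => s _; cts.
have split : Rintegral mu Rp (fun s => f s * w s) = Rintegral mu `[0, T] (fun s => f s * w s) + Rintegral mu `]T, +oo[ (fun s => f s * w s).
  have := @Rintegral_itvB R (fun s => f s * w s) (BLeft 0) (BInfty _ false) T iw.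
  rewrite !bnd_simp => /(_ T0 isT) <-; ring.
rewrite split.
have -> : Rintegral mu `[0, T] f - (Rintegral mu `[0, T] (fun s => f s * w s) + Rintegral mu `]T, +oo[ (fun s => f s * w s)) =
   (Rintegral mu `[0, T] f - Rintegral mu `[0, T] (fun s => f s * w s)) - Rintegral mu `]T, +oo[ (fun s => f s * w s) by ring.
rewrite -RintegralB//; apply: le_trans (ler_normB _ _) _.
have rXu s : 0 <= rr s * X by rewrite mulr_ge0 ?ltW// rr_gt0.
have p1 : `|Rintegral mu `[0, T] (fun s => f s - f s * w s)| <= C * (8 / L + ka * L).
  (* The first term dominates where [rr s * X > L / 2], by [cutoff_mid] and [rr_lip]; the second
     where [rr s * X <= L / 2], by [cutoff_lo]. *)
  pose g s := C * (2 * X / L * expR ((s - T) * (X / 4)) + X * ka).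
  pose G s := C * (8 / L * expR ((s - T) * (X / 4)) + X * ka * s).
  have dG (s : R) : is_derive s 1 G (g s).
    by rewrite /G; der; rewrite /g /=; field; rewrite gt_eqF.
  have cg (s : R) : {for s, continuous g} by rewrite /g; cts.
  apply: (@le_trans _ _ (Rintegral mu `[0, T] g)).
    apply: normr_Rintegral_le => //.
    - exact: integrable_diff.
    - by apply: continuous_integrable_itv => s _; exact: cg.
    move=> s; rewrite /= in_itv/= => /andP[s0 sT].
    have -> : f s - f s * w s = f s * (1 - cutoff n.+1 (rr s * X)) by rewrite /w; ring.
    have r0 := rr_gt0 s; have u0 := rXu s.
    have -> : 1 - cutoff n.+1 (rr s * X) = (1 - expR (- (rr s * X))) ^+ n.+1 by rewrite /cutoff; ring.
    have P0 : 0 <= (1 - expR (- (rr s * X))) ^+ n.+1.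
      by apply: exprn_ge0; rewrite subr_ge0 -[leRHS]expR0 ler_expR oppr_le0.
    rewrite normrM (ger0_norm P0); apply: (@le_trans _ _ (C / rr s * (1 - expR (- (rr s * X))) ^+ n.+1)).
      by apply: ler_wpM2r => //; exact: fC.
    rewrite /g -mulrA; apply: ler_wpM2l => //.
    have E0 := expR_gt0 ((s - T) * (X / 4)).
    have [hu|hu] := leP (rr s * X) (L / 2).
      have := cutoff_lo n u0 hu; rewrite -/ka => h.
      apply: (@le_trans _ _ (X * ka)).
        rewrite mulrC ler_pdivrMr//; apply: le_trans h _; by rewrite le_eqVlt; apply/orP; left; apply/eqP; ring.
      rewrite lerDr; apply: mulr_ge0; last exact: ltW.
      exact: (divr_ge0 (mulr_ge0 (ler0n _ 2) (ltW X0)) (ltW L0)).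
    have h := cutoff_mid NL u0.
    apply: (@le_trans _ _ (2 * X / L * expR ((s - T) * (X / 4)))); last first.
      by rewrite lerDl mulr_ge0// ltW.
    apply: ler_pM => //; first by rewrite invr_ge0 ltW.
      rewrite ler_pdivlMr// mulrC ler_pdivrMr//; lra.
    apply: le_trans h _; rewrite ler_expR.
    have := rr_lip T1 s0 sT; rewrite -XT => k.
    have : (T - s) / 4 * X <= (rr T - rr s) * X by rewrite ler_pM2r.
    lra.
  rewrite (@Rintegral_FTC R 0 T G g T0 (fun s _ => dG s) (fun s _ => cg s)).
  rewrite /G -mulrBr; apply: ler_wpM2l => //.
  rewrite subrr mul0r expR0 mulr1 mulr0 addr0.
  have E0 := expR_gt0 ((0 - T) * (X / 4)).
  have : 0 <= 8 / L * expR ((0 - T) * (X / 4)) by rewrite mulr_ge0 ?(ltW E0)// divr_ge0// ltW.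
  have : X * ka * T <= ka * L.
    rewrite -XT mulrAC [leRHS]mulrC; apply: ler_wpM2r; first exact: ltW.
    by rewrite mulrC ler_pM2r//; exact: rr_ge.
  lra.
have p2 : `|Rintegral mu `]T, +oo[ (fun s => f s * w s)| <= C * (4 / L).
  pose g s := C * (X / L * expR (- ((s - T) * (X / 4)))).
  pose G s := - (C * (4 / L * expR (- ((s - T) * (X / 4))))).
  have dG (s : R) : is_derive s 1 G (g s).
    by rewrite /G; der; rewrite /g /=; field; rewrite gt_eqF.
  have cg (s : R) : {for s, continuous g} by rewrite /g; cts.
  have X4 : 0 < X / 4 by rewrite divr_gt0.
  have eE s : expR (- ((s - T) * (X / 4))) = expR (T * (X / 4)) * expR (- (X / 4 * s)).
    by rewrite -expRD; congr expR; ring.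
  have ge s : g s = C * (X / L * expR (T * (X / 4))) * expR (- (X / 4 * s)).
    by rewrite /g eE; ring.
  have ig : mu.-integrable `[T, +oo[ (EFin \o g).
    have -> : g = (fun s => C * (X / L * expR (T * (X / 4))) * expR (- (X / 4 * s))) by apply/funext => s; exact: ge.
    apply: integrable_scale => //; apply: (@integrableS _ _ _ mu Rp) (integrable_expRN X4) => //.
    by move=> s /=; rewrite !in_itv/= !andbT; lra.
  have igo : mu.-integrable `]T, +oo[ (EFin \o g).
    by apply: (@integrableS _ _ _ mu `[T, +oo[) ig => // s /=; rewrite !in_itv/= !andbT; exact: ltW.
  apply: (@le_trans _ _ (Rintegral mu `]T, +oo[ g)).
    apply: normr_Rintegral_le => //.
    move=> s; rewrite /= in_itv/= andbT => Ts.
    have s0 : 0 <= s by lra.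
    have r0 := rr_gt0 s; have u0 := rXu s.
    have /andP[c0 c1] := cutoff_hi NL u0.
    rewrite normrM (ger0_norm c0); apply: (@le_trans _ _ (C / rr s * expR (L - rr s * X))).
      by apply: ler_pM => //; exact: fC.
    rewrite /g -mulrA; apply: ler_wpM2l => //.
    have k := rr_lip_hi T1 (ltW Ts).
    have k2 : (s - T) / 4 * X <= (rr s - rr T) * X by rewrite ler_pM2r.
    apply: ler_pM => //; [by rewrite invr_ge0 ltW| |].
      rewrite ler_pdivlMr// mulrC ler_pdivrMr// -XT mulrC; apply: ler_wpM2l; first exact: ltW.
      lra.
    by rewrite ler_expR -XT; lra.
  rewrite Rintegral_itv_obnd_cbnd//.
  have l0 : G s @[s --> +oo] --> (0 : R).
    have c1 := @cvg_expRN_pinfty R _ X4.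
    have c2 : - (C * (4 / L * expR (T * (X / 4)))) * expR (- (X / 4 * s)) @[s --> +oo] --> - (C * (4 / L * expR (T * (X / 4)))) * 0.
      by apply: cvgM => //; exact: cvg_cst.
    rewrite mulr0 in c2; apply: cvg_trans c2; apply: near_eq_cvg; near=> s.
    by rewrite /G eE; ring.
  rewrite (@Rintegral_FTCy R T 0 G g (fun s _ => dG s) (fun s _ => cg s) ig l0).
  by rewrite /G subrr mul0r oppr0 expR0 mulr1 sub0r opprK.
have -> : C * (12 / L + ka * L) = C * (8 / L + ka * L) + C * (4 / L) by ring.
exact: lerD.
Unshelve. all: by end_near. Qed.

(** With [q = e^(L/2)] the exponent is [- (q - 1/q)], and [e^-q <= 2 / q^2] together with
    [q >= L / 2] gives the bound. *)
Lemma kappa_le n (L : R) : 0 < L -> n.+1%:R = expR L :> R ->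
  expR (- (n%:R * expR (- (L / 2)))) * L <= 8 * expR 1 / L.
Proof.
move=> L0 NL; set q := expR (L / 2).
have q1 : 1 <= q by rewrite -[leLHS]expR0 ler_expR; lra.
have q0 : 0 < q by lra.
have nq : n%:R = q ^+ 2 - 1 :> R.
  have : expR L = q ^+ 2 by rewrite /q -expRM_natl; congr expR; field.
  by rewrite -NL -natr1; lra.
have -> : expR (- (L / 2)) = q^-1 by rewrite expRN.
have h1 : expR (- (n%:R / q)) <= expR 1 * expR (- q).
  rewrite -expRD ler_expR nq mulrBl expr2 mulfK ?gt_eqF// mul1r.
  have : q^-1 <= 1 by rewrite invf_le1.
  lra.
have Lq : L / 2 <= q by have := expR_ge1Dx (L / 2); rewrite -/q; lra.
have h2 : expR (- q) <= 2 / q ^+ 2.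
  have := @expR_ge1Dxn R q 1 (ltW q0); rewrite -[2`!]/2%N => h.
  rewrite expRN -[leRHS]invrK lef_pV2 ?posrE ?expR_gt0 ?invr_gt0 ?divr_gt0 ?exprn_gt0//.
  by rewrite invfM invrK mulrC; lra.
have e0 := expR_gt0 (1 : R).
apply: (@le_trans _ _ (expR 1 * (2 / q ^+ 2) * L)).
  by rewrite ler_pM2r//; apply: le_trans h1 _; rewrite ler_pM2l.
rewrite ler_pdivlMr//.
have -> : expR 1 * (2 / q ^+ 2) * L * L = 2 * expR 1 * (L ^+ 2 / q ^+ 2) by move: (q ^+ 2) => q2; ring.
have -> : 8 * expR 1 = 2 * expR 1 * 4 :> R by ring.
apply: ler_wpM2l; first lra.
rewrite ler_pdivrMr ?exprn_gt0//.
by nra.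
Qed.

Lemma tauber : Rintegral mu `[0, T] f @[T --> +oo] --> A.
Proof.
apply/cvgrPdist_le => e e0.
have K0 : 0 <= C * (12 + 8 * expR 1) by rewrite mulr_ge0 ?C_ge0// addr_ge0// mulr_ge0// expR_ge0.
(* [L > Q] makes the error of [tauber_error] at most [e / 2]. The profile is then fixed, and the
   Abel limit along it accounts for the other half as [T] grows. *)
pose Q := C * (12 + 8 * expR 1) / (e / 2) + 1.
have Q1 : 1 <= Q by rewrite lerDr divr_ge0//; lra.
pose N := Num.bound (expR Q).
have NQ : expR Q < N%:R by apply: archi_boundP; exact: expR_ge0.
case EN : N NQ => [|n]; first by move=> NQ; have := expR_gt0 Q; lra.
move=> NQ; pose L := ln (n.+1%:R : R).
have N0 : 0 < n.+1%:R :> R by rewrite ltr0n.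
have NL : n.+1%:R = expR L :> R by rewrite lnK.
have QL : Q < L by move: NQ; rewrite NL ltr_expR.
have L0 : 0 < L by lra.
have [_ _ cN] := good_cutoff n; rewrite mul1r in cN.
have e2 : 0 < e / 2 by lra.
move/cvgrPdist_le : cN => /(_ _ e2)[d /= d0 hd].
near=> T.
have T1 : 1 <= T by near: T; exact: nbhs_pinfty_ge.
have TL : L / d + 1 <= T by near: T; apply: nbhs_pinfty_ge; exact: num_real.
have rT : L / d < rr T by apply: (@lt_le_trans _ _ T); [lra|apply: rr_ge; lra].
have X0 : 0 < L / rr T by rewrite divr_gt0// rr_gt0.
have Xd : L / rr T < d by rewrite ltr_pdivrMr ?rr_gt0// mulrC -ltr_pdivrMr.
have := hd (L / rr T); rewrite /= sub0r normrN gtr0_norm// => /(_ Xd X0) h1.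
have h2 := tauber_error L0 NL T1.
have h3 : C * (12 / L + expR (- (n%:R * expR (- (L / 2)))) * L) <= e / 2.
  apply: (@le_trans _ _ (C * (12 / L + 8 * expR 1 / L))).
    by apply: ler_wpM2l; [exact: C_ge0|rewrite lerD2l; exact: kappa_le].
  have -> : C * (12 / L + 8 * expR 1 / L) = C * (12 + 8 * expR 1) / L by ring.
  rewrite ler_pdivrMr// [leRHS]mulrC -ler_pdivrMr//; move: QL; rewrite /Q; lra.
set I := Rintegral mu `[0, T] f in h2 *; set J := Rintegral mu Rp _ in h1 h2.
have -> : A - I = (A - J) - (I - J) by ring.
by apply: le_trans (ler_normB _ _) _; lra.
Unshelve. all: by end_near. Qed.

End tauberian.

(** * From the kernel to the integrand of the statement *)

Section main_aux.
Variable R : realType.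
Local Notation mu := (@lebesgue_measure R).
Local Notation Rp := (`[0, +oo[%classic : set R).

Lemma exhaustion_shift (Om : nat -> set (R * R)) m : exhaustion Om -> exhaustion (fun n => Om (n + m)%N).
Proof.
move=> exh; have [h1 h2 h3] := exh; split => [n|n|]; first exact: h1.
  by rewrite addSn; exact: h2.
rewrite -h3; apply/seteqP; split => [q [n _ h]|q [n _ h]]; first by exists (n + m)%N.
by exists n => //; apply: (Om_mono exh) h; exact: leq_addr.
Qed.

Lemma green_integrandE (x y xi eta s : R) : s != 0 -> 0 < y -> 0 < eta ->
  green_integrand x y xi eta s = Ef s y eta / rr s * expR (- (rr s * `|x - xi|)).
Proof.
move=> s0 y0 e0; rewrite /green_integrand (green_densityE s0 y0 e0); cbv zeta.
rewrite -/(Ef s y eta) -/(rr s) [rr s * _]mulrC.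
by move: (Ef _ _ _) (expR _) ((rr s)^-1) => a b c; ring.
Qed.

Lemma Ef_rr (s y eta : R) : 0 < y -> 0 < eta -> `|Ef s y eta / rr s| <= 2 * (Bd y * Bd eta) / rr s.
Proof.
move=> y0 e0; have r0 := rr_gt0 s; rewrite normrM (gtr0_norm (_ : 0 < (rr s)^-1)) ?invr_gt0//.
by rewrite ler_pM2r ?invr_gt0//; exact: Ef_bound.
Qed.

Lemma measurable_Ef_rr (y eta : R) : 0 < y -> measurable_fun (setT : set R) (fun s => Ef s y eta / rr s).
Proof.
move=> y0; apply: measurable_funM; first exact: measurable_Ef.
apply: continuous_measurableT => // s; have c := cts_rr; have h : rr s != 0 by rewrite gt_eqF// rr_gt0.
by cts.
Qed.

(** The two integrands are compared only at [s != 0]; opening the interval at 0 discards that null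
    point. *)
Lemma Rintegral_green (x y xi eta T : R) : 0 < y -> 0 < eta ->
  Rintegral mu `[0, T] (green_integrand x y xi eta) =
  Rintegral mu `[0, T] (fun s => Ef s y eta / rr s * expR (- (rr s * `|x - xi|))).
Proof.
move=> y0 e0.
have i : mu.-integrable `]0, T] (EFin \o (fun s => Ef s y eta / rr s * expR (- (rr s * `|x - xi|)))).
  apply: (@integrable_dom _ _ _ mu _ _ (fun=> 4 * (Bd y * Bd eta))) => //.
  - apply: measurable_funTS; apply: measurable_funM; first exact: measurable_Ef_rr.
    by apply: continuous_measurableT => // s; have c := @cts_rr R; cts.
  - move=> s _; rewrite normrM (ger0_norm (expR_ge0 _)).
    apply: (@le_trans _ _ `|Ef s y eta / rr s|).
      by rewrite ler_piMr// -[leRHS]expR0 ler_expR oppr_le0 mulr_ge0// ltW// rr_gt0.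
    apply: le_trans (Ef_rr s y0 e0) _; rewrite ler_pdivrMr ?rr_gt0//.
    have B0 : 0 < Bd y * Bd eta by rewrite mulr_gt0// Bd_gt0.
    by have := rr_ge_half s; move: (Bd y * Bd eta) B0 => B B0; nra.
  - apply: (@integrableS _ _ _ mu `[0, T]) => //.
      by move=> s /=; rewrite !in_itv/= => /andP[/ltW -> ->].
    by apply: continuous_integrable_itv => s _; cts.
have s0 (s : R) : s \in `]0, T]%classic -> s != 0.
  by rewrite inE /= in_itv/= => /andP[h _]; rewrite gt_eqF.
rewrite -[RHS]Rintegral_itv_obnd_cbnd// -(@Rintegral_itv_obnd_cbnd R 0 (BRight T) (green_integrand x y xi eta)).
  by apply: eq_Rintegral => s /s0 sn; rewrite green_integrandE.
by move: i; apply: eq_integrable => // s /s0 sn; congr EFin; rewrite green_integrandE.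
Qed.

(** As [C0] is [pi / (2 rr s)] times the exponential, the integrand is [2 / pi] times that of [Kf],
    which matches [2 pi] times the value found in [gl_kernel]. *)
Lemma KfE (X y eta : R) : 0 < X -> 0 < y -> 0 < eta ->
  mu.-integrable Rp (EFin \o (fun s => Ef s y eta / rr s * expR (- (rr s * X)))) /\
  Rintegral mu Rp (fun s => Ef s y eta / rr s * expR (- (rr s * X))) = 2 * pi * (pi^-1 * (pi^-1 * Kf X y eta)).
Proof.
move=> X0 y0 e0; have pi0 : 0 < pi :> R := pi_gt0 R.
have i := integrable_EfC y0 e0 (@measurable_C0 R X) (@C0_bound R X X0).
have e : (fun s => Ef s y eta / rr s * expR (- (rr s * X))) = (fun s => (2 / pi) * (Ef s y eta * C0 X s)).
  apply/funext => s; rewrite /C0; have r0 := rr_gt0 s; move: (pi : R) pi0 => w w0.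
  by move: (Ef _ _ _) (expR _) => E F; field; rewrite !gt_eqF.
rewrite e; split; first exact: integrable_scale.
rewrite RintegralZl// -/(Kf X y eta); move: (pi : R) pi0 => w w0; field; by rewrite gt_eqF.
Qed.

End main_aux.

(* For every exhaustion (Om n) of Sigma by relatively compact smooth domains and
   every choice of Dirichlet Green's functions G n of L on Om n, at every pair of
   distinct points (x,y), (xi,eta) of Sigma the Green's functions converge (their
   limit is the minimal positive Green's function) to g, and
   g = 1/(2 pi) \int_0^oo green_integrand ds (improper integral). *)
Theorem theorem4p4 (R : realType) (Om : nat -> set (R * R))
    (G : nat -> R -> R -> R -> R -> R) :
  exhaustion Om ->
  (forall n, dirichlet_green (Om n) (G n)) ->
  forall x y xi eta : R, 0 < y -> 0 < eta -> (x, y) <> (xi, eta) ->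
  exists g : R,
    (fun n => G n x y xi eta) @ \oo --> g /\
    (fun T : R => Rintegral (@lebesgue_measure R) `[0%R, T]
                    (green_integrand x y xi eta)) @ +oo --> 2 * pi * g.
Proof.
move=> exh dg x y xi eta y0 e0 ne.
have [_ _ U] := exh.
(* The exhaustion is shifted so that its first domain already contains the pole; the limit is that
   of the original sequence. *)
have : @Sigma R (x, y) by [].
rewrite -U => -[m _ Om0].
pose Om' n := Om (n + m)%N; pose G' n := G (n + m)%N.
have exh' : exhaustion Om' by exact: exhaustion_shift.
have dg' n : dirichlet_green (Om' n) (G' n) by exact: dg.
have Op : Om' 0%N (x, y) by rewrite /Om' add0n.
have nq : (xi, eta) <> (x, y) by move=> h; apply: ne; rewrite h.
have Sq : @Sigma R (xi, eta) by [].
exists (gl Om' G' (x, y) (xi, eta)); split.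
  rewrite -(cvg_shiftn m).
  have c := @gl_cvg R Om' G' exh' dg' (x, y) Op (xi, eta).
  have [_ _ U'] := exh'; have := Sq; rewrite -U' => -[n0 _ On0].
  apply: cvg_trans c; apply: near_eq_cvg; exists n0 => // n /= n0n.
  by rewrite Gt_in//; exact: (Om_mono exh' n0n).
under eq_fun do rewrite Rintegral_green//.
(* For [xi != x] the exponential makes the integral absolutely convergent. For [xi = x] the
   integrand is only known to be of order [1 / s], and the Tauberian theorem takes over. *)
have [exi|xix] := eqVneq xi x; last first.
  have X0 : 0 < `|x - xi| by rewrite normr_gt0 subr_eq0 eq_sym.
  have [i E] := KfE X0 y0 e0.
  have -> := gl_kernel exh' dg' Op e0 (elimN eqP xix); rewrite /= -E.
  exact: Rintegral_itvcy_cvg.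
subst xi; rewrite subrr normr0.
under eq_fun do under eq_Rintegral do rewrite mulr0 oppr0 expR0 mulr1.
apply: (@tauber R (fun s => Ef s y eta / rr s) (2 * (Bd y * Bd eta))).
- exact: measurable_Ef_rr.
- by move=> s _; exact: Ef_rr.
have cg := gl_cont exh' dg' Op Sq nq.
(* The Abel hypothesis: the damped integral with parameter [X] is the formula at the point
   [(x - X, eta)], and the limit function is continuous at [(x, eta)], which is not the pole. *)
have c1 : gl Om' G' (x, y) (x - X, eta) @[X --> 0^'+] --> gl Om' G' (x, y) (x, eta).
  apply/cvgrPdist_le => e ep; move/cvgrPdist_le : cg => /(_ _ ep) n1.
  have [d d0 sd] := sqr_small n1; exists d => // X; rewrite /= sub0r normrN => Xd X0.
  apply: (sd (x - X, eta)); apply/sqrP; rewrite /= subrr normr0 addrAC subrr sub0r normrN.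
  by split; exact: ltW.
have c3 : 2 * pi * gl Om' G' (x, y) (x - X, eta) @[X --> 0^'+] --> 2 * pi * gl Om' G' (x, y) (x, eta).
  by apply: cvgM => //; exact: cvg_cst.
apply: cvg_trans c3; apply: near_eq_cvg; near=> X.
have X0 : 0 < X by near: X; exact: nbhs_right_gt.
have [_ ->] := KfE X0 y0 e0.
have xX : x - X <> x by move=> h; move: X0; lra.
have -> := gl_kernel exh' dg' Op e0 xX; rewrite /=.
by have -> : `|x - (x - X)| = X by rewrite (_ : x - (x - X) = X) ?gtr0_norm//; ring.
Unshelve. all: by end_near. Qed.
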